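(* Let $\gamma,\kappa>0$, let $A:\mathbb{R}^n\to\mathbb{R}$ be a $\gamma$-function and $V:\mathbb{R}^n\to\mathbb{R}$ a $\kappa$-function, let $q>0$ be such that $q+V(x)+A(\xi)\ge 1$ for all $x,\xi\in\mathbb{R}^n$, and let $g=g^{(A,V)}$ be the associated metric. Let $1\le r<\infty$ and assume that $\mu>0$ satisfies $$\int_{\mathbb{R}^n}\int_{\mathbb{R}^n}(q+V(x)+A(\xi))^{-\mu}\,dx\,d\xi<\infty .$$ Then, for every $a\in S\big((q+V(x)+A(\xi))^{-\mu/r},g\big)$, $$a_t(x,D)\in S_r(L^2(\mathbb{R}^n))\quad\text{for all } t\in\mathbb{R}.$$
   Context: $\tau$-functions: a continuous function $\Gamma:\mathbb{R}^n\to\mathbb{R}$ is a $\tau$-function ($\tau>0$) if there is $q_0>0$ such that (a) $\Gamma(x)+\frac{q_0}{4}>0$ for all $x\in\mathbb{R}^n$; and (b) there are $C_1>0$, $R>0$ with $C_1\big|(\frac{q_0}{2}+\Gamma(x))^{\frac1{2\tau}}-(\frac{q_0}{2}+\Gamma(y))^{\frac1{2\tau}}\big|\le |x-y|$ for all $|x|,|y|\ge R$. Metric: for $X=(x,\xi)$, $T=(t,\tau)\in\mathbb{R}^n\times\mathbb{R}^n$, $$g_X(T)=g^{(A,V)}_X(T)=\frac{|t|^2}{(q+V(x)+A(\xi))^{1/\kappa}}+\frac{|\tau|^2}{(q+V(x)+A(\xi))^{1/\gamma}} .$$ Symbol classes: for a positive function $M$ on $\mathbb{R}^n\times\mathbb{R}^n$,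 $S(M,g)$ is the set of smooth functions $a$ on $\mathbb{R}^n\times\mathbb{R}^n$ such that for every integer $k\ge0$ there is $C_k>0$ with $|a^{(k)}(X;T_1,\dots,T_k)|\le C_kM(X)\prod_{i=1}^k g_X^{1/2}(T_i)$ for all $X,T_1,\dots,T_k\in\mathbb{R}^n\times\mathbb{R}^n$, where $a^{(k)}(X;T_1,\dots,T_k)$ is the $k$-th derivative of $a$ at $X$ in the directions $T_1,\dots,T_k$. Quantization: for $t\in\mathbb{R}$, $a_t(x,D)u(x)=(2\pi)^{-n}\int_{\mathbb{R}^n}\int_{\mathbb{R}^n}e^{i(x-y)\cdot\xi}a(tx+(1-t)y,\xi)u(y)\,dy\,d\xi$ for Schwartz functions $u$ (oscillatory integral). Membership in $S_r(L^2(\mathbb{R}^n))$ means that the operator extends to a bounded operator on $L^2(\mathbb{R}^n)$ belonging to the Schatten-von Neumann class $S_r$, i.e. compact with $r$-summable singular values. *)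

(* Defs.v *)
From HB Require Import structures.
From mathcomp Require Import all_boot all_order all_algebra.
From mathcomp Require Import complex.
From mathcomp Require Import all_classical all_reals all_analysis.

Set Implicit Arguments.
Unset Strict Implicit.
Unset Printing Implicit Defensive.
Import Order.TTheory GRing.Theory Num.Theory.
Import numFieldNormedType.Exports.
Import Normc.

Local Open Scope classical_set_scope.
Local Open Scope ring_scope.
Local Open Scope complex_scope.

Section measurable_rV.
Context (R : realType) (n : nat).

Definition rV_coord (i : 'I_n) (x : 'rV[R]_n) : R := x ord0 i.

Let rV_set0 : g_sigma_preimage rV_coord set0.
Proof. exact: sigma_algebra0. Qed.

Let rV_setC A : g_sigma_preimage rV_coord A -> g_sigma_preimage rV_coord (~` A).
Proof. exact: sigma_algebraC. Qed.

Let rV_bigcup (F : (set 'rV[R]_n)^nat) :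
  (forall i, g_sigma_preimage rV_coord (F i)) ->
  g_sigma_preimage rV_coord (\bigcup_i (F i)).
Proof. exact: sigma_algebra_bigcup. Qed.

(* The sigma-algebra generated by the coordinates, i.e. the Borel one. *)
HB.instance Definition _ := @isMeasurable.Build default_measure_display
  'rV[R]_n (g_sigma_preimage rV_coord) rV_set0 rV_setC rV_bigcup.

Lemma measurable_rV_coord (i : 'I_n) :
  measurable_fun [set: 'rV[R]_n] (rV_coord i).
Proof.
move=> _ Y mY; rewrite setTI; apply: sub_sigma_algebra => /=.
rewrite -bigcup_seq/=; exists i => /=; first by rewrite mem_index_enum.
by exists Y => //; rewrite setTI.
Qed.

Lemma measurable_fun_rVP d (T : measurableType d) (f : T -> 'rV[R]_n) :
  (forall i, measurable_fun [set: T] (rV_coord i \o f)) ->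
  measurable_fun [set: T] f.
Proof.
move=> mf _ A mA.
suff : g_sigma_preimage (fun i => rV_coord i \o f) `<=` measurable.
  by rewrite g_sigma_preimage_comp; apply; exists A.
apply: smallest_sub; first exact: sigma_algebra_measurable.
rewrite -bigcup_seq/=; apply: bigcup_sub => i _.
by move=> B [C mC <-]; exact: mf.
Qed.

End measurable_rV.

Section lebesgue_rV.
Context (R : realType).

Definition rV_cons n (p : R * 'rV[R]_n) : 'rV[R]_n.+1 :=
  row_mx (\row_(_ < 1) p.1) p.2.

Definition rV_uncons n (x : 'rV[R]_n.+1) : R * 'rV[R]_n :=
  (x ord0 ord0, \row_j x ord0 (lift ord0 j)).

Lemma rV_consE0 n (p : R * 'rV[R]_n) : rV_cons p ord0 ord0 = p.1.
Proof.
have -> : ord0 = lshift n (ord0 : 'I_1) :> 'I_n.+1 by apply: val_inj.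
by rewrite (@row_mxEl _ 1 1 n) mxE.
Qed.

Lemma rV_consES n (p : R * 'rV[R]_n) j :
  rV_cons p ord0 (lift ord0 j) = p.2 ord0 j.
Proof.
have -> : lift ord0 j = rshift 1 j :> 'I_n.+1 by apply: val_inj.
by rewrite (@row_mxEr _ 1 1 n).
Qed.

Lemma rV_unconsK n : cancel (@rV_uncons n) (@rV_cons n).
Proof.
move=> x; apply/rowP => i.
by case: (unliftP ord0 i) => [j ->|->];
  rewrite ?rV_consES ?rV_consE0 // mxE.
Qed.

Lemma rV_consK n : cancel (@rV_cons n) (@rV_uncons n).
Proof.
move=> p; rewrite /rV_uncons rV_consE0 [RHS]surjective_pairing; congr pair.
by apply/rowP => j; rewrite mxE rV_consES.
Qed.

Lemma measurable_rV_cons n : measurable_fun setT (@rV_cons n).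
Proof.
apply: measurable_fun_rVP => i; case: (unliftP ord0 i) => [j ->|->].
  rewrite (_ : _ \o _ = rV_coord j \o snd); last first.
    by apply/funext => p /=; exact: rV_consES.
  by apply: measurableT_comp => //; exact: measurable_rV_coord.
rewrite (_ : _ \o _ = fst) //.
by apply/funext => p /=; exact: rV_consE0.
Qed.

Lemma measurable_rV_uncons n : measurable_fun setT (@rV_uncons n).
Proof.
apply/measurable_fun_pairP; split => /=.
  exact: (@measurable_rV_coord _ _ ord0).
apply: measurable_fun_rVP => i.
rewrite (_ : _ \o _ = rV_coord (lift ord0 i)).
  exact: measurable_rV_coord.
by apply/funext => x /=; rewrite /rV_coord /= mxE.
Qed.

Section step.
Context (n : nat) (m : {sigma_finite_measure set 'rV[R]_n -> \bar R}).

Definition lebesgue_rV_step : set 'rV[R]_n.+1 -> \bar R :=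
  pushforward (lebesgue_measure \x m)%E (@rV_cons n).

Let step0 : lebesgue_rV_step set0 = 0%E.
Proof. by rewrite /lebesgue_rV_step /pushforward preimage_set0 measure0. Qed.

Let step_ge0 B : (0 <= lebesgue_rV_step B)%E.
Proof. by rewrite /lebesgue_rV_step /pushforward measure_ge0. Qed.

Let step_sigma_additive : semi_sigma_additive lebesgue_rV_step.
Proof.
have mK (F : set 'rV[R]_n.+1) : measurable F ->
    measurable (@rV_cons n @^-1` F).
  by move=> mF; rewrite -[X in measurable X]setTI; exact: measurable_rV_cons.
move=> F mF tF mUF; rewrite /lebesgue_rV_step /pushforward preimage_bigcup.
apply: measure_semi_sigma_additive.
- by move=> i; exact: mK.
- apply/trivIsetP => /= i j _ _ ij; rewrite -preimage_setI.
  by move/trivIsetP : tF => /(_ _ _ _ _ ij) ->//; rewrite preimage_set0.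
- by rewrite -preimage_bigcup; exact: mK.
Qed.

HB.instance Definition _ := isMeasure.Build _ _ _ lebesgue_rV_step
  step0 step_ge0 step_sigma_additive.

Let step_sigma_finite : sigma_finite setT lebesgue_rV_step.
Proof.
have /sigma_finiteP[F [FT ndF Foo]] := sigma_finiteT (@lebesgue_measure R).
have /sigma_finiteP[G [GT ndG Goo]] := sigma_finiteT m.
exists (fun i => @rV_uncons n @^-1` (F i `*` G i)) => [|i].
  rewrite -preimage_bigcup; apply/esym; rewrite -subTset => x _ /=.
  have [i _ Fi] : (\bigcup_i F i) (rV_uncons x).1 by rewrite -FT.
  have [j _ Gj] : (\bigcup_i G i) (rV_uncons x).2 by rewrite -GT.
  exists (maxn i j) => //; split.
    by move: Fi; exact/subsetPset/ndF/leq_maxl.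
  by move: Gj; exact/subsetPset/ndG/leq_maxr.
have [mF Fi] := Foo i; have [mG Gi] := Goo i; split.
  by rewrite -[X in measurable X]setTI; apply: measurable_rV_uncons => //;
    exact: measurableX.
rewrite /lebesgue_rV_step /pushforward -comp_preimage.
rewrite (_ : _ \o _ = id); last by apply/funext => x /=; exact: rV_consK.
by rewrite preimage_id product_measure1E// lte_mul_pinfty// ge0_fin_numE.
Qed.

HB.instance Definition _ := Measure_isSigmaFinite.Build _ _ _ lebesgue_rV_step
  step_sigma_finite.

End step.

(* Built so that lebesgue_rV n.+1 is the image of (lebesgue_measure \x
   lebesgue_rV n) under rV_cons; lebesgue_rV_box gives the volume of boxes. *)
Fixpoint lebesgue_rV n : {sigma_finite_measure set 'rV[R]_n -> \bar R} :=
  match n with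
  | 0 => dirac (0 : 'rV[R]_0)
  | n'.+1 => lebesgue_rV_step (lebesgue_rV n')
  end.

Lemma lebesgue_rV_box n (B : 'I_n -> set R) :
  (forall i, measurable (B i)) ->
  lebesgue_rV n [set x | forall i, B i (x ord0 i)] =
  (\prod_(i < n) lebesgue_measure (B i))%E.
Proof.
elim: n B => [|n IH] B mB /=.
  by rewrite big_ord0 diracE mem_set// => -[].
rewrite big_ord_recl -IH//.
have mS : measurable
    [set x : 'rV[R]_n | forall i, B (lift ord0 i) (x ord0 i)].
  rewrite [X in measurable X](_ : _ =
      \bigcap_(i in [set: 'I_n]) (rV_coord i @^-1` B (lift ord0 i))).
    apply: fin_bigcap_measurable => // i _.
    by rewrite -[X in measurable X]setTI; exact: measurable_rV_coord.
  apply/seteqP; split => x Bx.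
    by move=> i _; exact: Bx.
  by move=> i; exact: (Bx i).
rewrite -product_measure1E//; last exact: mB.
rewrite /lebesgue_rV_step /pushforward; congr (product_measure1 _ _ _).
apply/seteqP; split => p /=.
  move=> Bp; split => [|i]; first by have := Bp ord0; rewrite rV_consE0.
  by have := Bp (lift ord0 i); rewrite rV_consES.
move=> [Bp1 Bp2] i.
by case: (unliftP ord0 i) => [j ->|->]; rewrite ?rV_consES ?rV_consE0.
Qed.

End lebesgue_rV.

Section euclidean.
Context (R : realType) (n : nat).
Implicit Types x y : 'rV[R]_n.

Definition dotv x y : R := \sum_i x ord0 i * y ord0 i.

(* The library norm `|x| on 'rV[R]_n is the sup norm, not this one. *)
Definition enorm x : R := Num.sqrt (dotv x x).

End euclidean.

Section smooth.
Context (R : realType).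

(* In finite dimension, continuity of all the maps x |-> 'D_v f x is continuity
   of the differential, so Cn k is the usual class C^k. *)
Fixpoint Cn (V W : normedModType R) (k : nat) (f : V -> W) : Prop :=
  match k with
  | 0 => continuous f
  | k'.+1 => (forall x, differentiable f x) /\
             forall v, Cn k' (fun x => 'D_v f x)
  end.

Definition iter_derive (V W : normedModType R) (Ts : seq V) (f : V -> W) :
    V -> W :=
  foldr (fun v h x => 'D_v h x) f Ts.

Context (V : normedModType R).
Implicit Types (f : V -> R[i]) (Ts : seq V).

Definition smooth f : Prop :=
  forall k, Cn k (fun x => complex.Re (f x) : R^o) /\
            Cn k (fun x => complex.Im (f x) : R^o).

(* f^{(k)}(x; T_1, ..., T_k) where Ts = [:: T_1; ...; T_k] *)
Definition cderive Ts f (x : V) : R[i] :=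
  iter_derive Ts (fun y => complex.Re (f y) : R^o) x +i*
  iter_derive Ts (fun y => complex.Im (f y) : R^o) x.

Definition schwartz f : Prop :=
  smooth f /\ forall (N : nat) Ts, exists C : R, forall x,
    (1 + `|x|) ^+ N * normc (cderive Ts f x) <= C.

End smooth.

Section complex_L2.
Context d (T : measurableType d) (R : realType).
Variable mu : {measure set T -> \bar R}.
Implicit Types (f g : T -> R[i]) (Op : (T -> R[i]) -> T -> R[i]).

Definition cmeasurable f : Prop :=
  measurable_fun setT (fun x => complex.Re (f x)) /\
  measurable_fun setT (fun x => complex.Im (f x)).

Definition cintegrable f : Prop :=
  mu.-integrable setT (fun x => (complex.Re (f x))%:E) /\
  mu.-integrable setT (fun x => (complex.Im (f x))%:E).

Definition cintegral f : R[i] :=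
  (\int[mu]_x complex.Re (f x)) +i* (\int[mu]_x complex.Im (f x)).

Definition L2norm f : \bar R := ('N[mu]_2%:E [EFin \o (@normc R \o f)])%E.

Definition L2 : set (T -> R[i]) :=
  [set f | cmeasurable f /\ (L2norm f < +oo)%E].

Definition L2inner f g : R[i] := cintegral (fun x => f x * (g x)^*).

(* Elements of L^2 are given by representatives. Since Op is linear and bounded
   up to a.e. equality, it sends a.e. equal functions to a.e. equal ones, so it
   is the same thing as a bounded operator on the quotient. *)
Definition bounded_operator Op : Prop :=
  [/\ forall f, L2 f -> L2 (Op f),
      forall (c : R[i]) f g, L2 f -> L2 g ->
        Op (fun x => c * f x + g x) = (fun x => c * Op f x + Op g x) %[ae mu]
    & exists C : R, forall f, L2 f -> (L2norm (Op f) <= C%:E * L2norm f)%E].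

Definition compact_operator Op : Prop :=
  forall u : nat -> T -> R[i],
    (forall k, L2 (u k) /\ (L2norm (u k) <= 1)%E) ->
    exists (phi : nat -> nat) (g : T -> R[i]),
      [/\ {homo phi : j k / (j < k)%N}, L2 g
        & L2norm (fun x => Op (u (phi k)) x - g x) @[k --> \oo] --> 0%E].

Definition is_adjoint Op Ops : Prop :=
  bounded_operator Ops /\
  forall f g, L2 f -> L2 g -> L2inner (Op f) g = L2inner f (Ops g).

(* dim ker (Op - lam) >= m in L^2 *)
Definition eigen_dim_ge Op (lam : R) (m : nat) : Prop :=
  exists e : 'I_m -> T -> R[i],
    (forall j, L2 (e j) /\ Op (e j) = (fun x => lam%:C * e j x) %[ae mu]) /\
    forall c : 'I_m -> R[i],
      (fun x => \sum_j c j * e j x) = cst 0 %[ae mu] -> forall j, c j = 0.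

(* s lists in nonincreasing order the square roots of the positive eigenvalues
   of Op^* Op, each repeated according to its multiplicity, and is completed by
   zeros if there are finitely many of them. *)
Definition singular_values Op (s : R^nat) : Prop :=
  [/\ forall k, 0 <= s k,
      nonincreasing_seq s
    & exists2 Ops, is_adjoint Op Ops &
        forall sigma : R, 0 < sigma -> forall m : nat,
          eigen_dim_ge (Ops \o Op) (sigma ^+ 2) m <->
          exists2 J : 'I_m -> nat, injective J & forall j, s (J j) = sigma].

Definition schatten (r : R) Op : Prop :=
  [/\ bounded_operator Op, compact_operator Op
    & exists2 s, singular_values Op s &
        (\sum_(0 <= k <oo) ((s k) `^ r)%:E < +oo)%E].

End complex_L2.

Section symbols.
Context (R : realType) (n : nat).
Local Notation Rn := 'rV[R]_n.
Local Notation leb := (lebesgue_rV R n).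
Implicit Types (A V : Rn -> R) (X T : Rn * Rn) (a : Rn * Rn -> R[i]).

Definition tau_function (tau : R) (Gamma : Rn -> R) : Prop :=
  continuous Gamma /\
  exists2 q0 : R, 0 < q0 &
    (forall x, 0 < Gamma x + q0 / 4) /\
    exists C1 r0 : R, [/\ 0 < C1, 0 < r0 &
      forall x y, r0 <= enorm x -> r0 <= enorm y ->
        C1 * `|(q0 / 2 + Gamma x) `^ (1 / (2 * tau)) -
               (q0 / 2 + Gamma y) `^ (1 / (2 * tau))| <= enorm (x - y)].

Definition metric (q kappa gamma : R) A V X T : R :=
  enorm T.1 ^+ 2 / (q + V X.1 + A X.2) `^ (1 / kappa) +
  enorm T.2 ^+ 2 / (q + V X.1 + A X.2) `^ (1 / gamma).

Definition symbol_class (M : Rn * Rn -> R) (g : Rn * Rn -> Rn * Rn -> R) :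
    set (Rn * Rn -> R[i]) :=
  [set a | smooth a /\
    forall k : nat, exists2 C : R, 0 < C &
      forall X (Ts : k.-tuple (Rn * Rn)),
        normc (cderive Ts a X) <= C * M X * \prod_(T <- Ts) Num.sqrt (g X T)].

(* The oscillatory integral of f over R^n x R^n exists and equals l: limit of
   the integrals regularized by any cutoff chi(eps y, eps xi), chi Schwartz,
   chi(0, 0) = 1. *)
Definition is_osc_integral (f : Rn * Rn -> R[i]) (l : R[i]) : Prop :=
  forall chi : Rn * Rn -> R[i], schwartz chi -> chi 0 = 1 ->
    let reg (eps : R) (p : Rn * Rn) := chi (eps *: p) * f p in
    [/\ forall eps, 0 < eps -> cintegrable (leb \x leb)%E (reg eps),
        complex.Re (cintegral (leb \x leb)%E (reg eps)) @[eps --> 0^'+]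
          --> complex.Re l
      & complex.Im (cintegral (leb \x leb)%E (reg eps)) @[eps --> 0^'+]
          --> complex.Im l].

Definition cexpi (theta : R) : R[i] := cos theta +i* sin theta.

(* v = a_t(x,D) u; in the integrand p = (y, xi) *)
Definition is_quantization a (t : R) (u v : Rn -> R[i]) : Prop :=
  forall x, exists2 l,
    is_osc_integral
      (fun p => cexpi (dotv (x - p.1) p.2) *
                a (t *: x + (1 - t) *: p.1, p.2) * u p.1) l
    & v x = ((2 * pi) ^- n)%:C * l.

(* a_t(x,D), defined on Schwartz functions, extends to an operator of the
   Schatten class S_r on L^2(R^n) *)
Definition quantization_in_schatten a (t r : R) : Prop :=
  exists2 Op, schatten leb r Op &
    forall u, schwartz u ->
      exists2 v, is_quantization a t u v & Op u = v %[ae leb].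

End symbols.

(* Main.v *)
Require Import Defs.
From HB Require Import structures.
From mathcomp Require Import all_boot all_order all_algebra.
From mathcomp Require Import complex.
From mathcomp Require Import all_classical all_reals all_analysis.
From mathcomp Require Import measurable_realfun ring lra.
Import Order.TTheory GRing.Theory Num.Theory.
Import numFieldNormedType.Exports.
Import Normc.

Set Implicit Arguments.
Unset Strict Implicit.
Unset Printing Implicit Defensive.

Local Open Scope classical_set_scope.
Local Open Scope ring_scope.
Local Open Scope complex_scope.

(* The phase space is tiled by the lattice points j = (m, k) of Z^n x Z^n.  With
   h a smooth bump whose integer translates add up to 1 and h' a wider bump equal
   to 1 on its support, the functions phi_j(x) = h(x - m) e^(ik.x) and
   theta_j(x) = h'(x - m) e^(ik.x) are Bessel families, and Parseval on cubes
   gives (2 pi)^n u = sum_j <u, theta_j> phi_j together with the lower frame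
   bound |v|^2 <= C sum_k |<v, phi_k>|^2.  Hence
   a_t(x,D) = (2 pi)^-n sum_j <., theta_j> psi_j with psi_j = a_t(x,D) phi_j.

   The tau-function hypotheses make M = (q + V + A)^(-mu/r) temperate, and since
   q + V + A >= 1 the metric g is dominated by the Euclidean one.  Integrating by
   parts in y, x and xi yields |<psi_j, phi_k>| <= C M(j) (1 + |j - k|)^-N, so by
   the frame bound and Schur's test |sum_j c_j psi_j|^2 <= C sum_j M(j)^2 |c_j|^2.
   Thus a_t(x,D) factors through the diagonal operator with entries M(j); these
   are r-summable by comparison with the integral of (q + V + A)^(-mu), and the
   k-th singular value is at most a constant times the k-th largest M(j). *)

(** * Semi-inner products and form-compact spectral theory *)

(** Elements of [L2t] are functions, not classes, so the pairing is degenerate. The Hilbert space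
    part therefore works with positive semidefinite sesquilinear forms and equality up to seminorm
    zero. No operator is diagonalized: the spectral theorem concerns the form b(x, y) = <Tx, Ty>,
    which is exactly sesquilinear although T, a choice of limits, is linear only up to null vectors.
    The wide window serves polarization: the product of the two windows is the narrow one, whose
    translates add up to 1, so the cross terms of Parseval's identity give back the inner product
    and no dual window has to be built. The obstacle in the matrix coefficients is that the integral
    over (x, y, xi) does not converge absolutely: the bumps localize x and y, but nothing localizes
    xi until one has integrated by parts in y. This fixes the order of the variables, and likewise
    the order of integration in [quant]. Since (1 + |x|)^-2n is the basic integrable weight, decay
    is spent in multiples of 2n: once for integrability, once for summability over the lattice. *)

Section complex_facts.
Context (R : realType).
Implicit Types (z w : R[i]).
Local Notation Re := complex.Re.
Local Notation Im := complex.Im.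

Lemma normc2 z : normc z ^+ 2 = Re z ^+ 2 + Im z ^+ 2.
Proof. by case: z => a b /=; rewrite sqr_sqrtr// addr_ge0// sqr_ge0. Qed.

Lemma normc_ge0 z : 0 <= normc z.
Proof. by case: z => a b /=; rewrite sqrtr_ge0. Qed.

Lemma cReD z w : Re (z + w) = Re z + Re w. Proof. by case: z; case: w. Qed.
Lemma cImD z w : Im (z + w) = Im z + Im w. Proof. by case: z; case: w. Qed.
Lemma cReN z : Re (- z) = - Re z. Proof. by case: z. Qed.
Lemma cImN z : Im (- z) = - Im z. Proof. by case: z. Qed.
Lemma cReB z w : Re (z - w) = Re z - Re w. Proof. by rewrite cReD cReN. Qed.
Lemma cImB z w : Im (z - w) = Im z - Im w. Proof. by rewrite cImD cImN. Qed.
Lemma cReM z w : Re (z * w) = Re z * Re w - Im z * Im w.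
Proof. by case: z; case: w. Qed.
Lemma cImM z w : Im (z * w) = Re z * Im w + Im z * Re w.
Proof. by case: z => a b; case: w => c d /=. Qed.
Lemma cReJ z : Re (conjc z) = Re z. Proof. by case: z. Qed.
Lemma cImJ z : Im (conjc z) = - Im z. Proof. by case: z. Qed.
Definition cE := (cReD, cImD, cReN, cImN, cReM, cImM, cReJ, cImJ).

Lemma complexP z w : Re z = Re w -> Im z = Im w -> z = w.
Proof. by case: z => a b; case: w => c d /= -> ->. Qed.

Lemma Re_sum I (r : seq I) (P : pred I) (F : I -> R[i]) :
  Re (\sum_(i <- r | P i) F i) = \sum_(i <- r | P i) Re (F i).
Proof. exact: (big_morph _ cReD). Qed.
Lemma normcJ' z : normc (conjc z) = normc z.
Proof. by case: z => a b /=; rewrite sqrrN. Qed.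

Lemma normc_real (x : R) : normc x%:C = `|x|.
Proof. by rewrite /= expr0n addr0 sqrtr_sqr. Qed.

Lemma normc_sum I (r : seq I) (P : pred I) (F : I -> R[i]) :
  normc (\sum_(i <- r | P i) F i) <= \sum_(i <- r | P i) normc (F i).
Proof.
elim/big_rec2: _ => [|i y x _ h]; first by rewrite normc0.
by rewrite (le_trans (le_normcD _ _))// lerD2l.
Qed.

Lemma normc_ReIm z : normc z <= `|Re z| + `|Im z|.
Proof.
rewrite -(@ler_pXn2r _ 2)// ?nnegrE ?addr_ge0 ?normc_ge0//.
rewrite normc2 sqrrD !real_normK ?num_real//.
have := mulr_ge0 (normr_ge0 (Re z)) (normr_ge0 (Im z)); lra.
Qed.

Lemma Re_le_normc z : `|Re z| <= normc z.
Proof.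
rewrite -(@ler_pXn2r _ 2)// ?nnegrE ?normc_ge0//.
by rewrite normc2 real_normK ?num_real// lerDl sqr_ge0.
Qed.

Lemma Im_le_normc z : `|Im z| <= normc z.
Proof.
rewrite -(@ler_pXn2r _ 2)// ?nnegrE ?normc_ge0//.
by rewrite normc2 real_normK ?num_real// lerDr sqr_ge0.
Qed.

Lemma mulcJ z : z * conjc z = (normc z ^+ 2)%:C.
Proof. by apply: complexP; rewrite ?cE /= ?normc2 ?expr2; ring. Qed.

Lemma conjcM z w : conjc (z * w) = conjc z * conjc w.
Proof. by apply: complexP; rewrite ?cE; ring. Qed.
Lemma conjcD z w : conjc (z + w) = conjc z + conjc w.
Proof. by apply: complexP; rewrite ?cE; ring. Qed.
Lemma conjcN z : conjc (- z) = - conjc z.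
Proof. by apply: complexP; rewrite ?cE; ring. Qed.
Lemma conjcK' z : conjc (conjc z) = z.
Proof. by apply: complexP; rewrite ?cE; ring. Qed.
Lemma conjc_sum I (r : seq I) (P : pred I) (F : I -> R[i]) :
  conjc (\sum_(i <- r | P i) F i) = \sum_(i <- r | P i) conjc (F i).
Proof. by apply: (big_morph _ conjcD); exact: conjc0. Qed.

(** The discriminant inequality in the shape that Cauchy-Schwarz produces, where b is already a
    squared modulus. The case D = 0 is included because the forms may be degenerate. *)
Lemma quad_ge0 (A D b : R) : 0 <= D ->
  (forall t : R, 0 <= A - 2 * t * b + t ^+ 2 * b * D) -> 0 <= b -> b <= A * D.
Proof.
rewrite le_eqVlt => /predU1P[<-|D0] H b0; last first.
  have := H D^-1; rewrite -(ler_pM2r D0) mul0r.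
  suff -> : (A - 2 * D^-1 * b + D^-1 ^+ 2 * b * D) * D = A * D - b.
    by rewrite subr_ge0.
  by field; rewrite gt_eqF.
rewrite mulr0 leNgt; apply/negP => b1.
(* For D = 0 the quadratic is the affine function A - 2tb, and this t gives it the value -1. *)
have := H ((A + 1) / (2 * b)).
have -> : A - 2 * ((A + 1) / (2 * b)) * b +
  ((A + 1) / (2 * b)) ^+ 2 * b * 0 = - 1 by field; rewrite gt_eqF.
by rewrite lerNr oppr0 ler10.
Qed.

End complex_facts.

Section sesq.
Context (R : realType) (E : lmodType R[i]).
Local Notation Re := complex.Re.
Local Notation Im := complex.Im.
Implicit Types (x y z : E) (b : E -> E -> R[i]).

(** Positivity is kept apart: [next_exists] uses the form l <x, y> - b(x, y), which is nonnegative
    only on an orthogonal complement. *)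
Definition sesq b :=
  (forall a x y z, b (a *: x + y) z = a * b x z + b y z) /\
  (forall x y, b y x = conjc (b x y)).

Section one.
Variables (b : E -> E -> R[i]) (hb : sesq b).
Lemma sesq_lin : forall a x y z, b (a *: x + y) z = a * b x z + b y z.
Proof. exact: hb.1. Qed.
Let bl := sesq_lin.
Lemma sesqC : forall x y, b y x = conjc (b x y).
Proof. exact: hb.2. Qed.
Let bC := sesqC.

Lemma sesq0l z : b 0 z = 0.
Proof.
have := bl 1 0 0 z; rewrite scale1r addr0 mul1r => /eqP.
by rewrite -subr_eq0 opprD addNKr oppr_eq0 => /eqP.
Qed.
Lemma sesqZl a x z : b (a *: x) z = a * b x z.
Proof. by have := bl a x 0 z; rewrite !addr0 sesq0l addr0. Qed.
Lemma sesqDl x y z : b (x + y) z = b x z + b y z.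
Proof. by have := bl 1 x y z; rewrite scale1r mul1r. Qed.
Lemma sesqNl x z : b (- x) z = - b x z.
Proof. by rewrite -scaleN1r sesqZl mulN1r. Qed.
Lemma sesqBl x y z : b (x - y) z = b x z - b y z.
Proof. by rewrite sesqDl sesqNl. Qed.
Lemma sesq0r z : b z 0 = 0.
Proof. by rewrite bC sesq0l conjc0. Qed.
Lemma sesqZr a x z : b z (a *: x) = conjc a * b z x.
Proof. by rewrite bC sesqZl conjcM -bC. Qed.
Lemma sesqDr x y z : b z (x + y) = b z x + b z y.
Proof. by rewrite bC sesqDl conjcD -!bC. Qed.
Lemma sesqNr x z : b z (- x) = - b z x.
Proof. by rewrite bC sesqNl conjcN -bC. Qed.
Lemma sesqBr x y z : b z (x - y) = b z x - b z y.
Proof. by rewrite sesqDr sesqNr. Qed.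
Lemma sesq_suml I (r : seq I) (P : pred I) (F : I -> E) z :
  b (\sum_(i <- r | P i) F i) z = \sum_(i <- r | P i) b (F i) z.
Proof.
by apply: (big_morph (b^~ z)) => [x y|]; rewrite ?sesqDl ?sesq0l.
Qed.
Lemma sesq_sumr I (r : seq I) (P : pred I) (F : I -> E) z :
  b z (\sum_(i <- r | P i) F i) = \sum_(i <- r | P i) b z (F i).
Proof. by apply: (big_morph (b z)) => [x y|]; rewrite ?sesqDr ?sesq0r. Qed.

Lemma sesq_diag x : b x x = (Re (b x x))%:C.
Proof.
apply: complexP => //=.
by have := congr1 (@complex.Im R) (bC x x); rewrite cImJ => h; lra.
Qed.

Lemma sesq_quad c x y : Re (b (x + c *: y) (x + c *: y)) =
  Re (b x x) + 2 * Re (conjc c * b x y) + normc c ^+ 2 * Re (b y y).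
Proof.
rewrite !(sesqDl, sesqDr, sesqZl, sesqZr) (bC x y).
rewrite normc2 !cE; have := congr1 (@complex.Im R) (bC y y); rewrite cImJ.
move=> h; have {h} h : Im (b y y) = 0 by lra.
by rewrite h; ring.
Qed.

(** Positivity is required only along the line x + c y and at y, which is all that is known for a
    form that is nonnegative on a subspace. *)
Lemma sesq_CS x y : (forall c, 0 <= Re (b (x + c *: y) (x + c *: y))) ->
  0 <= Re (b y y) -> normc (b x y) ^+ 2 <= Re (b x x) * Re (b y y).
Proof.
move=> H D0; apply: quad_ge0 => //; last by rewrite exprn_ge0// normc_ge0.
(* This multiple of y turns the linear term into the real number -2t |b(x, y)|^2. *)
move=> t; have := H (- t%:C * b x y); rewrite sesq_quad => /le_trans; apply.
by rewrite normcM exprMn !normc2 !cE /=; rewrite le_eqVlt; apply/orP; left; apply/eqP; ring.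
Qed.

End one.
End sesq.

Section seminorm.
Context (R : realType) (E : lmodType R[i]) (b : E -> E -> R[i]).
Hypothesis hb : sesq b.
Hypothesis b0 : forall x, 0 <= complex.Re (b x x).
Implicit Types x y z : E.

Definition nsq x : R := complex.Re (b x x).
Definition nrm x : R := Num.sqrt (nsq x).

Lemma nsq_ge0 x : 0 <= nsq x. Proof. exact: b0. Qed.
Lemma nrm_ge0 x : 0 <= nrm x. Proof. exact: sqrtr_ge0. Qed.
Lemma nrm2 x : nrm x ^+ 2 = nsq x. Proof. by rewrite sqr_sqrtr// nsq_ge0. Qed.

Lemma CS_sq x y : normc (b x y) ^+ 2 <= nsq x * nsq y.
Proof. by apply: sesq_CS => //; exact: b0. Qed.

Lemma CS x y : normc (b x y) <= nrm x * nrm y.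
Proof.
rewrite -(@ler_pXn2r _ 2)// ?nnegrE ?mulr_ge0 ?nrm_ge0 ?normc_ge0//.
by rewrite exprMn !nrm2 CS_sq.
Qed.

Lemma nsqD x y : nsq (x + y) = nsq x + 2 * complex.Re (b x y) + nsq y.
Proof.
have := sesq_quad hb 1 x y; rewrite scale1r /nsq => ->.
by rewrite normc1 !cE /=; ring.
Qed.

Lemma nsqZ a x : nsq (a *: x) = normc a ^+ 2 * nsq x.
Proof.
rewrite /nsq (sesqZl hb) (sesqZr hb) mulrA mulcJ {1}(sesq_diag hb) !cE /=.
by ring.
Qed.

Lemma nrmZ a x : nrm (a *: x) = normc a * nrm x.
Proof.
by rewrite /nrm nsqZ sqrtrM ?sqr_ge0// sqrtr_sqr ger0_norm// normc_ge0.
Qed.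

Lemma nsqN x : nsq (- x) = nsq x.
Proof. by rewrite -scaleN1r nsqZ normcN normc1 expr1n mul1r. Qed.

Lemma nrmN x : nrm (- x) = nrm x. Proof. by rewrite /nrm nsqN. Qed.

Lemma nrmB x y : nrm (x - y) = nrm (y - x).
Proof. by rewrite -nrmN opprB. Qed.

Lemma nrm0 : nrm 0 = 0.
Proof. by rewrite /nrm /nsq (sesq0l hb) sqrtr0. Qed.

Lemma nrmD x y : nrm (x + y) <= nrm x + nrm y.
Proof.
rewrite -(@ler_pXn2r _ 2)// ?nnegrE ?addr_ge0 ?nrm_ge0//.
have h : complex.Re (b x y) <= nrm x * nrm y.
  by rewrite (le_trans (ler_norm _))// (le_trans (Re_le_normc _))// CS.
rewrite nrm2 nsqD sqrrD !nrm2 -mulr_natl; lra.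
Qed.

Lemma nrm_tri z x y : nrm (x - y) <= nrm (x - z) + nrm (z - y).
Proof. by rewrite (le_trans _ (nrmD _ _))// addrA subrK. Qed.

Lemma nrm_eq0_ip x z : nrm x = 0 -> b x z = 0.
Proof.
move=> x0; apply: eq0_normc; apply/eqP; rewrite eq_le normc_ge0 andbT.
by have := CS x z; rewrite x0 mul0r.
Qed.

Lemma nrm_sum I (r : seq I) (P : pred I) (F : I -> E) :
  nrm (\sum_(i <- r | P i) F i) <= \sum_(i <- r | P i) nrm (F i).
Proof.
elim/big_rec2: _ => [|i y x _ h]; first by rewrite nrm0.
by rewrite (le_trans (nrmD _ _))// lerD2l.
Qed.

Lemma nsqD2 x y : nsq (x + y) <= 2 * nsq x + 2 * nsq y.
Proof.
have := nsq_ge0 (x - y); rewrite !nsqD nsqN (sesqNr hb) !cE; lra.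
Qed.

End seminorm.

Section spectral.
Context (R : realType) (E : lmodType R[i]) (ip b : E -> E -> R[i]).
Local Notation Re := complex.Re.
Hypothesis hi : sesq ip.
Hypothesis ip0 : forall x, 0 <= Re (ip x x).
Hypothesis hb : sesq b.
Hypothesis b0 : forall x, 0 <= Re (b x x).
Variable B : R.
Hypothesis bB : forall x, nsq b x <= B * nsq ip x.

Definition cauchy_nrm (ip : E -> E -> R[i]) (u : nat -> E) :=
  forall e : R, 0 < e -> exists N, forall i j, (N <= i)%N -> (N <= j)%N ->
    nrm ip (u i - u j) < e.

Definition cvg_nrm (ip : E -> E -> R[i]) (u : nat -> E) (l : E) :=
  forall e : R, 0 < e -> exists N, forall i, (N <= i)%N -> nrm ip (u i - l) < e.

Hypothesis complete : forall u, cauchy_nrm ip u -> exists l, cvg_nrm ip u l.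
Hypothesis compact : forall u, (forall k, nsq ip (u k) <= 1) ->
  exists2 phi : nat -> nat, (forall k, (k <= phi k)%N) &
    cauchy_nrm b (u \o phi).

Implicit Types (x y z : E) (s : seq E).

Definition perp s x := forall e, e \in s -> ip x e = 0.

(* Eigenvectors are stored in a list; [good] lets one test the eigenvector
   equation on the orthogonal complement only. *)
Definition good s := (forall e, e \in s -> exists l : R, forall w, b e w = l%:C * ip e w)
  /\ forall w, exists2 w', perp s w' &
       forall x, perp s x -> ip x w = ip x w' /\ b x w = b x w'.

(** The alternative [l = 0], [e = 0] pads the sequence once b vanishes on the orthogonal complement
    of [s], so that the construction never stops. *)
Definition next s (e : E) (l : R) := [/\ 0 <= l, perp s e,
  forall w, b e w = l%:C * ip e w,
  forall x, perp s x -> nsq b x <= l * nsq ip x &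
  (0 < l /\ nsq ip e = 1) \/ (l = 0 /\ e = 0)].

Lemma perpD s x y : perp s x -> perp s y -> perp s (x + y).
Proof. by move=> hx hy e es; rewrite (sesqDl hi) hx// hy// addr0. Qed.

Lemma perpZ s c x : perp s x -> perp s (c *: x).
Proof. by move=> hx e es; rewrite (sesqZl hi) hx// mulr0. Qed.

Lemma perp_cvg s u l : (forall k, perp s (u k)) -> cvg_nrm ip u l -> perp s l.
Proof.
move=> hu ul e es; apply: eq0_normc; apply/eqP.
rewrite eq_le normc_ge0 andbT; apply/ler_addgt0Pr => eps eps0; rewrite add0r.
have e1 : 0 < nrm ip e + 1 by have := nrm_ge0 ip e; lra.
have [|N hN] := ul (eps / (nrm ip e + 1)); first by rewrite divr_gt0.
have -> : ip l e = - ip (u N - l) e.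
  by rewrite (sesqBl hi) hu// sub0r opprK.
rewrite normcN (le_trans (CS hi ip0 _ _))//.
have := hN N (leqnn _); rewrite ltr_pdivlMr// => h.
rewrite (le_trans _ (ltW h))// ler_wpM2l ?nrm_ge0//; lra.
Qed.

(** One Gram-Schmidt step on the projected vector. Vectors orthogonal to [e] are also b-orthogonal
    to it, [e] being an eigenvector, so neither form sees the subtracted component. *)
Lemma next_good s e l : good s -> next s e l -> good (e :: s).
Proof.
move=> [s1 s2] [l0 pe el _ le]; split=> [f|w].
  by rewrite inE => /predU1P[->|/s1//]; exists l.
have [w' pw' hw'] := s2 w; exists (w' - ip w' e *: e).
  move=> f; rewrite inE => /predU1P[->|fs]; rewrite (sesqBl hi) (sesqZl hi).
    case: le => [[_ e1]|[_ ->]]; last by rewrite !(sesq0r hi) mulr0 subr0.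
    by rewrite (sesq_diag hi) -/(nsq ip e) e1 mulr1 subrr.
  by rewrite pw'// pe// mulr0 subr0.
move=> x px; have px' : perp s x.
  by move=> f fs; apply: px; rewrite inE fs orbT.
have [-> ->] := hw' _ px'; have xe : ip x e = 0 by apply: px; rewrite mem_head.
rewrite (sesqBr hi) (sesqBr hb) (sesqZr hi) (sesqZr hb) xe mulr0 subr0.
split=> //; rewrite (sesqC hb e x) el (sesqC hi x e) xe conjc0 mulr0 conjc0.
by rewrite mulr0 subr0.
Qed.

(** Maximize the Rayleigh quotient on the complement of [s]. A maximizing sequence has a b-Cauchy
    subsequence by compactness; the parallelogram law makes it Cauchy for [ip], and its limit
    attains the supremum [l]. The eigenvector equation then follows from Cauchy-Schwarz for l <x, y>
    - b(x, y), which is nonnegative on the complement and vanishes at the maximizer. *)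
Lemma next_exists s : good s -> exists el : E * R, next s el.1 el.2.
Proof.
move=> [s1 s2].
pose S := [set nsq b x | x in [set x | perp s x /\ nsq ip x <= 1]].
have S0 : S 0.
  exists 0; rewrite /nsq ?(sesq0l hb)//=; split; last by rewrite (sesq0l hi) ler01.
  by move=> e es; rewrite (sesq0l hi).
have B0 x : nsq ip x <= 1 -> nsq b x <= `|B|.
  move=> x1; rewrite (le_trans (bB x))// (le_trans (ler_norm _))//.
  by rewrite normrM ler_piMr// ger0_norm// ip0.
have hS : has_sup S.
  by split; [exists 0|exists `|B| => _ [x [_ x1] <-]; exact: B0].
set l := sup S.
have l0 : 0 <= l by apply: ub_le_sup => //; exact: hS.2.
have lP x : perp s x -> nsq b x <= l * nsq ip x.
  move=> px; have [x0|x0] := ltP 0 (nsq ip x); last first.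
    have x0' : nsq ip x = 0 by apply/eqP; rewrite eq_le x0 ip0.
    by have := bB x; rewrite x0' !mulr0.
  have : nsq b ((nrm ip x)^-1%:C *: x) <= l.
    apply: ub_le_sup; first exact: hS.2.
    eexists; last by []; split; first exact: perpZ.
    rewrite (nsqZ hi) normc_real ger0_norm ?invr_ge0 ?nrm_ge0//.
    by rewrite exprVn (nrm2 ip0) mulVf// gt_eqF.
  rewrite (nsqZ hb) normc_real ger0_norm ?invr_ge0 ?nrm_ge0//.
  by rewrite exprVn (nrm2 ip0) mulrC ler_pdivrMr.
move: l0; rewrite le_eqVlt => /predU1P[l0|l0].
  exists (0, 0); split => //=.
  - by move=> e es; rewrite (sesq0l hi).
  - by move=> w; rewrite (sesq0l hb) mul0r.
  - by move=> x /lP; rewrite -l0.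
  - by right.
have /choice[u uP] (k : nat) : exists x, [/\ perp s x, nsq ip x <= 1 & l - k.+1%:R^-1 < nsq b x].
  have k0 : 0 < (k.+1%:R^-1 : R) by rewrite invr_gt0.
  have [_ [x [px x1] <-] h] := sup_adherent k0 hS.
  by exists x.
have [phi phik phiC] : exists2 phi : nat -> nat, (forall k, (k <= phi k)%N) &
    cauchy_nrm b (u \o phi).
  by apply: compact => k; case: (uP k).
have par f (hf : sesq f) x y : nsq f (x + y) + nsq f (x - y) = 2 * nsq f x + 2 * nsq f y.
  by rewrite !(nsqD hf) (nsqN hf) (sesqNr hf) !cE; ring.
have small (e : R) : 0 < e -> exists N, forall i, (N <= i)%N -> l - e < nsq b (u i).
  move=> e0; exists (Num.truncn e^-1) => i hi'.
  have [_ _] := uP i; apply: le_lt_trans; rewrite lerD2l lerN2.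
  rewrite invf_ple ?posrE// (le_trans (ltW (truncnS_gt _)))// ler_nat.
  by rewrite ltnS.
have cau : cauchy_nrm ip (u \o phi).
  (* If b(x), b(y) > l - d and b(x - y) < d, then l |x - y|^2 <= 4l - b(x + y) < 5d, which is below
     l e^2 = 8d. *)
  move=> e e0; pose d := l * e ^+ 2 / 8.
  have d0 : 0 < d by rewrite divr_gt0// mulr_gt0// exprn_gt0.
  have [N1 h1] := small d d0.
  have [|N2 h2] := phiC (Num.sqrt d); first by rewrite sqrtr_gt0.
  exists (maxn N1 N2) => i j; rewrite !geq_max => /andP[i1 i2] /andP[j1 j2].
  have := h1 _ (leq_trans i1 (phik i)); have := h1 _ (leq_trans j1 (phik j)).
  have := h2 _ _ i2 j2; rewrite -(@ltr_pXn2r _ 2)// ?nnegrE ?nrm_ge0 ?sqrtr_ge0//.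
  rewrite (nrm2 b0) sqr_sqrtr ?(ltW d0)//=.
  have [px x1 _] := uP (phi i); have [py y1 _] := uP (phi j).
  move: (u (phi i)) (u (phi j)) px x1 py y1 => x y px x1 py y1 A1 A2 A3.
  rewrite -(@ltr_pXn2r _ 2)// ?nnegrE ?nrm_ge0 ?(ltW e0)//.
  rewrite (nrm2 ip0); have := lP _ (perpD px py).
  have := par _ hb x y; have := par _ hi x y => P1 P2 P3.
  rewrite -(ltr_pM2l l0).
  have : l * nsq ip (x - y) = 2 * (l * nsq ip x) + 2 * (l * nsq ip y) - l * nsq ip (x + y).
    have -> : nsq ip (x - y) = 2 * nsq ip x + 2 * nsq ip y - nsq ip (x + y) by lra.
    ring.
  have := ler_piMr (ltW l0) x1; have := ler_piMr (ltW l0) y1.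
  have : d * 8 = l * e ^+ 2 by rewrite /d; field.
  lra.
have [e ue] := complete cau.
have pe : perp s e by apply: perp_cvg ue => k; case: (uP (phi k)).
have nb x : nrm b x <= (`|B| + 1) * nrm ip x.
  rewrite -(@ler_pXn2r _ 2)// ?nnegrE ?nrm_ge0 ?mulr_ge0 ?nrm_ge0 ?addr_ge0//.
  rewrite exprMn (nrm2 b0) (nrm2 ip0) (le_trans (bB x))// ler_wpM2r ?ip0//.
  have := ler_norm B; have := normr_ge0 B; nra.
(* Upper semicontinuity along the subsequence: b is continuous for [ip] by [nb], and the values of b
   on the sequence tend to [l]. *)
have be : l <= nsq b e.
  apply/ler_addgt0Pr => eps eps0.
  rewrite -(nrm2 b0).
  have [d [d0 hd]] : exists d : R, 0 < d /\ 2 * nrm b e * d + d ^+ 2 <= eps / 2.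
    exists (Num.min 1 (eps / 2 / (2 * nrm b e + 1))).
    have c0 : 0 < 2 * nrm b e + 1 by have := nrm_ge0 b e; lra.
    set d := Num.min _ _.
    have d0 : 0 < d by rewrite lt_min ltr01 divr_gt0// divr_gt0.
    have d1 : d <= 1 by rewrite ge_min lexx.
    split=> //; have : d * (2 * nrm b e + 1) <= eps / 2.
      by rewrite -ler_pdivlMr// ge_min lexx orbT.
    have := nrm_ge0 b e; nra.
  have [|N1 h1] := ue (d / (`|B| + 1)); first by rewrite divr_gt0// ltr_wpDl.
  have [|N2 h2] := small (eps / 2); first by rewrite divr_gt0.
  pose k := maxn N1 N2.
  have := h2 _ (leq_trans (leq_maxr N1 N2) (phik k)).
  rewrite -(nrm2 b0).
  have hk : nrm b (u (phi k)) <= nrm b e + d.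
    have := nrmD hb b0 (u (phi k) - e) e; rewrite subrK => /le_trans; apply.
    rewrite addrC lerD2l (le_trans (nb _))// mulrC -ler_pdivlMr ?ltr_wpDl//.
    exact/ltW/h1/leq_maxl.
  have : nrm b (u (phi k)) ^+ 2 <= (nrm b e + d) ^+ 2.
    by rewrite ler_pXn2r// nnegrE ?addr_ge0 ?nrm_ge0// ltW.
  rewrite sqrrD -mulr_natl; lra.
have e1 : nsq ip e <= 1.
  rewrite -(nrm2 ip0) expr_le1// ?nrm_ge0//.
  apply/ler_addgt0Pr => eps eps0; have [N hN] := ue _ eps0.
  have := nrmD hi ip0 (e - u (phi N)) (u (phi N)); rewrite subrK => /le_trans; apply.
  rewrite addrC; apply: lerD.
    rewrite -(@expr_le1 _ 2)// ?nrm_ge0// (nrm2 ip0).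
    by case: (uP (phi N)).
  by rewrite (nrmB hi); exact/ltW/hN.
have le1 : nsq b e <= l * nsq ip e by exact: lP.
have ee : nsq ip e = 1 by apply/eqP; rewrite eq_le e1 -(ler_pM2l l0); lra.
exists (e, l); split=> //=; [exact: ltW| |by left].
pose p x y := l%:C * ip x y - b x y.
have hp : sesq p.
  split=> [a x y z|x y]; rewrite /p.
    by rewrite (sesq_lin hi) (sesq_lin hb); ring.
  rewrite conjcD conjcN conjcM conjc_real -(sesqC hi) -(sesqC hb)//.
have p0 x : perp s x -> 0 <= Re (p x x).
  by move=> /lP; rewrite /p !cE /= mul0r subr0 /nsq; lra.
(* Being [good] replaces [w] by a vector of the complement, the only place where [p] is known to be
   nonnegative. *)
move=> w; have [w' pw' hw'] := s2 w; have [-> ->] := hw' _ pe.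
suff : p e w' = 0 by rewrite /p => /eqP; rewrite subr_eq0 => /eqP.
apply: eq0_normc; apply/eqP; rewrite -sqrf_eq0 eq_le sqr_ge0 andbT.
have : Re (p e e) = 0.
  by apply/eqP; rewrite eq_le p0// andbT /p !cE /= mul0r subr0 -/(nsq ip e) ee -/(nsq b e); lra.
move=> pee; have := @sesq_CS _ _ p hp e w'; rewrite pee mul0r; apply; last exact: p0.
by move=> c; apply: p0; apply: perpD => //; exact: perpZ.
Qed.

(** Iterate [next_exists]. The last clause is the half of the min-max principle used later:
    orthogonality to the first k eigenvectors bounds the quotient by the k-th eigenvalue. *)
Lemma spectral_thm : exists (e : nat -> E) (l : nat -> R),
  [/\ forall k, 0 <= l k,
      forall i j, (i <= j)%N -> l j <= l i &
      forall i j, i != j -> ip (e i) (e j) = 0] /\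
  [/\ forall k w, b (e k) w = (l k)%:C * ip (e k) w,
      forall k, 0 < l k -> nsq ip (e k) = 1 &
      forall k x, (forall i, (i < k)%N -> ip x (e i) = 0) ->
         nsq b x <= l k * nsq ip x].
Proof.
have g0 : good [::].
  by split=> // w; exists w => //.
have /choice[f fP] (g : {s | good s}) : exists el : E * R, next (sval g) el.1 el.2.
  exact/next_exists/svalP.
(* The state carries the proof of [good], without which the next vector could not be chosen. *)
pose st (g : {s | good s}) : {s | good s} :=
  exist _ ((f g).1 :: sval g) (next_good (svalP g) (fP g)).
pose G k := iter k st (exist _ [::] g0).
pose e k := (f (G k)).1; pose l k := (f (G k)).2.
have GS k : sval (G k.+1) = e k :: sval (G k) by [].
have Gin i k : (i < k)%N -> e i \in sval (G k).
  elim: k => // k IH; rewrite ltnS leq_eqVlt GS inE => /predU1P[->|/IH ->].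
    by rewrite eqxx.
  by rewrite orbT.
have Gout k x : x \in sval (G k) -> exists2 i, (i < k)%N & x = e i.
  elim: k => // k IH; rewrite GS inE => /predU1P[->|/IH[i ik ->]].
    by exists k.
  by exists i => //; rewrite ltnS ltnW.
have eperp i j : (i < j)%N -> ip (e j) (e i) = 0.
  by move=> ij; have [_ p _ _ _] := fP (G j); apply: p; exact: Gin.
have lk0 k : 0 <= l k by have [] := fP (G k).
(* The next eigenvector lies in the previous, larger complement, and its quotient is its own
   eigenvalue. *)
have lS k : l k.+1 <= l k.
  have [_ p el _ [[l0 e1]|[l00 _]]] := fP (G k.+1); last by rewrite [l k.+1]l00; exact: lk0.
  have [_ _ _ h _] := fP (G k); have := h (e k.+1).
  rewrite /nsq el !cE /= mul0r subr0 -/(nsq ip _) e1 !mulr1; apply.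
  by move=> y yk; apply: p; rewrite GS inE yk orbT.
exists e, l; split; split=> //.
- move=> i j; elim: j => [|j IH]; first by rewrite leqn0 => /eqP ->.
  by rewrite leq_eqVlt => /predU1P[->//|/IH]; exact: le_trans.
- move=> i j; rewrite neq_ltn => /orP[ij|/eperp//].
  by rewrite (sesqC hi) eperp// conjc0.
- by move=> k w; have [_ _ el _ _] := fP (G k).
- move=> k k0.
  by have [_ _ _ _ [[]|[]]] := fP (G k) => // h; move: k0; rewrite /l h ltxx.
- move=> k x hx.
  by have [_ _ _ h _] := fP (G k); apply: h => y /Gout[i ik ->]; exact: hx.
Qed.

End spectral.

(** * Synthesis operators with summable weights *)

Lemma bounded_series_tail (R : realType) (u : nat -> R) (S : R) :
  (forall q, 0 <= u q) -> (forall N, \sum_(0 <= q < N) u q <= S) ->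
  forall e : R, 0 < e -> exists N, forall n m, (N <= n)%N -> \sum_(n <= q < m) u q < e.
Proof.
move=> u0 uS e e0.
pose A := range (fun N => \sum_(0 <= q < N) u q).
have hA : has_sup A by split; [exists (\sum_(0 <= q < 0) u q); exists 0%N|exists S => _ [N _ <-]].
have [_ [N _ <-] hN] := sup_adherent e0 hA.
exists N => n m Nn; have [nm|mn] := leqP n m; last by rewrite big_geq// ltnW.
have : \sum_(0 <= q < m) u q <= sup A by apply: ub_le_sup; [exact: hA.2|exists m].
rewrite (big_cat_nat (leq0n n) nm)/= (big_cat_nat (leq0n N) Nn)/=.
have : 0 <= \sum_(N <= q < n) u q by exact: sumr_ge0.
lra.
Qed.

Section synthesis.
Context (R : realType) (E : lmodType R[i]) (ip : E -> E -> R[i]).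
Local Notation Re := complex.Re.
Hypothesis hi : sesq ip.
Hypothesis ip0 : forall x, 0 <= Re (ip x x).
Hypothesis complete : forall u, cauchy_nrm ip u -> exists l, cvg_nrm ip u l.
Implicit Types (f g x y z : E) (t p : nat -> E).

Definition bessel t (B : R) :=
  forall f N, \sum_(0 <= q < N) normc (ip f (t q)) ^+ 2 <= B * nsq ip f.
Definition cobessel t (B : R) := forall (c : nat -> R[i]) N,
  nsq ip (\sum_(0 <= q < N) c q *: t q) <= B * \sum_(0 <= q < N) normc (c q) ^+ 2.

Lemma sum_CS (I : Type) (r : seq I) (P : pred I) (a c : I -> R) :
  (\sum_(i <- r | P i) a i * c i) ^+ 2 <=
  (\sum_(i <- r | P i) a i ^+ 2) * (\sum_(i <- r | P i) c i ^+ 2).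
Proof.
set D := \sum_(i <- r | P i) c i ^+ 2; set A := \sum_(i <- r | P i) a i ^+ 2.
set b := \sum_(i <- r | P i) a i * c i.
have D0 : 0 <= D by apply: sumr_ge0 => i _; exact: sqr_ge0.
apply: quad_ge0 => //; last exact: sqr_ge0.
move=> t; have : 0 <= \sum_(i <- r | P i) (a i - t * b * c i) ^+ 2.
  by apply: sumr_ge0 => i _; exact: sqr_ge0.
rewrite (eq_bigr (fun i => a i ^+ 2 + (- (2 * t * b) * (a i * c i) + (t * b) ^+ 2 * c i ^+ 2))).
  by rewrite !big_split/= -!mulr_sumr -/A -/b -/D; nra.
by move=> i _; ring.
Qed.

(** Duality without operators. If x is the finite sum and d its coefficients against [t], then |x|^2
    <= sum |c||d|; Cauchy-Schwarz and the Bessel bound at x give |x|^4 <= S B |x|^2. *)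
Lemma bessel_cobessel t B : 0 <= B -> bessel t B -> cobessel t B.
Proof.
move=> B0 hB c N; set x := \sum_(_ <= _ < _) _; set S := \sum_(_ <= _ < _) _.
have S0 : 0 <= S by apply: sumr_ge0 => q _; rewrite exprn_ge0// normc_ge0.
have [x0|x0] := ltP 0 (nsq ip x); last exact: (le_trans x0 (mulr_ge0 _ _)).
pose d q := ip x (t q).
have hd : \sum_(0 <= q < N) normc (d q) ^+ 2 <= B * nsq ip x by exact: hB.
have xE : nsq ip x <= \sum_(0 <= q < N) normc (c q) * normc (d q).
  rewrite {1}/nsq {1}/x (sesq_suml hi) Re_sum; apply: ler_sum => q _.
  rewrite (sesqZl hi) (sesqC hi x) (le_trans (ler_norm _))//.
  by rewrite (le_trans (Re_le_normc _))// normcM normcJ'.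
have := sum_CS (index_iota 0 N) xpredT (fun q => normc (c q)) (fun q => normc (d q)).
rewrite -/S => h; rewrite -(ler_pM2r x0) -expr2.
apply: (@le_trans _ _ ((\sum_(0 <= q < N) normc (c q) * normc (d q)) ^+ 2)).
  by rewrite ler_pXn2r// nnegrE ?(ltW x0)// (le_trans (ltW x0)).
apply: (le_trans h); have := ler_wpM2l S0 hd; lra.
Qed.

(** Test f against y = sum <f, p_q> p_q: the pairing <f, y> is the sum S itself, while |y|^2 <= B
    S. *)
Lemma cobessel_bessel p B : 0 <= B -> cobessel p B -> bessel p B.
Proof.
move=> B0 hB f N; set S := \sum_(_ <= _ < _) _.
have S0 : 0 <= S by apply: sumr_ge0 => q _; rewrite exprn_ge0// normc_ge0.
move: (S0); rewrite le_eqVlt => /predU1P[<-|S1]; first by rewrite mulr_ge0// ip0.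
pose y := \sum_(0 <= q < N) ip f (p q) *: p q.
have yB : nsq ip y <= B * S by exact: hB.
have yE : ip f y = S%:C.
  rewrite (sesq_sumr hi) /S rmorph_sum/=; apply: eq_bigr => q _.
  by rewrite (sesqZr hi) mulrC mulcJ.
have := CS_sq hi ip0 f y; rewrite yE normc_real ger0_norm// expr2.
move=> h; rewrite -(ler_pM2r S1); apply: (le_trans h).
have := ler_wpM2l (nsq_ge0 ip0 f) yB; lra.
Qed.

Lemma cobessel_cond p B (P : pred nat) (c : nat -> R[i]) N : cobessel p B ->
  nsq ip (\sum_(0 <= q < N | P q) c q *: p q) <= B * \sum_(0 <= q < N | P q) normc (c q) ^+ 2.
Proof.
move=> hB; have -> : \sum_(0 <= q < N | P q) c q *: p q =
    \sum_(0 <= q < N) (if P q then c q else 0) *: p q.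
  by rewrite big_mkcond; apply: eq_bigr => q _; case: ifP => // _; rewrite scale0r.
have -> : \sum_(0 <= q < N | P q) normc (c q) ^+ 2 =
    \sum_(0 <= q < N) normc (if P q then c q else 0) ^+ 2.
  rewrite big_mkcond; apply: eq_bigr => q _; case: ifP => // _.
  by rewrite normc0 expr0n.
exact: hB.
Qed.

Definition partial_syn t p f N := \sum_(0 <= q < N) ip f (t q) *: p q.

Lemma partial_synE t p f n m : (n <= m)%N ->
  partial_syn t p f m - partial_syn t p f n = \sum_(n <= q < m) ip f (t q) *: p q.
Proof. by move=> nm; rewrite /partial_syn (big_cat_nat (leq0n n) nm)/= addrAC subrr add0r. Qed.

Lemma partial_syn_linear t p a x y N :
  partial_syn t p (a *: x + y) N = a *: partial_syn t p x N + partial_syn t p y N.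
Proof.
rewrite /partial_syn scaler_sumr -big_split/=; apply: eq_bigr => q _.
by rewrite (sesq_lin hi) scalerDl scalerA.
Qed.

Lemma syn_exists t p B1 B2 : 0 <= B2 -> bessel t B1 -> cobessel p B2 ->
  exists T : E -> E, forall f, cvg_nrm ip (partial_syn t p f) (T f).
Proof.
move=> B20 h1 h2; suff /choice[T hT] : forall f, exists y, cvg_nrm ip (partial_syn t p f) y by exists T.
move=> f; apply: complete => e e0.
have [||N hN] := @bounded_series_tail R (fun q => normc (ip f (t q)) ^+ 2)
    (B1 * nsq ip f) _ (h1 f) (e ^+ 2 / (B2 + 1)).
- by move=> q; rewrite exprn_ge0// normc_ge0.
- by rewrite divr_gt0 ?exprn_gt0// ltr_wpDl.
suff H i j : (N <= i)%N -> (i <= j)%N -> nrm ip (partial_syn t p f j - partial_syn t p f i) < e.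
  exists N => i j Ni Nj; have [ij|/ltnW ji] := leqP i j; last exact: H.
  by rewrite (nrmB hi); exact: H.
move=> Ni ij; rewrite -(@ltr_pXn2r _ 2)// ?nnegrE ?nrm_ge0 ?(ltW e0)//.
rewrite (nrm2 ip0) partial_synE//.
have -> : \sum_(i <= q < j) ip f (t q) *: p q =
    \sum_(0 <= q < j | (i <= q)%N) ip f (t q) *: p q.
  by rewrite (big_nat_widenl i 0).
apply: (le_lt_trans (cobessel_cond _ _ _ h2)).
have -> : \sum_(0 <= q < j | (i <= q)%N) normc (ip f (t q)) ^+ 2 =
   \sum_(i <= q < j) normc (ip f (t q)) ^+ 2.
  by rewrite (big_nat_widenl i 0).
have := hN _ j Ni; rewrite ltr_pdivlMr ?ltr_wpDl// => h.
rewrite (le_lt_trans _ h)// mulrC ler_wpM2l ?lerDl//.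
by apply: sumr_ge0 => q _; rewrite exprn_ge0// normc_ge0.
Qed.

Lemma cvg_nrm_le u l x (X : R) N0 : 0 <= X -> cvg_nrm ip u l ->
  (forall N, (N0 <= N)%N -> nrm ip (u N - x) <= X) -> nrm ip (l - x) <= X.
Proof.
move=> X0 ul h; apply/ler_addgt0Pr => e e0; have [N hN] := ul _ e0.
rewrite (le_trans (nrm_tri hi ip0 (u (maxn N N0)) _ _))// addrC lerD//.
  by apply: h; rewrite leq_maxr.
by rewrite (nrmB hi) ltW// hN// leq_maxl.
Qed.

Lemma cvg_nsq_le u l (X : R) N0 : 0 <= X -> cvg_nrm ip u l ->
  (forall N, (N0 <= N)%N -> nsq ip (u N) <= X) -> nsq ip l <= X.
Proof.
move=> X0 ul h.
have : nrm ip (l - 0) <= Num.sqrt X.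
  apply: (cvg_nrm_le (N0 := N0)) ul _; first exact: sqrtr_ge0.
  by move=> N hN; rewrite subr0 ler_wsqrtr// h.
by rewrite subr0 -(@ler_pXn2r _ 2) ?nnegrE ?nrm_ge0 ?sqrtr_ge0// (nrm2 ip0) sqr_sqrtr.
Qed.

Lemma cvg_ip_eq u v l l' x y : cvg_nrm ip u l -> cvg_nrm ip v l' ->
  (forall N, ip (u N) x = ip y (v N)) -> ip l x = ip y l'.
Proof.
move=> ul vl h; apply/eqP; rewrite -subr_eq0; apply/eqP/eq0_normc/eqP.
rewrite eq_le normc_ge0 andbT; apply/ler_addgt0Pr => e e0; rewrite add0r.
have X0 : 0 < nrm ip x + 1 by have := nrm_ge0 ip x; lra.
have Y0 : 0 < nrm ip y + 1 by have := nrm_ge0 ip y; lra.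
have [|N1 h1] := ul (e / 2 / (nrm ip x + 1)); first by rewrite !divr_gt0.
have [|N2 h2] := vl (e / 2 / (nrm ip y + 1)); first by rewrite !divr_gt0.
pose N := maxn N1 N2.
have -> : ip l x - ip y l' = ip y (v N - l') - ip (u N - l) x.
  by rewrite (sesqBl hi) (sesqBr hi) h; ring.
have := h1 N (leq_maxl _ _); rewrite ltr_pdivlMr// => {}h1.
have := h2 N (leq_maxr _ _); rewrite ltr_pdivlMr// => {}h2.
have := CS hi ip0 (u N - l) x; have := CS hi ip0 y (v N - l').
have := le_normcD (ip y (v N - l')) (- ip (u N - l) x); rewrite normcN.
have := nrm_ge0 ip (u N - l); have := nrm_ge0 ip (v N - l').
nra.
Qed.

(** Limits are unique only up to null vectors, so a pointwise chosen [T] can be linear only in this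
    sense. *)
Lemma syn_linear t p T : (forall f, cvg_nrm ip (partial_syn t p f) (T f)) ->
  forall a x y, nrm ip (T (a *: x + y) - (a *: T x + T y)) = 0.
Proof.
move=> hT a x y; apply/eqP; rewrite eq_le nrm_ge0 andbT.
apply/ler_addgt0Pr => e e0; rewrite add0r.
have A0 : 0 < normc a + 1 by have := normc_ge0 a; lra.
have [|N1 h1] := hT (a *: x + y) (e / 3); first by rewrite divr_gt0.
have [|N2 h2] := hT x (e / 3 / (normc a + 1)); first by rewrite !divr_gt0.
have [|N3 h3] := hT y (e / 3); first by rewrite divr_gt0.
pose N := maxn N1 (maxn N2 N3).
have {}h1 := h1 N (leq_maxl _ _).
have {}h2 : nrm ip (partial_syn t p x N - T x) < e / 3 / (normc a + 1).
  by apply: h2; rewrite leq_max leq_maxl orbT.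
have {}h3 : nrm ip (partial_syn t p y N - T y) < e / 3.
  by apply: h3; rewrite leq_max leq_maxr orbT.
have -> : T (a *: x + y) - (a *: T x + T y) =
  - (partial_syn t p (a *: x + y) N - T (a *: x + y)) +
  (a *: (partial_syn t p x N - T x) + (partial_syn t p y N - T y)).
  by rewrite partial_syn_linear scalerBr [X in _ = _ + X]addrACA -opprD opprB addrA subrK.
have := nrmD hi ip0 (- (partial_syn t p (a *: x + y) N - T (a *: x + y)))
  (a *: (partial_syn t p x N - T x) + (partial_syn t p y N - T y)).
have := nrmD hi ip0 (a *: (partial_syn t p x N - T x)) (partial_syn t p y N - T y).
rewrite (nrmN hi) (nrmZ hi).
move: h2; rewrite ltr_pdivlMr// => h2.
have := nrm_ge0 ip (partial_syn t p x N - T x); nra.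
Qed.

End synthesis.

(** A single ultrafilter on the indices makes every bounded sequence converge. It gives simultaneous
    limits of all coefficients and replaces successive extractions of subsequences. *)
Lemma ultra_bounded_cvg (R : realType) (U : set_system nat) (g : nat -> R) (M : R) :
  UltraFilter U -> (forall k, `|g k| <= M) ->
  exists l : R, forall e : R, 0 < e -> U [set k | `|l - g k| < e].
Proof.
move=> UU gM; have UF : ProperFilter U by exact: ultra_proper.
have := @segment_compact R (- M) M; rewrite compact_ultra => /(_ (g @ U)).
have UI : UltraFilter (g @ U).
  split=> [|G GG gUG]; first exact: fmap_proper_filter.
  rewrite predeqE => A; split; last exact: gUG.
  move=> GA; have [//|UnA] := in_ultra_setVsetC (g @^-1` A) UU.
  have GnA : G (~` A) by exact: gUG.
  by have /filter_ex[? []] : G (A `&` ~` A) by exact: filterI.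
case=> //.
  suff : U (g @^-1` `[- M, M]) by [].
  by apply: filterE => k; rewrite /= in_itv/= -ler_norml.
move=> l [_ gl]; exists l => e e0.
by have /cvgrPdist_lt/(_ _ e0) := gl.
Qed.

(** Greedy enumeration in decreasing order of weight. Indices of weight zero may be left out, so [j]
    need not be onto; injectivity and domination of the indices not yet chosen suffice. *)
Lemma argmax_seq (R : realType) (w : nat -> R) :
  (forall q, 0 <= w q) ->
  (forall e : R, 0 < e -> exists N, forall q, (N <= q)%N -> w q < e) ->
  exists j : nat -> nat, injective j /\
    forall k q, (forall i, (i < k)%N -> j i != q) -> w q <= w (j k).
Proof.
move=> w0 wcvg.
have step (J : seq nat) : exists p, p \notin J /\ forall q, q \notin J -> w q <= w p.
  (* An index outside [J], chosen when all the remaining weights vanish. *)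
  pose m := (\max_(q <- J) q).+1.
  have mJ : m \notin J.
    by apply/negP => mJ; have := leq_bigmax_seq (F := fun q => q) (P := xpredT) m mJ isT; rewrite {1}/m ltnn.
  have [[q0 [q0J q0w]]|h] := pselect (exists q, q \notin J /\ 0 < w q).
    (* Beyond N every weight is below that of [q0], so the maximum outside [J] is attained among
       finitely many indices. *)
    have [N hN] := wcvg _ q0w; pose K := (maxn N q0).+1.
    have q0K : (q0 < K)%N by rewrite ltnS leq_maxr.
    have i0P : (fun i : 'I_K => (i : nat) \notin J) (Ordinal q0K) by [].
    pose i1 := [arg max_(i > Ordinal q0K | (i : nat) \notin J) w i]%O.
    have : (i1 : nat) \notin J /\ forall i : 'I_K, (i : nat) \notin J -> w i <= w i1.
      by rewrite /i1; case: arg_maxP => //= i iJ hi; split.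
    move=> [i1J hi1]; exists (nat_of_ord i1); split=> // q qJ.
    have [qK|Kq] := ltnP q K; first exact: (hi1 (Ordinal qK)).
    rewrite (le_trans (ltW (hN q _)))//; last exact: (hi1 (Ordinal q0K)).
    by rewrite (leq_trans _ Kq)// leqW// leq_maxl.
  exists m; split=> // q qJ; rewrite (le_trans _ (w0 m))// leNgt.
  by apply/negP => qw; apply: h; exists q.
have {step} /choice[f fP] := step.
pose G k := iter k (fun J => f J :: J) [::].
have Gin i k : (i < k)%N -> f (G i) \in G k.
  elim: k => // k IH; rewrite ltnS leq_eqVlt /= inE => /predU1P[->|/IH ->].
    by rewrite eqxx.
  by rewrite orbT.
have Gout k x : x \in G k -> exists2 i, (i < k)%N & f (G i) = x.
  elim: k => // k IH; rewrite /= inE => /predU1P[->|/IH[i ik <-]].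
    by exists k.
  by exists i => //; rewrite ltnS ltnW.
exists (fun k => f (G k)); split.
  have lt i k : (i < k)%N -> f (G i) <> f (G k).
    by move=> /Gin h h'; move: h; rewrite h'; apply/negP; have [] := fP (G k).
  by move=> i k /= h; case: (ltngtP i k) => // [/lt/(_ h)//|/lt/(_ (esym h))//].
move=> k q h; have [_] := fP (G k); apply.
by apply/negP => /Gout[i ik iq]; have := h i ik; rewrite iq eqxx.
Qed.

Lemma sum_injective_le (R : realType) (u : nat -> R) (S : R) (j : nat -> nat) N :
  injective j -> (forall q, 0 <= u q) -> (forall N, \sum_(0 <= q < N) u q <= S) ->
  \sum_(0 <= k < N) u (j k) <= S.
Proof.
move=> ji u0 uS; pose M := (\max_(q <- map j (iota 0 N)) q).+1.
have sM : {subset map j (iota 0 N) <= index_iota 0 M}.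
  move=> q qJ; rewrite mem_index_iota /M ltnS /=.
  exact: (leq_bigmax_seq (F := fun q => q) (P := xpredT) q qJ isT).
have us : uniq (map j (iota 0 N)) by rewrite map_inj_uniq// iota_uniq.
apply: (le_trans _ (uS M)); rewrite {1}/index_iota subn0 -(big_map j xpredT u).
rewrite (perm_big [seq q <- index_iota 0 M | q \in map j (iota 0 N)]); last first.
  apply: uniq_perm => //; first by rewrite filter_uniq// iota_uniq.
  move=> q; rewrite mem_filter; case: (boolP (q \in map j _)) => //= qJ.
  by rewrite (sM _ qJ).
rewrite big_filter big_mkcond; apply: ler_sum => q _.
by case: ifP.
Qed.

Section schatten_synthesis.
Context (R : realType) (E : lmodType R[i]) (ip : E -> E -> R[i]).
Local Notation Re := complex.Re.
Local Notation Im := complex.Im.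
Hypothesis hi : sesq ip.
Hypothesis ip0 : forall x, 0 <= Re (ip x x).
Hypothesis complete : forall u, cauchy_nrm ip u -> exists l, cvg_nrm ip u l.
Variables (t p : nat -> E) (B K r S : R) (w : nat -> R).
Hypotheses (B0 : 0 <= B) (K0 : 0 <= K) (r0 : 0 < r) (w0 : forall q, 0 <= w q).
Hypothesis tB : bessel ip t B.
Hypothesis pK : forall (c : nat -> R[i]) N,
  nsq ip (\sum_(0 <= q < N) c q *: p q) <=
  K * \sum_(0 <= q < N) w q ^+ 2 * normc (c q) ^+ 2.
Hypothesis wS : forall N, \sum_(0 <= q < N) w q `^ r <= S.
Variables (T Ts : E -> E).
Hypothesis hT : forall f, cvg_nrm ip (partial_syn ip t p f) (T f).
Hypothesis hTs : forall f, cvg_nrm ip (partial_syn ip p t f) (Ts f).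

Let ltr_powR' (x y : R) : 0 <= x -> 0 <= y -> x `^ r < y `^ r -> x < y.
Proof.
move=> x0 y0; rewrite !ltNge; apply: contra => yx.
by rewrite ge0_ler_powR ?nnegrE// ltW.
Qed.

Lemma weight_cvg (e : R) : 0 < e -> exists N, forall q, (N <= q)%N -> w q < e.
Proof.
move=> e0; have [||N hN] := bounded_series_tail _ wS (e := e `^ r).
- by move=> q; exact: powR_ge0.
- by rewrite powR_gt0.
exists N => q Nq; apply: ltr_powR' => //; first exact: ltW.
by have := hN q q.+1 Nq; rewrite big_nat1.
Qed.

Let W := S `^ r^-1.

Lemma weight_le q : w q <= W.
Proof.
have : w q `^ r <= S.
  apply: le_trans (wS q.+1); rewrite big_nat_recr//= lerDr.
  by apply: sumr_ge0 => i _; exact: powR_ge0.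
move=> h; have -> : w q = (w q `^ r) `^ r^-1.
  by rewrite -powRrM mulfV ?gt_eqF// powRr1.
by rewrite ge0_ler_powR ?nnegrE ?invr_ge0 ?powR_ge0 ?(ltW r0)// (le_trans _ h)// powR_ge0.
Qed.

Let sum_normc_ge0 (c : nat -> R[i]) N : 0 <= \sum_(0 <= q < N) normc (c q) ^+ 2.
Proof. by apply: sumr_ge0 => q _; rewrite exprn_ge0// normc_ge0. Qed.

Lemma synthesis_cobessel : cobessel ip p (K * W ^+ 2).
Proof.
move=> c N; apply: (le_trans (pK c N)); rewrite -mulrA ler_wpM2l// mulr_sumr.
apply: ler_sum => q _; rewrite ler_wpM2r ?exprn_ge0 ?normc_ge0//.
by rewrite ler_pXn2r// ?nnegrE ?powR_ge0// weight_le.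
Qed.

Let KW0 : 0 <= K * W ^+ 2.
Proof. by rewrite mulr_ge0// exprn_ge0// powR_ge0. Qed.

(** Once f is orthogonal to the t_q with q in [J], only the weights outside [J] enter. With [J]
    empty this is boundedness; with [J] the k heaviest indices it bounds the k-th singular value. *)
Lemma syn_rank (J : seq nat) (rho : R) f : 0 <= rho ->
  (forall q, q \notin J -> w q <= rho) ->
  (forall q, q \in J -> ip f (t q) = 0) ->
  nsq ip (T f) <= K * rho ^+ 2 * (B * nsq ip f).
Proof.
move=> rho0 hJ fJ; have X0 : 0 <= K * rho ^+ 2 * (B * nsq ip f).
  by rewrite !mulr_ge0// ?exprn_ge0// ip0.
apply: (cvg_nsq_le hi ip0 (N0 := 0%N) X0 (hT f)) => N _; apply: (le_trans (pK _ N)).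
rewrite -mulrA ler_wpM2l//; apply: (@le_trans _ _ (rho ^+ 2 * \sum_(0 <= q < N) normc (ip f (t q)) ^+ 2)).
  rewrite mulr_sumr; apply: ler_sum => q _.
  have [qJ|qJ] := boolP (q \in J); first by rewrite fJ// normc0 expr0n !mulr0.
  rewrite ler_wpM2r ?exprn_ge0 ?normc_ge0// ler_pXn2r ?nnegrE//; exact: hJ.
by rewrite ler_wpM2l ?exprn_ge0.
Qed.

Lemma syn_bounded f : nsq ip (T f) <= K * W ^+ 2 * B * nsq ip f.
Proof.
rewrite -mulrA; apply: (syn_rank (J := [::])) => //; first exact: powR_ge0.
by move=> q _; exact: weight_le.
Qed.

Lemma syn_adj_bounded f : nsq ip (Ts f) <= B * (K * W ^+ 2) * nsq ip f.
Proof.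
have h1 := cobessel_bessel hi ip0 KW0 synthesis_cobessel.
have h2 := bessel_cobessel hi B0 tB.
have X0 : 0 <= B * (K * W ^+ 2) * nsq ip f by exact: mulr_ge0 (mulr_ge0 B0 KW0) (ip0 f).
apply: (cvg_nsq_le hi ip0 (N0 := 0%N) X0 (hTs f)) => N _; apply: (le_trans (h2 _ N)).
by rewrite -mulrA ler_wpM2l.
Qed.

Lemma syn_adjoint f g : ip (T f) g = ip f (Ts g).
Proof.
apply: (cvg_ip_eq hi ip0 (hT f) (hTs g)) => N.
rewrite /partial_syn (sesq_suml hi) (sesq_sumr hi); apply: eq_bigr => q _.
by rewrite (sesqZl hi) (sesqZr hi) -(sesqC hi) mulrC.
Qed.

Lemma syn_linear_ip a x y z : ip (T (a *: x + y)) z = a * ip (T x) z + ip (T y) z.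
Proof.
have := nrm_eq0_ip hi ip0 z (syn_linear hi ip0 hT a x y).
by rewrite (sesqBl hi) (sesq_lin hi) => /eqP; rewrite subr_eq0 => /eqP.
Qed.

Let b x y := ip (T x) (T y).

Lemma syn_form : sesq b.
Proof.
split=> [a x y z|x y]; rewrite /b; first exact: syn_linear_ip.
by rewrite (sesqC hi).
Qed.

Lemma syn_formB x y : nrm b (x - y) = nrm ip (T x - T y).
Proof.
rewrite /nrm /nsq /b; congr (Num.sqrt (Re _)).
have h z : ip (T (x - y)) z = ip (T x - T y) z.
  have := syn_linear_ip (-1) y x z; rewrite scaleN1r addrC => ->.
  by rewrite mulN1r (sesqBl hi) addrC.
by rewrite h (sesqC hi) h -(sesqC hi).
Qed.

(** Along an ultrafilter all coefficients <u_k, t_q> converge. In |T(u_i - u_j)|^2 the finitely many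
    first coefficients are then close, and the tail carries small weights. *)
Lemma syn_compact u : (forall k, nsq ip (u k) <= 1) ->
  exists2 phi : nat -> nat, {homo phi : j k / (j < k)%N} &
    cauchy_nrm ip (fun k => T (u (phi k))).
Proof.
move=> u1.
have [U [UU oU]] := ultraFilterLemma (F := \oo%classic) _.
have UF : ProperFilter U by exact: ultra_proper.
have cB k q : normc (ip (u k) (t q)) <= Num.sqrt B.
  rewrite -(@ler_pXn2r _ 2)// ?nnegrE ?normc_ge0 ?sqrtr_ge0// sqr_sqrtr//.
  have := tB (u k) q.+1; rewrite big_nat_recr//= => h.
  have h1 := sum_normc_ge0 (fun q => ip (u k) (t q)) q.
  have := ler_piMr B0 (u1 k); lra.
have [lr hlr] : exists lr : nat -> R, forall q (e : R), 0 < e ->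
    U [set k | `|lr q - Re (ip (u k) (t q))| < e].
  suff /choice[l hl] : forall q, exists l : R, forall e : R, 0 < e ->
      U [set k | `|l - Re (ip (u k) (t q))| < e] by exists l.
  move=> q; apply: (ultra_bounded_cvg (M := Num.sqrt B)) => k.
  by rewrite (le_trans (Re_le_normc _)).
have [li hli] : exists li : nat -> R, forall q (e : R), 0 < e ->
    U [set k | `|li q - Im (ip (u k) (t q))| < e].
  suff /choice[l hl] : forall q, exists l : R, forall e : R, 0 < e ->
      U [set k | `|l - Im (ip (u k) (t q))| < e] by exists l.
  move=> q; apply: (ultra_bounded_cvg (M := Num.sqrt B)) => k.
  by rewrite (le_trans (Im_le_normc _)).
have near N (d : R) : 0 < d -> U [set k | forall q, (q < N)%N ->
    normc (ip (u k) (t q) - (lr q +i* li q)) < d].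
  move=> d0; elim: N => [|N IH]; first by apply: filterE => k q.
  have d2 : 0 < d / 2 by rewrite divr_gt0.
  apply: filterS (filterI IH (filterI (hlr N _ d2) (hli N _ d2))).
  move=> k /= [h1 [h2 h3]] q; rewrite ltnS leq_eqVlt => /predU1P[->|/h1//].
  apply: (le_lt_trans (normc_ReIm _)); rewrite !cE /=.
  by rewrite -[X in X + _]normrN -[X in _ + X]normrN !opprB; lra.
have small (e : R) : 0 < e -> exists2 A, U A & forall i j, A i -> A j ->
    nrm ip (T (u i) - T (u j)) < e.
  move=> e0.
  (* [rho] bounds the tail weights and [2 * d] the first N coefficients; each share is less than e^2
     / 2. The 4 bounds the squared seminorm of a difference of two vectors of the unit ball. *)
  have X0 : 0 < 4 * K * B + 1 by rewrite ltr_wpDl// !mulr_ge0.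
  pose rho := Num.sqrt (e ^+ 2 / 2 / (4 * K * B + 1)).
  have rho0 : 0 < rho by rewrite sqrtr_gt0 !divr_gt0// exprn_gt0.
  have [N hN] := weight_cvg rho0.
  have Y0 : 0 < K * W ^+ 2 * N%:R + 1 by rewrite ltr_wpDl// mulr_ge0.
  pose d := Num.sqrt (e ^+ 2 / 2 / (K * W ^+ 2 * N%:R + 1)) / 2.
  have d0 : 0 < d by rewrite divr_gt0// sqrtr_gt0 !divr_gt0// exprn_gt0.
  eexists; first exact: (near N d d0).
  move=> i j Ai Aj.
  rewrite -syn_formB -(@ltr_pXn2r _ 2)// ?nnegrE ?nrm_ge0 ?(ltW e0)// nrm2 ?/b//.
  rewrite /b -/(nsq ip _).
  set x := u i - u j.
  have x4 : nsq ip x <= 4.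
    rewrite /x; have := nsqD2 hi ip0 (u i) (- u j); rewrite (nsqN hi).
    have := u1 i; have := u1 j; lra.
  have hd q : (q < N)%N -> normc (ip x (t q)) ^+ 2 <= (2 * d) ^+ 2.
    move=> qN; rewrite ler_pXn2r ?nnegrE ?normc_ge0 ?mulr_ge0 ?(ltW d0)//.
    have -> : ip x (t q) = (ip (u i) (t q) - (lr q +i* li q)) - (ip (u j) (t q) - (lr q +i* li q)).
      by rewrite (sesqBl hi); ring.
    rewrite (le_trans (le_normcD _ _))// normcN.
    have := Ai q qN; have := Aj q qN; lra.
  have Z0 : 0 <= K * (W ^+ 2 * (N%:R * (2 * d) ^+ 2) + rho ^+ 2 * (B * nsq ip x)).
    apply: mulr_ge0 => //; apply: addr_ge0.
      by rewrite mulr_ge0 ?sqr_ge0// mulr_ge0 ?sqr_ge0.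
    by rewrite mulr_ge0 ?sqr_ge0// mulr_ge0 ?nsq_ge0.
  apply: (@le_lt_trans _ _ (K * (W ^+ 2 * (N%:R * (2 * d) ^+ 2) + rho ^+ 2 * (B * nsq ip x)))).
    apply: (cvg_nsq_le hi ip0 (N0 := N) Z0 (hT x)) => M NM; apply: (le_trans (pK _ M)).
    rewrite ler_wpM2l// (big_cat_nat (leq0n N) NM)/= lerD//.
      have -> : N%:R * (2 * d) ^+ 2 = \sum_(0 <= q < N) (2 * d) ^+ 2.
        by rewrite sumr_const_nat subn0 mulr_natl.
      rewrite mulr_sumr [leLHS]big_nat [leRHS]big_nat; apply: ler_sum => q /andP[_ qN].
      by rewrite ler_pM ?sqr_ge0 ?hd// ler_pXn2r ?nnegrE ?powR_ge0 ?weight_le.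
    apply: (@le_trans _ _ (rho ^+ 2 * \sum_(0 <= q < M) normc (ip x (t q)) ^+ 2)).
      rewrite [in leRHS](big_cat_nat (leq0n N) NM)/= mulrDr.
      rewrite -[leLHS]add0r lerD//; first by rewrite mulr_ge0 ?sqr_ge0.
      rewrite mulr_sumr [leLHS]big_nat [leRHS]big_nat; apply: ler_sum => q /andP[Nq _].
      by rewrite ler_wpM2r ?sqr_ge0// ler_pXn2r ?nnegrE ?(ltW rho0)// ltW// hN.
    by rewrite ler_wpM2l ?sqr_ge0.
  have E1 : (2 * d) ^+ 2 * (K * W ^+ 2 * N%:R + 1) = e ^+ 2 / 2.
    rewrite /d mulrC [2 * _]mulrC divfK// sqr_sqrtr; last first.
      by rewrite !divr_ge0// ?sqr_ge0// ltW.
    by rewrite mulrC divfK// gt_eqF.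
  have E2 : rho ^+ 2 * (4 * K * B + 1) = e ^+ 2 / 2.
    rewrite /rho sqr_sqrtr; last by rewrite !divr_ge0// ?sqr_ge0// ltW.
    by rewrite divfK// gt_eqF.
  have D0 : 0 < (2 * d) ^+ 2 by rewrite exprn_gt0// mulr_gt0.
  have R0 : 0 < rho ^+ 2 by rewrite exprn_gt0.
  have : K * (rho ^+ 2 * (B * nsq ip x)) <= K * (rho ^+ 2 * (B * 4)).
    by rewrite !ler_wpM2l// ltW.
  lra.
have [A hA] : exists A : nat -> set nat, forall k, U (A k) /\
    forall i j, A k i -> A k j -> nrm ip (T (u i) - T (u j)) < k.+1%:R^-1.
  suff /choice[A hA] : forall k, exists X : set nat, U X /\
      forall i j, X i -> X j -> nrm ip (T (u i) - T (u j)) < k.+1%:R^-1 by exists A.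
  move=> k; have [|X UX hX] := small k.+1%:R^-1; first by rewrite invr_gt0.
  by exists X.
have Acap k : U (fun i => forall l, (l <= k)%N -> A l i).
  elim: k => [|k IH].
    by apply: filterS (hA 0%N).1 => i Ai l; rewrite leqn0 => /eqP ->.
  apply: filterS (filterI IH (hA k.+1).1) => i [h1 h2] l.
  by rewrite leq_eqVlt => /predU1P[->//|/h1].
have [f fP] : exists f : nat -> nat -> nat, forall k m,
    (m < f k m)%N /\ forall l, (l <= k)%N -> A l (f k m).
  suff /choice[f hf] : forall k, exists g : nat -> nat, forall m,
      (m < g m)%N /\ forall l, (l <= k)%N -> A l (g m) by exists f.
  move=> k; suff /choice[f hf] : forall m, exists y : nat,
      (m < y)%N /\ forall l, (l <= k)%N -> A l y by exists f.
  move=> m.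
  have Um : U [set i | (m < i)%N] by apply: oU; exists m.+1.
  by have [y [h1 h2]] := filter_ex (filterI Um (Acap k)); exists y.
(* The k-th index is taken beyond the previous one and in the first k + 1 sets [A]; both are
   possible since the sets of the ultrafilter meet every tail. *)
pose phi := fix phi k := match k with 0 => f 0%N 0%N | k'.+1 => f k'.+1 (phi k') end.
exists phi.
  apply: homo_ltn; first exact: ltn_trans.
  by move=> k /=; have [] := fP k.+1 (phi k).
have phiA k l : (l <= k)%N -> A l (phi k).
  by case: k => [|k] lk; [have [_] := fP 0%N 0%N|have [_] := fP k.+1 (phi k)]; apply.
move=> e e0; exists (Num.truncn e^-1) => i j hi' hj.
apply: (@lt_le_trans _ _ (Num.truncn e^-1).+1%:R^-1).
  by apply: (hA _).2; exact: phiA.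
by rewrite invf_ple ?posrE// ltW// truncnS_gt.
Qed.

(** Eigenvalues of the form <Tx, Ty> are compared with the weights sorted by [argmax_seq]: l_k <= K
    B w(j_k)^2. Summability of the powers w^r then passes to the square roots of the l_k. *)
Lemma syn_singular : exists (e : nat -> E) (s : nat -> R),
  [/\ forall k, 0 <= s k,
      forall i j, (i <= j)%N -> s j <= s i &
      forall i j, i != j -> ip (e i) (e j) = 0] /\
  [/\ forall k v, b (e k) v = (s k ^+ 2)%:C * ip (e k) v,
      forall k, 0 < s k -> nsq ip (e k) = 1,
      forall k x, (forall i, (i < k)%N -> ip x (e i) = 0) ->
         nsq b x <= s k ^+ 2 * nsq ip x &
      exists S', forall N, \sum_(0 <= k < N) s k `^ r <= S'].
Proof.
have bp0 x : 0 <= Re (b x x) by exact: ip0.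
have bK x : nsq b x <= K * W ^+ 2 * B * nsq ip x by exact: syn_bounded.
have cpt u : (forall k, nsq ip (u k) <= 1) -> exists2 phi : nat -> nat,
    (forall k, (k <= phi k)%N) & cauchy_nrm b (u \o phi).
  move=> u1; have [phi hphi uc] := syn_compact u1; exists phi.
    elim=> // k IH; apply: (leq_ltn_trans IH); exact: hphi.
  by move=> d /uc[N hN]; exists N => i j iN jN; rewrite /= syn_formB; exact: hN.
have [e [l [[l0 lm eo] [el e1 lx]]]] := spectral_thm hi ip0 syn_form bp0 bK complete cpt.
have [j [ji jw]] := argmax_seq w0 weight_cvg.
have lw k : l k <= K * B * w (j k) ^+ 2.
  have [lk|lk] := leP (l k) 0; first by rewrite (le_trans lk)// !mulr_ge0// exprn_ge0.
  (* k + 1 eigenvectors against k linear conditions: a nonzero row of the left kernel is a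
     combination x orthogonal to t_(j 0), ..., t_(j (k-1)). Its quotient is at least l_k, and
     [syn_rank] bounds it from above. *)
  pose M := \matrix_(i < k.+1, q < k) ip (e i) (t (j q)).
  have : kermx M != 0.
    rewrite kermx_eq0 /row_free; apply/eqP => h.
    by have := rank_leq_col M; rewrite h ltnn.
  case/rowV0Pn => v /sub_kermxP vM v0.
  pose x := \sum_(i < k.+1) v 0 i *: e i.
  have lpos (i : 'I_k.+1) : 0 < l i by rewrite (lt_le_trans lk)// lm// -ltnS.
  have xe (i : 'I_k.+1) : ip x (e i) = v 0 i.
    rewrite /x (sesq_suml hi) (bigD1 i)//= big1 ?addr0.
      by rewrite (sesqZl hi) (sesq_diag hi) -/(nsq ip _) e1// mulr1.
    by move=> i' ii'; rewrite (sesqZl hi) eo ?mulr0.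
  have nx : nsq ip x = \sum_(i < k.+1) normc (v 0 i) ^+ 2.
    rewrite /nsq {2}/x (sesq_sumr hi) Re_sum; apply: eq_bigr => i _.
    by rewrite (sesqZr hi) xe mulrC mulcJ.
  have bx : nsq b x = \sum_(i < k.+1) l i * normc (v 0 i) ^+ 2.
    rewrite /nsq {1}/x (sesq_suml syn_form) Re_sum; apply: eq_bigr => i _.
    rewrite (sesqZl syn_form) el (sesqC hi x) xe mulrCA mulcJ !cE /=.
    by rewrite mul0r subr0.
  have x0 : 0 < nsq ip x.
    rewrite lt_neqAle ip0 andbT eq_sym; apply: contra v0 => /eqP x0.
    apply/eqP/rowP => i; rewrite mxE -xe; apply: (nrm_eq0_ip hi ip0).
    by rewrite /nrm x0 sqrtr0.
  have : l k * nsq ip x <= nsq b x.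
    rewrite nx bx mulr_sumr; apply: ler_sum => i _.
    by rewrite ler_wpM2r ?sqr_ge0// lm// -ltnS.
  have : nsq b x <= K * w (j k) ^+ 2 * (B * nsq ip x).
    apply: (syn_rank (J := map j (iota 0 k))) => // q.
      move=> qJ; apply: jw => i ik; apply: contra qJ => /eqP <-.
      by apply: map_f; rewrite mem_iota.
    move=> qJ; have [i + ->] := elimT (@seq.mapP nat nat j (iota 0 k) q) qJ.
    rewrite mem_iota add0n => /= ik.
    have := congr1 (fun N : 'rV_k => N 0 (Ordinal ik)) vM; rewrite !mxE => h.
    rewrite /x (sesq_suml hi) -{}[RHS]h; apply: eq_bigr => i' _.
    by rewrite mxE (sesqZl hi).
  move=> h1 h2; rewrite -(ler_pM2r x0) (le_trans h2)// (le_trans h1)//.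
  by rewrite le_eqVlt; apply/orP; left; apply/eqP; ring.
exists e, (fun k => Num.sqrt (l k)); split; split=> //.
- by move=> i k ik; rewrite ler_wsqrtr// lm.
- by move=> k v; rewrite sqr_sqrtr.
- by move=> k; rewrite sqrtr_gt0; exact: e1.
- by move=> k x hx; rewrite sqr_sqrtr// lx.
exists (Num.sqrt (K * B) `^ r * S) => N.
have C0 : 0 <= Num.sqrt (K * B) by exact: sqrtr_ge0.
apply: (@le_trans _ _ (\sum_(0 <= k < N) Num.sqrt (K * B) `^ r * w (j k) `^ r)).
  apply: ler_sum => k _; rewrite -powRM//.
  rewrite ge0_ler_powR ?nnegrE ?(ltW r0) ?sqrtr_ge0 ?mulr_ge0//.
  rewrite -(@ler_pXn2r _ 2)// ?nnegrE ?sqrtr_ge0 ?mulr_ge0//.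
  by rewrite exprMn !sqr_sqrtr ?mulr_ge0.
rewrite -mulr_sumr ler_wpM2l ?powR_ge0//.
apply: (sum_injective_le (u := fun q => w q `^ r)) => // q; exact: powR_ge0.
Qed.

End schatten_synthesis.

Section eigen_multiplicity.
Context (R : realType) (E : lmodType R[i]) (ip b : E -> E -> R[i]).
Local Notation Re := complex.Re.
Hypothesis hi : sesq ip.
Hypothesis ip0 : forall x, 0 <= Re (ip x x).
Hypothesis hb : sesq b.
Variables (e : nat -> E) (s : nat -> R) (r S : R).
Hypothesis (s0 : forall k, 0 <= s k) (r0 : 0 < r).
Hypothesis sm : forall i j, (i <= j)%N -> s j <= s i.
Hypothesis eo : forall i j, i != j -> ip (e i) (e j) = 0.
Hypothesis eb : forall k v, b (e k) v = (s k ^+ 2)%:C * ip (e k) v.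
Hypothesis e1 : forall k, 0 < s k -> nsq ip (e k) = 1.
Hypothesis sx : forall k x, (forall i, (i < k)%N -> ip x (e i) = 0) ->
         nsq b x <= s k ^+ 2 * nsq ip x.
Hypothesis sS : forall N, \sum_(0 <= k < N) s k `^ r <= S.

(** Since s tends to 0, sigma occurs only finitely often, at the indices [I]. An eigenvector for
    sigma^2 is orthogonal to the e_k with s_k different from sigma, so m independent ones give an
    m-row matrix of full rank with columns indexed by [I]. Independence is meant modulo null
    vectors. *)
Lemma eigen_multiplicity (sigma : R) (m : nat) : 0 < sigma ->
  (exists x : 'I_m -> E,
    (forall j v, b (x j) v = (sigma ^+ 2)%:C * ip (x j) v) /\
    forall c : 'I_m -> R[i], nrm ip (\sum_j c j *: x j) = 0 -> forall j, c j = 0) <->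
  exists2 J : 'I_m -> nat, injective J & forall j, s (J j) = sigma.
Proof.
move=> sig0; split=> [[x [xb xi]]|[J Ji Js]]; last first.
  exists (fun j => e (J j)); split=> [j v|c hc j]; first by rewrite eb Js.
  have := nrm_eq0_ip hi ip0 (e (J j)) hc.
  rewrite (sesq_suml hi) (bigD1 j)//= big1 ?addr0.
    by rewrite (sesqZl hi) (sesq_diag hi) -/(nsq ip _) e1 ?Js// mulr1.
  move=> i ij; rewrite (sesqZl hi) eo ?mulr0//.
  by apply: contra ij => /eqP/Ji ->.
have [K hK] := weight_cvg r0 s0 sS sig0.
pose I := [seq k <- iota 0 K | s k == sigma].
have sI k : (k < K)%N -> k \notin I -> s k != sigma.
  by move=> kK; rewrite mem_filter mem_iota /= kK andbT.
have xe j k : s k != sigma -> ip (x j) (e k) = 0.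
  move=> sk; have := xb j (e k); rewrite (sesqC hb) eb conjcM conjc_real -(sesqC hi).
  move/eqP; rewrite -subr_eq0 -mulrBl mulf_eq0 => /orP[|/eqP//].
  rewrite subr_eq0 => /eqP/complexI/eqP; rewrite eqrXn2 ?(ltW sig0)//.
  by rewrite (negbTE sk).
pose X := \matrix_(j < m, i < size I) ip (x j) (e (nth 0%N I i)).
have Xf : row_free X.
  rewrite -kermx_eq0; apply/rowV0P => v /sub_kermxP vX.
  pose y := \sum_j v 0 j *: x j.
  have ye i : (i < K)%N -> ip y (e i) = 0.
    move=> iK; rewrite (sesq_suml hi); have [iI|/(sI _ iK) si] := boolP (i \in I).
      have iI' : (index i I < size I)%N by rewrite index_mem.
      have := congr1 (fun N : 'rV_(size I) => N 0 (Ordinal iI')) vX; rewrite !mxE => h.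
      rewrite -{}[RHS]h; apply: eq_bigr => j _.
      by rewrite mxE (sesqZl hi) nth_index.
    by rewrite big1// => j _; rewrite (sesqZl hi) xe// mulr0.
  (* The form b has quotient sigma^2 at y, yet y is orthogonal to the first K eigenvectors, which
     bounds it by s_K^2 < sigma^2; hence y is null. *)
  have yb : nsq b y = sigma ^+ 2 * nsq ip y.
    rewrite /nsq {1}/y {3}/y (sesq_suml hb) (sesq_suml hi) !Re_sum mulr_sumr.
    apply: eq_bigr => j _; rewrite (sesqZl hb) (sesqZl hi) xb mulrCA.
    by rewrite [in LHS]cReM /= mul0r subr0.
  have y0 : nrm ip y = 0.
    have sK : s K ^+ 2 < sigma ^+ 2.
      by rewrite ltr_pXn2r ?nnegrE ?(ltW sig0)//; exact: hK.
    have := sx ye; rewrite yb; have := nsq_ge0 ip0 y => h1 h2.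
    suff h : nsq ip y = 0 by rewrite /nrm h sqrtr0.
    nra.
  by apply/rowP => j; rewrite mxE; apply: xi.
have mI : (m <= size I)%N by move: Xf; rewrite /row_free => /eqP <-; exact: rank_leq_col.
have jI (j : 'I_m) : (j < size I)%N by exact: leq_trans mI.
exists (fun j : 'I_m => nth 0%N I j) => [i j /eqP|j].
  by rewrite nth_uniq ?filter_uniq ?iota_uniq// => /eqP/val_inj.
by have := mem_nth 0%N (jI j); rewrite mem_filter => /andP[/eqP].
Qed.
End eigen_multiplicity.

(** * Integrals of complex functions and the space L2 *)

Section cmeasurable.
Context d (T : measurableType d) (R : realType).
Local Notation Re := complex.Re.
Local Notation Im := complex.Im.
Implicit Types f g : T -> R[i].

Lemma cmeasurable_cst (c : R[i]) : cmeasurable (fun _ : T => c).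
Proof. by split; exact: measurable_cst. Qed.

Lemma cmeasurableD f g : cmeasurable f -> cmeasurable g ->
  cmeasurable (fun x => f x + g x).
Proof.
move=> [f1 f2] [g1 g2]; split.
  rewrite (_ : (fun _ => _) = (fun x => Re (f x)) \+ (fun x => Re (g x))).
    exact: measurable_funD.
  by apply/funext => x; rewrite /= cReD.
rewrite (_ : (fun _ => _) = (fun x => Im (f x)) \+ (fun x => Im (g x))).
  exact: measurable_funD.
by apply/funext => x; rewrite /= cImD.
Qed.

Lemma cmeasurableM f g : cmeasurable f -> cmeasurable g ->
  cmeasurable (fun x => f x * g x).
Proof.
move=> [f1 f2] [g1 g2]; split.
  rewrite (_ : (fun _ => _) = ((fun x => Re (f x)) \* (fun x => Re (g x))) \- 
     ((fun x => Im (f x)) \* (fun x => Im (g x)))).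
    by apply: measurable_funB; exact: measurable_funM.
  by apply/funext => x; rewrite /= cReM.
rewrite (_ : (fun _ => _) = ((fun x => Re (f x)) \* (fun x => Im (g x))) \+
     ((fun x => Im (f x)) \* (fun x => Re (g x)))).
  by apply: measurable_funD; exact: measurable_funM.
by apply/funext => x; rewrite /= cImM.
Qed.

Lemma cmeasurableJ f : cmeasurable f -> cmeasurable (fun x => conjc (f x)).
Proof.
move=> [f1 f2]; split.
  by rewrite (_ : (fun _ => _) = (fun x => Re (f x)))//; apply/funext => x; rewrite cReJ.
rewrite (_ : (fun _ => _) = \- (fun x => Im (f x))).
  exact: measurableT_comp.
by apply/funext => x; rewrite /= cImJ.
Qed.

Lemma cmeasurable_comp d' (T' : measurableType d') (h : T' -> T) f :
  measurable_fun setT h -> cmeasurable f -> cmeasurable (f \o h).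
Proof.
by move=> mh [f1 f2]; split; [apply: (measurableT_comp f1)|apply: (measurableT_comp f2)].
Qed.

Lemma measurable_normc2 f : cmeasurable f ->
  measurable_fun setT (fun x => normc (f x) ^+ 2).
Proof.
move=> [f1 f2].
rewrite (_ : (fun _ => _) = (fun x => Re (f x) ^+ 2) \+ (fun x => Im (f x) ^+ 2)).
  by apply: measurable_funD; exact: measurable_funX.
by apply/funext => x; rewrite /= normc2.
Qed.

Lemma measurable_normc f : cmeasurable f -> measurable_fun setT (fun x => normc (f x)).
Proof.
move=> mf; rewrite (_ : (fun _ => _) = (fun x => Num.sqrt (normc (f x) ^+ 2))).
  apply: (@measurableT_comp _ _ _ _ _ _ (@Num.sqrt R)); last exact: measurable_normc2.
  by apply: continuous_measurable_fun; exact: sqrt_continuous.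
by apply/funext => x; rewrite sqrtr_sqr ger0_norm// normc_ge0.
Qed.

End cmeasurable.

Section cintegral.
Context d (T : measurableType d) (R : realType) (mu : {measure set T -> \bar R}).
Local Notation Re := complex.Re.
Local Notation Im := complex.Im.
Implicit Types f g : T -> R[i].

Lemma cintegrable_measurable f : cintegrable mu f -> cmeasurable f.
Proof.
by move=> [/measurable_int f1 /measurable_int f2]; split; exact/measurable_EFinP.
Qed.

Lemma le_integrable_real (h g : T -> R) : measurable_fun setT h ->
  (forall x, `|h x| <= g x) -> mu.-integrable setT (EFin \o g) ->
  mu.-integrable setT (EFin \o h).
Proof.
move=> mh hg; apply: le_integrable => //; first exact/measurable_EFinP.
by move=> x _ /=; rewrite lee_fin (le_trans (hg x))// ler_norm.
Qed.

Lemma cintegrable_le f (g : T -> R) : cmeasurable f ->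
  (forall x, normc (f x) <= g x) -> mu.-integrable setT (EFin \o g) -> cintegrable mu f.
Proof.
move=> [f1 f2] fg ig; split; apply: (le_integrable_real (g := g)) => // x.
  exact: le_trans (Re_le_normc _) (fg x).
exact: le_trans (Im_le_normc _) (fg x).
Qed.

Lemma integrable_normc f : cintegrable mu f ->
  mu.-integrable setT (EFin \o (fun x => normc (f x))).
Proof.
move=> if0; have mf := cintegrable_measurable if0; case: if0 => i1 i2.
apply: (le_integrable_real (g := fun x => `|Re (f x)| + `|Im (f x)|)).
- exact: measurable_normc.
- by move=> x; rewrite ger0_norm ?normc_ge0// normc_ReIm.
- rewrite (_ : _ \o _ = (abse \o (EFin \o (fun x => Re (f x)))) \+ (abse \o (EFin \o (fun x => Im (f x))))).
    by apply: integrableD => //; exact: integrable_abse.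
  by apply/funext => x.
Qed.

Lemma integrable_ge0P (g : T -> R) : measurable_fun setT g -> (forall x, 0 <= g x) ->
  mu.-integrable setT (EFin \o g) <-> (\int[mu]_x (g x)%:E < +oo)%E.
Proof.
move=> mg g0; have mg' : measurable_fun setT (EFin \o g) by exact/measurable_EFinP.
have E : (\int[mu]_x (`|(EFin \o g) x|) = \int[mu]_x (g x)%:E)%E.
  by apply: eq_integral => x _ /=; rewrite ger0_norm.
split=> [/integrableP[_]|h]; first by rewrite E.
by apply/integrableP; rewrite E.
Qed.

Lemma cintegrableP f : cintegrable mu f <->
  cmeasurable f /\ (\int[mu]_x (normc (f x))%:E < +oo)%E.
Proof.
split=> [if0|[mf fo]].
  have mf := cintegrable_measurable if0; split=> //.
  apply/(integrable_ge0P (measurable_normc mf)) => [x|]; first exact: normc_ge0.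
  exact: integrable_normc.
apply: (@cintegrable_le f (fun x => normc (f x))) => //.
by apply/(integrable_ge0P (measurable_normc mf)) => // x; exact: normc_ge0.
Qed.

Lemma cintegrableD f g : cintegrable mu f -> cintegrable mu g ->
  cintegrable mu (fun x => f x + g x).
Proof.
move=> [f1 f2] [g1 g2]; split.
  rewrite (_ : (fun _ => _) = (fun x => (Re (f x))%:E) \+ (fun x => (Re (g x))%:E)).
    exact: integrableD.
  by apply/funext => x; rewrite /= cReD.
rewrite (_ : (fun _ => _) = (fun x => (Im (f x))%:E) \+ (fun x => (Im (g x))%:E)).
  exact: integrableD.
by apply/funext => x; rewrite /= cImD.
Qed.

Lemma cintegrable0 : cintegrable mu (fun=> 0).
Proof. by split; exact: integrable0. Qed.

Lemma cintegrableZ c f : cintegrable mu f -> cintegrable mu (fun x => c * f x).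
Proof.
move=> if0; apply: (@cintegrable_le _ (fun x => normc c * normc (f x))).
- apply: cmeasurableM; [exact: cmeasurable_cst|exact: (cintegrable_measurable if0)].
- by move=> x; rewrite normcM.
- have := @integrableZl _ _ _ mu setT measurableT (normc c) _ (integrable_normc if0).
  by congr (integrable _ _ _); apply/funext => x /=; rewrite EFinM.
Qed.

Lemma cintegrableJ f : cintegrable mu f -> cintegrable mu (fun x => conjc (f x)).
Proof.
move=> if0; apply: (@cintegrable_le _ (fun x => normc (f x))).
- exact/cmeasurableJ/(cintegrable_measurable if0).
- by move=> x; rewrite normcJ'.
- exact: integrable_normc.
Qed.

Lemma cintegrable_sum I (s : seq I) (F : I -> T -> R[i]) :
  (forall i, cintegrable mu (F i)) -> cintegrable mu (fun x => \sum_(i <- s) F i x).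
Proof.
move=> iF; elim: s => [|i s IH].
  by under [X in cintegrable _ X]funext do rewrite big_nil; exact: cintegrable0.
under [X in cintegrable _ X]funext do rewrite big_cons.
exact: cintegrableD.
Qed.

Lemma cintegrable_bM (b f : T -> R[i]) (C : R) : cmeasurable b ->
  (forall x, normc (b x) <= C) -> cintegrable mu f -> cintegrable mu (fun x => b x * f x).
Proof.
move=> mb bC if0; have := cintegrableZ C%:C if0 => /integrable_normc h.
apply: cintegrable_le h; first by apply: cmeasurableM => //; exact: cintegrable_measurable.
move=> x; rewrite !normcM ler_wpM2r ?normc_ge0// normc_real.
by rewrite (le_trans (bC x))// ler_norm.
Qed.

Lemma cintegralD f g : cintegrable mu f -> cintegrable mu g ->
  cintegral mu (fun x => f x + g x) = cintegral mu f + cintegral mu g.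
Proof.
move=> [f1 f2] [g1 g2]; apply: complexP; rewrite ?cReD ?cImD /=.
  rewrite -RintegralD//; congr fine; apply: eq_integral => x _; by rewrite cReD.
rewrite -RintegralD//; congr fine; apply: eq_integral => x _; by rewrite cImD.
Qed.

Lemma cintegralZ c f : cintegrable mu f ->
  cintegral mu (fun x => c * f x) = c * cintegral mu f.
Proof.
move=> [f1 f2].
have iZ (a : R) (h : T -> R) : mu.-integrable setT (EFin \o h) ->
    mu.-integrable setT (EFin \o (fun x => a * h x)).
  by move=> /(integrableZl measurableT a).
apply: complexP; rewrite ?cReM ?cImM /=.
  rewrite -!RintegralZl// -RintegralB//; [|exact: iZ|exact: iZ].
  by congr fine; apply: eq_integral => x _; rewrite cReM.
rewrite -!RintegralZl// -RintegralD//; [|exact: iZ|exact: iZ].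
by congr fine; apply: eq_integral => x _; rewrite cImM.
Qed.

Lemma cintegral0 : cintegral mu (fun=> 0) = 0.
Proof. by rewrite /cintegral /Rintegral integral0. Qed.

Lemma cintegralB f g : cintegrable mu f -> cintegrable mu g ->
  cintegral mu (fun x => f x - g x) = cintegral mu f - cintegral mu g.
Proof.
move=> if0 ig; rewrite -mulN1r -cintegralZ// -cintegralD//; last exact: cintegrableZ.
by congr cintegral; apply/funext => x; rewrite mulN1r.
Qed.

Lemma cintegrableB f g : cintegrable mu f -> cintegrable mu g ->
  cintegrable mu (fun x => f x - g x).
Proof.
move=> if0 ig; have := cintegrableD if0 (cintegrableZ (-1) ig).
by congr cintegrable; apply/funext => x; rewrite mulN1r.
Qed.

Lemma cintegral_sum I (s : seq I) (F : I -> T -> R[i]) :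
  (forall i, cintegrable mu (F i)) ->
  cintegral mu (fun x => \sum_(i <- s) F i x) = \sum_(i <- s) cintegral mu (F i).
Proof.
move=> iF; elim: s => [|i s IH].
  by under [X in cintegral _ X]funext do rewrite big_nil; rewrite big_nil cintegral0.
under [X in cintegral _ X]funext do rewrite big_cons.
by rewrite cintegralD ?IH ?big_cons//; exact: cintegrable_sum.
Qed.

Lemma cintegralJ f : cintegrable mu f ->
  cintegral mu (fun x => conjc (f x)) = conjc (cintegral mu f).
Proof.
move=> [f1 f2]; apply: complexP; rewrite ?cReJ ?cImJ /=.
  by congr fine; apply: eq_integral => x _; rewrite cReJ.
rewrite -mulN1r -RintegralZl//.
by congr fine; apply: eq_integral => x _; rewrite cImJ mulN1r.
Qed.

(** Multiplying by the conjugate of the integral reduces the inequality to real parts. *)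
Lemma normc_cintegral f : cintegrable mu f ->
  normc (cintegral mu f) <= \int[mu]_x normc (f x).
Proof.
move=> if0; set I := cintegral mu f.
have [/eqP|I0] := eqVneq (normc I) 0.
  by rewrite eq_le => /andP[/le_trans + _]; apply; apply: Rintegral_ge0 => x _; exact: normc_ge0.
have I1 : 0 < normc I by rewrite lt_neqAle eq_sym I0 normc_ge0.
have : normc I ^+ 2 = \int[mu]_x Re (conjc I * f x).
  rewrite -[RHS]/(Re (cintegral mu (fun x => conjc I * f x))).
  by rewrite cintegralZ// mulrC -/I mulcJ.
have iN := integrable_normc if0.
rewrite expr2 => h; rewrite -(ler_pM2l I1) h -RintegralZl//.
apply: le_Rintegral => //.
- by have [] := cintegrableZ (conjc I) if0.
- exact: (@integrableZl _ _ _ mu setT measurableT (normc I) _ iN).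
by move=> x _; rewrite (le_trans (ler_norm _))// (le_trans (Re_le_normc _))// normcM normcJ'.
Qed.

Lemma normc_cintegral_le f (g : T -> R) : cmeasurable f ->
  (forall x, normc (f x) <= g x) -> mu.-integrable setT (EFin \o g) ->
  normc (cintegral mu f) <= \int[mu]_x g x.
Proof.
move=> mf fg ig; have if0 := cintegrable_le mf fg ig.
rewrite (le_trans (normc_cintegral if0))//; apply: le_Rintegral => //.
exact: integrable_normc.
Qed.

Lemma eq_cintegral f g : f =1 g -> cintegral mu f = cintegral mu g.
Proof. by move=> /funext ->. Qed.

End cintegral.

Section cfubini.
Context d1 d2 (T1 : measurableType d1) (T2 : measurableType d2) (R : realType).
Variable m1 : {sigma_finite_measure set T1 -> \bar R}.
Variable m2 : {sigma_finite_measure set T2 -> \bar R}.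
Local Notation Re := complex.Re.
Local Notation Im := complex.Im.
Variable f : T1 * T2 -> R[i].
Hypothesis if0 : cintegrable (m1 \x m2)%E f.

(** With every slice integrable, the inner extended integrals are finite everywhere and [fine] can
    be moved through them. *)
Lemma Rfubini1 (h : T1 * T2 -> R) : (m1 \x m2)%E.-integrable setT (EFin \o h) ->
  (forall x, m2.-integrable setT (EFin \o (fun y => h (x, y)))) ->
  \int[(m1 \x m2)%E]_z h z = \int[m1]_x \int[m2]_y h (x, y).
Proof.
move=> ih is1; rewrite /Rintegral -integral12_prod_meas1//; congr fine.
by apply: eq_integral => x _; rewrite fineK//; exact: integrable_fin_num (is1 x).
Qed.

Lemma Rfubini2 (h : T1 * T2 -> R) : (m1 \x m2)%E.-integrable setT (EFin \o h) ->
  (forall y, m1.-integrable setT (EFin \o (fun x => h (x, y)))) ->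
  \int[(m1 \x m2)%E]_z h z = \int[m2]_y \int[m1]_x h (x, y).
Proof.
move=> ih is1; rewrite /Rintegral -integral21_prod_meas1//; congr fine.
by apply: eq_integral => x _; rewrite fineK//; exact: integrable_fin_num (is1 x).
Qed.

Lemma cfubini1 : (forall x, cintegrable m2 (fun y => f (x, y))) ->
  cintegral (m1 \x m2)%E f = cintegral m1 (fun x => cintegral m2 (fun y => f (x, y))).
Proof.
move=> is1; rewrite /cintegral (Rfubini1 (h := fun z => Re (f z))).
- rewrite (Rfubini1 (h := fun z => Im (f z)))//; first exact: if0.2.
  by move=> x; exact: (is1 x).2.
- exact: if0.1.
- by move=> x; exact: (is1 x).1.
Qed.

Lemma cfubini2 : (forall y, cintegrable m1 (fun x => f (x, y))) ->
  cintegral (m1 \x m2)%E f = cintegral m2 (fun y => cintegral m1 (fun x => f (x, y))).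
Proof.
move=> is1; rewrite /cintegral (Rfubini2 (h := fun z => Re (f z))).
- rewrite (Rfubini2 (h := fun z => Im (f z)))//; first exact: if0.2.
  by move=> x; exact: (is1 x).2.
- exact: if0.1.
- by move=> x; exact: (is1 x).1.
Qed.

End cfubini.

Section L2_char.
Context d (T : measurableType d) (R : realType) (mu : {measure set T -> \bar R}).
Local Notation Re := complex.Re.
Local Notation Im := complex.Im.
Implicit Types f g : T -> R[i].

Definition sqint f : \bar R := (\int[mu]_x (normc (f x) ^+ 2)%:E)%E.

Lemma sqint_ge0 f : (0 <= sqint f)%E.
Proof. by apply: integral_ge0 => x _; rewrite lee_fin sqr_ge0. Qed.

Lemma L2norm_sqint f : L2norm mu f = (sqint f `^ 2^-1)%E.
Proof.
rewrite /L2norm unlock /sqint; congr (_ `^ _)%E; apply: eq_integral => x _ /=.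
by rewrite ger0_norm ?normc_ge0// powR_mulrn ?normc_ge0.
Qed.

Lemma L2P f : L2 mu f <-> cmeasurable f /\ (sqint f < +oo)%E.
Proof.
rewrite /L2 /= L2norm_sqint; split=> -[mf h]; split=> //; last exact: poweR_lty.
have := poweR_lty 2 h; rewrite -poweRrM mulVf// poweRe1//; exact: sqint_ge0.
Qed.

Lemma L2_integrable f : L2 mu f ->
  mu.-integrable setT (EFin \o (fun x => normc (f x) ^+ 2)).
Proof.
move=> /L2P[mf h]; apply/(integrable_ge0P _ (measurable_normc2 mf)) => // x.
exact: sqr_ge0.
Qed.

Lemma L2_cintegrable f g : L2 mu f -> L2 mu g ->
  cintegrable mu (fun x => f x * conjc (g x)).
Proof.
move=> hf hg; have [mf _] := (L2P f).1 hf; have [mg _] := (L2P g).1 hg.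
apply: (@cintegrable_le _ _ _ _ _ (fun x => normc (f x) ^+ 2 + normc (g x) ^+ 2)).
- by apply: cmeasurableM => //; exact: cmeasurableJ.
- move=> x; rewrite normcM normcJ'; have := sqr_ge0 (normc (f x) - normc (g x)).
  have := mulr_ge0 (normc_ge0 (f x)) (normc_ge0 (g x)); nra.
- have := integrableD measurableT (L2_integrable hf) (L2_integrable hg).
  by congr (integrable _ _ _); apply/funext => x.
Qed.

Lemma L2_le f (g : T -> R) : cmeasurable f -> (forall x, normc (f x) ^+ 2 <= g x) ->
  mu.-integrable setT (EFin \o g) -> L2 mu f.
Proof.
move=> mf fg ig; apply/L2P; split=> //.
apply/(integrable_ge0P _ (measurable_normc2 mf)) => [x|]; first exact: sqr_ge0.
apply: le_integrable_real ig; first exact: measurable_normc2.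
by move=> x; rewrite ger0_norm ?sqr_ge0.
Qed.

Lemma L2_submod_closed : submod_closed (mem (L2 mu) : {pred (T -> R[i]^o)}).
Proof.
split=> [|a f g /set_mem hf /set_mem hg].
  apply/mem_set/L2P; split; first exact: cmeasurable_cst.
  rewrite /sqint; under eq_integral => x _ do rewrite normc0 expr0n/=.
  by rewrite integral0.
apply/mem_set; have [mf _] := (L2P f).1 hf; have [mg _] := (L2P g).1 hg.
apply: (@L2_le _ (fun x => (2 * normc a ^+ 2) * normc (f x) ^+ 2 + 2 * normc (g x) ^+ 2)).
- by apply: cmeasurableD => //; apply: cmeasurableM => //; exact: cmeasurable_cst.
- move=> x; apply: (@le_trans _ _ ((normc (a * f x) + normc (g x)) ^+ 2)).
    by rewrite ler_pXn2r ?nnegrE ?addr_ge0 ?normc_ge0// le_normcD.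
  rewrite normcM; have := sqr_ge0 (normc a * normc (f x) - normc (g x)); nra.
- have := integrableD measurableT (integrableZl measurableT (2 * normc a ^+ 2) (L2_integrable hf)) (integrableZl measurableT 2 (L2_integrable hg)).
  by congr (integrable _ _ _); apply/funext => x.
Qed.

End L2_char.

Section L2_type.
Context d (T : measurableType d) (R : realType) (mu : {measure set T -> \bar R}).

Definition L2pred : {pred (T -> R[i]^o)} := mem (L2 mu).

HB.instance Definition _ := GRing.isSubmodClosed.Build _ _ L2pred (L2_submod_closed mu).

(** Functions rather than classes modulo null sets: this makes a vector space with point values, at
    the price of a degenerate pairing. [nrm_eq0_ae] identifies its null vectors. *)
Record L2t := MkL2 { L2f : T -> R[i]^o ; L2fP : L2f \in L2pred }.

HB.instance Definition _ := [isSub for L2f].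
HB.instance Definition _ := [Choice of L2t by <:].
HB.instance Definition _ := [SubChoice_isSubLmodule of L2t by <:].

Definition L2e (f : L2t) : T -> R[i] := L2f f.

End L2_type.

Section L2_hilbert.
Context d (T : measurableType d) (R : realType) (mu : {measure set T -> \bar R}).
Local Notation Re := complex.Re.
Local Notation Im := complex.Im.
Local Notation E := (L2t mu).
Implicit Types f g : E.

Lemma L2eP f : L2 mu (L2e f). Proof. exact: (set_mem (L2fP f)). Qed.
Lemma L2e_inj f g : L2e f = L2e g -> f = g. Proof. by move=> h; exact: val_inj. Qed.
Lemma L2eD f g x : L2e (f + g) x = L2e f x + L2e g x. Proof. by []. Qed.
Lemma L2eB f g x : L2e (f - g) x = L2e f x - L2e g x. Proof. by []. Qed.
Lemma L2eZ (c : R[i]) f x : L2e (c *: f) x = c * L2e f x. Proof. by []. Qed.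
Lemma L2e_sum I (s : seq I) (F : I -> E) x :
  L2e (\sum_(i <- s) F i) x = \sum_(i <- s) L2e (F i) x.
Proof.
by elim: s => [|i s IH]; rewrite ?big_nil ?big_cons ?L2eD ?IH.
Qed.
Definition toL2 (h : T -> R[i]) (hh : L2 mu h) : E := @MkL2 _ _ _ mu h (mem_set hh).
Lemma toL2K h (hh : L2 mu h) : L2e (toL2 hh) = h. Proof. by []. Qed.

Definition ip f g : R[i] := L2inner mu (L2e f) (L2e g).

Lemma ipE f g : ip f g = cintegral mu (fun x => L2e f x * conjc (L2e g x)).
Proof. by []. Qed.

Lemma ip_sesq : sesq ip.
Proof.
split=> [a f g h|f g]; rewrite !ipE.
  have i1 := L2_cintegrable (L2eP f) (L2eP h).
  have i2 := L2_cintegrable (L2eP g) (L2eP h).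
  rewrite -cintegralZ// -cintegralD//; last exact: cintegrableZ.
  by apply: eq_cintegral => x; rewrite L2eD L2eZ mulrDl mulrA.
rewrite -cintegralJ; last exact: L2_cintegrable (L2eP f) (L2eP g).
by apply: eq_cintegral => x; rewrite conjcM conjcK' mulrC.
Qed.

Lemma nsq_ip f : nsq ip f = \int[mu]_x normc (L2e f x) ^+ 2.
Proof.
rewrite /nsq ipE /=; congr fine; apply: eq_integral => x _.
by rewrite mulcJ.
Qed.

Lemma ip_ge0 f : 0 <= Re (ip f f).
Proof. by rewrite -/(nsq ip f) nsq_ip; apply: Rintegral_ge0 => x _; exact: sqr_ge0. Qed.

Lemma sqint_nsq f : sqint mu (L2e f) = (nsq ip f)%:E.
Proof.
rewrite nsq_ip /Rintegral fineK//; apply: integrable_fin_num => //.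
exact: L2_integrable (L2eP f).
Qed.

Lemma L2norm_nrm f : L2norm mu (L2e f) = (nrm ip f)%:E.
Proof. by rewrite L2norm_sqint sqint_nsq poweR_EFin powR12_sqrt// ip_ge0. Qed.

Lemma nrm_eq0_ae f g : nrm ip (f - g) = 0 <-> L2e f = L2e g %[ae mu].
Proof.
have mN := measurable_normc2 (cmeasurableD ((L2P _ _).1 (L2eP f)).1 (cmeasurableM (cmeasurable_cst _ (-1)) ((L2P _ _).1 (L2eP g)).1)).
have E1 x : normc (L2e f x + -1 * L2e g x) ^+ 2 = normc (L2e (f - g) x) ^+ 2.
  by rewrite L2eB mulN1r.
have {}mN : measurable_fun setT (fun x => (normc (L2e (f - g) x) ^+ 2)%:E).
  by apply/measurable_EFinP; move: mN; congr measurable_fun; apply/funext => x.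
have E2 : (\int[mu]_x `|(normc (L2e (f - g) x) ^+ 2)%:E| = (nsq ip (f - g))%:E)%E.
  by rewrite -sqint_nsq; apply: eq_integral => x _ /=; rewrite ger0_norm ?sqr_ge0.
have [h1 h2] := ae_eq_integral_abs mu measurableT mN.
split=> h.
  have : ae_eq mu setT (fun x => (normc (L2e (f - g) x) ^+ 2)%:E) (cst 0%E).
    by apply: h1; rewrite E2 -(nrm2 ip_ge0) h expr0n.
  apply: filterS => x /(_ I) /= [] /eqP; rewrite sqrf_eq0 => /eqP/eq0_normc/eqP.
  by rewrite subr_eq0 => /eqP h' _.
suff : nsq ip (f - g) = 0 by rewrite /nrm => ->; rewrite sqrtr0.
apply: EFin_inj; rewrite -E2; apply: h2; apply: filterS h => x xE _ /=.
by rewrite -[(L2f f - L2f g) x]/(L2e f x - L2e g x) (xE I) subrr normc0 expr0n.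
Qed.

(** The bound is demanded only from rank N on, to match estimates that come from convergence in
    norm. *)
Lemma fatou_real (F : nat -> T -> R) (G : T -> R) (X : R) N :
  (forall j, measurable_fun setT (F j)) -> (forall j x, 0 <= F j x) ->
  (forall x, F ^~ x @ \oo --> G x) ->
  (forall j, (N <= j)%N -> (\int[mu]_x (F j x)%:E <= X%:E)%E) ->
  (\int[mu]_x (G x)%:E <= X%:E)%E.
Proof.
move=> mF F0 FG FX.
have := @fatou _ _ _ mu setT measurableT (fun j x => (F (j + N)%N x)%:E) _ _.
move=> /(_ (fun j => (measurable_EFinP _ _).2 (mF (j + N)%N))) /(_ (fun j x _ => F0 _ x)).
have -> : (\int[mu]_x limn_einf (fun j => (F (j + N)%N x)%:E) = \int[mu]_x (G x)%:E)%E.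
  apply: eq_integral => x _; apply: (cvg_limn_einf_sup _).1.
  apply: cvg_EFin; first exact: nearW.
  by have := FG x; rewrite -(cvg_shiftn N).
move=> /le_trans; apply; rewrite limn_einf_lim; apply: lime_le.
  exact: is_cvg_einfs.
apply: nearW => n; rewrite /einfs.
apply: (le_trans (ereal_inf_lbound _) (FX (n + N)%N (leq_addl _ _))).
by exists n => //=.
Qed.

Lemma monotone_bounded_ae (F : nat -> T -> R) (X : R) :
  (forall j, measurable_fun setT (F j)) -> (forall j x, 0 <= F j x) ->
  (forall x i j, (i <= j)%N -> F i x <= F j x) ->
  (forall j, (\int[mu]_x (F j x)%:E <= X%:E)%E) ->
  {ae mu, forall x, exists M : R, forall j, F j x <= M}.
Proof.
move=> mF F0 ndF FX.
have mF' j : measurable_fun setT (EFin \o F j) by exact/measurable_EFinP.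
have ndF' x : {homo (fun j => (F j x)%:E) : n m / (n <= m)%N >-> (n <= m)%E}.
  by move=> i j ij; rewrite lee_fin ndF.
have cF x : cvgn (fun j => (F j x)%:E) by exact: ereal_nondecreasing_is_cvgn.
have mono := @monotone_convergence _ _ _ mu setT measurableT (fun j => EFin \o F j) mF'
  (fun j x _ => F0 j x) (fun x _ => ndF' x).
have lim0 x : (0 <= limn (fun j => (F j x)%:E))%E.
  by apply: lime_ge => //; apply: nearW => j; rewrite lee_fin.
have : mu.-integrable setT (fun x => limn (fun j => (F j x)%:E)).
  apply/integrableP; split.
    by apply: (emeasurable_fun_cvg (fun j => EFin \o F j)) => // x _; exact: cF.
  apply: (@le_lt_trans _ _ X%:E); last exact: ltry.
  rewrite (eq_integral (fun x => limn (fun j => (F j x)%:E))); last first.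
    by move=> x _; rewrite gee0_abs.
  rewrite mono; apply: lime_le; last exact: nearW.
  apply: ereal_nondecreasing_is_cvgn => i j ij; apply: ge0_le_integral => //.
  - by move=> x _; rewrite /= lee_fin.
  - by move=> x _; rewrite /= lee_fin ndF.
move=> /(integrable_ae measurableT); apply: filterS => x /(_ I) lf.
exists (fine (limn (fun j => (F j x)%:E))) => j.
by rewrite -lee_fin fineK//; apply: lime_ge => //; exists j => // k /=; exact: ndF'.
Qed.

Lemma summable_increments_cvg (s D : nat -> R) (M : R) :
  (forall k, `|s k.+1 - s k| <= D k) -> (forall K, \sum_(0 <= k < K) D k <= M) ->
  cvgn s.
Proof.
move=> sD DM; have D0 k : 0 <= D k by exact: le_trans (sD k).
have cD : cvgn (series D).
  apply: nondecreasing_is_cvgn.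
    apply: nondecreasing_series => k _ _; exact: D0.
  by exists M => _ [K _ <-]; exact: DM.
have := series_le_cvg (fun k => normr_ge0 (s k.+1 - s k)) D0 sD cD.
move=> /normed_cvg cS.
rewrite (_ : s = (fun k => s 0%N + series (fun k => s k.+1 - s k) k)).
  by apply: is_cvgD => //; exact: is_cvg_cst.
by apply/funext => k; rewrite /series/= telescope_sumr// addrC subrK.
Qed.

(** Riesz-Fischer. A subsequence with increments below 2^-(k+1) has square integrable sum of moduli
    of increments, hence converges almost everywhere; Fatou's lemma bounds the distance to the
    limit. *)
Theorem L2_complete (u : nat -> E) : cauchy_nrm ip u -> exists l, cvg_nrm ip u l.
Proof.
move=> cu.
have hi := ip_sesq; have i0 := ip_ge0.
have /choice[N hN] (k : nat) : exists N, forall i j, (N <= i)%N -> (N <= j)%N ->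
    nrm ip (u i - u j) < 2^-1 ^+ k.+1.
  by apply: cu; rewrite exprn_gt0// invr_gt0.
(* Strictly increasing and at least [N k], so that consecutive terms obey the k-th bound. *)
pose phi := fix phi k := match k with 0 => N 0%N | k'.+1 => maxn (phi k').+1 (N k'.+1) end.
have phiN k : (N k <= phi k)%N by case: k => //= k; rewrite leq_maxr.
have phiS k : (phi k <= phi k.+1)%N by rewrite /= leq_max leqnSn.
have phik k : (k <= phi k)%N.
  by elim: k => // k IH; rewrite /= leq_max ltnS IH.
have phim i j : (i <= j)%N -> (phi i <= phi j)%N.
  elim: j => [|j IH]; first by rewrite leqn0 => /eqP->.
  by rewrite leq_eqVlt => /predU1P[->//|/IH h]; exact: leq_trans (phiS j).
pose v k := u (phi k).
have vS k : nrm ip (v k.+1 - v k) < 2^-1 ^+ k.+1.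
  by apply: hN => //; apply: leq_trans (phiS k).
have mv k : cmeasurable (L2e (v k)) := ((L2P _ _).1 (L2eP (v k))).1.
pose D k x := normc (L2e (v k.+1) x - L2e (v k) x).
have mDc k : cmeasurable (fun x => (D k x)%:C).
  split; last exact: measurable_cst.
  apply: (@measurable_normc _ _ _ (fun x => L2e (v k.+1) x - L2e (v k) x)).
  exact: ((L2P _ _).1 (L2eP (v k.+1 - v k))).1.
have DL2 k : L2 mu (fun x => (D k x)%:C).
  apply: (L2_le (g := fun x => normc (L2e (v k.+1 - v k) x) ^+ 2)) => //.
    by move=> x; rewrite normc_real ger0_norm ?normc_ge0.
  exact/L2_integrable/L2eP.
have nD k : nrm ip (toL2 (DL2 k)) < 2^-1 ^+ k.+1.
  apply: le_lt_trans (vS k); rewrite le_eqVlt; apply/orP; left; apply/eqP.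
  rewrite /nrm !nsq_ip; congr (Num.sqrt (fine _)); apply: eq_integral => x _.
  by rewrite toL2K normc_real ger0_norm// normc_ge0.
pose g K := \sum_(0 <= k < K) toL2 (DL2 k).
have gE K x : L2e (g K) x = (\sum_(0 <= k < K) D k x)%:C.
  by rewrite /g L2e_sum rmorph_sum.
have ng K : nrm ip (g K) <= 1.
  rewrite (le_trans (nrm_sum hi i0 _ _ _))//.
  apply: (@le_trans _ _ (1 - 2^-1 ^+ K)); last by rewrite gerBl exprn_ge0// invr_ge0.
  elim: K => [|K IH]; first by rewrite big_geq// expr0 subrr.
  rewrite big_nat_recr//=; have := nD K; rewrite exprS.
  have -> : 1 - 2^-1 * 2^-1 ^+ K = (1 - 2^-1 ^+ K) + 2^-1 * 2^-1 ^+ K :> R by field.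
  by move=> h; rewrite lerD// ltW.
have D0 k x : 0 <= D k x by exact: normc_ge0.
have [||||] := @monotone_bounded_ae (fun K x => (\sum_(0 <= k < K) D k x) ^+ 2) 1.
- move=> K; have := measurable_normc2 ((L2P _ _).1 (L2eP (g K))).1.
  congr measurable_fun; apply/funext => x; rewrite gE normc_real ger0_norm//.
  by apply: sumr_ge0.
- by move=> K x; exact: sqr_ge0.
- move=> x i j ij; rewrite ler_pXn2r ?nnegrE ?sumr_ge0//.
  by rewrite (big_cat_nat (leq0n i) ij)/= lerDl sumr_ge0.
- move=> K; have -> : (\int[mu]_x ((\sum_(0 <= k < K) D k x) ^+ 2)%:E = (nsq ip (g K))%:E)%E.
    rewrite -sqint_nsq; apply: eq_integral => x _; rewrite gE normc_real ger0_norm//.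
    exact: sumr_ge0.
  by rewrite lee_fin -(nrm2 i0) expr_le1// nrm_ge0.
move=> Z [mZ Z0 hZ].
pose A := ~` Z.
have mA : measurable A by exact: measurableC.
have AM x : A x -> exists M : R, forall K, \sum_(0 <= k < K) D k x <= M.
  move=> Ax; have [M hM] : exists M : R, forall K, (\sum_(0 <= k < K) D k x) ^+ 2 <= M.
    by apply: contrapT => h; apply: Ax; exact: hZ.
  exists (M + 1) => K; have := hM K.
  have S0 : 0 <= \sum_(0 <= k < K) D k x by exact: sumr_ge0.
  move: (\sum_(0 <= k < K) D k x) S0 => S' S0 SM; nra.
(* Cutting off to the complement of a measurable null set makes the convergence hold at every point,
   which gives the measurability of the limit. *)
pose w (k : nat) (x : T) : R[i] := (\1_A x)%:C * L2e (v k) x.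
have mw k : cmeasurable (w k).
  apply: cmeasurableM => //; split; last exact: measurable_cst.
  exact: measurable_indic.
have wD k x : normc (w k.+1 x - w k x) = \1_A x * D k x.
  by rewrite -mulrBr normcM normc_real ger0_norm.
have wM x : exists M : R, forall K, \sum_(0 <= k < K) normc (w k.+1 x - w k x) <= M.
  have [Ax|nAx] := pselect (A x).
    have [M hM] := AM x Ax; exists M => K; apply: le_trans (hM K).
    by apply: ler_sum => k _; rewrite wD indicE mem_set// mul1r.
  by exists 0 => K; rewrite big1// => k _; rewrite wD indicE memNset// mul0r.
have cRe x : cvgn (fun k => Re (w k x)).
  have [M hM] := wM x; apply: summable_increments_cvg hM => k.
  by rewrite -cReB Re_le_normc.
have cIm x : cvgn (fun k => Im (w k x)).
  have [M hM] := wM x; apply: summable_increments_cvg hM => k.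
  by rewrite -cImB Im_le_normc.
pose l : T -> R[i] := fun x => limn (fun k => Re (w k x)) +i* limn (fun k => Im (w k x)).
have ml : cmeasurable l.
  split.
    by apply: (@measurable_fun_cvg _ _ _ _ (fun k x => Re (w k x))) => [k|x _]; [exact: (mw k).1|exact: cRe].
  by apply: (@measurable_fun_cvg _ _ _ _ (fun k x => Im (w k x))) => [k|x _]; [exact: (mw k).2|exact: cIm].
have est k (e : R) : 0 <= e -> (forall j, (k <= j)%N -> nrm ip (v j - v k) <= e) ->
    (sqint mu (fun x => (l x - w k x)%R) <= (e ^+ 2)%:E)%E.
  move=> e0 he; apply: (@fatou_real (fun j x => normc (w j x - w k x) ^+ 2) _ _ k).
  - move=> j; apply: measurable_normc2; have := cmeasurableD (mw j) (cmeasurableM (cmeasurable_cst _ (-1)) (mw k)).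
    by congr cmeasurable; apply/funext => x; rewrite mulN1r.
  - by move=> j x; exact: sqr_ge0.
  - move=> x; rewrite normc2 cReB cImB.
    have sq (a : nat -> R) (A0 b0 : R) : a @ \oo --> A0 ->
        (fun j => (a j - b0) ^+ 2) @ \oo --> (A0 - b0) ^+ 2.
      by move=> aA; rewrite expr2; under eq_fun do rewrite expr2;
        apply: cvgM; apply: cvgB => //; exact: cvg_cst.
    rewrite (_ : (fun j => _) = (fun j => (Re (w j x) - Re (w k x)) ^+ 2 + (Im (w j x) - Im (w k x)) ^+ 2)).
      by apply: cvgD; apply: sq; [exact: cRe|exact: cIm].
    by apply/funext => j; rewrite normc2 cReB cImB.
  - move=> j kj; apply: (@le_trans _ _ (sqint mu (L2e (v j - v k)))).
      apply: ge0_le_integral => //.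
      + by move=> x _; rewrite lee_fin sqr_ge0.
      + apply/measurable_EFinP/measurable_normc2; have := cmeasurableD (mw j) (cmeasurableM (cmeasurable_cst _ (-1)) (mw k)).
        by congr cmeasurable; apply/funext => x; rewrite mulN1r.
      + apply/measurable_EFinP/measurable_normc2; exact: ((L2P _ _).1 (L2eP _)).1.
      + move=> x _; rewrite lee_fin -mulrBr normcM normc_real ger0_norm//.
        by rewrite L2eB exprMn ler_piMl ?sqr_ge0.
    rewrite sqint_nsq lee_fin -(nrm2 i0) ler_pXn2r ?nnegrE ?nrm_ge0//; exact: he.
have wae k : (w k : T -> R[i]) = L2e (v k) %[ae mu].
  exists Z; split=> // x; apply: contra_notP => nZx /=.
  by rewrite /w indicE mem_set// mul1r.
have vL2 k : L2 mu (w k).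
  apply: (L2_le (g := fun x => normc (L2e (v k) x) ^+ 2)) => //; last exact/L2_integrable/L2eP.
  by move=> x; rewrite normcM normc_real ger0_norm// exprMn ler_piMl ?sqr_ge0.
have lw k (e : R) : 0 <= e -> (forall j, (k <= j)%N -> nrm ip (v j - v k) <= e) ->
    L2 mu (fun x => l x - w k x).
  move=> e0 he; apply/L2P; split; last exact: le_lt_trans (est k e e0 he) (ltry _).
  have := cmeasurableD ml (cmeasurableM (cmeasurable_cst _ (-1)) (mw k)).
  by congr cmeasurable; apply/funext => x; rewrite mulN1r.
have small (e : R) : 0 < e -> exists K, forall i j, (K <= i)%N -> (K <= j)%N ->
    nrm ip (u i - v j) <= e.
  move=> /cu[K hK]; exists K => i j Ki Kj; apply/ltW/hK => //.
  exact: leq_trans Kj (phik j).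
have vsmall (e : R) : 0 < e -> exists K, forall k, (K <= k)%N -> forall j, (k <= j)%N ->
    nrm ip (v j - v k) <= e.
  move=> /small[K hK]; exists K => k Kk j kj.
  by apply: hK => //; rewrite (leq_trans Kk)// (leq_trans kj).
have [K1 hK1] := vsmall 1 ltr01.
have lL2 : L2 mu l.
  pose f1 := toL2 (lw K1 1 ler01 (hK1 K1 (leqnn _))); pose f2 := toL2 (vL2 K1).
  have := L2eP (f1 + f2); congr (L2 _ _); apply/funext => x.
  by rewrite L2eD !toL2K subrK.
exists (toL2 lL2) => e e0.
have e3 : 0 < e / 3 by rewrite divr_gt0.
have [Ka hKa] := small _ e3; have [Kb hKb] := vsmall _ e3.
exists (maxn Ka Kb) => i; rewrite geq_max => /andP[iKa iKb].
have h1 := hKa i i iKa iKa.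
have h2 := est i _ (ltW e3) (hKb i iKb).
have h3 : nrm ip (toL2 (vL2 i) - v i) = 0 by apply/nrm_eq0_ae; exact: wae.
have h4 : nrm ip (toL2 lL2 - toL2 (vL2 i)) <= e / 3.
  rewrite -(@ler_pXn2r _ 2)// ?nnegrE ?nrm_ge0 ?(ltW e3)// (nrm2 i0).
  by rewrite -lee_fin -sqint_nsq.
have h5 : nrm ip (v i - toL2 lL2) <= e / 3.
  apply: (le_trans (nrm_tri hi i0 (toL2 (vL2 i)) _ _)).
  by rewrite (nrmB hi (v i)) h3 add0r (nrmB hi).
apply: (le_lt_trans (nrm_tri hi i0 (v i) _ _)); apply: (le_lt_trans (lerD h1 h5)).
by clear -e0; lra.
Qed.
End L2_hilbert.

(** * Lebesgue measure on row vectors *)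

Section rV_norm.
Context (R : realType) (n : nat).
Implicit Types x y : 'rV[R]_n.

Lemma rV_coord_le x i : `|x ord0 i| <= `|x|.
Proof.
rewrite -[leRHS]/(mx_norm x) mx_normrE.
exact: (@le_bigmax _ _ _ 0 (fun ij : 'I_1 * 'I_n => `|x ij.1 ij.2|) (ord0, i)).
Qed.

Lemma rV_norm_le x (c : R) : 0 <= c -> (forall i, `|x ord0 i| <= c) -> `|x| <= c.
Proof.
move=> c0 h; rewrite -[leLHS]/(mx_norm x) mx_normrE.
by apply: bigmax_le => //= -[i j] _ /=; rewrite (ord1 i).
Qed.

End rV_norm.

Lemma rV_cons_norm_ge (R : realType) n (p : R * 'rV[R]_n) :
  `|p.1| <= `|rV_cons p| /\ `|p.2| <= `|rV_cons p|.
Proof.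
split; first by have := rV_coord_le (rV_cons p) ord0; rewrite rV_consE0.
apply: rV_norm_le => // i.
by have := rV_coord_le (rV_cons p) (lift ord0 i); rewrite rV_consES.
Qed.

(** * Measurability of continuous functions for the coordinate sigma-algebra *)

Section discretization.

(** Preimages are countable unions of fibres of [c], so no structure on [K] is involved. *)
Lemma measurable_countable_comp d (T : measurableType d) d' (U : measurableType d')
    (K : countType) (c : T -> K) (h : K -> U) :
  (forall k, measurable (c @^-1` [set k])) -> measurable_fun setT (h \o c).
Proof.
move=> mc _ Y mY; rewrite setTI.
rewrite (_ : _ @^-1` Y = \bigcup_i (if unpickle i is Some k then
    (if `[< Y (h k) >] then c @^-1` [set k] else set0) else set0)).
  apply: bigcupT_measurable => i; case: (unpickle i) => [k|//].
  by case: ifP.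
apply/seteqP; split=> [x /= Yx|x [i _]].
  by exists (pickle (c x)) => //=; rewrite pickleK; case: ifP => // /negbT/asboolPn.
by case: (unpickle i) => [k|//]; case: ifP => // /asboolP Yk /= ->.
Qed.

Context (R : realType).

Definition grid n N (x : 'rV[R]_n) : 'rV[int]_n := \row_j Num.floor (N.+1%:R * x ord0 j).
Definition ungrid n N (k : 'rV[int]_n) : 'rV[R]_n := \row_j ((k ord0 j)%:~R / N.+1%:R).

Lemma ungridK n N (x : 'rV[R]_n) : `|x - ungrid N (grid N x)| <= N.+1%:R^-1.
Proof.
apply: rV_norm_le => // j; rewrite !mxE.
have N0 : 0 < N.+1%:R :> R by [].
have := floor_itv (N.+1%:R * x ord0 j) => /andP[h1 h2].
rewrite -(ler_pM2l N0) -[X in X * `|_|]gtr0_norm// -normrM mulfV ?gt_eqF//.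
rewrite mulrBr mulrCA mulfV ?gt_eqF// mulr1 ger0_norm ?subr_ge0//.
by move: h2; rewrite rmorphD/=; lra.
Qed.

Lemma ungrid_cvg n (x : 'rV[R]_n) : (fun N => ungrid N (grid N x)) @ \oo --> x.
Proof.
apply/cvgrPdist_le => e e0; exists (Num.truncn e^-1) => // N /= hN.
rewrite (le_trans (ungridK _ _))// invf_ple ?posrE//.
by rewrite (le_trans (ltW (truncnS_gt _)))// ler_nat.
Qed.

Lemma measurable_grid n N (k : 'rV[int]_n) : measurable (@grid n N @^-1` [set k]).
Proof.
rewrite (_ : _ @^-1` _ = \bigcap_(j in [set: 'I_n])
   (rV_coord j @^-1` ((fun s : R => N.+1%:R * s) @^-1` `[(k ord0 j)%:~R, (k ord0 j + 1)%:~R[))).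
  apply: fin_bigcap_measurable => // j _.
  rewrite -[X in measurable X]setTI; apply: measurable_rV_coord => //.
  by rewrite -[X in measurable X]setTI; exact: measurable_funM.
apply/seteqP; split=> [x /= <- j _|x h] /=.
  rewrite /rV_coord mxE in_itv/=; exact: floor_itv.
apply/rowP => j; rewrite mxE; apply: floor_def.
by have := h j I; rewrite /= in_itv/=.
Qed.

Let grid2 n N (z : 'rV[R]_n * 'rV[R]_n) := (grid N z.1, grid N z.2).
Let grid3 n N (z : 'rV[R]_n * 'rV[R]_n * 'rV[R]_n) := (grid2 N z.1, grid N z.2).

(** Pointwise limit of f at the point rounded down to the grid of mesh 1/(N+1); each approximation
    factors through a countable type. *)
Lemma measurable_cts1 n (f : 'rV[R]_n -> R) : continuous f -> measurable_fun setT f.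
Proof.
move=> cf; apply: (@measurable_fun_cvg _ _ _ _ (fun N => (f \o @ungrid n N) \o grid N)).
  by move=> N; apply: measurable_countable_comp => k; exact: measurable_grid.
move=> x _; apply: (@cvg_comp _ _ _ (fun N => ungrid N (grid N x)) f _ (nbhs x)); last exact: cf.
exact: ungrid_cvg.
Qed.

Let mgrid2 n N k : measurable (@grid2 n N @^-1` [set k]).
Proof.
rewrite (_ : _ @^-1` _ = (grid N @^-1` [set k.1]) `*` (grid N @^-1` [set k.2])).
  by apply: measurableX; exact: measurable_grid.
by apply/seteqP; split=> [z /= <-//|[x y] [/= h1 h2]]; rewrite /grid2/= h1 h2; case: k {h1 h2}.
Qed.

Lemma measurable_cts2 n (f : 'rV[R]_n * 'rV[R]_n -> R) :
  continuous f -> measurable_fun setT f.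
Proof.
move=> cf; apply: (@measurable_fun_cvg _ _ _ _
   (fun N => (fun k => f (ungrid N k.1, ungrid N k.2)) \o grid2 N)).
  by move=> N; apply: measurable_countable_comp => k; exact: mgrid2.
move=> [x y] _.
apply: (@cvg_comp _ _ _ (fun N => (ungrid N (grid N x), ungrid N (grid N y))) f _ (nbhs (x, y))); last exact: cf.
exact: cvg_pair (@ungrid_cvg n x) (@ungrid_cvg n y).
Qed.

Lemma measurable_cts3 n (f : 'rV[R]_n * 'rV[R]_n * 'rV[R]_n -> R) :
  continuous f -> measurable_fun setT f.
Proof.
move=> cf; apply: (@measurable_fun_cvg _ _ _ _
   (fun N => (fun k => f ((ungrid N k.1.1, ungrid N k.1.2), ungrid N k.2)) \o grid3 N)).
  move=> N; apply: measurable_countable_comp => k.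
  rewrite (_ : _ @^-1` _ = (grid2 N @^-1` [set k.1]) `*` (grid N @^-1` [set k.2])).
    by apply: measurableX; [exact: mgrid2|exact: measurable_grid].
  by apply/seteqP; split=> [z /= <-//|[x y] [/= h1 h2]]; rewrite /grid3/= h1 h2; case: k {h1 h2}.
move=> [[x y] z] _.
apply: (@cvg_comp _ _ _ (fun N => ((ungrid N (grid N x), ungrid N (grid N y)), ungrid N (grid N z))) f _ (nbhs ((x, y), z))); last exact: cf.
exact: cvg_pair (cvg_pair (@ungrid_cvg n x) (@ungrid_cvg n y)) (@ungrid_cvg n z).
Qed.

End discretization.

Section rV_integral.
Context (R : realType).
Local Notation leb n := (lebesgue_rV R n).

Lemma integral_rV_cons n (f : 'rV[R]_n.+1 -> \bar R) : measurable_fun setT f ->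
  (forall x, (0 <= f x)%E) ->
  (\int[leb n.+1]_x f x =
   \int[@lebesgue_measure R]_s \int[leb n]_x' f (rV_cons (s, x')))%E.
Proof.
move=> mf f0.
transitivity (\int[(@lebesgue_measure R \x leb n)%E]_p f (rV_cons p))%E.
  rewrite -[LHS]/(\int[pushforward (@lebesgue_measure R \x leb n)%E (@rV_cons R n)]_x f x)%E.
  rewrite ge0_integral_pushforward ?preimage_setT//; exact: measurable_rV_cons.
rewrite fubini_tonelli1//.
by apply: measurableT_comp => //; exact: measurable_rV_cons.
Qed.

Definition shiftR (c : R) : measurableTypeR R -> measurableTypeR R := fun s : R => s + c.

Let measurable_shiftR c : measurable_fun setT (shiftR c).
Proof. exact: measurable_funD. Qed.

HB.instance Definition _ c := isMeasurableFun.Build _ _ _ _ (shiftR c) (measurable_shiftR c).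

(** Both measures agree on half-open intervals, which determine Lebesgue measure. *)
Lemma lebesgue_measure_shift (c : R) (A : set R) : measurable A ->
  pushforward (@lebesgue_measure R) (shiftR c) A =
  lebesgue_measure A.
Proof.
move=> mA; apply/esym/lebesgue_measure_unique => //= _ [[a b]] _ <-.
rewrite /pushforward (_ : _ @^-1` _ = `]a - c, b - c]%classic); last first.
  apply/seteqP; split=> x /=; rewrite /shiftR !in_itv/= => /andP[h1 h2]; apply/andP; split; lra.
rewrite !lebesgue_measure_itv/= !lte_fin ltrD2r; case: ifP => // _.
by congr (_%:E); ring.
Qed.

Lemma integral_R_shift (c : R) (f : R -> \bar R) : measurable_fun setT f ->
  (forall r, 0 <= f r)%E ->
  (\int[@lebesgue_measure R]_s f (s + c)%R = \int[@lebesgue_measure R]_s f s)%E.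
Proof.
move=> mf f0.
rewrite -[LHS]/(\int[@lebesgue_measure R]_(s in setT) (f \o shiftR c) s)%E.
rewrite -[X in integral _ X](preimage_setT (shiftR c)) -ge0_integral_pushforward//.
apply: eq_measure_integral => A mA _.
exact: lebesgue_measure_shift.
Qed.

Lemma measurable_rV_shift n (v : 'rV[R]_n) : measurable_fun setT (fun x : 'rV[R]_n => x + v).
Proof.
apply: measurable_fun_rVP => i.
rewrite (_ : _ \o _ = (fun x => rV_coord i x + v ord0 i)).
  by apply: measurable_funD => //; exact: measurable_rV_coord.
by apply/funext => x; rewrite /rV_coord /= mxE.
Qed.

Lemma integral_rV_shift n (v : 'rV[R]_n) (f : 'rV[R]_n -> \bar R) :
  measurable_fun setT f -> (forall x, 0 <= f x)%E ->
  (\int[leb n]_x f (x + v)%R = \int[leb n]_x f x)%E.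
Proof.
elim: n v f => [|n IH] v f mf f0.
  by apply: eq_integral => x _; congr f; apply/rowP => -[].
rewrite !integral_rV_cons//; last first.
  by apply: measurableT_comp => //; exact: measurable_rV_shift.
pose v' : 'rV[R]_n := \row_j v ord0 (lift ord0 j).
have mc := measurableT_comp mf (@measurable_rV_cons R n).
transitivity (\int[@lebesgue_measure R]_s \int[leb n]_x' f (rV_cons ((s + v ord0 ord0)%R, x')))%E.
  apply: eq_integral => s _.
  rewrite -(IH v' (fun x' => f (rV_cons ((s + v ord0 ord0)%R, x')))) => [|//|//].
    apply: eq_integral => x' _; congr f; apply/rowP => i; rewrite mxE.
    by case: (unliftP ord0 i) => [j ->|->]; rewrite ?rV_consES ?rV_consE0 /= ?mxE.
  exact: (measurableT_comp mc (pair1_measurable _)).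
rewrite (integral_R_shift (v ord0 ord0) (f := fun s => \int[leb n]_x' f (rV_cons (s, x')))%E)//.
  apply: (measurable_fun_fubini_tonelli_F (f \o @rV_cons R n)) => // p.
  exact: f0.
by move=> s; apply: integral_ge0.
Qed.

Lemma onep_gt0 (V : normedModType R) (x : V) : 0 < 1 + `|x|.
Proof. by rewrite ltr_wpDr. Qed.

Lemma continuous_onepVX (V : normedModType R) k : continuous (fun x : V => (1 + `|x|) ^- k).
Proof.
move=> x; apply: (@cvgV _ _ _ _ (fun x : V => (1 + `|x|) ^+ k) ((1 + `|x|) ^+ k)).
  by rewrite gt_eqF// exprn_gt0// onep_gt0.
apply: (@cvg_comp _ _ _ (fun x : V => 1 + `|x|) (fun r : R => r ^+ k) _ (nbhs (1 + `|x|))); last exact: exprn_continuous.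
by apply: cvgD; [exact: cvg_cst|exact: norm_continuous].
Qed.

(* Integrable because `|x| is the sup norm: the exponent 2n allows a bound by
   the product over the coordinates of (1 + |x_i|)^-2. *)
Definition wt n (x : 'rV[R]_n) : R := (1 + `|x|) ^- (2 * n).

Lemma wt_gt0 n (x : 'rV[R]_n) : 0 < wt x.
Proof. by rewrite invr_gt0 exprn_gt0// onep_gt0. Qed.

Lemma wt_ge0 n (x : 'rV[R]_n) : 0 <= wt x.
Proof. exact/ltW/wt_gt0. Qed.

Lemma measurable_wt n : measurable_fun setT (@wt n).
Proof.
by apply: measurable_cts1; exact: continuous_onepVX.
Qed.

Lemma measurable_wtR : measurable_fun setT (fun s : R => (1 + `|s|) ^- 2).
Proof.
apply: continuous_measurable_fun => s.
apply: (@cvgV _ _ _ _ (fun x : R => (1 + `|x|) ^+ 2) ((1 + `|s|) ^+ 2)).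
  by rewrite gt_eqF// exprn_gt0// ltr_wpDr.
apply: (@cvg_comp _ _ _ (fun x : R => 1 + `|x|) (fun r : R => r ^+ 2) _ (nbhs (1 + `|s|))).
  by apply: cvgD; [exact: cvg_cst|exact: norm_continuous].
exact: exprn_continuous.
Qed.

Lemma integral_R_wt : (\int[@lebesgue_measure R]_s ((1 + `|s|) ^- 2)%:E < +oo)%E.
Proof.
apply: (@le_lt_trans _ _ (\int[@lebesgue_measure R]_s ((oneDsqr s)^-1)%:E)%E).
  apply: ge0_le_integral => //.
  - by apply/measurable_EFinP; exact: measurable_wtR.
  - apply/measurable_EFinP; apply: continuous_measurable_fun; exact: (@continuous_oneDsqrV R).
  - move=> s _; rewrite lee_fin /oneDsqr lef_pV2 ?posrE ?exprn_gt0 ?ltr_wpDr ?sqr_ge0//.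
    by rewrite sqrrD expr1n mul1r real_normK ?num_real// lerD2r lerDl mulrn_wge0.
rewrite ge0_symfun_integralT//.
- rewrite (_ : [set x | _] = `[0%R, +oo[%classic); last first.
    by apply/seteqP; split=> x /=; rewrite in_itv/= andbT.
  by rewrite integral0y_oneDsqr -EFinM ltry.
- exact: (@continuous_oneDsqrV R).
- by move=> s; rewrite /= /oneDsqr sqrrN.
Qed.

(** Induction on n: the sup norm of (s, x) dominates both |s| and |x|, so the weight splits as (1 +
    |s|)^-2 (1 + |x|)^-2n. *)
Lemma integral_wt n : (\int[leb n]_x (wt x)%:E < +oo)%E.
Proof.
elim: n => [|n IH].
  rewrite (eq_integral (fun=> 1%E)) => [|x _]; last by rewrite /wt expr0 invr1.
  by rewrite integral_cst//= diracT mule1 ltry.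
rewrite integral_rV_cons; last 2 first.
- by apply/measurable_EFinP; exact: measurable_wt.
- by move=> x; rewrite lee_fin wt_ge0.
have fin : (\int[leb n]_x (wt x)%:E)%E \is a fin_num.
  by rewrite ge0_fin_numE//; apply: integral_ge0 => x _; rewrite lee_fin wt_ge0.
have mw : measurable_fun setT (fun x : 'rV[R]_n => (wt x)%:E).
  by apply/measurable_EFinP; exact: measurable_wt.
have w0 (x : 'rV[R]_n) : (0 <= (wt x)%:E)%E by rewrite lee_fin wt_ge0.
apply: (@le_lt_trans _ _ (\int[@lebesgue_measure R]_s (((1 + `|s|) ^- 2)%:E * \int[leb n]_x (wt x)%:E))%E).
  have msw : measurable_fun setT (fun s : R => ((1 + `|s|) ^- 2)%:E).
    by apply/measurable_EFinP; exact: measurable_wtR.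
  apply: ge0_le_integral => //.
  - by move=> s _; apply: integral_ge0 => x _; rewrite lee_fin wt_ge0.
  - apply: (measurable_fun_fubini_tonelli_F (fun p => (wt (rV_cons p))%:E)).
      apply/measurable_EFinP; apply: (measurableT_comp (@measurable_wt _)).
      exact: measurable_rV_cons.
    by move=> p; rewrite lee_fin wt_ge0.
  - by apply: emeasurable_funM => //; exact: measurable_cst.
  move=> s _; have s0 : (0 <= ((1 + `|s|) ^- 2)%:E)%E by rewrite lee_fin invr_ge0 exprn_ge0// addr_ge0.
  rewrite -(@ge0_integralZl _ _ _ (leb n) setT measurableT _ mw _ (fun x _ => w0 x) s0).
  apply: ge0_le_integral => //.
  - by move=> x _; rewrite lee_fin wt_ge0.
  - apply/measurable_EFinP; apply: (measurableT_comp (@measurable_wt _)).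
    exact: (measurableT_comp (@measurable_rV_cons R n) (pair1_measurable _)).
  - exact: measurable_funeM.
  move=> x _; rewrite -EFinM lee_fin /wt -invfM lef_pV2 ?posrE ?mulr_gt0 ?exprn_gt0 ?onep_gt0 ?ltr_wpDr//.
  have [h1 h2] := rV_cons_norm_ge (s, x).
  by rewrite mulnS exprD ler_pM ?exprn_ge0 ?addr_ge0// lerXn2r ?nnegrE ?addr_ge0 ?lerD2l.
have msw : measurable_fun setT (fun s : R => ((1 + `|s|) ^- 2)%:E).
  by apply/measurable_EFinP; exact: measurable_wtR.
have sw0 (s : R) : (0 <= ((1 + `|s|) ^- 2)%:E)%E by rewrite lee_fin invr_ge0 exprn_ge0// addr_ge0.
rewrite (@ge0_integralZr _ _ _ (@lebesgue_measure R) setT measurableT _ msw _ (fun s _ => sw0 s)); last first.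
  by apply: integral_ge0 => x _; exact: w0.
apply: lte_mul_pinfty => //.
- by apply: integral_ge0 => s _; rewrite lee_fin invr_ge0 exprn_ge0// addr_ge0.
- rewrite ge0_fin_numE ?integral_R_wt//.
  by apply: integral_ge0 => s _; rewrite lee_fin invr_ge0 exprn_ge0// addr_ge0.
Qed.

End rV_integral.

Section swap.
Context (R : realType) (n : nat).
Local Notation leb := (lebesgue_rV R n).
Local Notation Rn := 'rV[R]_n.
Local Notation Re := complex.Re.
Local Notation Im := complex.Im.
Local Notation wt := (@wt R n).

Lemma integrable_wt : leb.-integrable setT (EFin \o wt).
Proof.
apply/(integrable_ge0P _ (@measurable_wt R n)); last exact: integral_wt.
by move=> x; exact: wt_ge0.
Qed.

Lemma integrable_cwt (C : R) : leb.-integrable setT (EFin \o (fun x => C * wt x)).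
Proof. exact: (integrableZl measurableT C integrable_wt). Qed.

Definition Iwt : R := \int[leb]_x wt x.

Lemma Iwt_ge0 : 0 <= Iwt.
Proof. by apply: Rintegral_ge0 => x _; exact: wt_ge0. Qed.

Lemma cint_wt (f : Rn -> R[i]) C : cmeasurable f ->
  (forall x, normc (f x) <= C * wt x) -> cintegrable leb f.
Proof. by move=> mf fC; exact: (cintegrable_le mf fC (integrable_cwt C)). Qed.

Lemma normc_cint_wt (f : Rn -> R[i]) C : cmeasurable f ->
  (forall x, normc (f x) <= C * wt x) -> normc (cintegral leb f) <= C * Iwt.
Proof.
move=> mf fC; rewrite (le_trans (normc_cintegral_le mf fC (integrable_cwt C)))//.
by rewrite RintegralZl//; exact: integrable_wt.
Qed.

(** Tonelli gives measurability only for nonnegative integrands, hence the splitting into positive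
    and negative parts. *)
Lemma measurable_Rint d (T : measurableType d) (h : T * Rn -> R) :
  measurable_fun setT h -> measurable_fun setT (fun x => \int[leb]_y h (x, y)).
Proof.
move=> mh.
have mh' : measurable_fun setT (EFin \o h) by exact/measurable_EFinP.
apply: (measurableT_comp (f := fine)); first exact: fine_measurable.
rewrite (_ : (fun x => _) = ((fun x => \int[leb]_y (EFin \o h)^\+ (x, y)) \- (fun x => \int[leb]_y (EFin \o h)^\- (x, y)))%E).
  apply: emeasurable_funB.
    apply: (measurable_fun_fubini_tonelli_F ((EFin \o h)^\+)%E) => //.
    exact: measurable_funepos.
  apply: (measurable_fun_fubini_tonelli_F ((EFin \o h)^\-)%E) => //.
  exact: measurable_funeneg.
apply/funext => x; rewrite [LHS]integralE; congr (_ - _)%E; apply: eq_integral => y _.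
  by rewrite !funeposE.
by rewrite !funenegE.
Qed.

Lemma cmeasurable_cint d (T : measurableType d) (h : T * Rn -> R[i]) :
  cmeasurable h -> cmeasurable (fun x => cintegral leb (fun y => h (x, y))).
Proof. move=> [h1 h2]; split; first exact: (measurable_Rint (h := fun z => Re (h z))).
exact: (measurable_Rint (h := fun z => Im (h z))). Qed.

Lemma cmeasurable_slice1 d (T : measurableType d) (h : T * Rn -> R[i]) x :
  cmeasurable h -> cmeasurable (fun y => h (x, y)).
Proof. by move=> mh; exact: (cmeasurable_comp (pair1_measurable x) mh). Qed.

Lemma cmeasurable_slice2 d (T : measurableType d) (h : T * Rn -> R[i]) y :
  cmeasurable h -> cmeasurable (fun x => h (x, y)).
Proof. by move=> mh; exact: (cmeasurable_comp (pair2_measurable y) mh). Qed.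

Lemma cint_wt2 (h : Rn * Rn -> R[i]) C : cmeasurable h ->
  (forall x y, normc (h (x, y)) <= C * (wt x * wt y)) ->
  cintegrable (leb \x leb)%E h.
Proof.
move=> mh hC; apply: (@cintegrable_le _ _ _ _ _ (fun z => C * (wt z.1 * wt z.2))) => //.
  by move=> [x y]; exact: hC.
apply: (@integrableZl _ _ _ _ setT measurableT C (EFin \o (fun z => wt z.1 * wt z.2))).
have mw : measurable_fun setT (fun z : Rn * Rn => wt z.1 * wt z.2).
  by apply: measurable_funM; apply: (measurableT_comp (@measurable_wt R n)).
apply/(integrable_ge0P _ mw); first by move=> z; rewrite mulr_ge0 ?wt_ge0.
rewrite fubini_tonelli1/=; last 2 first.
- exact/measurable_EFinP.
- by move=> z; rewrite lee_fin mulr_ge0 ?wt_ge0.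
have wfin : (\int[leb]_x (wt x)%:E = Iwt%:E)%E.
  by rewrite /Iwt /Rintegral fineK//; exact: integrable_fin_num integrable_wt.
rewrite (eq_integral (fun x => (wt x * Iwt)%:E)) => [|x _].
  under eq_integral => x _ do rewrite EFinM.
  rewrite ge0_integralZr//; last 3 first.
  - by apply/measurable_EFinP; exact: measurable_wt.
  - by move=> x _; rewrite lee_fin wt_ge0.
  - by rewrite lee_fin Iwt_ge0.
  by rewrite wfin -EFinM ltry.
rewrite /fubini_F /=; under eq_integral => y _ do rewrite EFinM.
rewrite ge0_integralZl//.
- by rewrite wfin EFinM.
- by apply/measurable_EFinP; exact: measurable_wt.
- by move=> y _; rewrite lee_fin wt_ge0.
- by rewrite lee_fin wt_ge0.
Qed.

Lemma wt_le1 x : wt x <= 1.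
Proof. by rewrite invf_le1 ?exprn_gt0 ?onep_gt0// exprn_ege1// lerDl. Qed.

Lemma cint_slices (h : Rn * Rn -> R[i]) C : cmeasurable h ->
  (forall x y, normc (h (x, y)) <= C * (wt x * wt y)) ->
  (forall x, cintegrable leb (fun y => h (x, y))) /\
  (forall y, cintegrable leb (fun x => h (x, y))).
Proof.
move=> mh hC; split=> [x|y].
  apply: (@cint_wt _ (C * wt x)); first exact: cmeasurable_slice1.
  by move=> y; rewrite -mulrA hC.
apply: (@cint_wt _ (C * wt y)); first exact: cmeasurable_slice2.
by move=> x; rewrite -mulrA [wt y * _]mulrC hC.
Qed.

Lemma cfubini_wt (h : Rn * Rn -> R[i]) C : cmeasurable h ->
  (forall x y, normc (h (x, y)) <= C * (wt x * wt y)) ->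
  cintegral (leb \x leb)%E h = cintegral leb (fun x => cintegral leb (fun y => h (x, y))) /\
  cintegral (leb \x leb)%E h = cintegral leb (fun y => cintegral leb (fun x => h (x, y))).
Proof.
move=> mh hC; have ih := cint_wt2 mh hC; have [i1 i2] := cint_slices mh hC.
by split; [exact: cfubini1|exact: cfubini2].
Qed.

Lemma cswap_wt (h : Rn * Rn -> R[i]) C : cmeasurable h ->
  (forall x y, normc (h (x, y)) <= C * (wt x * wt y)) ->
  cintegral leb (fun x => cintegral leb (fun y => h (x, y))) =
  cintegral leb (fun y => cintegral leb (fun x => h (x, y))).
Proof. by move=> mh hC; have [<- <-] := cfubini_wt mh hC. Qed.

Lemma Rintegral_shift (v : Rn) (h : Rn -> R) : measurable_fun setT h ->
  \int[leb]_x h (x + v) = \int[leb]_x h x.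
Proof.
move=> mh; congr fine; have mh' : measurable_fun setT (EFin \o h) by exact/measurable_EFinP.
rewrite [LHS]integralE [RHS]integralE; congr (_ - _)%E.
  transitivity (\int[leb]_x (EFin \o h)^\+ (x + v)%R)%E.
    by apply: eq_integral => x _; rewrite !funeposE.
apply: integral_rV_shift => //.
  exact: measurable_funepos.
transitivity (\int[leb]_x (EFin \o h)^\- (x + v)%R)%E.
    by apply: eq_integral => x _; rewrite !funenegE.
apply: integral_rV_shift => //.
exact: measurable_funeneg.
Qed.

Lemma peetre (V : normedModType R) (x y : V) : 1 + `|x + y| <= (1 + `|x|) * (1 + `|y|).
Proof.
have := ler_normD x y; have := mulr_ge0 (normr_ge0 x) (normr_ge0 y).
rewrite mulrDl mul1r mulrDr mulr1; lra.
Qed.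

Lemma peetreV (V : normedModType R) (x y : V) k :
  (1 + `|x + y|) ^- k <= (1 + `|y|) ^+ k * (1 + `|x|) ^- k.
Proof.
rewrite ler_pdivlMr ?exprn_gt0 ?onep_gt0// mulrC ler_pdivrMr ?exprn_gt0 ?onep_gt0//.
rewrite -exprMn lerXn2r ?nnegrE ?mulr_ge0 ?addr_ge0//.
by have := peetre (x + y) (- y); rewrite addrK normrN mulrC.
Qed.

Lemma segment_increment (phi dphi : R -> R) (K : R) :
  (forall s : R, is_derive s (1 : R) phi (dphi s)) -> (forall s, 0 <= s <= 1 -> `|dphi s| <= K) ->
  forall s, 0 <= s <= 1 -> `|phi s - phi 0| <= s * K.
Proof.
move=> dp dK s /andP[s0 s1]; move: s0; rewrite le_eqVlt => /predU1P[<-|s0].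
  by rewrite subrr normr0 mul0r.
have cphi : {within `[0, s], continuous phi}.
  by apply: derivable_within_continuous => x _; have [] := dp x.
have [c cs ->] := @MVT R phi dphi 0 s s0 (fun x _ => dp x) cphi.
rewrite subr0 normrM mulrC [`|s|]ger0_norm ?(ltW s0)// ler_wpM2l ?(ltW s0)// dK//.
by move: cs; rewrite in_itv/= => /andP[/ltW -> /ltW h2]; rewrite (le_trans h2).
Qed.

Lemma is_derive_line (V : normedModType R) (f : V -> R) (x v : V) (df : V -> R) (s : R) :
  (forall y, is_derive y v f (df y)) -> is_derive s (1 : R) (fun r : R => f (x + r *: v)) (df (x + s *: v)).
Proof.
move=> h; have [d1 d2] := h (x + s *: v).
have E : (fun h : R => h^-1 *: (((fun r => f (x + r *: v)) \o shift s) (h *: 1) - f (x + s *: v))) =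
         (fun h : R => h^-1 *: ((f \o shift (x + s *: v)) (h *: v) - f (x + s *: v))).
  apply/funext => k /=; congr (_ *: (f _ - _)).
  by rewrite [k *: 1]mulr1 scalerDl addrA addrAC addrC addrA.
split; first by rewrite /derivable E.
by rewrite -d2 /derive E.
Qed.

(** Difference quotients have integral zero by translation invariance, and dominated convergence
    passes to the derivative. *)
Lemma Rint_derive0 (g g' : Rn -> R) (v : Rn) (C : R) :
  (forall x, is_derive x v g (g' x)) ->
  measurable_fun setT g -> measurable_fun setT g' ->
  (forall x, `|g x| <= C * wt x) -> (forall x, `|g' x| <= C * wt x) ->
  \int[leb]_x g' x = 0.
Proof.
move=> dg mg mg' gC g'C.
have C0 : 0 <= C by have := le_trans (normr_ge0 _) (gC 0); rewrite pmulr_lge0// wt_gt0.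
pose c k : R := k.+1%:R^-1.
have c0 k : 0 < c k by rewrite invr_gt0.
have c1 k : c k <= 1 by rewrite invf_le1// ler1n.
pose h k (x : Rn) := (c k)^-1 * (g (x + c k *: v) - g x).
have mgs k : measurable_fun setT (fun x : Rn => g (x + c k *: v)).
  by apply: (measurableT_comp mg); exact: measurable_rV_shift.
have mh k : measurable_fun setT (h k).
  by apply: measurable_funM; [exact: measurable_cst|exact: measurable_funB].
(* By the mean value theorem a quotient is a value of g' at a point of [x, x + v]; the factor (1 +
   |v|)^2n is the cost of moving the weight back to x. *)
pose D := (1 + `|v|) ^+ (2 * n) * C.
have D0 : 0 <= D by rewrite mulr_ge0// exprn_ge0// addr_ge0.
have hD k x : `|h k x| <= D * wt x.
  have := @segment_increment (fun r => g (x + r *: v)) (fun r => g' (x + r *: v)) (D * wt x) _ _ (c k).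
  rewrite scale0r addr0 => H; rewrite /h normrM [`|(c k)^-1|]gtr0_norm ?invr_gt0// ler_pdivrMl//.
  apply: H => [s|s /andP[s0 s1]|]; last by rewrite (ltW (c0 k)) c1.
    exact: is_derive_line.
  rewrite (le_trans (g'C _))// /D mulrAC [X in _ <= X]mulrC ler_wpM2l//.
  rewrite (le_trans (peetreV _ _ _))// ler_wpM2r ?wt_ge0//.
  rewrite lerXn2r ?nnegrE ?addr_ge0// lerD2l normrZ ger0_norm// ler_piMl//.
have hcvg x : h^~ x @ \oo --> g' x.
  have [d1 d2] := dg x.
  have cv : (h^-1 *: ((g \o shift x) (h *: v) - g x)) @[h --> 0^'] --> g' x by rewrite -d2; exact: d1.
  have H := (cvgr_dnbhsP _ 0 (g' x)).1 cv c.
  rewrite (_ : h^~ x = (fun k => (c k)^-1 *: ((g \o shift x) (c k *: v) - g x))); last first.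
    by apply/funext => k /=; rewrite [c k *: v + x]addrC.
  apply: H; split=> [k|]; first by rewrite gt_eqF.
  exact: cvg_harmonic.
have ih0 k : \int[leb]_x h k x = 0.
  have ig : leb.-integrable setT (EFin \o g).
    exact: (le_integrable_real mg gC (integrable_cwt C)).
  have igs : leb.-integrable setT (EFin \o (fun x => g (x + c k *: v))).
    apply: (le_integrable_real (mgs k) _ (integrable_cwt D)) => x.
    rewrite (le_trans (gC _))// /D mulrAC [X in _ <= X]mulrC ler_wpM2l//.
    rewrite (le_trans (peetreV _ _ _))// ler_wpM2r ?wt_ge0//.
    rewrite lerXn2r ?nnegrE ?addr_ge0// lerD2l normrZ ger0_norm ?(ltW (c0 k))//.
    by rewrite ler_piMl.
  rewrite /h RintegralZl//; last first.
    by have := integrableB measurableT igs ig.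
  by rewrite RintegralB// Rintegral_shift// subrr mulr0.
have mE (f : Rn -> R) : measurable_fun setT f -> measurable_fun setT (EFin \o f).
  by move=> mf; exact/measurable_EFinP.
have aecvg : {ae leb, forall x, setT x -> (EFin \o h k) x @[k --> \oo] --> (EFin \o g') x}.
  by apply: aeW => x _; apply: cvg_EFin; [exact: nearW|exact: hcvg].
have [_ _] := dominated_convergence measurableT (fun k => mE _ (mh k)) (mE _ mg') aecvg
  (integrable_cwt D) (aeW _ (fun x k _ => hD k x)).
have -> : [sequence (\int[leb]_x (EFin \o h n) x)%E]_n = (fun=> 0%E).
  apply/funext => k; have := congr1 (@EFin R) (ih0 k); rewrite /Rintegral fineK//.
  apply: integrable_fin_num => //.
  exact: (le_integrable_real (mh k) (hD k) (integrable_cwt D)).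
move=> /(cvg_unique _ (cvg_cst 0%E)) => E0.
by rewrite /Rintegral -[X in fine X]E0.
Qed.

End swap.

(** * Families of symbols and integration by parts *)

Section cderivative.
Context (R : realType) (V : normedModType R).
Local Notation Re := complex.Re.
Local Notation Im := complex.Im.
Implicit Types (f g : V -> R[i]) (v z : V) (d e : R[i]).

Definition cis_derive z v f d :=
  is_derive z v (fun y => Re (f y) : R^o) (Re d) /\
  is_derive z v (fun y => Im (f y) : R^o) (Im d).

Definition Dc v f z : R[i] :=
  'D_v (fun y => Re (f y) : R^o) z +i* 'D_v (fun y => Im (f y) : R^o) z.

Definition cderivable f z v :=
  derivable (fun y => Re (f y) : R^o) z v /\ derivable (fun y => Im (f y) : R^o) z v.

Lemma cderivableP f z v : cderivable f z v -> cis_derive z v f (Dc v f z).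
Proof. by move=> [d1 d2]; split; exact/derivableP. Qed.

Lemma cis_derive_derivable f z v d : cis_derive z v f d -> cderivable f z v.
Proof. by move=> [[d1 _] [d2 _]]. Qed.

Lemma cis_derive_val f z v d : cis_derive z v f d -> Dc v f z = d.
Proof. by move=> [[_ d1] [_ d2]]; rewrite /Dc d1 d2; case: d {d1 d2}. Qed.

Lemma cis_deriveD f g z v d e : cis_derive z v f d -> cis_derive z v g e ->
  cis_derive z v (fun y => f y + g y) (d + e).
Proof.
move=> [f1 f2] [g1 g2]; split; rewrite ?cReD ?cImD.
  rewrite (_ : (fun y => _) = (fun y => Re (f y) : R^o) + (fun y => Re (g y) : R^o)).
    exact: is_deriveD.
  by apply/funext => y; rewrite cReD.
rewrite (_ : (fun y => _) = (fun y => Im (f y) : R^o) + (fun y => Im (g y) : R^o)).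
  exact: is_deriveD.
by apply/funext => y; rewrite cImD.
Qed.

Let is_deriveM' (f g : V -> R) z v (a b : R) : is_derive z v (f : V -> R^o) a ->
  is_derive z v (g : V -> R^o) b -> is_derive z v (fun y => f y * g y : R^o) (a * g z + f z * b).
Proof.
move=> h1 h2; have := is_deriveM h1 h2.
by rewrite addrC [g z *: a]mulrC.
Qed.

Lemma cis_deriveM f g z v d e : cis_derive z v f d -> cis_derive z v g e ->
  cis_derive z v (fun y => f y * g y) (d * g z + f z * e).
Proof.
move=> [f1 f2] [g1 g2]; split; rewrite ?cReD ?cImD ?cReM ?cImM.
  rewrite (_ : (fun y => _) = (fun y => Re (f y) * Re (g y) : R^o) - (fun y => Im (f y) * Im (g y) : R^o)).
    rewrite addrACA -opprD; apply: is_deriveB; exact: is_deriveM'.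
  by apply/funext => y; rewrite cReM.
rewrite (_ : (fun y => _) = (fun y => Re (f y) * Im (g y) : R^o) + (fun y => Im (f y) * Re (g y) : R^o)).
  rewrite addrACA; apply: is_deriveD; exact: is_deriveM'.
by apply/funext => y; rewrite cImM.
Qed.

Lemma cis_derive_cst c z v : cis_derive z v (fun=> c) 0.
Proof. by split; exact: is_derive_cst. Qed.

Let ReV (z : R[i]) : Re z^-1 = Re z * (Re z * Re z + Im z * Im z)^-1.
Proof. by case: z => x y /=; rewrite !expr2. Qed.

Let ImV (z : R[i]) : Im z^-1 = - Im z * (Re z * Re z + Im z * Im z)^-1.
Proof. by case: z => x y /=; rewrite !expr2 mulNr. Qed.

Let n20 (z : R[i]) : z != 0 -> Re z * Re z + Im z * Im z != 0.
Proof.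
move=> z0; rewrite -!expr2 -normc2 expf_eq0/=; apply: contra z0 => /eqP/eq0_normc ->.
exact: eqxx.
Qed.

Lemma cis_deriveV f z v d : f z != 0 -> cis_derive z v f d ->
  cis_derive z v (fun y => (f y)^-1) (- (d * ((f z)^-1 * (f z)^-1))).
Proof.
move=> fz0 [f1 f2].
pose N y := Re (f y) * Re (f y) + Im (f y) * Im (f y).
have N0 : N z != 0 by exact: n20.
have dN : is_derive z v (N : V -> R^o) (2 * (Re (f z) * Re d + Im (f z) * Im d)).
  have := is_deriveD (is_deriveM' f1 f1) (is_deriveM' f2 f2).
  by move=> h; apply: (is_derive_eq h); ring.
have dNV : is_derive z v (fun y => (N y)^-1 : R^o) (- (N z) ^- 2 * (2 * (Re (f z) * Re d + Im (f z) * Im d))).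
  have [a1 a2] := dN; split; first exact: derivableV.
  by rewrite deriveV// a2.
split.
  rewrite (_ : (fun y => _) = (fun y => Re (f y) * (N y)^-1 : R^o)); last first.
    by apply/funext => y; rewrite ReV.
  apply: (is_derive_eq (is_deriveM' f1 dNV)).
  by rewrite !cE !ReV !ImV -/(N z) /N; move: N0; rewrite /N => N0; field.
rewrite (_ : (fun y => _) = (fun y => (- Im (f y)) * (N y)^-1 : R^o)); last first.
  by apply/funext => y; rewrite ImV.
apply: (is_derive_eq (is_deriveM' (is_deriveN f2) dNV)).
rewrite -[(- _) z]/(- Im (f z)) !cE !ReV !ImV -/(N z) /N; move: N0; rewrite /N => N0.
by field.
Qed.

Definition ccont f := continuous (fun y => Re (f y)) /\ continuous (fun y => Im (f y)).

Lemma ccont_cst c : ccont (fun=> c).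
Proof. by split=> z; exact: cvg_cst. Qed.

Lemma ccontD f g : ccont f -> ccont g -> ccont (fun y => f y + g y).
Proof.
move=> [f1 f2] [g1 g2]; split=> z; rewrite /continuous_at ?cReD ?cImD;
  under eq_fun do rewrite ?cReD ?cImD; apply: cvgD; by [exact: f1|exact: f2|exact: g1|exact: g2].
Qed.

Lemma ccontM f g : ccont f -> ccont g -> ccont (fun y => f y * g y).
Proof.
move=> [f1 f2] [g1 g2]; split=> z; rewrite /continuous_at ?cReM ?cImM;
  under eq_fun do rewrite ?cReM ?cImM.
  by apply: cvgB; apply: cvgM; [exact: f1|exact: g1|exact: f2|exact: g2].
by apply: cvgD; apply: cvgM; [exact: f1|exact: g2|exact: f2|exact: g1].
Qed.

Lemma ccontJ f : ccont f -> ccont (fun y => conjc (f y)).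
Proof.
move=> [f1 f2]; split=> z; rewrite /continuous_at ?cReJ ?cImJ;
  under eq_fun do rewrite ?cReJ ?cImJ; first exact: f1.
by apply: cvgN; exact: f2.
Qed.

Lemma ccontV f : (forall z, f z != 0) -> ccont f -> ccont (fun y => (f y)^-1).
Proof.
move=> f0 [f1 f2].
have cN : continuous (fun y => (Re (f y) * Re (f y) + Im (f y) * Im (f y))^-1).
  move=> z; apply: cvgV; first exact: n20.
  by apply: cvgD; apply: cvgM; by [exact: f1|exact: f2].
split=> z.
  rewrite (_ : (fun y => _) = (fun y => Re (f y) * (Re (f y) * Re (f y) + Im (f y) * Im (f y))^-1)).
    by apply: cvgM; [exact: f1|exact: cN].
  by apply/funext => y; rewrite ReV.
rewrite (_ : (fun y => _) = (fun y => - Im (f y) * (Re (f y) * Re (f y) + Im (f y) * Im (f y))^-1)).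
  by apply: cvgM; [apply: cvgN; exact: f2|exact: cN].
by apply/funext => y; rewrite ImV.
Qed.

End cderivative.

Section line.
Context (R : realType) (V W : normedModType R).
Local Notation Re := complex.Re.
Local Notation Im := complex.Im.

(* Directional derivatives only see the restriction to a line. *)
Lemma is_derive_along (f : W -> R) (j : V -> W) (z v : V) (w : W) d :
  (forall h : R, j (h *: v + z) = h *: w + j z) ->
  is_derive (j z) w (f : W -> R^o) d -> is_derive z v (f \o j : V -> R^o) d.
Proof.
move=> hj [d1 d2].
have E : (fun h : R => h^-1 *: (((f \o j : V -> R^o) \o shift z) (h *: v) - (f \o j) z)) =
         (fun h : R => h^-1 *: (((f : W -> R^o) \o shift (j z)) (h *: w) - f (j z))).
  by apply/funext => h /=; rewrite hj.
by split; [rewrite /derivable E|rewrite -d2 /derive E].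
Qed.

Lemma cis_derive_along (f : W -> R[i]) (j : V -> W) (z v : V) (w : W) d :
  (forall h : R, j (h *: v + z) = h *: w + j z) ->
  cis_derive (j z) w f d -> cis_derive z v (f \o j) d.
Proof.
move=> hj [f1 f2]; split.
  exact: (is_derive_along (f := fun y => Re (f y)) hj).
exact: (is_derive_along (f := fun y => Im (f y)) hj).
Qed.

Lemma ccont_comp (f : W -> R[i]) (j : V -> W) : continuous j -> ccont f -> ccont (f \o j).
Proof.
move=> cj [f1 f2]; split=> z.
  by apply: (@cvg_comp _ _ _ j (fun y => Re (f y)) _ (nbhs (j z))); [exact: cj|exact: f1].
by apply: (@cvg_comp _ _ _ j (fun y => Im (f y)) _ (nbhs (j z))); [exact: cj|exact: f2].
Qed.

(** Only directional derivatives are assumed, so homogeneity in the direction is obtained from the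
    one-variable chain rule along the line. *)
Lemma is_derive_scale (f df : W -> R) (w : W) (s : R) z :
  (forall y, is_derive y w (f : W -> R^o) (df y)) ->
  is_derive z (s *: w) (f : W -> R^o) (s * df z).
Proof.
move=> hf.
have h1 : is_derive (0 : R) (1 : R) ((fun r : R => f (z + r *: w)) \o (fun h : R => s * h)) (df z * s).
  apply: is_derive1_comp.
    by have := @is_derive_line R W f z w df (s * 0) hf; rewrite mulr0 scale0r addr0.
  have := @is_deriveZ R R R id s 0 1 1 (is_derive_id _ _).
  by rewrite /GRing.scale/= mulr1.
have E : (fun h : R => h^-1 *: (((f : W -> R^o) \o shift z) (h *: (s *: w)) - f z)) =
    (fun h : R => h^-1 *: ((((fun r : R => f (z + r *: w)) \o (fun h : R => s * h)) \o shift 0) (h *: 1)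
       - ((fun r : R => f (z + r *: w)) \o (fun h : R => s * h)) 0)).
  apply/funext => h /=; rewrite mulr0 scale0r !addr0 scalerA [s * _]mulrC.
  by rewrite -[h *: 1]/(h * 1) mulr1 [z + _]addrC.
have [d1 d2] := h1.
by split; [rewrite /derivable E|rewrite mulrC -d2 /derive E].
Qed.

Lemma cis_derive_scale (f df : W -> R[i]) (w : W) (s : R) z :
  (forall y, cis_derive y w f (df y)) -> cis_derive z (s *: w) f (s%:C * df z).
Proof.
move=> hf; split; rewrite !cE /= mul0r ?subr0 ?addr0.
  by apply: (is_derive_scale (f := fun y => Re (f y)) (df := fun y => Re (df y))) => y; have [] := hf y.
by apply: (is_derive_scale (f := fun y => Im (f y)) (df := fun y => Im (df y))) => y; have [] := hf y.
Qed.

End line.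

Section sym.
Context (R : realType) (V : normedModType R) (I : Type).
Local Notation Re := complex.Re.
Local Notation Im := complex.Im.
Implicit Types (w : I -> V -> R) (F G : I -> V -> R[i]) (k : nat).

(* The constants are uniform in the index i, so that one integration by parts
   treats all lattice points at once. *)
Fixpoint symk k w F : Prop :=
  (forall i, ccont (F i)) /\
  (exists C : R, forall i z, normc (F i z) <= C * w i z) /\
  if k is k'.+1 then
    forall v, (forall i z, cderivable (F i) z v) /\ symk k' w (fun i => Dc v (F i))
  else True.

Definition sym w F := forall k, symk k w F.

Lemma symk_cont k w F i : symk k w F -> ccont (F i).
Proof. by case: k => [|k] []. Qed.

Lemma symk_bound k w F : symk k w F -> exists C : R, 0 <= C /\
  ((forall i z, 0 <= w i z) -> forall i z, normc (F i z) <= C * w i z).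
Proof.
have H : (exists C : R, forall i z, normc (F i z) <= C * w i z) -> exists C : R, 0 <= C /\
  ((forall i z, 0 <= w i z) -> forall i z, normc (F i z) <= C * w i z).
  move=> [C hC]; exists `|C|; split=> // w0 i z; rewrite (le_trans (hC i z))//.
  by rewrite ler_wpM2r// ler_norm.
by case: k => [|k] [_ [h _]]; exact: H.
Qed.

Lemma symkS k w F : symk k.+1 w F -> symk k w F.
Proof.
elim: k F => [|k IH] F [cF [bF dF]]; first by split.
by split=> //; split=> // v; have [h1 h2] := dF v; split=> //; exact: IH.
Qed.

Lemma symk_mono k w w' F (K : R) : 0 <= K -> (forall i z, 0 <= w i z) ->
  (forall i z, w i z <= K * w' i z) -> symk k w F -> symk k w' F.
Proof.
move=> K0 w0 ww'; elim: k F => [|k IH] F sF.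
  have [C [C0 hC]] := symk_bound sF; split; first by move=> i; exact: symk_cont sF.
  split=> //; exists (C * K) => i z; rewrite (le_trans (hC w0 i z))// -mulrA.
  by rewrite ler_wpM2l.
have [C [C0 hC]] := symk_bound sF; case: (sF) => [cF [_ dF]]; split=> //; split.
  exists (C * K) => i z; rewrite (le_trans (hC w0 i z))// -mulrA.
  by rewrite ler_wpM2l.
by move=> v; have [h1 h2] := dF v; split=> //; exact: IH.
Qed.

Lemma symkD k w F G : (forall i z, 0 <= w i z) -> symk k w F -> symk k w G ->
  symk k w (fun i z => F i z + G i z).
Proof.
move=> w0; elim: k F G => [|k IH] F G sF sG;
  have [C1 [_ /(_ w0) h1]] := symk_bound sF; have [C2 [_ /(_ w0) h2]] := symk_bound sG;
  (split; first by move=> i; apply: ccontD; [exact: symk_cont sF|exact: symk_cont sG]);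
  (split; first by exists (C1 + C2) => i z; rewrite (le_trans (le_normcD _ _))// mulrDl lerD).
  by [].
move=> v; have [_ [_ /(_ v)[dF sF']]] := sF; have [_ [_ /(_ v)[dG sG']]] := sG.
split=> [i z|].
  exact: cis_derive_derivable (cis_deriveD (cderivableP (dF i z)) (cderivableP (dG i z))).
rewrite (_ : (fun i => _) = (fun i z => Dc v (F i) z + Dc v (G i) z)); first exact: IH.
apply/funext => i; apply/funext => z; apply: cis_derive_val.
exact: (cis_deriveD (cderivableP (dF i z)) (cderivableP (dG i z))).
Qed.

Lemma symkM k w1 w2 F G : (forall i z, 0 <= w1 i z) -> (forall i z, 0 <= w2 i z) ->
  symk k w1 F -> symk k w2 G ->
  symk k (fun i z => w1 i z * w2 i z) (fun i z => F i z * G i z).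
Proof.
move=> w10 w20; have w0 i z : 0 <= w1 i z * w2 i z by exact: mulr_ge0.
elim: k F G => [|k IH] F G sF sG;
  have [C1 [C10 /(_ w10) h1]] := symk_bound sF; have [C2 [C20 /(_ w20) h2]] := symk_bound sG;
  (split; first by move=> i; apply: ccontM; [exact: symk_cont sF|exact: symk_cont sG]);
  (split; first by exists (C1 * C2) => i z; rewrite normcM mulrACA ler_pM ?normc_ge0).
  by [].
move=> v; have [_ [_ /(_ v)[dF sF']]] := sF; have [_ [_ /(_ v)[dG sG']]] := sG.
split=> [i z|].
  exact: cis_derive_derivable (cis_deriveM (cderivableP (dF i z)) (cderivableP (dG i z))).
rewrite (_ : (fun i => _) = (fun i z => Dc v (F i) z * G i z + F i z * Dc v (G i) z)).
  apply: symkD => //; apply: IH => //; exact: symkS.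
apply/funext => i; apply/funext => z; apply: cis_derive_val.
exact: (cis_deriveM (cderivableP (dF i z)) (cderivableP (dG i z))).
Qed.

Lemma symk_cst k w (c : I -> R[i]) C : (forall i z, 0 <= w i z) ->
  (forall i z, normc (c i) <= C * w i z) -> symk k w (fun i _ => c i).
Proof.
move=> w0; elim: k c C => [|k IH] c C hC;
  (split; first by move=> i; exact: ccont_cst); (split; first by exists C).
  by [].
move=> v; split=> [i z|]; first exact: cis_derive_derivable (cis_derive_cst _ z v).
rewrite (_ : (fun i => _) = (fun i _ => 0)).
  by apply: (IH _ 0) => i z; rewrite mul0r normc0.
by apply/funext => i; apply/funext => z; apply: cis_derive_val; exact: cis_derive_cst.
Qed.

Lemma symkZ k w F (c : I -> R[i]) : (forall i z, 0 <= w i z) -> (forall i, normc (c i) <= 1) ->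
  symk k w F -> symk k w (fun i z => c i * F i z).
Proof.
move=> w0 c1 sF.
have s1 : symk k (fun _ _ => 1) (fun i (_ : V) => c i).
  by apply: (@symk_cst _ _ _ 1) => // i z; rewrite mulr1.
have := symkM (fun _ _ => ler01) w0 s1 sF.
by apply: (@symk_mono _ _ _ _ 1) => // i z; rewrite ?mulr_ge0// !mul1r.
Qed.

Lemma symkN k w F : (forall i z, 0 <= w i z) ->
  symk k w F -> symk k w (fun i z => - F i z).
Proof.
move=> w0 sF; rewrite (_ : (fun i => _) = (fun i z => (-1) * F i z)); last first.
  by apply/funext => i; apply/funext => z; rewrite mulN1r.
by apply: (symkZ (c := fun=> -1)) => // i; rewrite normcN normc1.
Qed.

Lemma symkB k w F G : (forall i z, 0 <= w i z) -> symk k w F -> symk k w G ->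
  symk k w (fun i z => F i z - G i z).
Proof. by move=> w0 sF sG; apply: symkD => //; exact: symkN. Qed.

(** The derivative of 1/F is -F'/F^2, whose weight w (1/w)^2 is again 1/w; the induction on the
    order closes up. *)
Lemma symk_inv k w F (c : R) : 0 < c -> (forall i z, 0 < w i z) ->
  (forall i z, c * w i z <= normc (F i z)) ->
  symk k w F -> symk k (fun i z => (w i z)^-1) (fun i z => (F i z)^-1).
Proof.
move=> c0 w0 hF.
have F0 i z : F i z != 0.
  apply/eqP => E; have := hF i z; rewrite E normc0 leNgt mulr_gt0//.
have wi0 i z : 0 <= (w i z)^-1 by rewrite invr_ge0 ltW.
have bd i z : normc (F i z)^-1 <= c^-1 * (w i z)^-1.
  by rewrite normcV -invfM lef_pV2 ?posrE ?mulr_gt0// (lt_le_trans _ (hF i z))// mulr_gt0.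
elim: k => [|k IH] sF.
  split; first by move=> i; apply: ccontV => //; exact: symk_cont sF.
  by split=> //; exists c^-1.
split; first by move=> i; apply: ccontV => //; exact: symk_cont sF.
split; first by exists c^-1.
move=> v; have [_ [_ /(_ v)[dF sF']]] := sF.
have dV i z := cis_deriveV (F0 i z) (cderivableP (dF i z)).
split=> [i z|]; first exact: cis_derive_derivable (dV i z).
rewrite (_ : (fun i => _) = (fun i z => - (Dc v (F i) z * ((F i z)^-1 * (F i z)^-1)))); last first.
  by apply/funext => i; apply/funext => z; rewrite (cis_derive_val (dV i z)).
apply: symkN => //; have sI := IH (symkS sF).
have := symkM (fun i z => ltW (w0 i z)) (fun i z => mulr_ge0 (wi0 i z) (wi0 i z)) sF' (symkM wi0 wi0 sI sI).
apply: (@symk_mono _ _ _ _ 1) => // i z.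
  by rewrite !mulr_ge0// ltW.
by rewrite mulrA mulfV ?mul1r// gt_eqF.
Qed.

End sym.

(** The linear part of the substitution is s_i L with |s_i| <= 1 and L the same for all i. A
    derivative along v becomes s_i times a derivative along Lv, which keeps the constants uniform in
    i. *)
Lemma symk_comp (R : realType) (V V' : normedModType R) (I I' : Type) k
    (w : I' -> V' -> R) (F : I' -> V' -> R[i]) (rho : I -> I') (B : I -> V -> V')
    (s : I -> R) (L : V -> V') :
  (forall i z, 0 <= w i z) -> (forall i, `|s i| <= 1) ->
  (forall i, continuous (B i)) ->
  (forall i (h : R) v z, B i (h *: v + z) = h *: (s i *: L v) + B i z) ->
  symk k w F -> symk k (fun i z => w (rho i) (B i z)) (fun i z => F (rho i) (B i z)).
Proof.
move=> w0 s1 cB aB; elim: k F => [|k IH] F sF;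
  have [C [C0 /(_ w0) hC]] := symk_bound sF;
  (split; first by move=> i; apply: (ccont_comp (cB i)); exact: symk_cont sF);
  (split; first by exists C => i z).
  by [].
move=> v; have [_ [_ /(_ (L v))[dF sF']]] := sF.
have D i z : cis_derive z v (fun y => F (rho i) (B i y)) ((s i)%:C * Dc (L v) (F (rho i)) (B i z)).
  apply: (@cis_derive_along _ _ _ (F (rho i)) (B i) z v (s i *: L v)) => //.
  by apply: cis_derive_scale => y; exact: cderivableP.
split=> [i z|]; first exact: cis_derive_derivable (D i z).
rewrite (_ : (fun i => _) = (fun i z => (s i)%:C * Dc (L v) (F (rho i)) (B i z))); last first.
  by apply/funext => i; apply/funext => z; rewrite (cis_derive_val (D i z)).
apply: symkZ => //; first by move=> i; rewrite normc_real.
exact: (IH (fun i => Dc (L v) (F i))).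
Qed.

Lemma continuous_sum (R : realType) (T : topologicalType) (I : Type) (s : seq I) (f : I -> T -> R) :
  (forall i, continuous (f i)) -> continuous (fun x => \sum_(i <- s) f i x).
Proof.
move=> cf; elim: s => [|i s IH] x.
  by rewrite /continuous_at big_nil; under eq_fun do rewrite big_nil; exact: cvg_cst.
rewrite /continuous_at big_cons; under eq_fun do rewrite big_cons.
by apply: cvgD; [exact: cf|exact: IH].
Qed.

Section cexpi.
Context (R : realType).
Local Notation Re := complex.Re.
Local Notation Im := complex.Im.
Implicit Types s t : R.

Lemma normc_cexpi t : normc (cexpi t) = 1.
Proof. by rewrite /cexpi /= cos2Dsin2 sqrtr1. Qed.

Lemma cexpiD s t : cexpi (s + t) = cexpi s * cexpi t.
Proof. by apply: complexP; rewrite !cE /= ?cosD ?sinD// addrC [sin s * _]mulrC; ring. Qed.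

Lemma cexpi0 : cexpi (0 : R) = 1.
Proof. by rewrite /cexpi cos0 sin0. Qed.

Lemma cexpiN t : cexpi (- t) = conjc (cexpi t).
Proof. by rewrite /cexpi cosN sinN. Qed.

Lemma ccont_cexpi (V : normedModType R) (theta : V -> R) : continuous theta ->
  ccont (fun z => cexpi (theta z)).
Proof.
move=> ct; split=> z /=.
  apply: (@cvg_comp _ _ _ theta cos _ (nbhs (theta z))); [exact: ct|exact: continuous_cos].
apply: (@cvg_comp _ _ _ theta sin _ (nbhs (theta z))); [exact: ct|exact: continuous_sin].
Qed.

Lemma cis_derive_cexpi (V : normedModType R) (theta : V -> R) z v s :
  (forall h : R, theta (h *: v + z) = h * s + theta z) ->
  cis_derive z v (fun y => cexpi (theta y)) ((0 +i* s) * cexpi (theta z)).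
Proof.
move=> ht.
have H (f df : R -> R) : (forall y : R, is_derive y (1 : R) (f : R -> R^o) (df y)) ->
    is_derive z v (f \o theta : V -> R^o) (s * df (theta z)).
  move=> hf; apply: (@is_derive_along R V R f theta z v (s *: 1)).
    by move=> h; rewrite ht -[s *: 1]/(s * 1) mulr1.
  exact: (@is_derive_scale R R f df 1).
split; rewrite !cE /=.
  have := H cos (fun y => - sin y) (fun y => is_derive_cos y).
  by rewrite mul0r sub0r mulrN.
have := H sin cos (fun y => is_derive_sin y).
by rewrite mul0r add0r.
Qed.

End cexpi.

Section ccont_measurable.
Context (R : realType) (n : nat).
Local Notation Rn := 'rV[R]_n.
Local Notation leb := (lebesgue_rV R n).
Local Notation Re := complex.Re.
Local Notation Im := complex.Im.

Lemma ccont_meas1 (f : Rn -> R[i]) : ccont f -> cmeasurable f.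
Proof. by move=> [f1 f2]; split; exact: measurable_cts1. Qed.

Lemma ccont_meas2 (f : Rn * Rn -> R[i]) : ccont f -> cmeasurable f.
Proof. by move=> [f1 f2]; split; exact: measurable_cts2. Qed.

Lemma ccont_meas3 (f : Rn * Rn * Rn -> R[i]) : ccont f -> cmeasurable f.
Proof. by move=> [f1 f2]; split; exact: measurable_cts3. Qed.

Lemma cint_derive0 (g g' : Rn -> R[i]) (v : Rn) (C : R) :
  (forall x, cis_derive x v g (g' x)) -> ccont g -> ccont g' ->
  (forall x, normc (g x) <= C * wt x) -> (forall x, normc (g' x) <= C * wt x) ->
  cintegral leb g' = 0.
Proof.
move=> dg /ccont_meas1[m1 m2] /ccont_meas1[m3 m4] b1 b2; rewrite /cintegral.
apply: complexP => /=.
  apply: (@Rint_derive0 R n (fun x => Re (g x)) _ v C) => // x.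
  - by have [] := dg x.
  - by rewrite (le_trans _ (b1 x))// Re_le_normc.
  - by rewrite (le_trans _ (b2 x))// Re_le_normc.
apply: (@Rint_derive0 R n (fun x => Im (g x)) _ v C) => // x.
- by have [] := dg x.
- by rewrite (le_trans _ (b1 x))// Im_le_normc.
- by rewrite (le_trans _ (b2 x))// Im_le_normc.
Qed.

End ccont_measurable.

(** * Integration by parts against a phase linear in one group of variables *)

Section ibp.
Context (R : realType) (n : nat) (V : normedModType R) (I : Type).
Local Notation Rn := 'rV[R]_n.
Local Notation leb := (lebesgue_rV R n).
Local Notation Re := complex.Re.
Local Notation Im := complex.Im.
Variable E : Rn -> V.
Hypothesis linE : forall (h : R) u v, E (h *: u + v) = h *: E u + E v.
Hypothesis contE : continuous E.
Variables (l : I -> 'I_n -> V -> R) (lin : 'I_n -> V -> R).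
Hypothesis contl : forall i j, continuous (l i j).
Hypothesis affl : forall i j (h : R) v z, l i j (h *: v + z) = h * lin j v + l i j z.
Hypothesis lin0 : forall j b, lin j (E b) = 0.
Implicit Types (F G : I -> V -> R[i]) (w : I -> V -> R).

Definition ph i z (b : Rn) : R[i] := cexpi (\sum_j l i j z * b ord0 j).

(** Integrable domination along each slice z + E b. The constant may depend on i and z because it
    only justifies the vanishing of integrals of derivatives. *)
Definition slice_le w := forall i z, exists K : R, forall b, w i (z + E b) <= K * wt b.

(* Transpose of (1 + i l_j)^-1 (1 + d/db_j), which fixes the phase exp(i l.b). *)
Definition gain j F i z := (1 +i* l i j z)^-1 * (F i z - Dc (E (delta_mx ord0 j)) (F i) z).

Let w1 j i z := (1 + `|l i j z|)^-1.

Let w1_ge0 j i z : 0 <= w1 j i z.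
Proof. by rewrite invr_ge0 addr_ge0. Qed.

Let l_const i j z b : l i j (z + E b) = l i j z.
Proof. by rewrite addrC -[E b]scale1r affl lin0 mulr0 add0r. Qed.

Let n1 (s : R) : (1 + `|s|) <= 2 * normc (1 +i* s).
Proof. by have := Re_le_normc (1 +i* s); have := Im_le_normc (1 +i* s); rewrite /= normr1; lra. Qed.

Lemma symk_mult k j : symk k (w1 j) (fun i z => (1 +i* l i j z)^-1).
Proof.
have w0 i z : 0 < 1 + `|l i j z| by rewrite ltr_pwDl.
apply: (@symk_inv R V I k (fun i z => 1 + `|l i j z|) _ 2^-1) => //.
  by move=> i z; rewrite mulrC ler_pdivrMr// mulrC n1.
have c1 i : ccont (fun z => 1 +i* l i j z).
  by split=> z /=; [exact: cvg_cst|exact: contl].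
have D i z v : cis_derive z v (fun y => 1 +i* l i j y) (0 +i* lin j v).
  split=> /=; first exact: is_derive_cst.
  apply: (@is_derive_along R V R id (l i j) z v (lin j v *: 1)).
    by move=> h; rewrite affl -[lin j v *: 1]/(lin j v * 1) mulr1.
  by have := @is_derive_scale R R id (fun=> 1) 1 (lin j v) (l i j z); rewrite mulr1; apply.
have b1 i z : normc (1 +i* l i j z) <= 1 * (1 + `|l i j z|).
  by rewrite mul1r (le_trans (normc_ReIm _))//= normr1.
case: k => [|k]; (split=> //; split; first by exists 1).
  by [].
move=> v; split=> [i z|]; first exact: cis_derive_derivable (D i z v).
rewrite (_ : (fun i => _) = (fun (i : I) (z : V) => 0 +i* lin j v)); last first.
  by apply/funext => i; apply/funext => z; rewrite (cis_derive_val (D i z v)).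
apply: (@symk_cst _ _ _ _ _ _ `|lin j v|) => [i z|i z]; first exact: ltW.
by rewrite (le_trans (normc_ReIm _))//= normr0 add0r ler_peMr// lerDl.
Qed.

Lemma gain_sym k j w F : (forall i z, 0 <= w i z) -> symk k.+1 w F ->
  symk k (fun i z => w1 j i z * w i z) (gain j F).
Proof.
move=> w0 sF; have [_ [_ /(_ (E (delta_mx ord0 j)))[dF sF']]] := sF.
apply: symkM => //; first exact: symk_mult.
by apply: symkB => //; exact: symkS.
Qed.

Let line_b z (b : Rn) v (h : R) : z + E (h *: v + b) = h *: E v + (z + E b).
Proof. by rewrite linE addrCA. Qed.

Let cont_line z : continuous (fun b => z + E b).
Proof. by move=> b; have h := contE (x := b); exact: (cvgD (cvg_cst z) h). Qed.

Lemma ccont_ph i z : ccont (ph i z).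
Proof.
apply: ccont_cexpi; apply: (continuous_sum (f := fun j (b : Rn) => l i j z * b ord0 j)) => j b.
exact: (cvgM (cvg_cst (l i j z)) (@coord_continuous _ _ _ ord0 j b)).
Qed.

Lemma slice_bound k w F : (forall i z, 0 <= w i z) -> slice_le w -> symk k w F ->
  forall i z, exists C, forall b, normc (ph i z b * F i (z + E b)) <= C * wt b.
Proof.
move=> w0 sw sF i z; have [C [C0 /(_ w0) hC]] := symk_bound sF; have [K hK] := sw i z.
exists (C * K) => b; rewrite normcM normc_cexpi mul1r (le_trans (hC _ _))//.
by rewrite -mulrA ler_wpM2l.
Qed.

Lemma slice_ccont k w F i z : symk k w F -> ccont (fun b => ph i z b * F i (z + E b)).
Proof.
move=> sF; apply: ccontM; first exact: ccont_ph.
exact: ccont_comp (@cont_line z) (symk_cont i sF).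
Qed.

(** The derivative of phase times F integrates to zero, so the integrals X of phase times F and X'
    of phase times the derivative of F satisfy i l X + X' = 0, that is (1 + i l) X = X - X'. The
    factor l is constant on the slice. *)
Lemma cintegral_gain j w F i z : (forall i z, 0 <= w i z) -> slice_le w -> symk 1 w F ->
  cintegral leb (fun b => ph i z b * F i (z + E b)) =
  cintegral leb (fun b => ph i z b * gain j F i (z + E b)).
Proof.
move=> w0 sw sF; set ej : Rn := delta_mx ord0 j; pose F' i := Dc (E ej) (F i).
have [_ [_ /(_ (E ej))[dF sF']]] := sF.
have sF0 : symk 0 w F by exact: symkS.
have [C1 h1] := slice_bound w0 sw sF i z; have [C2 h2] := slice_bound (k := 0) w0 sw sF' i z.
have c1 := slice_ccont i z sF0; have c2 := slice_ccont (k := 0) i z sF'.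
have i1 := cint_wt (ccont_meas1 c1) h1; have i2 := cint_wt (ccont_meas1 c2) h2.
pose il : R[i] := 0 +i* l i j z.
have D b : cis_derive b ej (fun b => ph i z b * F i (z + E b))
    (il * (ph i z b * F i (z + E b)) + ph i z b * F' i (z + E b)).
  rewrite mulrA; apply: cis_deriveM.
    apply: cis_derive_cexpi => h; rewrite -[l i j z]mulr1 mulrA.
    rewrite (_ : h * l i j z * 1 = \sum_j0 h * l i j0 z * ej ord0 j0).
      by rewrite -big_split/=; apply: eq_bigr => q _; rewrite !mxE; ring.
    rewrite (bigD1 j)//= big1 ?addr0 => [|q qj]; rewrite /ej mxE/= ?eqxx//.
    by rewrite (negbTE qj) mulr0.
  apply: (@cis_derive_along R Rn V (F i) (fun b => z + E b) b ej (E ej)) => [h|].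
    exact: line_b.
  exact: cderivableP.
have Z : cintegral leb (fun b => il * (ph i z b * F i (z + E b)) + ph i z b * F' i (z + E b)) = 0.
  apply: (@cint_derive0 R n _ _ ej (`|C1| + normc il * `|C1| + `|C2|) D c1).
  - by apply: ccontD c2; apply: ccontM c1; exact: ccont_cst.
  - move=> b; rewrite (le_trans (h1 b))// ler_wpM2r ?wt_ge0//.
    by rewrite (le_trans (ler_norm _))// -addrA lerDl addr_ge0// mulr_ge0// normc_ge0.
  move=> b; rewrite (le_trans (le_normcD _ _))// mulrDl lerD//; last first.
    by rewrite (le_trans (h2 b))// ler_wpM2r ?wt_ge0// ler_norm.
  rewrite normcM; apply: (@le_trans _ _ (normc il * (`|C1| * wt b))).
    by rewrite ler_wpM2l ?normc_ge0// (le_trans (h1 b))// ler_wpM2r ?wt_ge0// ler_norm.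
  by rewrite mulrA ler_wpM2r ?wt_ge0// lerDr.
move: Z; rewrite cintegralD//; last exact: cintegrableZ.
rewrite cintegralZ// => /eqP; rewrite addr_eq0 => /eqP Z.
have m0 : 1 +i* l i j z != 0.
  by apply/eqP => /(congr1 (@complex.Re R)) /eqP; rewrite /= oner_eq0.
transitivity ((1 +i* l i j z)^-1 * (cintegral leb (fun b => ph i z b * F i (z + E b)) -
    cintegral leb (fun b => ph i z b * F' i (z + E b)))).
  rewrite -[- _]opprK opprK -Z.
  set X := cintegral _ _; rewrite (_ : X + il * X = (1 +i* l i j z) * X) ?mulKf//.
  by rewrite -[1 +i* _](_ : 1 + il = _) ?mulrDl ?mul1r//; apply: complexP; rewrite !cE /= ?addr0 ?add0r.
rewrite -cintegralB// -cintegralZ; last exact: cintegrableB.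
by apply: eq_cintegral => b; rewrite /gain l_const /F' /ej; ring.
Qed.

Let wp w (js : seq 'I_n) i z := (\prod_(j <- js) w1 j i z) * w i z.

Let wp_ge0 w js : (forall i z, 0 <= w i z) -> forall i z, 0 <= wp w js i z.
Proof. by move=> w0 i z; rewrite mulr_ge0// prodr_ge0. Qed.

Let wp_le w js i z : (forall i z, 0 <= w i z) -> wp w js i z <= w i z.
Proof.
move=> w0; rewrite -[leRHS]mul1r ler_wpM2r//.
by apply: prodr_ile1 => j _; rewrite w1_ge0/= /w1 invf_le1 ?lerDl// ltr_pwDl.
Qed.

Let symk1 k w F : symk k.+1 w F -> symk 1 w F.
Proof. by elim: k => [//|k IH] /symkS; exact: IH. Qed.

Lemma gains k w F (js : seq 'I_n) : (forall i z, 0 <= w i z) -> slice_le w ->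
  symk (size js + k) w F ->
  exists G, symk k (wp w js) G /\
    forall i z, cintegral leb (fun b => ph i z b * F i (z + E b)) =
                cintegral leb (fun b => ph i z b * G i (z + E b)).
Proof.
move=> w0 sw; elim: js k => [|j js IH] k.
  move=> sF; exists F; split=> //; move: sF; rewrite add0n.
  by apply: (symk_mono (K := 1)) => // i z; rewrite /wp big_nil !mul1r.
rewrite -[size _]/(size js).+1 addSnnS => /IH[G [sG hG]].
exists (gain j G); split=> [|i z].
  have := gain_sym j (wp_ge0 js w0) sG.
  by apply: (symk_mono (K := 1)) => // [i z|i z]; [apply: mulr_ge0 => //; exact: wp_ge0|rewrite mul1r /wp big_cons mulrA].
rewrite hG; apply: (@cintegral_gain j (wp w js)) => //; first exact: wp_ge0.
  move=> {}i {}z; have [K hK] := sw i z; exists K => b; exact: le_trans (wp_le _ _ _ w0) (hK b).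
exact: symk1 sG.
Qed.

Definition freq i z : Rn := \row_j l i j z.

(** Applying each of the n gains N times costs N n derivatives and earns the N-th power of the
    product of the 1/(1 + |l_j|). That product is at most 1/(1 + max |l_j|). *)
Lemma ibp N k w F : (forall i z, 0 <= w i z) -> slice_le w -> symk (N * n + k) w F ->
  exists G, symk k (fun i z => (1 + `|freq i z|) ^- N * w i z) G /\
    forall i z, cintegral leb (fun b => ph i z b * F i (z + E b)) =
                cintegral leb (fun b => ph i z b * G i (z + E b)).
Proof.
move=> w0 sw sF; pose js := flatten (nseq N (enum 'I_n)).
have sjs : size js = (N * n)%N.
  by rewrite /js; elim: (N) => //= M IH; rewrite size_cat IH size_enum_ord mulSn.
rewrite -sjs in sF; have [G [sG hG]] := gains w0 sw sF.
exists G; split=> //; apply: (symk_mono (K := 1)) sG => //.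
  exact: wp_ge0.
move=> i z; rewrite mul1r /wp ler_wpM2r//.
have -> : \prod_(j <- js) w1 j i z = (\prod_(j < n) w1 j i z) ^+ N.
  rewrite /js; elim: (N) => [|M IH]; first by rewrite /= big_nil expr0.
  by rewrite /= big_cat /= IH exprS big_enum.
have p0 : 0 < 1 + `|freq i z| by rewrite ltr_pwDl.
rewrite -exprVn; apply: lerXn2r.
- by rewrite nnegrE prodr_ge0.
- by rewrite nnegrE invr_ge0 ltW.
rewrite -[leLHS]invrK lef_pV2 ?posrE ?invr_gt0 ?prodr_gt0// => [|j _]; last first.
  by rewrite invr_gt0 ltr_pwDl.
rewrite -prodfV; under eq_bigr do rewrite invrK.
have P1 (P : pred 'I_n) : 1 <= \prod_(j < n | P j) (1 + `|l i j z|).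
  by elim/big_rec: _ => // j x _ x1; rewrite mulr_ege1// lerDl.
rewrite addrC -lerBrDr; apply: rV_norm_le; first by rewrite subr_ge0.
move=> j; rewrite mxE lerBrDr addrC (bigD1 j)//= ler_peMr ?addr_ge0//.
Qed.

End ibp.

(** * Smooth partitions of unity *)

Section sym_extra.
Context (R : realType) (V : normedModType R) (I : Type).
Implicit Types (w : I -> V -> R) (F : I -> V -> R[i]).

Lemma symk_scale k w F (c : R[i]) : (forall i z, 0 <= w i z) ->
  symk k w F -> symk k w (fun i z => c * F i z).
Proof.
move=> w0 sF.
have s1 : symk k (fun _ _ => 1) (fun (_ : I) (_ : V) => c).
  by apply: (@symk_cst _ _ _ _ _ _ (normc c)) => // i z; rewrite mulr1.
have := symkM (fun _ _ => ler01) w0 s1 sF.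
by apply: (symk_mono (K := 1)) => // i z; rewrite ?mulr_ge0// !mul1r.
Qed.

(** A family vanishing on U may have its weight changed there at will. Openness of U makes the
    derivatives vanish on U too. *)
Lemma symk_supp k w w' F (K : R) (U : set V) : open U -> 0 <= K ->
  (forall i z, 0 <= w i z) -> (forall i z, 0 <= w' i z) ->
  (forall i z, U z -> F i z = 0) -> (forall i z, ~ U z -> w i z <= K * w' i z) ->
  symk k w F -> symk k w' F.
Proof.
move=> oU K0 w0 w0'; elim: k F => [|k IH] F FU ww' sF;
  have [C [C0 /(_ w0) hC]] := symk_bound sF;
  (split; first by move=> i; exact: symk_cont sF);
  (split; first by exists (C * K) => i z; have [Uz|Uz] := pselect (U z);
    [rewrite FU// normc0 !mulr_ge0|rewrite (le_trans (hC i z))// -mulrA ler_wpM2l// ww']).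
  by [].
move=> v; have [_ [_ /(_ v)[dF sF']]] := sF; split=> //; apply: IH => // i z Uz.
have nU : \forall y \near z, F i y = 0 by near=> y; apply: FU; near: y; exact: open_nbhs_nbhs.
apply: cis_derive_val; split.
  apply: (near_eq_is_derive _ (is_derive_cst (0 : R^o) z v)).
  by near=> y; rewrite (near nU y).
apply: (near_eq_is_derive _ (is_derive_cst (0 : R^o) z v)).
by near=> y; rewrite (near nU y).
Unshelve. all: by end_near. Qed.

End sym_extra.

Section flat.
Context (R : realType).
Local Notation Re := complex.Re.
Local Notation Im := complex.Im.
Implicit Types (x s : R) (j : nat).

(* The family is closed under differentiation:
   flat_j' = flat_(j+2) - j flat_(j+1). *)
Definition flat j x : R := if 0 < x then x ^- j * expR (- x^-1) else 0.

Lemma flat_ge0 j x : 0 <= flat j x.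
Proof. by rewrite /flat; case: ifP => // x0; rewrite mulr_ge0 ?expR_ge0// invr_ge0 exprn_ge0// ltW. Qed.

(** With y = 1/x the claim is y^j exp(-y) <= j!, one term of the exponential series. *)
Lemma flat_le j x : flat j x <= j`!%:R.
Proof.
rewrite /flat; case: ifPn => // x0.
rewrite expRN.
case: j => [|j].
  by rewrite expr0 invr1 fact0 mul1r -expRN -expR0 ler_expR oppr_le0 invr_ge0 ltW.
have y0 : 0 <= x^-1 by rewrite invr_ge0 ltW.
have h := expR_ge1Dxn j y0; rewrite -exprVn ler_pdivrMr ?expR_gt0// mulrC.
rewrite -ler_pdivrMr ?ltr0n ?fact_gt0//; move: h; lra.
Qed.

Lemma flatS j x : flat j x = x * flat j.+1 x.
Proof.
rewrite /flat; case: ifP => // x0; last by rewrite mulr0.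
by rewrite exprS invfM !mulrA mulfV ?mul1r// gt_eqF.
Qed.

Lemma is_derive_flat j x : is_derive x (1 : R) (flat j : R -> R^o) (- j%:R * flat j.+1 x + flat j.+2 x).
Proof.
have [x0|x0|->] := ltgtP x 0.
- rewrite /flat ltNge (ltW x0)/= mulr0 addr0.
  apply: (near_eq_is_derive _ (is_derive_cst (0 : R^o) x (1 : R))).
  near=> y; rewrite ltNge ifF//; apply/negbTE; rewrite negbK ltW//.
  by near: y; exact: lt_nbhsl.
- have xn0 : x != 0 by rewrite gt_eqF.
  have dV : is_derive x (1 : R) (fun y : R => y^-1) (- x ^- 2).
    by have := is_deriveV xn0 (is_derive_id x (1 : R)); rewrite -[_ *: 1]/(_ * 1) mulr1.
  have dN : is_derive x (1 : R) (fun y : R => - y^-1) (x ^- 2).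
    by have := is_deriveN dV; rewrite opprK.
  have dE : is_derive x (1 : R) (fun y : R => expR (- y^-1)) (expR (- x^-1) * x ^- 2).
    exact: (@is_derive1_comp R expR (fun y : R => - y^-1) x _ _ (is_derive_expR (- x^-1)) dN).
  have dP : is_derive x (1 : R) (fun y : R => y^-1 ^+ j) (- j%:R * x^-1 ^+ j.+1).
    have h := is_deriveX j dV.
    rewrite (_ : (fun y : R => y^-1 ^+ j) = (GRing.inv : R -> R) ^+ j); last first.
      by apply/funext => y; rewrite exprfctE.
    apply: (is_derive_eq h); rewrite /GRing.scale/=.
    case: (j) => [|i]; first by rewrite !mul0r oppr0 mul0r.
    rewrite /= -exprVn expr2 !exprS; ring.
  have D : is_derive x (1 : R) (fun y : R => y^-1 ^+ j * expR (- y^-1) : R^o)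
      (- j%:R * flat j.+1 x + flat j.+2 x).
    have h := is_deriveM dP dE; apply: (is_derive_eq h).
    rewrite /GRing.scale/= /flat x0 -!exprVn !exprS; ring.
  apply: (near_eq_is_derive _ D).
  near=> y; rewrite /flat exprVn ifT//.
  by near: y; exact: lt_nbhsr.
- have f0 k : flat k 0 = 0 by rewrite /flat ltxx.
  rewrite !f0 mulr0 addr0.
  (* The difference quotient of flat_j at 0 is flat_(j+1)(h) = h flat_(j+2)(h), at most |h| (j+2)!
     in modulus. *)
  have H : (fun h : R => h^-1 *: (((flat j : R -> R^o) \o shift 0) (h *: 1) - flat j 0)) @ 0^' --> (0 : R^o).
    rewrite (_ : (fun h => _) = (fun h => flat j.+1 h * (h^-1 * h))); last first.
      apply/funext => h; rewrite f0 subr0/= addr0 -[h *: 1]/(h * 1) mulr1 flatS -[_ *: _]/(_ * _).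
      by ring.
    apply/cvgr0Pnorm_le => e e0.
    near=> h.
    have hn0 : h != 0 by near: h; exact: nbhs_dnbhs_neq.
    rewrite mulVf// mulr1 flatS normrM (ger0_norm (flat_ge0 _ _)).
    apply: (@le_trans _ _ (`|h| * j.+2`!%:R)); first by rewrite ler_wpM2l ?flat_le.
    rewrite -ler_pdivlMr ?ltr0n ?fact_gt0//.
    near: h; apply: dnbhs0_le; first by rewrite divr_gt0// ltr0n fact_gt0.
  by split; [apply/cvg_ex; exists 0|exact: cvg_lim H].
Unshelve. all: by end_near. Qed.

Lemma flat_sym j : sym (fun _ _ => 1) (fun (_ : unit) (x : R) => (flat j x)%:C).
Proof.
have D i x v : cis_derive x v (fun y : R => (flat i y)%:C)
    (v%:C * ((- i%:R)%:C * (flat i.+1 x)%:C + (flat i.+2 x)%:C)).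
  have := @cis_derive_scale R R (fun y => (flat i y)%:C)
    (fun y => (- i%:R)%:C * (flat i.+1 y)%:C + (flat i.+2 y)%:C) 1 v x.
  rewrite -[v *: 1]/(v * 1) mulr1; apply => y; split; last first.
    by rewrite !cE /= !mul0r !mulr0 !addr0; exact: is_derive_cst.
  by rewrite !cE /= mul0r subr0; exact: is_derive_flat.
have cF i : ccont (fun x : R => (flat i x)%:C).
  split=> x /=; last exact: cvg_cst.
  apply: differentiable_continuous; apply/derivable1_diffP.
  by have [] := is_derive_flat i x.
move=> k; elim: k j => [|k IH] j; (split=> //; split;
  first by exists j`!%:R => i z; rewrite normc_real mulr1 ger0_norm ?flat_ge0// flat_le).
  by [].
move=> v; split=> [_ x|]; first exact: cis_derive_derivable (D _ _ _).
rewrite [X in symk _ _ X](_ : _ =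
   (fun (_ : unit) x => v%:C * ((- j%:R)%:C * (flat j.+1 x)%:C + (flat j.+2 x)%:C))).
  have s1 := symk_scale (- j%:R)%:C (fun _ _ => ler01) (IH j.+1).
  exact: (symk_scale v%:C (fun _ _ => ler01) (symkD (fun _ _ => ler01) s1 (IH j.+2))).
by apply/funext => _; apply/funext => x; rewrite (cis_derive_val (D _ _ _)).
Qed.

Let den x := flat 0 x + flat 0 (1 - x).

(** One of x and 1 - x is at least 1/2, which keeps the quotient defining [step] smooth. *)
Let den_gt x : expR (- 2) <= den x.
Proof.
have H y : 2^-1 <= y -> expR (- 2) <= flat 0 y.
  move=> y2; rewrite /flat ifT ?(lt_le_trans _ y2)// expr0 invr1 mul1r ler_expR lerN2.
  by rewrite -[leRHS]invrK lef_pV2 ?posrE// (lt_le_trans _ y2).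
have [h|h] := leP 2^-1 x.
  by rewrite (le_trans (H _ h))// lerDl flat_ge0.
by rewrite (le_trans (H (1 - x) _))// ?lerDr ?flat_ge0//; lra.
Qed.

Definition step x : R := flat 0 x / den x.

Lemma step0 x : x <= 0 -> step x = 0.
Proof. by move=> x0; rewrite /step /flat ltNge x0 mul0r. Qed.

Lemma step1 x : 1 <= x -> step x = 1.
Proof.
move=> x1; have d0 : 0 < den x by rewrite (lt_le_trans _ (den_gt x))// expR_gt0.
rewrite /step (_ : flat 0 x = den x) ?mulfV ?gt_eqF//.
by rewrite /den {3}/flat ifF ?addr0//; apply/negbTE; rewrite -leNgt subr_le0.
Qed.

Lemma step_shift_sym (c : R) : sym (fun _ _ => 1) (fun (_ : unit) (x : R) => (step (x + c))%:C).
Proof.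
move=> k.
have sc (f : R -> R) (s d : R) : `|s| <= 1 -> symk k (fun _ _ => 1) (fun (_ : unit) (x : R) => (f x)%:C) ->
    symk k (fun _ _ => 1) (fun (_ : unit) (x : R) => (f (s * x + d))%:C).
  move=> s1; apply: (@symk_comp R R R unit unit k (fun _ _ => 1) _ id (fun _ x => s * x + d) (fun=> s) id) => //.
    by move=> _ x; apply: cvgD; [apply: cvgM; [exact: cvg_cst|exact: cvg_id]|exact: cvg_cst].
  by move=> _ h v z; rewrite /GRing.scale/=; ring.
rewrite [X in symk _ _ X](_ : _ = (fun (_ : unit) (x : R) => (step (1 * x + c))%:C)); last first.
  by apply/funext => _; apply/funext => x; rewrite mul1r.
move: (sc) => /(_ step); apply; first by rewrite normr1.
have s2 : symk k (fun _ _ => 1) (fun (_ : unit) (x : R) => (flat 0 (-1 * x + 1))%:C).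
  by apply: (sc (flat 0) (-1)); rewrite ?normrN ?normr1//; exact: flat_sym.
rewrite [X in symk _ _ X](_ : _ = (fun (_ : unit) x => (flat 0 x)%:C * ((flat 0 x)%:C + (flat 0 (-1 * x + 1))%:C)^-1)); last first.
  apply/funext => _; apply/funext => x; rewrite /step /den mulN1r [- x + 1]addrC.
  by rewrite -rmorphD -fmorphV -rmorphM.
have s1 := @flat_sym 0 k.
have sI : symk k (fun _ _ => 1^-1) (fun (_ : unit) x => ((flat 0 x)%:C + (flat 0 (-1 * x + 1))%:C)^-1).
  have b (_ : unit) x : expR (-2) * 1 <= normc ((flat 0 x)%:C + (flat 0 (-1 * x + 1))%:C).
    by rewrite mulr1 -rmorphD normc_real mulN1r [- x + 1]addrC (le_trans (den_gt x))// ler_norm.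
  exact: (symk_inv (expR_gt0 (-2)) (fun _ _ => ltr01) b (symkD (fun _ _ => ler01) s1 s2)).
have := symkM (fun _ _ => ler01) _ s1 sI; rewrite invr1 => /(_ (fun _ _ => ler01)).
by apply: (symk_mono (K := 1)) => // _ _; rewrite !mul1r.
Qed.

(* The integer translates of eta telescope to 1, and etaw = 1 on the support
   of eta. *)
Definition eta x : R := step (x + 1) - step x.
Definition etaw x : R := step (x + 2) - step (x - 1).

Lemma eta_supp x : 1 <= `|x| -> eta x = 0.
Proof.
rewrite /eta ler_normr => /orP[h|h].
  by rewrite !step1 ?subrr//; lra.
by rewrite !step0 ?subrr//; lra.
Qed.

Lemma etaw_supp x : 2 <= `|x| -> etaw x = 0.
Proof.
rewrite /etaw ler_normr => /orP[h|h].
  by rewrite !step1 ?subrr//; lra.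
by rewrite !step0 ?subrr//; lra.
Qed.

Lemma etaw1 x : `|x| <= 1 -> etaw x = 1.
Proof. by rewrite /etaw ler_norml => /andP[h1 h2]; rewrite step1 ?step0 ?subr0//; lra. Qed.

Let shift_sym (a b : R) : sym (fun _ _ => 1) (fun (_ : unit) (x : R) => (step (x + a) - step (x + b))%:C).
Proof.
move=> k; rewrite [X in symk _ _ X](_ : _ = (fun (_ : unit) x => (step (x + a))%:C - (step (x + b))%:C)).
  by apply: symkB => //; exact: step_shift_sym.
by apply/funext => _; apply/funext => x; rewrite rmorphB.
Qed.

Lemma eta_sym : sym (fun _ _ => 1) (fun (_ : unit) (x : R) => (eta x)%:C).
Proof.
rewrite [X in sym _ X](_ : _ = (fun (_ : unit) (x : R) => (step (x + 1) - step (x + 0))%:C)).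
  exact: shift_sym.
by apply/funext => _; apply/funext => x; rewrite addr0.
Qed.

Lemma etaw_sym : sym (fun _ _ => 1) (fun (_ : unit) (x : R) => (etaw x)%:C).
Proof. exact: shift_sym. Qed.

End flat.

Section bump.
Context (R : realType) (n : nat).
Local Notation Rn := 'rV[R]_n.

Definition tens (f : R -> R) (x : Rn) : R := \prod_i f (x ord0 i).

Lemma tens_supp (f : R -> R) (c : R) x : 0 <= c -> (forall s, c <= `|s| -> f s = 0) ->
  c < `|x| -> tens f x = 0.
Proof.
move=> c0 hf cx; have [i ci] : exists i, c <= `|x ord0 i|.
  apply: contrapT => /forallNP h; move: cx; rewrite ltNge => /negP; apply.
  by apply: rV_norm_le => // i; rewrite leNgt; apply/negP => /ltW; exact: h.
by rewrite /tens (bigD1 i)//= hf ?mul0r.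
Qed.

(** On the support the norm is at most 2, so the constant weight may be traded for any power (1 +
    |x|)^-N at the cost of 3^N. *)
Lemma tens_sym (f : R -> R) N : (forall s, 2 <= `|s| -> f s = 0) ->
  sym (fun _ _ => 1) (fun (_ : unit) (x : R) => (f x)%:C) ->
  sym (fun _ x => (1 + `|x|) ^- N) (fun (_ : unit) (x : Rn) => (tens f x)%:C).
Proof.
move=> fs sf k.
apply: (@symk_supp _ _ _ _ (fun _ _ => 1) _ _ (3 ^+ N) [set x : Rn | 2 < `|x|]) => //.
- rewrite (_ : [set x | _] = (fun x : Rn => `|x|) @^-1` [set s | 2 < s])//.
  by apply: open_comp; [move=> x _; exact: norm_continuous|exact: open_gt].
- by move=> _ x /= h; rewrite (@tens_supp f 2).
- move=> _ x /= /negP; rewrite -leNgt => h; rewrite -[_ * _]/(3 ^+ N / (1 + `|x|) ^+ N).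
  rewrite ler_pdivlMr ?mul1r ?exprn_gt0 ?ltr_pwDl//; apply: lerXn2r.
  - by rewrite nnegrE addr_ge0.
  - by rewrite nnegrE.
  - by lra.
rewrite [X in symk _ _ X](_ : _ = (fun (_ : unit) (x : Rn) => \prod_i (f (x ord0 i))%:C)); last first.
  by apply/funext => _; apply/funext => x; rewrite /tens rmorph_prod.
elim: (index_enum _) => [|i s IH].
  rewrite [X in symk _ _ X](_ : _ = (fun (_ : unit) (x : Rn) => 1)); last first.
    by apply/funext => _; apply/funext => x; rewrite big_nil.
  by apply: (@symk_cst _ _ _ _ _ _ 1) => // _ _; rewrite normc1 mulr1.
rewrite [X in symk _ _ X](_ : _ = (fun (_ : unit) (x : Rn) => (f (x ord0 i))%:C * \prod_(j <- s) (f (x ord0 j))%:C)); last first.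
  by apply/funext => _; apply/funext => x; rewrite big_cons.
suff s1 : symk k (fun _ _ => 1) (fun (_ : unit) (x : Rn) => (f (x ord0 i))%:C).
  have := symkM (fun _ _ => ler01) (fun _ _ => ler01) s1 IH.
  by apply: (symk_mono (K := 1)) => // _ _; rewrite !mul1r.
apply: (@symk_comp R Rn R unit unit k (fun _ _ => 1) (fun _ s => (f s)%:C) id (fun _ x => x ord0 i) (fun=> 1) (fun x => x ord0 i)) => //.
- by move=> _; rewrite normr1.
- by move=> _; exact: coord_continuous.
- by move=> _ h v z; rewrite !mxE scale1r.
Qed.

Definition cell_bump : Rn -> R := tens (@eta R).
Definition wide_cell_bump : Rn -> R := tens (@etaw R).

Lemma bump_supp x : 1 < `|x| -> cell_bump x = 0.
Proof. by apply: tens_supp => // s; exact: eta_supp. Qed.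

Lemma bump_wide_bump x : cell_bump x * wide_cell_bump x = cell_bump x.
Proof.
have [h|h] := leP `|x| 1; last by rewrite bump_supp ?mul0r.
rewrite /wide_cell_bump /tens big1 ?mulr1// => i _; rewrite etaw1// (le_trans (rV_coord_le x i))//.
Qed.

Lemma bump_sym N : sym (fun _ x => (1 + `|x|) ^- N) (fun (_ : unit) (x : Rn) => (cell_bump x)%:C).
Proof.
apply: tens_sym; last exact: eta_sym.
by move=> s h; apply: eta_supp; apply: le_trans h; rewrite ler1n.
Qed.

Lemma wide_bump_sym N : sym (fun _ x => (1 + `|x|) ^- N) (fun (_ : unit) (x : Rn) => (wide_cell_bump x)%:C).
Proof. by apply: tens_sym; [exact: etaw_supp|exact: etaw_sym]. Qed.

End bump.

(** * Parseval on cubes *)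

Section lattice_sum.
Context (R : realType).

(** Enumeration of a sum over a countable type, which gives access to the theorems on series of
    nonnegative terms. *)
Definition lsum (L : countType) (b : L -> \bar R) : \bar R :=
  (\sum_(0 <= q <oo) oapp b 0 (pickle_inv q))%E.

Let oapp_ge0 (L : countType) (b : L -> \bar R) : (forall j, 0 <= b j)%E ->
  forall q, (0 <= oapp b 0 (pickle_inv q))%E.
Proof. by move=> b0 q; case: pickle_inv => //=. Qed.

Lemma lsumE (L : countType) (b : L -> \bar R) : (forall j, 0 <= b j)%E ->
  lsum b = \esum_(j in setT) b j.
Proof.
move=> b0; rewrite /lsum nneseries_esum; last by move=> q _; exact: oapp_ge0.
rewrite (_ : [set x | xpredT x] = setT); last by apply/seteqP; split.
transitivity (\esum_(q in range (@pickle L)) oapp b 0%E (pickle_inv q)).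
  rewrite [RHS]esum_mkcond; apply: eq_esum => q _.
  case: ifPn => // /negP qr; case E : (pickle_inv q) => [j|]//=.
  exfalso; apply: qr; rewrite inE; exists j => //.
  by have := @pickle_invK L q; rewrite E.
rewrite (@reindex_esum _ _ _ setT _ (@pickle L)).
  by apply: eq_esum => j _; rewrite pickleK_inv.
split; [by move=> j _; exists j|exact: in2W (pcan_inj pickleK_inv)|by []].
Qed.

Lemma esum_int (b : int -> \bar R) : (forall k, 0 <= b k)%E ->
  \esum_(k in setT) b k = (\sum_(0 <= i <oo) (b (Posz i) + b (Negz i)))%E.
Proof.
move=> b0; rewrite nneseriesD// !nneseries_esum//.
rewrite (_ : [set x | xpredT x] = setT); last by apply/seteqP; split.
rewrite (esumID (range Posz))// !setTI; congr (_ + _)%E.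
  rewrite (@reindex_esum _ _ _ setT _ Posz)//.
  by split; [move=> j _; exists j|by move=> i j _ _ []|].
rewrite (@reindex_esum _ _ _ setT _ Negz)//.
split; [by move=> j _ [k]|by move=> i j _ _ []|].
by move=> [k|k] /= h; [exfalso; apply: h; exists k|exists k].
Qed.

Lemma integral_lsum d (T : measurableType d) (mu : {measure set T -> \bar R})
    (L : countType) (f : L -> T -> \bar R) :
  (forall j, measurable_fun setT (f j)) -> (forall j x, (0 <= f j x)%E) ->
  (\int[mu]_x (\esum_(j in setT) f j x) = \esum_(j in setT) (\int[mu]_x f j x))%E.
Proof.
move=> mf f0; rewrite -lsumE; last by move=> j; exact: integral_ge0.
under eq_integral do rewrite -lsumE//.
rewrite /lsum integral_nneseries//.
- by apply: eq_eseriesr => q _; case: pickle_inv => //=; rewrite integral0.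
- by move=> q; case: pickle_inv => //=.
- by move=> q x _; case: pickle_inv => //=.
Qed.

Lemma measurable_esum d (T : measurableType d) (L : countType) (f : L -> T -> \bar R) :
  (forall j, measurable_fun setT (f j)) -> (forall j x, (0 <= f j x)%E) ->
  measurable_fun setT (fun x => \esum_(j in setT) f j x).
Proof.
move=> mf f0; rewrite (_ : (fun x => _) = (fun x => lsum (fun j => f j x))); last first.
  by apply/funext => x; rewrite lsumE.
apply: ge0_emeasurable_sum => [q x _ _|q _]; first by case: pickle_inv => //=.
by case: pickle_inv => //=.
Qed.

End lattice_sum.

Section dct.
Context d (T : measurableType d) (R : realType) (mu : {measure set T -> \bar R}).

Lemma rDCT (h : nat -> T -> R) (g : T -> R) :
  (forall k, measurable_fun setT (h k)) -> (forall k x, 0 <= h k x <= g x) ->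
  mu.-integrable setT (EFin \o g) -> (forall x, h ^~ x @ \oo --> 0) ->
  (fun k => \int[mu]_x h k x) @ \oo --> 0.
Proof.
move=> mh hg ig h0.
have me k : measurable_fun setT (EFin \o h k) by exact/measurable_EFinP.
have cv : {ae mu, forall x, setT x -> (fun k => (EFin \o h k) x) @ \oo --> cst 0%E x}.
  by apply: aeW => x _; apply: cvg_EFin; [exact: nearW|exact: h0].
have dom : {ae mu, forall x k, setT x -> (`|(EFin \o h k) x| <= (EFin \o g) x)%E}.
  by apply: aeW => x k _; rewrite /= lee_fin; have /andP[h1 h2] := hg k x; rewrite ger0_norm.
have [_ _] := dominated_convergence measurableT me (measurable_cst _) cv ig dom.
rewrite integral0 => H'.
by have /fine_cvgP[_] := H'.
Qed.

Lemma cDCT (f : nat -> T -> R[i]) (f0 : T -> R[i]) (g : T -> R) :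
  (forall k, cmeasurable (f k)) -> cmeasurable f0 ->
  (forall k x, normc (f k x) <= g x) -> mu.-integrable setT (EFin \o g) ->
  (forall x, (fun k => normc (f k x - f0 x)) @ \oo --> 0) ->
  (fun k => normc (cintegral mu (f k) - cintegral mu f0)) @ \oo --> 0.
Proof.
move=> mf mf0 fg ig fl.
have f0g x : normc (f0 x) <= g x.
  apply/ler_addgt0Pr => e e0.
  have /cvgrPdist_le/(_ _ e0) [N _ /(_ N (leqnn N))] := fl x.
  rewrite sub0r normrN ger0_norm ?normc_ge0// => h.
  have := le_normcD (f N x) (f0 x - f N x); rewrite addrC subrK => /le_trans; apply.
  by rewrite lerD// -opprB normcN.
have if0 := cintegrable_le mf0 f0g ig.
have ifk k := cintegrable_le (mf k) (fg k) ig.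
have H : (fun k => \int[mu]_x normc (f k x - f0 x)) @ \oo --> 0.
  apply: (@rDCT _ (fun x => g x + g x)) => //.
  - by move=> k; apply/measurable_normc/(cintegrable_measurable (mu := mu))/cintegrableB.
  - move=> k x; rewrite normc_ge0/= (le_trans (le_normcD _ _))// lerD// normcN//.
  - rewrite (_ : EFin \o _ = (EFin \o g) \+ (EFin \o g))%E; first exact: integrableD.
    by apply/funext.
apply/cvgr0Pnorm_le => e e0; have /cvgr0Pnorm_le/(_ _ e0) h := H.
near=> k; have := near h k => hk; rewrite ger0_norm ?normc_ge0//.
rewrite -cintegralB//; apply: le_trans (hk _) => //.
by rewrite (le_trans (normc_cintegral (cintegrableB (ifk k) if0)))// ler_norm.
Unshelve. all: by end_near. Qed.

End dct.

Section seq_continuity.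
Context (R : realType) (V W : normedModType R).

(** Dominated convergence speaks of sequences; this turns it into continuity of integrals in a
    parameter. *)
Lemma seq_continuous (f : V -> R) :
  (forall (u : nat -> V) x, u @ \oo --> x -> f \o u @ \oo --> f x) -> continuous f.
Proof.
move=> hf x; apply: contrapT => /cvgrPdist_le.
move=> /existsNP[e] /not_implyP[e0 hn].
have /choice[u hu] : forall k, exists y, `|x - y| < k.+1%:R^-1 /\ ~ (`|f x - f y| <= e).
  move=> k; apply: contrapT => /forallNP h; apply: hn.
  have hn1 : \forall y \near x, `|x - y| < k.+1%:R^-1.
    by apply: cvgr_dist_lt => //; rewrite invr_gt0.
  by apply: filterS hn1 => y hy; apply: contrapT => hy2; exact: (h y).
have ux : u @ \oo --> x.
  apply/cvgrPdist_lt => d d0.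
  near=> k; apply: lt_trans (hu k).1 _.
  by near: k; exact: (near_infty_natSinv_lt (PosNum d0)).
have /cvgrPdist_le/(_ _ e0)[N _ /(_ N (leqnn N))] := hf u x ux.
exact: (hu N).2.
Unshelve. all: by end_near. Qed.

Lemma ccont_seq (f : V -> R[i]) :
  (forall (u : nat -> V) x, u @ \oo --> x -> (fun k => normc (f (u k) - f x)) @ \oo --> 0) -> ccont f.
Proof.
move=> hf; split; apply: seq_continuous => u x /hf/cvgr0Pnorm_le h; apply/cvgrPdist_le => e e0;
  near=> k; have := near (h _ e0) k; rewrite ger0_norm ?normc_ge0// => hk;
  (apply: le_trans (hk _) => //).
  by rewrite distrC (_ : _ - _ = complex.Re (f (u k) - f x)) ?Re_le_normc// !cE.
by rewrite distrC (_ : _ - _ = complex.Im (f (u k) - f x)) ?Im_le_normc// !cE.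
Unshelve. all: by end_near. Qed.

Lemma ccont_cvg (f : V -> R[i]) (u : nat -> V) x : ccont f -> u @ \oo --> x ->
  (fun k => normc (f (u k) - f x)) @ \oo --> 0.
Proof.
move=> [f1 f2] ux.
have h1 := cvg_comp _ _ ux (f1 x); have h2 := cvg_comp _ _ ux (f2 x).
have H : (fun k => `|complex.Re (f (u k)) - complex.Re (f x)| + `|complex.Im (f (u k)) - complex.Im (f x)|) @ \oo --> 0.
  by rewrite -[X in _ --> X]addr0; apply: cvgD; apply/norm_cvg0P/subr_cvg0.
apply: squeeze_cvgr H; last exact: cvg_cst.
near=> k; rewrite normc_ge0/=.
by have := normc_ReIm (f (u k) - f x); rewrite !cE.
Unshelve. all: by end_near. Qed.

End seq_continuity.

(** * Orthogonality of exponentials on an interval of length 2 pi *)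

Section orthogonality.
Context (R : realType).
Local Notation mu := (@lebesgue_measure R).
Implicit Types (c s x y : R) (k : int).

Lemma cexpi2pi k : cexpi (k%:~R * (pi *+ 2)) = 1 :> R[i].
Proof.
have P (j : nat) : cexpi (j%:R * (pi *+ 2)) = 1 :> R[i].
  elim: j => [|j IH]; first by rewrite mul0r cexpi0.
  by rewrite -natr1 mulrDl cexpiD IH !mul1r /cexpi cos2pi sin2pi.
case: k => j; first by rewrite -pmulrn P.
by rewrite NegzE mulrNz mulNr cexpiN -pmulrn P; apply: complexP; rewrite !cE//= oppr0.
Qed.

Definition box c s : R := \1_(`[c - pi, c + pi]%classic) s.

Lemma measurable_box c : measurable_fun (setT : set (measurableTypeR R)) (box c).
Proof. exact: measurable_indic. Qed.

Lemma box01 c s : 0 <= box c s <= 1.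
Proof. by rewrite /box indicE ler0n lern1 leq_b1. Qed.

Lemma boxE c s : box c s = if `|s - c| <= pi then 1 else 0.
Proof.
rewrite /box indicE (_ : (s \in _) = (`|s - c| <= pi)); first by case: ifP.
by rewrite mem_setE in_itv/= ler_norml; apply/idP/idP => /andP[h1 h2]; apply/andP; split; lra.
Qed.

Let box_measure c : lebesgue_measure (`[c - pi, c + pi]%classic : set R) = (pi *+ 2)%:E.
Proof.
have p0 := pi_gt0 R; rewrite lebesgue_measure_itv/= lte_fin ifT; last by lra.
by rewrite -EFinD mulr2n; congr EFin; lra.
Qed.

Lemma integrable_box c : mu.-integrable setT (EFin \o box c).
Proof.
apply/integrable_ge0P; [exact: measurable_box|by move=> x; have /andP[] := box01 c x|].
rewrite integral_indic// setIT.
by rewrite [X in (X < _)%E](box_measure c) ltry.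
Qed.

Lemma integrable_cbox (C c : R) : mu.-integrable setT (EFin \o (fun s => C * box c s)).
Proof.
rewrite (_ : EFin \o _ = (fun s => C%:E * (box c s)%:E)%E); last by apply/funext.
by apply: integrableZl => //; exact: integrable_box.
Qed.

Lemma box_int c : \int[mu]_s box c s = pi *+ 2.
Proof.
rewrite /Rintegral integral_indic// setIT.
by rewrite [X in fine X](box_measure c).
Qed.

Lemma box_cexpi c k : cintegral mu (fun s => (box c s)%:C * cexpi (k%:~R * s)) =
  (if k == 0 then pi *+ 2 else 0)%:C.
Proof.
have p0 := pi_gt0 R.
rewrite /cintegral; under eq_Rintegral do rewrite !cE /= mul0r subr0.
under [X in _ +i* X]eq_Rintegral do rewrite !cE /= mul0r addr0.
case: eqP => [->|/eqP k0].
  under eq_Rintegral do rewrite mul0r cos0 mulr1.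
  under [X in _ +i* X]eq_Rintegral do rewrite mul0r sin0 mulr0.
  by rewrite box_int /Rintegral integral0.
have kn0 : k%:~R != 0 :> R by rewrite intr_eq0.
have FTC (F f : R -> R) : (forall s, is_derive s (1 : R) (F : R -> R^o) (f s)) -> continuous f ->
    F (c + pi) = F (c - pi) -> \int[mu]_s (box c s * f s) = 0.
  move=> dF cf EF.
  have -> : \int[mu]_s (box c s * f s) = \int[mu]_(s in `[c - pi, c + pi]) f s.
    rewrite [RHS]Rintegral_mkcond; apply: eq_Rintegral => s _.
    by rewrite /box indicE patchE; case: ifP; rewrite ?mul1r ?mul0r.
  have cF : continuous F.
    move=> s; apply: differentiable_continuous; apply/derivable1_diffP.
    by have [] := dF s.
  rewrite /Rintegral (@continuous_FTC2 _ f F); first by rewrite EF subee.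
  - by lra.
  - exact: continuous_subspaceT.
  - split; first by move=> s _; have [] := dF s.
      by apply: cvg_at_right_filter; exact: cF.
    by apply: cvg_at_left_filter; exact: cF.
  - by move=> s _; rewrite derive1E; have [_ ->] := dF s.
have per : cexpi (k%:~R * (c + pi)) = cexpi (k%:~R * (c - pi)) :> R[i].
  rewrite (_ : k%:~R * (c + pi) = k%:~R * (c - pi) + k%:~R * (pi *+ 2)).
    by rewrite cexpiD cexpi2pi mulr1.
  by rewrite mulr2n; ring.
have dk s : is_derive s (1 : R) (fun s => k%:~R * s : R^o) k%:~R.
  by have := @is_deriveZ R R R id k%:~R s 1 1 (is_derive_id _ _); rewrite -[_ *: 1]/(_ * 1) mulr1.
have ck : continuous (fun s : R => k%:~R * s).
  by move=> s; apply: cvgM; [exact: cvg_cst|exact: cvg_id].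
apply: complexP => /=.
- apply: (FTC (fun s => k%:~R^-1 * sin (k%:~R * s))).
  + move=> s; have h := is_derive1_comp (is_derive_sin (k%:~R * s)) (dk s).
    by have := is_deriveZ (k%:~R^-1) h; rewrite /GRing.scale/= mulrCA mulVf// mulr1.
  + by move=> s; apply: (@continuous_comp _ _ _ (fun s => k%:~R * s) cos); [exact: ck|exact: continuous_cos].
  + by congr (_ * _); exact: (congr1 (@complex.Im R) per).
- apply: (FTC (fun s => - (k%:~R^-1 * cos (k%:~R * s)))).
  + move=> s; have h := is_derive1_comp (is_derive_cos (k%:~R * s)) (dk s).
    have := is_deriveN (is_deriveZ (k%:~R^-1) h); rewrite /GRing.scale/= mulNr mulrN opprK.
    by rewrite mulrCA mulVf// mulr1.
  + by move=> s; apply: (@continuous_comp _ _ _ (fun s => k%:~R * s) sin); [exact: ck|exact: continuous_sin].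
  + by congr (- (_ * _)); exact: (congr1 (@complex.Re R) per).
Qed.

End orthogonality.

Lemma normc_cexpi_sub1 (R : realType) (s : R) : normc (cexpi s - 1) ^+ 2 = 4 * sin (s / 2) ^+ 2.
Proof.
rewrite normc2 !cE /= subr0.
have c2 : cos s = 1 - 2 * sin (s / 2) ^+ 2.
  rewrite {1}(_ : s = (s / 2) *+ 2); last by rewrite mulr2n; lra.
  by rewrite cos_mulr2n; have := cos2Dsin2 (s / 2); rewrite mulr2n; lra.
have := cos2Dsin2 s; rewrite c2 => h; nra.
Qed.

(** * Fejer means and Parseval's identity in one variable *)

Section fejer.
Context (R : realType).
Local Notation mu := (@lebesgue_measure R).
Local Notation mR := (measurableTypeR R).
Local Notation cmR := (@cmeasurable _ mR R).
Local Notation Re := complex.Re.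
Local Notation Im := complex.Im.

Definition dirichlet K (s : R) : R[i] := \sum_(j < K) cexpi (j%:R * s).
(** K times the Fejer kernel. *)
Definition dirichlet_sq K (s : R) : R := normc (dirichlet K s) ^+ 2.

Lemma dirichlet_telescope K s : (cexpi s - 1) * dirichlet K s = cexpi (K%:R * s) - 1.
Proof.
elim: K => [|K IH]; first by rewrite /dirichlet big_ord0 mulr0 mul0r cexpi0 subrr.
rewrite /dirichlet big_ord_recr/= mulrDr -/(dirichlet K s) IH.
have -> : K.+1%:R * s = K%:R * s + s by rewrite -natr1 mulrDl mul1r.
by rewrite cexpiD; ring.
Qed.

Lemma dirichlet_sq_ge0 K s : 0 <= dirichlet_sq K s. Proof. exact: sqr_ge0. Qed.

Lemma dirichlet_sq_le K s : dirichlet_sq K s * normc (cexpi s - 1) ^+ 2 <= 4.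
Proof.
rewrite /dirichlet_sq -exprMn -normcM mulrC dirichlet_telescope (_ : 4 = 2 ^+ 2 :> R); last by rewrite expr2; lra.
apply: lerXn2r; rewrite ?nnegrE ?normc_ge0//.
by rewrite (le_trans (le_normcD _ _))// normcN normc1 normc_cexpi.
Qed.

Lemma dirichlet_sq_double K x y : (dirichlet_sq K (x - y))%:C =
  \sum_(j < K) \sum_(l < K) cexpi ((j%:Z - l%:Z)%:~R * x) * cexpi (- ((j%:Z - l%:Z)%:~R * y)).
Proof.
rewrite /dirichlet_sq -mulcJ /dirichlet conjc_sum mulr_suml; apply: eq_bigr => j _.
rewrite mulr_sumr; apply: eq_bigr => l _.
rewrite -cexpiN -!cexpiD rmorphB/= -!pmulrn; congr cexpi; ring.
Qed.

Lemma ccont_real_measurable (g : R -> R[i]) : ccont g -> cmR g.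
Proof. by move=> [g1 g2]; split; exact: continuous_measurable_fun. Qed.

Lemma ccont_sum (V : normedModType R) I (r : seq I) (F : I -> V -> R[i]) :
  (forall i, ccont (F i)) -> ccont (fun z => \sum_(i <- r) F i z).
Proof.
move=> cF; elim: r => [|i r IH].
  by rewrite (_ : (fun z => _) = (fun=> 0)); [exact: ccont_cst|apply/funext => z; rewrite big_nil].
rewrite (_ : (fun z => _) = (fun z => F i z + \sum_(j <- r) F j z)); last first.
  by apply/funext => z; rewrite big_cons.
exact: ccontD.
Qed.

Lemma ccont_lin (a b : R) : ccont (fun s : R => cexpi (a * s + b)).
Proof.
apply: ccont_cexpi => s; apply: cvgD; last exact: cvg_cst.
by apply: cvgM; [exact: cvg_cst|exact: cvg_id].
Qed.

Lemma cmeasurable_dirichlet_sq K x : cmR (fun y : R => (dirichlet_sq K (x - y))%:C).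
Proof.
apply: ccont_real_measurable.
rewrite (_ : (fun y => _) = (fun y => \sum_(j < K) \sum_(l < K)
   cexpi ((j%:Z - l%:Z)%:~R * x) * cexpi (- ((j%:Z - l%:Z)%:~R) * y + 0))); last first.
  apply/funext => y; rewrite dirichlet_sq_double; apply: eq_bigr => j _; apply: eq_bigr => l _.
  by rewrite addr0 mulNr.
apply: ccont_sum => j; apply: ccont_sum => l.
by apply: ccontM; [exact: ccont_cst|exact: ccont_lin].
Qed.

Lemma dirichlet_sq_bound K s : dirichlet_sq K s <= K%:R ^+ 2.
Proof.
apply: lerXn2r; rewrite ?nnegrE ?normc_ge0//.
rewrite (le_trans (normc_sum _ _ _))// (eq_bigr (fun=> 1)) => [|j _]; last by rewrite normc_cexpi.
by rewrite sumr_const card_ord.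
Qed.

Section parseval1.
Variables (c : R) (f : R -> R[i]) (M : R).
Hypotheses (cf : ccont f) (fM : forall s, normc (f s) <= M).
Hypothesis fs : forall s, 2 <= `|s - c| -> f s = 0.

Let b := box c.
Let mb : cmR (fun s => (b s)%:C).
Proof. by split=> /=; [exact: measurable_box|exact: measurable_cst]. Qed.

Let b0 s : 0 <= b s. Proof. by have /andP[] := box01 c s. Qed.
Let b1 s : b s <= 1. Proof. by have /andP[] := box01 c s. Qed.

Let M0 : 0 <= M. Proof. exact: le_trans (normc_ge0 _) (fM 0). Qed.

Let fb s : normc (f s) <= M * b s.
Proof.
rewrite /b boxE; have [h|h] := leP `|s - c| pi; first by rewrite mulr1.
by rewrite fs ?normc0 ?mulr0// (le_trans (pi_ge2 R))// ltW.
Qed.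

Lemma cint_box (g : R -> R[i]) C : cmR g -> (forall s, normc (g s) <= C * b s) ->
  cintegrable mu g.
Proof. by move=> mg gC; exact: cintegrable_le mg gC (integrable_cbox C c). Qed.

Lemma normc_cint_box (g : R -> R[i]) C : cmR g -> (forall s, normc (g s) <= C * b s) ->
  normc (cintegral mu g) <= C * (pi *+ 2).
Proof.
move=> mg gC; apply: le_trans (normc_cintegral_le mg gC (integrable_cbox C c)) _.
rewrite -(box_int c) RintegralZl//; exact: integrable_box.
Qed.

Definition ft1 (k : int) : R[i] := cintegral mu (fun s => f s * cexpi (- (k%:~R * s))).

Let ifk (a : R) : cintegrable mu (fun s => f s * cexpi (a * s)).
Proof.
apply: (@cint_box _ M); last by move=> s; rewrite normcM normc_cexpi mulr1.
apply: ccont_real_measurable; apply: ccontM => //.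
by have := ccont_lin a 0; under eq_fun do rewrite addr0.
Qed.

Let mf : cmR f. Proof. exact: ccont_real_measurable. Qed.

Let Qf K x : cintegral mu (fun y : R => (dirichlet_sq K (x - y))%:C * f y) =
  \sum_(j < K) \sum_(l < K) cexpi ((j%:Z - l%:Z)%:~R * x) * ft1 (j%:Z - l%:Z).
Proof.
pose G (j l : 'I_K) y := cexpi ((j%:Z - l%:Z)%:~R * x) * (f y * cexpi (- ((j%:Z - l%:Z)%:~R * y))).
have iG j l : cintegrable mu (G j l).
  apply: cintegrableZ; have := ifk (- (j%:Z - l%:Z)%:~R); under eq_fun do rewrite mulNr; exact.
rewrite (@eq_cintegral _ mR _ mu _ (fun y : R => \sum_(j < K) \sum_(l < K) G j l y)); last first.
  move=> y; rewrite dirichlet_sq_double mulr_suml; apply: eq_bigr => j _.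
  by rewrite mulr_suml; apply: eq_bigr => l _; rewrite /G; ring.
rewrite cintegral_sum; last by move=> j; exact: cintegrable_sum.
apply: eq_bigr => j _; rewrite cintegral_sum//; apply: eq_bigr => l _.
rewrite /G cintegralZ//; have := ifk (- (j%:Z - l%:Z)%:~R); under eq_fun do rewrite mulNr; exact.
Qed.

Let Qb K x : cintegral mu (fun y : R => (dirichlet_sq K (x - y))%:C * (b y)%:C) = (K%:R * (pi *+ 2))%:C.
Proof.
pose G (j l : 'I_K) y := cexpi ((j%:Z - l%:Z)%:~R * x) * ((b y)%:C * cexpi ((l%:Z - j%:Z)%:~R * y)).
have iG0 (j l : 'I_K) : cintegrable mu (fun y : R => (b y)%:C * cexpi ((l%:Z - j%:Z)%:~R * y)).
  apply: (@cint_box _ 1); last by move=> s; rewrite normcM normc_cexpi mulr1 normc_real mul1r ger0_norm.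
  apply: cmeasurableM => //; apply: ccont_real_measurable.
  by have := ccont_lin ((l%:Z - j%:Z)%:~R) 0; under eq_fun do rewrite addr0.
have iG j l : cintegrable mu (G j l) by exact: cintegrableZ.
rewrite (@eq_cintegral _ mR _ mu _ (fun y : R => \sum_(j < K) \sum_(l < K) G j l y)); last first.
  move=> y; rewrite dirichlet_sq_double mulr_suml; apply: eq_bigr => j _.
  rewrite mulr_suml; apply: eq_bigr => l _; rewrite /G -mulNr -rmorphN opprB/=; ring.
rewrite cintegral_sum; last by move=> j; exact: cintegrable_sum.
transitivity (\sum_(j < K) (pi *+ 2)%:C : R[i]); last first.
  by rewrite sumr_const card_ord -rmorphMn/= mulr_natl.
apply: eq_bigr => j _; rewrite cintegral_sum// (bigD1 j)//= big1 => [|l lj].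
  by rewrite /G cintegralZ// box_cexpi !subrr eqxx mul0r cexpi0 mul1r addr0.
rewrite /G cintegralZ// box_cexpi ifF ?mulr0//; apply/negbTE.
by rewrite subr_eq0 eqz_nat; apply: contra lj => /eqP/val_inj ->.
Qed.

(** The error of the Fejer mean before division by K. The box of half-width pi stands for one
    period; it contains the support of f because 2 <= pi. *)
Let EK K (x : R) := cintegral mu (fun y : R => (dirichlet_sq K (x - y))%:C * (f y - (b y)%:C * f x)).

Let mE K x : cmR (fun y : R => (dirichlet_sq K (x - y))%:C * (f y - (b y)%:C * f x)).
Proof.
apply: cmeasurableM; first exact: cmeasurable_dirichlet_sq.
apply: cmeasurableD => //; rewrite (_ : (fun y => _) = (fun y => (- f x) * (b y)%:C)); last first.
  by apply/funext => y; ring.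
by apply: cmeasurableM => //; exact: cmeasurable_cst.
Qed.

Let EKE K x : EK K x = \sum_(j < K) \sum_(l < K) cexpi ((j%:Z - l%:Z)%:~R * x) * ft1 (j%:Z - l%:Z)
  - (K%:R * (pi *+ 2))%:C * f x.
Proof.
rewrite -Qf -(Qb _ x) [_ * f x]mulrC.
have i1 : cintegrable mu (fun y : R => (dirichlet_sq K (x - y))%:C * f y).
  apply: (@cint_box _ (K%:R ^+ 2 * M)); first by apply: cmeasurableM => //; exact: cmeasurable_dirichlet_sq.
  by move=> s; rewrite normcM normc_real ger0_norm ?dirichlet_sq_ge0// -mulrA ler_pM ?dirichlet_sq_ge0 ?normc_ge0 ?dirichlet_sq_bound.
have i2 : cintegrable mu (fun y : R => (dirichlet_sq K (x - y))%:C * (b y)%:C).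
  apply: (@cint_box _ (K%:R ^+ 2)); first by apply: cmeasurableM => //; exact: cmeasurable_dirichlet_sq.
  move=> s; rewrite -rmorphM normc_real; have h := mulr_ge0 (dirichlet_sq_ge0 K (x - s)) (b0 s).
  by rewrite ger0_norm//; exact: (ler_wpM2r (b0 s) (dirichlet_sq_bound K (x - s))).
rewrite -cintegralZ// -cintegralB//; last exact: cintegrableZ.
by apply: eq_cintegral => y; ring.
Qed.

Let diffb x y : normc (f y - (b y)%:C * f x) <= 2 * M * b y.
Proof.
rewrite (le_trans (le_normcD _ _))// normcN normcM normc_real (ger0_norm (b0 y)).
by have := fb y; have := ler_wpM2l (b0 y) (fM x); lra.
Qed.

Let EK_bound K x e C : 0 <= e -> 0 <= C ->
  (forall y, b y = 1 -> dirichlet_sq K (x - y) * normc (f y - f x) <= e * dirichlet_sq K (x - y) + C) ->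
  normc (EK K x) <= (e * K%:R + C) * (pi *+ 2).
Proof.
move=> e0 C0 H.
pose G y : R := e * (dirichlet_sq K (x - y) * b y) + C * b y.
have mG : measurable_fun (setT : set mR) (fun y : R => dirichlet_sq K (x - y) * b y).
  have [] := cmeasurableM (cmeasurable_dirichlet_sq K x) mb.
  by under eq_fun do rewrite -rmorphM/=.
have iG1 : mu.-integrable setT (EFin \o (fun y : R => dirichlet_sq K (x - y) * b y)).
  apply: (le_integrable_real mG _ (integrable_cbox (K%:R ^+ 2) c)) => y.
  rewrite ger0_norm; first exact: (ler_wpM2r (b0 y) (dirichlet_sq_bound K (x - y))).
  exact: (mulr_ge0 (dirichlet_sq_ge0 K (x - y)) (b0 y)).
have iG2 : mu.-integrable setT (EFin \o (fun y : R => e * (dirichlet_sq K (x - y) * b y))).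
  rewrite (_ : EFin \o _ = (fun s => e%:E * (EFin \o (fun y : R => (dirichlet_sq K (x - y) * b y)%R)) s)%E); last by apply/funext.
  exact: integrableZl.
have iG : mu.-integrable setT (EFin \o G).
  rewrite (_ : EFin \o _ = (EFin \o (fun y : R => (e * (dirichlet_sq K (x - y) * b y))%R)) \+ (EFin \o (fun y : R => (C * b y)%R)))%E; last by apply/funext.
  by apply: integrableD => //; exact: integrable_cbox.
apply: (le_trans (normc_cintegral_le (mE K x) _ iG)) => [y|].
  rewrite /G normcM normc_real ger0_norm ?dirichlet_sq_ge0//.
  have [by1|by0] : b y = 1 \/ b y = 0 by rewrite /b boxE; case: ifP; [left|right].
    by rewrite by1 mul1r !mulr1; exact: H.
  have := fb y; rewrite by0 !mulr0 mul0r subr0 => h; rewrite addr0.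
  by rewrite (_ : normc (f y) = 0) ?mulr0//; apply/eqP; rewrite eq_le h normc_ge0.
rewrite RintegralD//; last exact: integrable_cbox.
rewrite !RintegralZl//; last exact: integrable_box.
rewrite box_int mulrDl; have := congr1 (@complex.Re R) (Qb K x).
by rewrite /cintegral; under eq_fun do rewrite -rmorphM/=; move=> /= ->; rewrite mulrA.
Qed.

(** For x in the open support interval and y in the box, |x - y| <= |x - c| + pi < 2 pi. So x - y
    avoids the nonzero multiples of 2 pi, and sin^2(s/2) has a positive minimum on a compact
    interval. *)
Let sin_pos x d : 0 < d -> `|x - c| < 2 -> exists2 m : R, 0 < m &
  forall y, b y = 1 -> d <= `|x - y| -> m <= normc (cexpi (x - y) - 1) ^+ 2.
Proof.
move=> d0 xc; have p0 := pi_gt0 R; have p2 := pi_ge2 R.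
pose r := `|x - c| + pi; have r2 : r < pi *+ 2 by rewrite /r mulr2n; lra.
pose h (s : R) := sin (s / 2) ^+ 2.
have ch : {within `[d, Num.max d r], continuous h}.
  apply: continuous_subspaceT => s; rewrite /h.
  have cs : (fun s : R => sin (s / 2)) @ s --> sin (s / 2).
    apply: (@cvg_comp _ _ _ (fun s : R => s / 2) sin _ (nbhs (s / 2))); last exact: continuous_sin.
    by apply: cvgM; [exact: cvg_id|exact: cvg_cst].
  rewrite /continuous_at expr2; under eq_fun do rewrite expr2; exact: cvgM.
have dm : d <= Num.max d r by rewrite le_max lexx.
have sinp s : 0 < s -> s < pi *+ 2 -> 0 < h s.
  move=> s0 s2; rewrite exprn_gt0// sin_gt0_pi//; apply/andP; split; first by rewrite divr_gt0.
  by rewrite ltr_pdivrMr// mulr_natr.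
have [dr|rd] := leP d r; last first.
  exists 1 => // y yb; have : `|x - y| <= r; last by lra.
  move: yb; rewrite /b boxE; case: ifPn => [h1 _|_ /eqP]; last by rewrite eq_sym oner_eq0.
  by rewrite /r (_ : x - y = (x - c) - (y - c)) ?(le_trans (ler_normB _ _)) ?lerD2l//; ring.
have mr : Num.max d r = r by exact/max_idPr.
have [s0 hs0 smin] := EVT_min dm ch; move: hs0 smin; rewrite mr in_itv/= => /andP[ds sr] smin.
exists (4 * h s0) => [|y yb dxy].
  by rewrite mulr_gt0// sinp// ?(lt_le_trans d0)// (le_lt_trans sr).
have xyr : `|x - y| <= r.
  move: yb; rewrite /b boxE; case: ifPn => [h1 _|_ /eqP]; last by rewrite eq_sym oner_eq0.
  by rewrite /r (_ : x - y = (x - c) - (y - c)) ?(le_trans (ler_normB _ _)) ?lerD2l//; ring.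
rewrite normc_cexpi_sub1 ler_wpM2l// (_ : sin ((x - y) / 2) ^+ 2 = h `|x - y|).
  by apply: smin; rewrite in_itv/= dxy xyr.
rewrite /h; case: (ger0P (x - y)) => // _.
by rewrite mulNr sinN sqrrN.
Qed.

(** Fejer's argument: near x continuity of f makes the error a small multiple of K, and away from x
    the kernel is bounded independently of K. *)
Let EK_cvg x : `|x - c| < 2 -> (fun K => normc (EK K x) / K%:R) @ \oo --> 0.
Proof.
move=> xc; have p0 := pi_gt0 R; apply/cvgr0Pnorm_le => e e0.
pose e1 := e / 2 / (pi *+ 2).
have pp : 0 < (pi : R) *+ 2 by rewrite mulr2n addr_gt0.
have e10 : 0 < e1 by rewrite !divr_gt0.
have [d d0 hd] : exists2 d : R, 0 < d & forall y, `|x - y| < d -> normc (f y - f x) <= e1.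
  have [f1 f2] := cf; have h20 : 0 < e1 / 2 by rewrite divr_gt0.
  have /cvgrPdist_le/(_ _ h20)/nbhs_ballP[d1 /= d10 hd1] := f1 x.
  have /cvgrPdist_le/(_ _ h20)/nbhs_ballP[d2 /= d20 hd2] := f2 x.
  exists (Num.min d1 d2) => [|y]; first by rewrite lt_min d10 d20.
  rewrite lt_min => /andP[/hd1 h1 /hd2 h2].
  have := normc_ReIm (f y - f x); rewrite !cE.
  by move: h1 h2; rewrite /= [`|Re (f x) - _|]distrC [`|Im (f x) - _|]distrC; lra.
have [m m0 hm] := sin_pos d0 xc.
pose C := 2 * M * 4 / m; have C0 : 0 <= C by rewrite divr_ge0 ?mulr_ge0// ltW.
have B K : normc (EK K x) <= (e1 * K%:R + C) * (pi *+ 2).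
  apply: EK_bound => //; first exact: ltW.
  move=> y yb; have Q0 := dirichlet_sq_ge0 K (x - y).
  have [h|h] := ltP `|x - y| d.
    by have := ler_wpM2l Q0 (hd y h); lra.
  have df : normc (f y - f x) <= 2 * M.
    by rewrite (le_trans (le_normcD _ _))// normcN; have := fM y; have := fM x; lra.
  have Qm : dirichlet_sq K (x - y) <= 4 / m.
    rewrite ler_pdivlMr//; apply: le_trans (dirichlet_sq_le K (x - y)).
    by rewrite ler_wpM2l// hm.
  have : dirichlet_sq K (x - y) * normc (f y - f x) <= 4 / m * (2 * M) by rewrite ler_pM ?normc_ge0.
  have : 0 <= e1 * dirichlet_sq K (x - y) by rewrite mulr_ge0// ltW.
  by rewrite /C; lra.
pose C2 := C * (pi *+ 2) / (e / 2).
near=> K; have K0 : 0 < K%:R :> R by rewrite ltr0n; near: K; exact: nbhs_infty_gt.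
rewrite ger0_norm ?divr_ge0 ?normc_ge0//.
rewrite ler_pdivrMr// (le_trans (B K))// mulrDl.
have -> : e1 * K%:R * (pi *+ 2) = e / 2 * K%:R by rewrite /e1 mulrAC divfK ?gt_eqF.
have : C * (pi *+ 2) <= e / 2 * K%:R.
  rewrite mulrC -ler_pdivrMl ?divr_gt0// [leLHS]mulrC [X in X / _]mulrC.
  by near: K; exact: nbhs_infty_ger.
by lra.
Unshelve. all: by end_near. Qed.

Let bft (k : int) := normc (ft1 k) ^+ 2.

Let Int2 : R := \int[mu]_x normc (f x) ^+ 2.

Let EK_le K x : normc (EK K x) <= 2 * M * (pi *+ 2) * K%:R.
Proof.
have := @EK_bound K x (2 * M) 0 (mulr_ge0 (ler0n _ _) M0) (lexx _).
rewrite addr0 [leRHS]mulrAC; apply => y _; rewrite addr0 [leRHS]mulrC ler_wpM2l ?dirichlet_sq_ge0//.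
by rewrite (le_trans (le_normcD _ _))// normcN; have := fM y; have := fM x; lra.
Qed.

(** Pairing the Fejer error with the conjugate of f turns each Fourier coefficient into its squared
    modulus. *)
Let energy K : (\sum_(j < K) \sum_(l < K) bft (j%:Z - l%:Z))%:C =
  cintegral mu (fun x => conjc (f x) * EK K x) + (K%:R * (pi *+ 2) * Int2)%:C.
Proof.
pose G (j l : 'I_K) x := ft1 (j%:Z - l%:Z) * conjc (f x * cexpi (- (j%:Z - l%:Z)%:~R * x)).
have iG0 (j l : 'I_K) : cintegrable mu (fun x : R => conjc (f x * cexpi (- (j%:Z - l%:Z)%:~R * x))).
  exact: cintegrableJ.
have iG j l : cintegrable mu (G j l) by exact: cintegrableZ.
have i2 : cintegrable mu (fun x : R => (normc (f x) ^+ 2)%:C).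
  apply: (@cint_box _ (M * M)).
    by split=> /=; [exact: measurable_normc2|exact: measurable_cst].
  move=> s; rewrite normc_real ger0_norm ?sqr_ge0// expr2 -mulrA.
  exact: (ler_pM (normc_ge0 _) (normc_ge0 _) (fM s) (fb s)).
have E x : conjc (f x) * EK K x = \sum_(j < K) \sum_(l < K) G j l x - (K%:R * (pi *+ 2))%:C * (normc (f x) ^+ 2)%:C.
  rewrite EKE mulrBr; congr (_ - _); last by rewrite mulrCA -mulcJ; ring.
  rewrite mulr_sumr; apply: eq_bigr => j _; rewrite mulr_sumr; apply: eq_bigr => l _.
  by rewrite /G conjcM -cexpiN mulNr opprK; ring.
under eq_cintegral do rewrite E.
rewrite cintegralB; first last.
- exact: cintegrableZ.
- by apply: cintegrable_sum => j; exact: cintegrable_sum.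
rewrite cintegralZ// (_ : cintegral mu (fun x : R => (normc (f x) ^+ 2)%:C) = Int2%:C); last first.
  by rewrite /cintegral /= /Int2 [in X in _ +i* X]/Rintegral integral0.
rewrite -rmorphM/= subrK cintegral_sum; last by move=> j; exact: cintegrable_sum.
rewrite rmorph_sum/=; apply: eq_bigr => j _; rewrite cintegral_sum// rmorph_sum/=.
apply: eq_bigr => l _; rewrite /G cintegralZ// cintegralJ// /bft -mulcJ; congr (_ * conjc _).
by apply: eq_cintegral => s; rewrite mulNr.
Qed.

Let mEK K : cmR (EK K).
Proof.
apply: ccont_real_measurable; rewrite (_ : EK K = (fun x => \sum_(j < K) \sum_(l < K)
    (ft1 (j%:Z - l%:Z) * cexpi ((j%:Z - l%:Z)%:~R * x + 0)) + (- (K%:R * (pi *+ 2))%:C) * f x)); last first.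
  apply/funext => x; rewrite EKE mulNr; congr (_ - _).
  by apply: eq_bigr => j _; apply: eq_bigr => l _; rewrite addr0 mulrC.
apply: ccontD; last by apply: ccontM => //; exact: ccont_cst.
apply: ccont_sum => j; apply: ccont_sum => l; apply: ccontM; [exact: ccont_cst|exact: ccont_lin].
Qed.

(** Convergence of the Cesaro means of the partial sums of squared coefficients. *)
Lemma fejer_cvg : (fun K : nat => (\sum_(j < K) \sum_(l < K) bft (j%:Z - l%:Z)) / K%:R) @ \oo --> pi *+ 2 * Int2.
Proof.
pose F K (x : R) : R[i] := conjc (f x) * (EK K x * (K%:R^-1)%:C).
have mF K : cmR (F K).
  apply: cmeasurableM; first exact: cmeasurableJ.
  by apply: cmeasurableM => //; exact: cmeasurable_cst.
have nF K x : normc (F K x) = normc (f x) * (normc (EK K x) / K%:R).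
  by rewrite !normcM normcJ' normc_real ger0_norm// invr_ge0.
have FB K x : normc (F K x) <= (M * (2 * M * (pi *+ 2))) * b x.
  have p0 := pi_gt0 R.
  have pp : 0 <= (pi : R) *+ 2 by rewrite mulrn_wge0// ltW.
  have C0 := mulr_ge0 (mulr_ge0 (ler0n R 2) M0) pp.
  rewrite nF mulrAC; apply: (ler_pM (normc_ge0 _) _ (fb x)).
    by rewrite divr_ge0 ?normc_ge0.
  have [->|K0] := posnP K; first by rewrite invr0 mulr0.
  by rewrite ler_pdivrMr ?ltr0n// EK_le.
have F0 x : (fun K => normc (F K x - 0)) @ \oo --> 0.
  rewrite (_ : (fun K => _) = (fun K => normc (f x) * (normc (EK K x) / K%:R))); last first.
    by apply/funext => K; rewrite subr0 nF.
  (* [EK_cvg] stops at the edge of the support, but beyond it the factor f x vanishes. *)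
  have [h|h] := ltP `|x - c| 2; last first.
    rewrite (_ : (fun K => _) = (fun=> 0)); first exact: cvg_cst.
    by apply/funext => K; rewrite fs// normc0 mul0r.
  by rewrite -[X in _ --> X](mulr0 (normc (f x))); apply: cvgM; [exact: cvg_cst|exact: EK_cvg].
have := @cDCT _ mR R mu F (fun=> 0) _ mF (@cmeasurable_cst _ mR R 0) FB (integrable_cbox _ c) F0.
rewrite cintegral0; pose J K : R[i] := cintegral mu (F K).
rewrite -/(J _) => H; apply/cvgrPdist_le => e e0.
have {H} /cvgr0Pnorm_le/(_ _ e0) H1 : (fun K => normc (J K - 0)) @ \oo --> 0 by exact: H.
have {}H1 : \forall K \near \oo, normc (J K) <= e.
  apply: filterS H1 => K; have -> : J K - 0 = J K by exact: subr0.
  by move=> h; exact: le_trans (ler_norm _) h.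
near=> K; have H2 : normc (J K) <= e by near: K; exact: H1.
have K0 : (0 < K)%N by near: K; exact: nbhs_infty_gt.
have Kn0 : K%:R != 0 :> R by rewrite pnatr_eq0 -lt0n.
rewrite distrC (_ : _ - _ = Re (J K)); last first.
  rewrite /J /F (@eq_cintegral _ mR _ mu _ (fun x : R => (K%:R^-1)%:C * (conjc (f x) * EK K x))); last first.
    by move=> x; ring.
  rewrite cintegralZ; last first.
    apply: (@cint_box _ (M * (2 * M * (pi *+ 2) * K%:R))).
      by apply: cmeasurableM => //; exact: cmeasurableJ.
    move=> x; rewrite normcM normcJ' mulrAC; exact: (ler_pM (normc_ge0 _) (normc_ge0 _) (fb x) (EK_le K x)).
  have := energy K => /(congr1 (@complex.Re R)); rewrite !cE /= => ->.
  by rewrite mul0r subr0; field.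
exact: le_trans (Re_le_normc _) H2.
Unshelve. all: by end_near. Qed.

Let Bs K : R := \sum_(i < K) (bft (Posz i) + bft (Negz i)).
Let Ss K : R := \sum_(j < K) \sum_(l < K) bft (j%:Z - l%:Z).

Let bft0 k : 0 <= bft k. Proof. exact: sqr_ge0. Qed.

Let Ss_rec K : Ss K.+1 = Ss K + (\sum_(i < K.+1) bft (Posz i) + \sum_(i < K) bft (Negz i)).
Proof.
rewrite /Ss big_ord_recr/= (eq_bigr (fun j : 'I_K => \sum_(l < K) bft (j%:Z - l%:Z) + bft (j%:Z - K%:Z))); last first.
  by move=> j _; rewrite big_ord_recr.
rewrite big_split/= -addrA addrA [in RHS]addrA -!addrA; congr (_ + _); rewrite addrC; congr (_ + _).
  rewrite (reindex_inj rev_ord_inj)/=; apply: eq_bigr => i _; congr bft.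
  by rewrite subSS subzn ?leq_subr// subKn// -ltnS.
rewrite (reindex_inj rev_ord_inj)/=; apply: eq_bigr => i _; congr bft.
by rewrite NegzE -subzn// addrAC subrr add0r.
Qed.

Let Bs_mono i j : (i <= j)%N -> Bs i <= Bs j.
Proof.
move=> ij; rewrite -(subnK ij) addnC; elim: (j - i)%N => [|k IH]; first by rewrite addn0.
by rewrite addnS (le_trans IH)// /Bs big_ord_recr/= lerDl addr_ge0.
Qed.

(** One more row and column of the Toeplitz sum adds the frequencies from -K to K, a range between
    those of Bs K and Bs (K+1). *)
Let Ss_inc K : Bs K <= Ss K.+1 - Ss K <= Bs K.+1.
Proof.
rewrite Ss_rec addrC addKr /Bs !big_split/= big_ord_recr/= [X in _ && (_ <= _ + X)]big_ord_recr/=.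
by have := bft0 (Posz K); have := bft0 (Negz K); move=> h1 h2; apply/andP; split; lra.
Qed.

Let Ss_lo K m : m%:R * Bs K <= Ss (K + m) - Ss K.
Proof.
elim: m => [|m IH]; first by rewrite addn0 subrr mul0r.
have /andP[h _] := Ss_inc (K + m); have := Bs_mono (leq_addr m K).
by rewrite addnS -natr1 mulrDl mul1r; lra.
Qed.

Let Ss_hi K : Ss K <= K%:R * Bs K.
Proof.
elim: K => [|K IH]; first by rewrite /Ss big_ord0 mul0r.
have /andP[_ h] := Ss_inc K; rewrite -natr1 mulrDl mul1r.
have := Bs_mono (leqnSn K); have := ler_wpM2l (ler0n R K) (Bs_mono (leqnSn K)); lra.
Qed.

(** Tauberian step for nonnegative terms. Monotonicity gives Ss K <= K Bs K <= Ss (2K) - Ss K, and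
    after division by K both ends have the same limit. *)
Let Bs_cvg : Bs @ \oo --> pi *+ 2 * Int2.
Proof.
set X := _ * Int2; have H : (fun K => Ss K / K%:R) @ \oo --> X by exact: fejer_cvg.
have H2 : (fun K => 2 * (Ss (K + K) / (K + K)%:R) - Ss K / K%:R) @ \oo --> X.
  rewrite [X in _ --> X](_ : X = 2 * X - X); last by ring.
  apply: cvgB => //; apply: cvgM; first exact: cvg_cst.
  apply: (@cvg_comp _ _ _ (fun K => (K + K)%N) (fun K => Ss K / K%:R) _ \oo) => // A [N _ hN].
  by exists N => // k /= Nk; apply: hN => /=; rewrite (leq_trans Nk)// leq_addr.
apply: squeeze_cvgr H H2; near=> K.
have K0 : 0 < K%:R :> R by rewrite ltr0n; near: K; exact: nbhs_infty_gt.
rewrite ler_pdivrMr// mulrC Ss_hi/= natrD.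
have := Ss_lo K K; rewrite [K%:R * _]mulrC -ler_pdivlMr// => /le_trans; apply.
rewrite le_eqVlt; apply/orP; left; apply/eqP; field.
by rewrite gt_eqF//= -mulr2n mulrn_eq0/= gt_eqF.
Unshelve. all: by end_near. Qed.

Lemma parseval1 : \esum_(k in [set: int]) (normc (ft1 k) ^+ 2)%:E =
  ((pi *+ 2) * \int[mu]_x normc (f x) ^+ 2)%:E.
Proof.
rewrite esum_int; last by move=> k; rewrite lee_fin sqr_ge0.
apply: cvg_lim => //.
rewrite (_ : (fun K => _) = EFin \o Bs); first by apply: cvg_EFin Bs_cvg; exact: nearW.
by apply/funext => K; rewrite /= /Bs -sumEFin big_mkord.
Qed.

End parseval1.
End fejer.

Lemma esumZ (R : realType) (L : countType) (b : L -> \bar R) (c : R) : 0 <= c ->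
  (forall j, 0 <= b j)%E ->
  \esum_(j in setT) (c%:E * b j)%E = (c%:E * \esum_(j in setT) b j)%E.
Proof.
move=> c0 b0; rewrite -!lsumE//; last by move=> j; rewrite mule_ge0// lee_fin.
rewrite /lsum -nneseriesZl; last by move=> q _; case: pickle_inv => //=.
by apply: eq_eseriesr => q _; case: pickle_inv => //=; rewrite mule0.
Qed.

Section cons.
Context (R : realType) (n : nat).
Local Notation leb n := (lebesgue_rV R n).
Local Notation mu := (@lebesgue_measure R).

Lemma rV_cons_norm_le (p : R * 'rV[R]_n) : `|rV_cons p| <= Num.max `|p.1| `|p.2|.
Proof.
apply: rV_norm_le => [|i]; first by rewrite le_max normr_ge0.
case: (unliftP ord0 i) => [j ->|->]; last by rewrite rV_consE0 le_max lexx.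
by rewrite rV_consES le_max rV_coord_le orbT.
Qed.

Lemma rV_consB (p q : R * 'rV[R]_n) : rV_cons p - rV_cons q = rV_cons (p - q).
Proof.
apply/rowP => i; rewrite [LHS]mxE [X in _ + X]mxE.
case: (unliftP ord0 i) => [j ->|->]; last by rewrite !rV_consE0.
by rewrite !rV_consES !mxE.
Qed.

Lemma continuous_cons1 (x : 'rV[R]_n) : continuous (fun s : R => rV_cons (s, x)).
Proof.
move=> s; apply/cvgrPdist_lt => e e0; near=> t.
rewrite rV_consB (le_lt_trans (rV_cons_norm_le _))//= subrr normr0.
by rewrite gt_max e0 andbT; near: t; exact: cvgr_dist_lt.
Unshelve. all: by end_near. Qed.

Lemma continuous_cons2 (s : R) : continuous (fun x : 'rV[R]_n => rV_cons (s, x)).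
Proof.
move=> x; have FF : Filter (nbhs x) by exact: (@nbhs_filter 'rV[R]_n x).
apply/cvgrPdist_lt => e e0; near=> t.
rewrite rV_consB (le_lt_trans (rV_cons_norm_le _))//= subrr normr0.
by rewrite gt_max e0/=; near: t; exact: cvgr_dist_lt.
Unshelve. all: by end_near. Qed.

Lemma integral_rV_cons2 (f : 'rV[R]_n.+1 -> \bar R) : measurable_fun setT f ->
  (forall x, (0 <= f x)%E) ->
  (\int[leb n.+1]_x f x = \int[leb n]_x' \int[mu]_s f (rV_cons (s, x')))%E.
Proof.
move=> mf f0.
transitivity (\int[(mu \x leb n)%E]_p f (rV_cons p))%E.
  rewrite -[LHS]/(\int[pushforward (mu \x leb n)%E (@rV_cons R n)]_x f x)%E.
  by rewrite ge0_integral_pushforward ?preimage_setT//; exact: measurable_rV_cons.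
rewrite fubini_tonelli2//.
by apply: measurableT_comp => //; exact: measurable_rV_cons.
Qed.

Let mc : measurable_fun (setT : set (measurableTypeR R * 'rV[R]_n)) (@rV_cons R n).
Proof. exact: measurable_rV_cons. Qed.

Lemma cintegrable_cons (g : 'rV[R]_n.+1 -> R[i]) : cintegrable (leb n.+1) g ->
  cintegrable (mu \x leb n)%E (g \o @rV_cons R n).
Proof.
move=> /cintegrableP[mg ig]; apply/cintegrableP; split.
  by apply: cmeasurable_comp => //; exact: measurable_rV_cons.
have mh : measurable_fun setT (fun x => (normc (g x))%:E).
  by apply/measurable_EFinP; exact: measurable_normc.
have := ge0_integral_pushforward mc (mu \x leb n)%E measurableT mh.
rewrite preimage_setT => <- //; first by move=> y _; rewrite lee_fin normc_ge0.
Qed.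

Lemma cintegral_cons (g : 'rV[R]_n.+1 -> R[i]) : cmeasurable g ->
  cintegrable (mu \x leb n)%E (g \o @rV_cons R n) ->
  (forall x', cintegrable mu (fun s => g (rV_cons (s, x')))) ->
  cintegral (leb n.+1) g = cintegral (leb n) (fun x' => cintegral mu (fun s => g (rV_cons (s, x')))).
Proof.
move=> [m1 m2] [i1 i2] is_; rewrite -(cfubini2 (m1 := mu) (m2 := leb n) (conj i1 i2) is_).
have H (h : 'rV[R]_n.+1 -> R) : measurable_fun setT h ->
    (mu \x leb n)%E.-integrable setT (EFin \o (h \o @rV_cons R n)) ->
    (\int[leb n.+1]_x (h x)%:E = \int[(mu \x leb n)%E]_p (h (rV_cons p))%:E)%E.
  move=> mh ih; have mh' : measurable_fun setT (EFin \o h) by exact/measurable_EFinP.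
  have := integral_pushforward mc mh' (D := setT).
  by rewrite preimage_setT => /(_ _ ih measurableT).
by rewrite /cintegral /Rintegral; congr (fine _ +i* fine _); exact: H.
Qed.

Definition icons (p : int * 'rV[int]_n) : 'rV[int]_n.+1 :=
  \row_j if unlift ord0 j is Some i then p.2 ord0 i else p.1.

Lemma icons0 p : icons p ord0 ord0 = p.1.
Proof. by rewrite mxE unlift_none. Qed.

Lemma iconsS p i : icons p ord0 (lift ord0 i) = p.2 ord0 i.
Proof. by rewrite mxE liftK. Qed.

Lemma icons_bij : set_bij setT setT icons.
Proof.
split=> //.
  move=> p q _ _ h; rewrite [p]surjective_pairing [q]surjective_pairing; congr pair.
    by rewrite -!icons0 h.
  by apply/rowP => i; rewrite -!iconsS h.
move=> k _ /=; exists (k ord0 ord0, \row_i k ord0 (lift ord0 i)) => //.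
apply/rowP => j; case: (unliftP ord0 j) => [i ->|->]; rewrite ?iconsS ?icons0//=.
by rewrite mxE.
Qed.

End cons.

Definition kdot (R : realType) n (k : 'rV[int]_n) (x : 'rV[R]_n) : R :=
  \sum_i (k ord0 i)%:~R * x ord0 i.

Lemma continuous_kdot (R : realType) n (k : 'rV[int]_n) : continuous (@kdot R n k).
Proof.
apply: (continuous_sum (f := fun i (x : 'rV[R]_n) => (k ord0 i)%:~R * x ord0 i)) => i x.
exact: (cvgM (cvg_cst _) (@coord_continuous _ _ _ ord0 i x)).
Qed.

Lemma kdot_cons (R : realType) n p (s : R) (x : 'rV[R]_n) :
  kdot (icons p) (rV_cons (s, x)) = p.1%:~R * s + kdot p.2 x.
Proof.
rewrite /kdot big_ord_recl icons0 rV_consE0; congr (_ + _).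
by apply: eq_bigr => i _; rewrite iconsS rV_consES.
Qed.

Lemma ccont_kdot (R : realType) n (k : 'rV[int]_n) : ccont (fun x : 'rV[R]_n => cexpi (- kdot k x)).
Proof. by apply: ccont_cexpi => y; have h := @continuous_kdot R n k y; exact: (cvgN h). Qed.

Definition ft (R : realType) n (f : 'rV[R]_n -> R[i]) (k : 'rV[int]_n) : R[i] :=
  cintegral (lebesgue_rV R n) (fun x => f x * cexpi (- kdot k x)).

Section parseval.
Context (R : realType).
Local Notation leb n := (lebesgue_rV R n).
Local Notation mu := (@lebesgue_measure R).
Local Notation Re := complex.Re.
Local Notation Im := complex.Im.

Lemma parseval1_sqint (c : R) (f : R -> R[i]) M : ccont f -> (forall s, normc (f s) <= M) ->
  (forall s, 2 <= `|s - c| -> f s = 0) ->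
  \esum_(k in [set: int]) (normc (ft1 f k) ^+ 2)%:E = ((pi *+ 2)%:E * \int[mu]_x (normc (f x) ^+ 2)%:E)%E.
Proof.
move=> cf fM fs; rewrite (parseval1 cf fM fs) EFinM; congr (_ * _)%E.
rewrite /Rintegral fineK//.
have M0 : 0 <= M by exact: le_trans (normc_ge0 _) (fM 0).
apply: integrable_fin_num => //.
apply: (le_integrable_real _ _ (integrable_cbox (M ^+ 2) c)).
  by apply: measurable_normc2; exact: ccont_real_measurable.
move=> s; rewrite ger0_norm ?sqr_ge0// boxE; case: ifPn => h; last first.
  rewrite fs ?normc0 ?expr0n ?mulr0//.
  by move: h; rewrite -ltNge => /ltW; apply: le_trans; exact: pi_ge2.
by rewrite mulr1; apply: lerXn2r; rewrite ?nnegrE ?normc_ge0.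
Qed.

Lemma supp_wt n (c : 'rV[R]_n) (f : 'rV[R]_n -> R[i]) M : 0 <= M ->
  (forall x, normc (f x) <= M) ->
  (forall (x : 'rV[R]_n) i, 2 <= `|x ord0 i - c ord0 i| -> f x = 0) ->
  forall x, normc (f x) <= M * (3 + `|c|) ^+ (2 * n) * wt x.
Proof.
move=> M0 fM fs x; have w0 : 0 < 1 + `|x| by rewrite ltr_pwDl.
have c3 : 0 <= 3 + `|c| by rewrite addr_ge0.
have [h|h] := leP `|x - c| 2; last first.
  have [i hi] : exists i, 2 <= `|x ord0 i - c ord0 i|.
    apply: contrapT => /forallNP H; move: h; rewrite ltNge => /negP; apply.
    apply: rV_norm_le => // i; rewrite !mxE leNgt; apply/negP => /ltW; exact: H.
  by rewrite (fs _ _ hi) normc0 !mulr_ge0 ?exprn_ge0// wt_ge0.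
rewrite /wt ler_pdivlMr ?exprn_gt0//.
apply: (ler_pM (normc_ge0 _) (exprn_ge0 _ (ltW w0)) (fM x)).
apply: lerXn2r; [by rewrite nnegrE ltW|by rewrite nnegrE|].
by have := ler_normD (x - c) c; rewrite subrK; lra.
Qed.

(** Induction on the dimension: the Fourier coefficient in the first variable is, as a function of
    the others, again continuous, bounded and supported in a cube. The support condition is stated
    coordinatewise so that it survives slicing. *)
Theorem parseval n (c : 'rV[R]_n) (f : 'rV[R]_n -> R[i]) M : ccont f ->
  (forall x, normc (f x) <= M) ->
  (forall (x : 'rV[R]_n) i, 2 <= `|x ord0 i - c ord0 i| -> f x = 0) ->
  \esum_(k in [set: 'rV[int]_n]) (normc (ft f k) ^+ 2)%:E =
  (((pi *+ 2) ^+ n)%:E * sqint (leb n) f)%E.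
Proof.
elim: n c f M => [|n IH] c f M cf fM fs.
  (* In dimension 0 there is one frequency and the measure is a point mass. *)
  rewrite expr0 mul1e (_ : [set: 'rV[int]_0] = [set 0]); last first.
    by apply/seteqP; split=> // k _ /=; apply/rowP => -[].
  rewrite esum_set1; last by rewrite lee_fin sqr_ge0.
  have cg (k : 'rV[int]_0) : ccont (fun x => f x * cexpi (- kdot k x)).
    by apply: ccontM => //; exact: ccont_kdot.
  rewrite /sqint /ft /= /cintegral /Rintegral !integral_dirac// ?diracT ?mul1e /=.
  - by rewrite /kdot big_ord0 oppr0 cexpi0 mulr1; case: (f 0).
  - apply/measurable_EFinP; apply: measurable_normc2; exact: ccont_meas1.
  - apply/measurable_EFinP; (try exact: (ccont_meas1 (cg 0)).1); exact: (ccont_meas1 (cg 0)).2.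
  - apply/measurable_EFinP; (try exact: (ccont_meas1 (cg 0)).1); exact: (ccont_meas1 (cg 0)).2.
have M0 : 0 <= M by exact: le_trans (normc_ge0 _) (fM 0).
pose c0 := c ord0 ord0; pose c' : 'rV[R]_n := \row_i c ord0 (lift ord0 i).
pose f1 x' (s : R) := f (rV_cons (s, x')).
pose F (k1 : int) x' : R[i] := ft1 (f1 x') k1.
have cf1 x' : ccont (f1 x') by exact: ccont_comp (@continuous_cons1 R n x') cf.
have f1s x' s : 2 <= `|s - c0| -> f1 x' s = 0.
  by move=> h; apply: (fs _ ord0); rewrite rV_consE0.
have f1b x' s : normc (f1 x' s) <= M * box c0 s.
  rewrite boxE; case: ifPn => h; first by rewrite mulr1 fM.
  rewrite mulr0 f1s ?normc0//.
  by move: h; rewrite -ltNge => /ltW; apply: le_trans; exact: pi_ge2.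
have mF1 (a : R) x' : @cmeasurable _ (measurableTypeR R) R (fun s : R => f1 x' s * cexpi (- (a * s))).
  apply: ccont_real_measurable; apply: ccontM => //.
  by have := ccont_lin (- a) 0; under eq_fun do rewrite addr0 mulNr.
(* Continuity in the remaining variables, by dominated convergence along sequences. *)
have cF k1 : ccont (F k1).
  apply: ccont_seq => u x ux.
  apply: (@cDCT _ (measurableTypeR R) R mu (fun k s => f1 (u k) s * cexpi (- (k1%:~R * s)))
    (fun s => f1 x s * cexpi (- (k1%:~R * s))) (fun s => M * box c0 s)) => //.
  - by move=> k s; rewrite normcM normc_cexpi mulr1.
  - exact: integrable_cbox.
  - move=> s; have := ccont_cvg (ccont_comp (@continuous_cons2 R n s) cf) ux.
    by under [X in _ -> X @ _ --> _]eq_fun do rewrite -mulrBl normcM normc_cexpi mulr1.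
have FM k1 x' : normc (F k1 x') <= M * (pi *+ 2).
  apply: (normc_cint_box (c := c0)) => [|s]; first exact: mF1.
  by rewrite normcM normc_cexpi mulr1.
have Fs k1 (x' : 'rV[R]_n) i : 2 <= `|x' ord0 i - c' ord0 i| -> F k1 x' = 0.
  move=> h; rewrite /F /ft1 -[RHS](@cintegral0 _ (measurableTypeR R) R mu).
  apply: eq_cintegral => s; rewrite /f1 (fs _ (lift ord0 i)) ?mul0r//.
  by rewrite rV_consES; move: h; rewrite mxE.
have ck k1 k' : ccont (fun x => f x * cexpi (- kdot (icons (k1, k')) x)).
  by apply: ccontM => //; exact: ccont_kdot.
have ftF k1 k' : ft f (icons (k1, k')) = ft (F k1) k'.
  rewrite /ft (@cintegral_cons R n); first last.
  - move=> x'; apply: (cint_box (c := c0) (C := M)).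
      by apply: ccont_real_measurable; exact: ccont_comp (@continuous_cons1 R n x') (ck k1 k').
    by move=> s; rewrite normcM normc_cexpi mulr1; exact: f1b.
  - apply: cintegrable_cons; apply: (cint_wt (C := M * (3 + `|c|) ^+ (2 * n.+1))).
      exact: ccont_meas1 (ck k1 k').
    move=> x; rewrite normcM normc_cexpi mulr1; exact: supp_wt.
  - exact: ccont_meas1 (ck k1 k').
  apply: eq_cintegral => x'; rewrite /F /ft1 mulrC -cintegralZ; last first.
    apply: (cint_box (c := c0) (C := M)) => // s.
    by rewrite normcM normc_cexpi mulr1.
  by apply: eq_cintegral => s; rewrite kdot_cons/= opprD cexpiD /f1; ring.
rewrite (reindex_esum _ _ (@icons n) _ (icons_bij n)).
transitivity (\esum_(k1 in [set: int]) \esum_(k' in [set: 'rV[int]_n]) (normc (ft (F k1) k') ^+ 2)%:E).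
  rewrite esum_esum; last by move=> *; rewrite lee_fin sqr_ge0.
  rewrite (_ : _ `*`` _ = setT); last by apply/seteqP; split.
  by apply: eq_esum => -[k1 k'] _; rewrite ftF.
under eq_esum do rewrite (IH c' _ _ (cF _) (FM _) (Fs _)).
have p0 : 0 <= (pi : R) *+ 2 by rewrite mulrn_wge0// pi_ge0.
rewrite esumZ ?exprn_ge0//; last by move=> k; exact: sqint_ge0.
rewrite exprSr EFinM -muleA; congr (_ * _)%E.
rewrite /sqint -integral_lsum; first last.
- by move=> k x'; rewrite lee_fin sqr_ge0.
- by move=> k; apply/measurable_EFinP; apply: measurable_normc2; exact: ccont_meas1.
have mf2 : measurable_fun setT (fun x : 'rV[R]_n.+1 => (normc (f x) ^+ 2)%:E).
  by apply/measurable_EFinP; apply: measurable_normc2; exact: ccont_meas1.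
rewrite integral_rV_cons2//; last by move=> x; rewrite lee_fin sqr_ge0.
rewrite -ge0_integralZl//.
- apply: eq_integral => x' _.
  exact: (@parseval1_sqint c0 (f1 x') M (cf1 x') (fun s => fM _) (f1s x')).
- have mc : measurable_fun (setT : set (measurableTypeR R * 'rV[R]_n)) (@rV_cons R n).
    exact: measurable_rV_cons.
  have mfc := measurableT_comp mf2 mc.
  apply: (measurable_fun_fubini_tonelli_G (m1 := mu) _ mfc) => p.
  by rewrite /= lee_fin sqr_ge0.
- by move=> x' _; apply: integral_ge0 => s _; rewrite lee_fin sqr_ge0.
Qed.

End parseval.

(** * A frame of localized exponentials *)

Section near.
Context (R : realType) (n : nat).
Local Notation Rn := 'rV[R]_n.
Local Notation Zn := 'rV[int]_n.
Local Notation B := {ffun 'I_n -> 'I_4}.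
Implicit Types (x : Rn) (m : Zn) (b : B).

Definition lattice_pt m : Rn := map_mx intr m.

(** The 4^n lattice points floor(x) + {-1, 0, 1, 2}^n contain all those at distance less than 2 from
    x in every coordinate. Indexing by a fixed finite type makes sums over them finite sums with an
    x-independent number of terms. *)
Definition near_pt x b : Zn := \row_i (Num.floor (x ord0 i) + (b i)%:Z - 1).

Lemma near_ptP x m : (forall i, `|x ord0 i - (m ord0 i)%:~R| < 2) -> exists b, m = near_pt x b.
Proof.
move=> h.
have /choice[b cell_bump] : forall i, exists c : 'I_4, m ord0 i = Num.floor (x ord0 i) + c%:Z - 1.
  move=> i; have := h i; have /andP[f1 f2] := floor_itv (x ord0 i).
  rewrite ltr_norml => /andP[h1 h2].
  set f := Num.floor _ in f1 f2 *; pose d := m ord0 i - f + 1.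
  have d0 : 0 <= d.
    rewrite -ltzD1 -(ltr_int R) /d !rmorphD/= !rmorphN/=; move: f2; rewrite rmorphD/=; lra.
  have d4 : d < 4.
    rewrite -(ltr_int R) /d !rmorphD/= !rmorphN/=; move: f1; lra.
  have d4' : (`|d| < 4)%N by rewrite -ltz_nat gez0_abs.
  by exists (Ordinal d4'); rewrite /= gez0_abs// /d; ring.
by exists (finfun b); apply/rowP => i; rewrite mxE ffunE -cell_bump.
Qed.

Lemma near_pt_inj x : injective (near_pt x).
Proof.
move=> b c /rowP h; apply/ffunP => i; have := h i; rewrite !mxE.
by move=> /addIr/addrI[] /val_inj.
Qed.

Lemma near_esum x (a : Zn -> \bar R) : (forall m, (0 <= a m)%E) ->
  (forall m i, 2 <= `|x ord0 i - (m ord0 i)%:~R| -> a m = 0%E) ->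
  \esum_(m in [set: Zn]) a m = (\sum_(b : B) a (near_pt x b))%E.
Proof.
move=> a0 aS; pose s := [seq near_pt x b | b <- enum {: B}].
have us : uniq s by rewrite map_inj_uniq ?enum_uniq//; exact: near_pt_inj.
transitivity (\esum_(m in [set` s]) a m).
  rewrite [RHS]esum_mkcond; apply: eq_esum => m _; case: ifPn => // /negP ms.
  have [i hi] : exists i, 2 <= `|x ord0 i - (m ord0 i)%:~R|.
    apply: contrapT => /forallNP h; apply: ms; rewrite inE/=.
    have [|b ->] := @near_ptP x m; first by move=> i; rewrite ltNge; apply/negP; exact: h.
    by apply: map_f; rewrite mem_enum.
  exact: aS hi.
rewrite esum_fset; [|exact: finite_seq|by move=> *].
by rewrite -fsbig_seq// big_map big_enum.
Qed.

Let eta_sum (x : R) : \sum_(c < 4) eta (x - (Num.floor x + c%:Z - 1)%:~R) = 1.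
Proof.
have /andP[f1 f2] := floor_itv x; move: f2; rewrite rmorphD/= => f2.
set f := (Num.floor x)%:~R : R in f1 f2 *.
rewrite !big_ord_recr big_ord0 /= add0r.
have E (c : nat) : (Num.floor x + c%:Z - 1)%:~R = f + c%:R - 1 :> R.
  by rewrite !rmorphD/= rmorphN/= -pmulrn.
rewrite !E /eta step1; last by lra.
rewrite [step (x - (f + 3%:R - 1))]step0; last by lra.
rewrite (_ : x - (f + 0%:R - 1) = x - (f + 1%:R - 1) + 1); last by lra.
rewrite (_ : x - (f + 1%:R - 1) = x - (f + 2%:R - 1) + 1); last by lra.
rewrite (_ : x - (f + 2%:R - 1) = x - (f + 3%:R - 1) + 1); last by lra.
ring.
Qed.

Lemma bump_near_sum x : \sum_(b : B) cell_bump (x - lattice_pt (near_pt x b)) = 1.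
Proof.
transitivity (\prod_(i < n) \sum_(c < 4) eta (x ord0 i - (Num.floor (x ord0 i) + c%:Z - 1)%:~R)).
  by rewrite bigA_distr_bigA; apply: eq_bigr => b _; apply: eq_bigr => i _; rewrite !mxE.
by rewrite big1 => // i _; exact: eta_sum.
Qed.

Let step_le1 (s : R) : 0 <= step s <= 1.
Proof.
have d0 : 0 < flat 0 s + flat 0 (1 - s).
  have [h|h] := ltP 0 s.
    by rewrite ltr_pwDl ?flat_ge0// /flat h mulr_gt0 ?expR_gt0// invr_gt0 exprn_gt0.
  rewrite ltr_wpDl ?flat_ge0// /flat ifT; last by lra.
  by rewrite mulr_gt0 ?expR_gt0// invr_gt0 exprn_gt0//; lra.
apply/andP; split; first by rewrite divr_ge0 ?flat_ge0 ?ltW.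
by rewrite /step ler_pdivrMr// mul1r lerDl flat_ge0.
Qed.

Let tens_le1 (f : R -> R) x : (forall s, `|f s| <= 1) -> `|tens f x| <= 1.
Proof. by move=> h; rewrite /tens normr_prod; apply: prodr_ile1 => i _; rewrite normr_ge0 h. Qed.

Lemma bump_le1 x : `|cell_bump x| <= 1.
Proof.
apply: tens_le1 => s; rewrite /eta ler_norml.
by have /andP[a1 a2] := step_le1 (s + 1); have /andP[a3 a4] := step_le1 s; apply/andP; split; lra.
Qed.

Lemma wide_bump_le1 x : `|wide_cell_bump x| <= 1.
Proof.
apply: tens_le1 => s; rewrite /etaw ler_norml.
by have /andP[a1 a2] := step_le1 (s + 2); have /andP[a3 a4] := step_le1 (s - 1); apply/andP; split; lra.
Qed.

Definition num_cells : R := #|{: B}|%:R.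

Lemma num_cells_gt0 : 0 < num_cells.
Proof. by rewrite ltr0n; apply/card_gt0P; exists [ffun=> ord0]. Qed.

(** Cauchy-Schwarz applied to the sum 1 of at most [num_cells] translates. *)
Lemma bump_near_sq x : num_cells^-1 <= \sum_(b : B) cell_bump (x - lattice_pt (near_pt x b)) ^+ 2.
Proof.
have := sum_CS (index_enum B) xpredT (fun b => cell_bump (x - lattice_pt (near_pt x b))) (fun=> 1 : R).
under eq_bigr do rewrite mulr1; rewrite bump_near_sum expr1n.
by rewrite sumr_const -/num_cells -ler_pdivrMr ?num_cells_gt0// mul1r.
Qed.

Lemma near_sq_le x (t : Rn -> R) : (forall y, `|t y| <= 1) -> \sum_(b : B) t (x - lattice_pt (near_pt x b)) ^+ 2 <= num_cells.
Proof.
move=> t1; apply: (@le_trans _ _ (\sum_(b : B) 1)); last by rewrite sumr_const.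
by apply: ler_sum => b _; rewrite -real_normK ?num_real// exprn_ile1.
Qed.

Lemma bump_supp_coord x i : 2 <= `|x ord0 i| -> cell_bump x = 0.
Proof.
by move=> h; rewrite /cell_bump /tens (bigD1 i)//= eta_supp ?mul0r// (le_trans _ h)// ler1n.
Qed.

Lemma wide_bump_supp_coord x i : 2 <= `|x ord0 i| -> wide_cell_bump x = 0.
Proof. by move=> h; rewrite /wide_cell_bump /tens (bigD1 i)//= etaw_supp ?mul0r. Qed.

Lemma bump_ccont (a : Rn) : ccont (fun x => (cell_bump (x - a))%:C).
Proof.
have c := symk_cont tt (@bump_sym R n 0 0).
apply: (ccont_comp (j := fun x : Rn => x - a)) c => x.
exact: (cvgB cvg_id (cvg_cst a)).
Qed.

Lemma wide_bump_ccont (a : Rn) : ccont (fun x => (wide_cell_bump (x - a))%:C).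
Proof.
have c := symk_cont tt (@wide_bump_sym R n 0 0).
apply: (ccont_comp (j := fun x : Rn => x - a)) c => x.
exact: (cvgB cvg_id (cvg_cst a)).
Qed.

End near.

Section frame.
Context (R : realType) (n : nat).
Local Notation Rn := 'rV[R]_n.
Local Notation Zn := 'rV[int]_n.
Local Notation L := ('rV[int]_n * 'rV[int]_n)%type.
Local Notation B := {ffun 'I_n -> 'I_4}.
Local Notation leb := (lebesgue_rV R n).
Local Notation Re := complex.Re.
Local Notation Im := complex.Im.
Local Notation c2p := ((pi *+ 2) ^+ n : R).
Implicit Types (x : Rn) (m : Zn) (b : B) (f g u v : Rn -> R[i]) (j : L).

Definition gabor_atom (t : Rn -> R) j x : R[i] := (t (x - lattice_pt R j.1))%:C * cexpi (kdot j.2 x).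

Definition cbd f := ccont f /\ exists M, forall x, normc (f x) <= M.

(** The pairing for bare functions: it is also used for bounded continuous f that are not yet known
    to be in L^2. *)
Definition ip2 f g : R[i] := cintegral leb (fun x => f x * conjc (g x)).

Lemma cbdD f g : cbd f -> cbd g -> cbd (fun x => f x + g x).
Proof.
move=> [cf [M hM]] [cg [N hN]]; split; first exact: ccontD.
by exists (M + N) => x; rewrite (le_trans (le_normcD _ _))// lerD.
Qed.

Lemma cbdM f g : cbd f -> cbd g -> cbd (fun x => f x * g x).
Proof.
move=> [cf [M hM]] [cg [N hN]]; split; first exact: ccontM.
by exists (M * N) => x; rewrite normcM ler_pM ?normc_ge0.
Qed.

Lemma cbd_cst c : cbd (fun=> c).
Proof. by split; [exact: ccont_cst|exists (normc c)]. Qed.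

Lemma cbd_bump (a : Rn) : cbd (fun x => (cell_bump (x - a))%:C).
Proof. by split; [exact: bump_ccont|exists 1 => x; rewrite normc_real bump_le1]. Qed.

Lemma cbd_wide_bump (a : Rn) : cbd (fun x => (wide_cell_bump (x - a))%:C).
Proof. by split; [exact: wide_bump_ccont|exists 1 => x; rewrite normc_real wide_bump_le1]. Qed.

Lemma cbd_cexpi (k : Zn) : cbd (fun x : Rn => cexpi (kdot k x)).
Proof.
split; last by exists 1 => x; rewrite normc_cexpi.
by apply: ccont_cexpi; exact: continuous_kdot.
Qed.

(* Parseval on a cube applied to glue gives at once the frame bounds
   (u = 0 or v = 0) and, by polarization, the reproducing formula. *)
Definition glue u v m x := (wide_cell_bump (x - lattice_pt R m))%:C * u x + (cell_bump (x - lattice_pt R m))%:C * v x.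

Lemma ft_glue u v j : cbd u -> cbd v -> ft (glue u v j.1) j.2 = ip2 u (gabor_atom (@wide_cell_bump R n) j) + ip2 v (gabor_atom (@cell_bump R n) j).
Proof.
move=> cu cv; have H (t : Rn -> R) f : cbd f -> cbd (fun x => (t (x - lattice_pt R j.1))%:C) ->
    (forall x i, 2 <= `|x ord0 i| -> t x = 0) -> cintegrable leb (fun x => f x * conjc (gabor_atom t j x)).
  move=> cf ct ts.
  have [cF [M hM]] := cbdM cf ct.
  have M0 : 0 <= M by exact: le_trans (normc_ge0 _) (hM 0).
  have E : (fun x => f x * conjc (gabor_atom t j x)) = (fun x => f x * (t (x - lattice_pt R j.1))%:C * conjc (cexpi (kdot j.2 x))).
    apply/funext => x; rewrite /gabor_atom conjcM -mulrA; congr (_ * (_ * _)).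
    by apply: complexP; rewrite !cE//= oppr0.
  rewrite E; apply: (cint_wt (C := M * (3 + `|lattice_pt R j.1|) ^+ (2 * n))).
    apply: ccont_meas1; apply: ccontM => //; apply: ccontJ.
    by have [] := cbd_cexpi j.2.
  move=> x; rewrite normcM normcJ' normc_cexpi mulr1.
  apply: (supp_wt (f := fun x => f x * (t (x - lattice_pt R j.1))%:C)) => // {}x i h.
  by rewrite (ts _ i) ?mulr0// !mxE; move: h; rewrite mxE.
rewrite /ip2 -cintegralD; first last.
- by apply: H => //; [exact: cbd_bump|exact: bump_supp_coord].
- by apply: H => //; [exact: cbd_wide_bump|exact: wide_bump_supp_coord].
apply: eq_cintegral => x; rewrite /glue /gabor_atom cexpiN !conjcM.
have J (s : R) : conjc (s%:C : R[i]) = s%:C by apply: complexP; rewrite !cE//= oppr0.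
rewrite !J; ring.
Qed.

Lemma glue_cbd u v m : cbd u -> cbd v -> cbd (glue u v m).
Proof. by move=> cu cv; apply: cbdD; apply: cbdM => //; [exact: cbd_wide_bump|exact: cbd_bump]. Qed.

(** For fixed position m the sum over frequencies is Parseval for the function [glue u v m],
    supported in a cube around m. Summing over m under the integral leaves finitely many m near each
    x. *)
Lemma key_identity u v : cbd u -> cbd v ->
  \esum_(j in [set: L]) (normc (ip2 u (gabor_atom (@wide_cell_bump R n) j) + ip2 v (gabor_atom (@cell_bump R n) j)) ^+ 2)%:E =
  (c2p%:E * \int[leb]_x (\sum_(b : B) normc (glue u v (near_pt x b) x) ^+ 2)%:E)%E.
Proof.
move=> cu cv.
have p0 : 0 <= c2p by rewrite exprn_ge0// mulrn_wge0// pi_ge0.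
transitivity (\esum_(m in [set: Zn]) \esum_(k in [set: Zn]) (normc (ft (glue u v m) k) ^+ 2)%:E).
  rewrite esum_esum; last by move=> *; rewrite lee_fin sqr_ge0.
  rewrite (_ : _ `*`` _ = setT); last by apply/seteqP; split.
  by apply: eq_esum => j _; rewrite -ft_glue.
transitivity (\esum_(m in [set: Zn]) (c2p%:E * sqint leb (glue u v m))%E).
  apply: eq_esum => m _; have [cg [M hM]] := glue_cbd m cu cv.
  apply: (parseval (c := lattice_pt R m) cg hM) => x i h.
  by rewrite /glue (@wide_bump_supp_coord R n _ i) ?(@bump_supp_coord R n _ i) ?mul0r ?addr0//; move: h; rewrite !mxE.
rewrite esumZ//; last by move=> m; exact: sqint_ge0.
congr (_ * _)%E; rewrite /sqint -integral_lsum; first last.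
- by move=> m x; rewrite lee_fin sqr_ge0.
- move=> m; apply/measurable_EFinP; apply: measurable_normc2; apply: ccont_meas1.
  by have [] := glue_cbd m cu cv.
apply: eq_integral => x _; rewrite (near_esum (x := x)).
- by rewrite sumEFin.
- by move=> m; rewrite lee_fin sqr_ge0.
move=> m i h; rewrite /glue (@wide_bump_supp_coord R n _ i) ?(@bump_supp_coord R n _ i) ?mul0r ?addr0 ?normc0 ?expr0n//; by rewrite !mxE.
Qed.

(** The case u = 0 of [key_identity], where the squares of the narrow windows add up to at least
    1/[num_cells]. *)
Lemma frame_lower v : cbd v ->
  ((c2p / num_cells R n)%:E * sqint leb v <= \esum_(j in [set: L]) (normc (ip2 v (gabor_atom (@cell_bump R n) j)) ^+ 2)%:E)%E.
Proof.
move=> cv; have p0 : 0 <= c2p by rewrite exprn_ge0// mulrn_wge0// pi_ge0.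
have := key_identity (cbd_cst 0) cv.
have Z j : ip2 (fun=> 0) (gabor_atom (@wide_cell_bump R n) j) = 0.
  by rewrite /ip2 -[RHS](cintegral0 leb); apply: eq_cintegral => x; rewrite mul0r.
under eq_esum do rewrite Z add0r.
move=> ->; rewrite EFinM -muleA; apply: lee_wpmul2l; first by rewrite lee_fin.
have mv := ccont_meas1 cv.1.
rewrite /sqint -ge0_integralZl//; first last.
- by rewrite lee_fin invr_ge0 ltW// num_cells_gt0.
- by move=> x _; rewrite lee_fin sqr_ge0.
- by apply/measurable_EFinP; exact: measurable_normc2.
apply: ge0_le_integral => //.
- by move=> x _; rewrite mule_ge0// lee_fin ?sqr_ge0// invr_ge0 ltW// num_cells_gt0.
- by apply: measurable_funeM; apply/measurable_EFinP; exact: measurable_normc2.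
- rewrite (_ : (fun x => _) = (fun x => \esum_(m in [set: Zn]) (normc (glue (fun=> 0) v m x) ^+ 2)%:E)).
    apply: measurable_esum => [m|m x]; last by rewrite lee_fin sqr_ge0.
    apply/measurable_EFinP; apply: measurable_normc2; apply: ccont_meas1.
    by have [] := glue_cbd m (cbd_cst 0) cv.
  apply/funext => x; rewrite (near_esum (x := x)); first by rewrite sumEFin.
    by move=> m; rewrite lee_fin sqr_ge0.
  by move=> m i h; rewrite /glue mulr0 add0r (@bump_supp_coord R n _ i) ?mul0r ?normc0 ?expr0n//; rewrite !mxE.
move=> x _; rewrite -EFinM lee_fin.
rewrite (eq_bigr (fun b => cell_bump (x - lattice_pt R (near_pt x b)) ^+ 2 * normc (v x) ^+ 2)) => [|b _]; last first.
  by rewrite /glue mulr0 add0r normcM normc_real exprMn real_normK ?num_real.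
by rewrite -mulr_suml ler_wpM2r ?sqr_ge0// bump_near_sq.
Qed.

Lemma Re_sq_polar (z w : R[i]) : 4 * Re (z * conjc w) = normc (z + w) ^+ 2 - normc (z - w) ^+ 2.
Proof. by rewrite !normc2 !cE; ring. Qed.

Lemma measurable_glue_sum u v : cbd u -> cbd v ->
  measurable_fun setT (fun x => \sum_(b : B) normc (glue u v (near_pt x b) x) ^+ 2).
Proof.
move=> cu cv; apply/measurable_EFinP.
rewrite (_ : (_ \o _) = (fun x => \esum_(m in [set: Zn]) (normc (glue u v m x) ^+ 2)%:E)).
  apply: measurable_esum => [m|m x]; last by rewrite lee_fin sqr_ge0.
  apply/measurable_EFinP; apply: measurable_normc2; apply: ccont_meas1.
  by have [] := glue_cbd m cu cv.
apply/funext => x; rewrite (near_esum (x := x)); first by rewrite sumEFin.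
  by move=> m; rewrite lee_fin sqr_ge0.
move=> m i h; rewrite /glue (@wide_bump_supp_coord R n _ i) ?(@bump_supp_coord R n _ i) ?mul0r ?addr0 ?normc0 ?expr0n//; by rewrite !mxE.
Qed.

Lemma glue_sum_le u v x : \sum_(b : B) normc (glue u v (near_pt x b) x) ^+ 2 <=
  2 * num_cells R n * normc (u x) ^+ 2 + 2 * num_cells R n * normc (v x) ^+ 2.
Proof.
have H (s t : R) (a b : R[i]) : normc (s%:C * a + t%:C * b) ^+ 2 <= 2 * s ^+ 2 * normc a ^+ 2 + 2 * t ^+ 2 * normc b ^+ 2.
  have := sqr_ge0 (s * Re a - t * Re b); have := sqr_ge0 (s * Im a - t * Im b).
  rewrite !normc2 !cE /= !mul0r !subr0 !addr0; lra.
apply: (le_trans (ler_sum _ (fun b _ => H _ _ _ _))).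
rewrite big_split/= -!mulr_suml -!mulr_sumr; apply: lerD; rewrite ler_wpM2r ?sqr_ge0// ler_wpM2l//.
  by apply: near_sq_le; exact: wide_bump_le1.
by apply: near_sq_le; exact: bump_le1.
Qed.

Definition L2c f := cbd f /\ L2 leb f.

Lemma L2c_gabor_atom (t : Rn -> R) j : (forall a, cbd (fun x => (t (x - a))%:C)) ->
  (forall x i, 2 <= `|x ord0 i| -> t x = 0) -> L2c (gabor_atom t j).
Proof.
move=> ct ts; have cf : cbd (gabor_atom t j) by apply: cbdM; [exact: ct|exact: cbd_cexpi].
split=> //; have [cc [M hM]] := cf.
have M0 : 0 <= M by exact: le_trans (normc_ge0 _) (hM 0).
apply: (L2_le (g := fun x => M ^+ 2 * (3 + `|lattice_pt R j.1|) ^+ (2 * n) * wt x)).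
- exact: ccont_meas1.
- move=> x; rewrite -[leLHS]ger0_norm ?sqr_ge0// -normc_real.
  apply: (supp_wt (f := fun x => (normc (gabor_atom t j x) ^+ 2)%:C)) => [|{}x|{}x i h].
  + exact: sqr_ge0.
  + by rewrite normc_real ger0_norm ?sqr_ge0//; apply: lerXn2r; rewrite ?nnegrE ?normc_ge0.
  + by rewrite /gabor_atom (ts _ i) ?mul0r ?normc0 ?expr0n//; move: h; rewrite !mxE.
- exact: integrable_cwt.
Qed.

Lemma L2c_bump j : L2c (gabor_atom (@cell_bump R n) j).
Proof. by apply: L2c_gabor_atom; [exact: cbd_bump|exact: bump_supp_coord]. Qed.

Lemma L2c_wide_bump j : L2c (gabor_atom (@wide_cell_bump R n) j).
Proof. by apply: L2c_gabor_atom; [exact: cbd_wide_bump|exact: wide_bump_supp_coord]. Qed.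

Lemma glue_sum_integrable u v : L2c u -> L2c v ->
  leb.-integrable setT (EFin \o (fun x => \sum_(b : B) normc (glue u v (near_pt x b) x) ^+ 2)).
Proof.
move=> [cu lu] [cv lv].
apply: (@le_integrable_real _ _ _ leb _ (fun x => 2 * num_cells R n * normc (u x) ^+ 2 + 2 * num_cells R n * normc (v x) ^+ 2)).
- exact: measurable_glue_sum.
- by move=> x; rewrite ger0_norm ?glue_sum_le// sumr_ge0// => b _; exact: sqr_ge0.
have I f : L2 leb f -> leb.-integrable setT (EFin \o (fun x => 2 * num_cells R n * normc (f x) ^+ 2)).
  move=> lf; rewrite (_ : EFin \o _ = (fun x => (2 * num_cells R n)%:E * (EFin \o (fun x => (normc (f x) ^+ 2)%R)) x)%E); last by apply/funext.
  by apply: integrableZl => //; exact: L2_integrable.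
rewrite (_ : EFin \o _ = (EFin \o (fun x => (2 * num_cells R n * normc (u x) ^+ 2)%R)) \+ (EFin \o (fun x => (2 * num_cells R n * normc (v x) ^+ 2)%R)))%E; last by apply/funext.
by apply: integrableD => //; exact: I.
Qed.

Definition lattice_enum (q : nat) : option L := pickle_inv q.

(** Naturals that encode no lattice pair receive the coefficient 0, so that lattice families become
    sequences. *)
Definition coef (a : L -> R) (q : nat) : R := oapp a 0 (lattice_enum q).

Lemma lsum_real (a : L -> R) (X : R) : (forall j, 0 <= a j) ->
  \esum_(j in [set: L]) (a j)%:E = X%:E -> (fun N => \sum_(0 <= q < N) coef a q) @ \oo --> X.
Proof.
move=> a0 aX; have b0 j : (0 <= (a j)%:E)%E by rewrite lee_fin.
have aX' : lsum (fun j => (a j)%:E) = X%:E by rewrite lsumE.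
have cf q : oapp (fun j => (a j)%:E) 0%E (pickle_inv q) = (coef a q)%:E.
  by rewrite /coef /lattice_enum; case: pickle_inv.
have H : (fun N => \sum_(0 <= q < N) (coef a q)%:E)%E @ \oo --> X%:E.
  rewrite -aX' /lsum; under eq_eseriesr do rewrite cf.
  apply: is_cvg_nneseries => q _ _.
  by rewrite lee_fin /coef; case: (lattice_enum q) => //=.
have /fine_cvgP[_] := H; apply: cvg_trans; apply: near_eq_cvg; near=> N.
by rewrite /= sumEFin.
Unshelve. all: by end_near. Qed.

Lemma lsum_le (a : L -> R) (X : R) N : (forall j, 0 <= a j) ->
  (\esum_(j in [set: L]) (a j)%:E <= X%:E)%E -> \sum_(0 <= q < N) coef a q <= X.
Proof.
move=> a0 aX; rewrite -lee_fin -sumEFin; apply: le_trans aX; rewrite -lsumE; last by move=> j; rewrite lee_fin.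
rewrite /lsum.
have cf q : oapp (fun j => (a j)%:E) 0%E (pickle_inv q) = (coef a q)%:E.
  by rewrite /coef /lattice_enum; case: pickle_inv.
under [leRHS]eq_eseriesr do rewrite cf.
by apply: nneseries_lim_ge => q _ _; rewrite lee_fin /coef; case: (lattice_enum q) => //=.
Qed.

(** Subtract [key_identity] for (u, v) and (u, -v). The cross terms are 4 times wide window times
    narrow window times Re(u conj v); the product of the windows is the narrow one, and its
    translates add up to 1. *)
Lemma polar_frame u v : L2c u -> L2c v ->
  (fun N => \sum_(0 <= q < N) coef (fun j => Re (ip2 u (gabor_atom (@wide_cell_bump R n) j) * conjc (ip2 v (gabor_atom (@cell_bump R n) j)))) q)
   @ \oo --> c2p * Re (ip2 u v).
Proof.
move=> Lu Lv; have [cu lu] := Lu; have [cv lv] := Lv.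
pose nv x := - v x.
have cnv : cbd nv.
  by have := cbdM (cbd_cst (-1)) cv; under eq_fun do rewrite mulN1r.
have lnv : L2 leb nv.
  have /L2P[mv iv] := lv; apply/L2P; split; first exact: ccont_meas1 cnv.1.
  by move: iv; rewrite /sqint /nv; under [in X in _ -> X]eq_integral do rewrite normcN.
have Lnv : L2c nv by [].
pose al j := ip2 u (gabor_atom (@wide_cell_bump R n) j); pose be j := ip2 v (gabor_atom (@cell_bump R n) j).
pose S w x : R := \sum_(b : B) normc (glue u w (near_pt x b) x) ^+ 2.
have fin w : L2c w -> \esum_(j in [set: L]) (normc (al j + ip2 w (gabor_atom (@cell_bump R n) j)) ^+ 2)%:E = (c2p * \int[leb]_x S w x)%:E.
  move=> Lw; rewrite /al key_identity//; last by have [] := Lw.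
  by rewrite EFinM /Rintegral fineK//; apply: integrable_fin_num => //; exact: glue_sum_integrable.
have h1 := lsum_real (fun j => sqr_ge0 _) (fin _ Lv).
have h2 := lsum_real (fun j => sqr_ge0 _) (fin _ Lnv).
have nbe j : ip2 nv (gabor_atom (@cell_bump R n) j) = - be j.
  rewrite /ip2 /nv /be -mulN1r /ip2 -cintegralZ; first by apply: eq_cintegral => x; rewrite mulrA mulN1r.
  by apply: L2_cintegrable => //; have [] := L2c_bump j.
have H : (fun N => \sum_(0 <= q < N) coef (fun j => Re (al j * conjc (be j))) q) =
   (fun N => 4^-1 * (\sum_(0 <= q < N) coef (fun j => normc (al j + be j) ^+ 2) q
     - \sum_(0 <= q < N) coef (fun j => normc (al j + ip2 nv (gabor_atom (@cell_bump R n) j)) ^+ 2) q)).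
  apply/funext => N; rewrite -sumrB mulr_sumr; apply: eq_bigr => q _.
  rewrite /coef; case: (lattice_enum q) => [j|]; last by rewrite /= subr0 mulr0.
  change (Re (al j * conjc (be j)) =
    4^-1 * (normc (al j + be j) ^+ 2 - normc (al j + ip2 nv (gabor_atom (@cell_bump R n) j)) ^+ 2)).
  by rewrite nbe -Re_sq_polar mulKf.
rewrite H (_ : c2p * _ = 4^-1 * (c2p * (\int[leb]_x S v x) - c2p * (\int[leb]_x S nv x))).
  by apply: cvgM; [exact: cvg_cst|exact: cvgB].
rewrite -mulrBr mulrCA; congr (_ * _).
rewrite -RintegralB//; try exact: glue_sum_integrable.
rewrite -RintegralZl//; last first.
  rewrite (_ : EFin \o _ = (EFin \o S v) \- (EFin \o S nv))%E; last by apply/funext.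
  by apply: integrableB => //; exact: glue_sum_integrable.
apply: eq_Rintegral => x _; rewrite /S -sumrB.
rewrite (eq_bigr (fun b => 4 * (cell_bump (x - lattice_pt R (near_pt x b)) * Re (u x * conjc (v x))))) => [|b _].
  by rewrite -mulr_sumr -mulr_suml bump_near_sum mul1r mulKf.
rewrite /glue /nv mulrN -Re_sq_polar; congr (_ * _); rewrite -[in RHS](bump_wide_bump (x - lattice_pt R _)) !cE/=; ring.
Qed.

End frame.
Arguments lattice_enum {n}.

Section gabor.
Context (R : realType) (n : nat).
Local Notation Rn := 'rV[R]_n.
Local Notation Zn := 'rV[int]_n.
Local Notation L := ('rV[int]_n * 'rV[int]_n)%type.
Local Notation B := {ffun 'I_n -> 'I_4}.
Local Notation leb := (lebesgue_rV R n).
Local Notation Re := complex.Re.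
Local Notation Im := complex.Im.
Local Notation c2p := ((pi *+ 2) ^+ n : R).
Local Notation E := (L2t leb).
Local Notation phi := (gabor_atom (@cell_bump R n)).
Local Notation theta := (gabor_atom (@wide_cell_bump R n)).
Implicit Types (j : L) (f : E) (u v w : Rn -> R[i]).

Let hi : sesq (@ip _ _ _ leb) := ip_sesq leb.
Let ip0 : forall f, 0 <= nsq (@ip _ _ _ leb) f := ip_ge0 (mu := leb).

Lemma c2p_gt0 : 0 < c2p.
Proof. by rewrite exprn_gt0// pmulrn_lgt0// pi_gt0. Qed.

Lemma esum_le_partial (a : L -> R) (X : R) : (forall j, 0 <= a j) ->
  (forall N, \sum_(0 <= q < N) coef a q <= X) ->
  (\esum_(j in [set: L]) (a j)%:E <= X%:E)%E.
Proof.
move=> a0 aX; rewrite -lsumE; last by move=> j; rewrite lee_fin.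
have cf q : oapp (fun j => (a j)%:E) 0%E (pickle_inv q) = (coef a q)%:E.
  by rewrite /coef /lattice_enum; case: pickle_inv.
rewrite /lsum; under eq_eseriesr do rewrite cf.
apply: lime_le.
  by apply: is_cvg_nneseries => q _ _; rewrite lee_fin /coef; case: (lattice_enum q) => //= j.
by apply: nearW => N; rewrite sumEFin lee_fin.
Qed.

(** A bound on the coefficients of a bounded continuous function proves at the same time that it is
    in L^2. *)
Lemma frame_bound w (X : R) : cbd w ->
  (forall N, \sum_(0 <= q < N) coef (fun j => normc (ip2 w (phi j)) ^+ 2) q <= X) ->
  (sqint leb w <= (num_cells R n / c2p * X)%:E)%E.
Proof.
move=> cw hX; have := le_trans (frame_lower cw) (esum_le_partial (fun j => sqr_ge0 _) hX).
have p0 := c2p_gt0; have n0 := num_cells_gt0 R n.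
have c0 : 0 < c2p / num_cells R n by rewrite divr_gt0.
rewrite -lee_pdivlMl// => /le_trans; apply.
by rewrite -EFinM lee_fin invf_div.
Qed.

Lemma upper_frame v : L2c v -> forall N,
  \sum_(0 <= q < N) coef (fun j => normc (ip2 v (phi j)) ^+ 2) q <= c2p * (2 * num_cells R n) * fine (sqint leb v).
Proof.
move=> Lv N; have [cv lv] := Lv.
apply: lsum_le => [j|]; first exact: sqr_ge0.
have L0 : L2c (fun _ : Rn => 0 : R[i]).
  split; first exact: cbd_cst.
  apply/L2P; split; first exact: cmeasurable_cst.
  by rewrite /sqint; under eq_integral do rewrite normc0 expr0n; rewrite integral0 ltry.
have Z j : ip2 (fun=> 0) (theta j) = 0.
  by rewrite /ip2 -[RHS](cintegral0 leb); apply: eq_cintegral => x; rewrite mul0r.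
rewrite (_ : \esum_(j in _) _ = \esum_(j in [set: L])
    (normc (ip2 (fun=> 0) (theta j) + ip2 v (phi j)) ^+ 2)%:E); last first.
  by apply: eq_esum => j _; rewrite Z add0r.
rewrite (key_identity L0.1 cv).
have /L2P[mv iv] := lv.
rewrite -mulrA EFinM; apply: lee_wpmul2l; first by rewrite lee_fin ltW// c2p_gt0.
rewrite EFinM fineK; last by rewrite ge0_fin_numE// sqint_ge0.
have nn0 : (0 <= (2 * num_cells R n)%:E)%E by rewrite lee_fin mulr_ge0// ltW// num_cells_gt0.
rewrite /sqint -ge0_integralZl//; first last.
- by move=> x _; rewrite lee_fin sqr_ge0.
- by apply/measurable_EFinP; exact: measurable_normc2.
apply: ge0_le_integral => //.
- by move=> x _; rewrite lee_fin; apply: sumr_ge0 => b _; exact: sqr_ge0.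
- by apply/measurable_EFinP; exact: measurable_glue_sum L0.1 cv.
- by apply: measurable_funeM; apply/measurable_EFinP; exact: measurable_normc2.
move=> x _; rewrite -EFinM lee_fin.
by have := glue_sum_le (fun=> 0) v x; rewrite normc0 expr0n mulr0 add0r.
Qed.

Lemma upper_frame_w v : L2c v -> forall N,
  \sum_(0 <= q < N) coef (fun j => normc (ip2 v (theta j)) ^+ 2) q <= c2p * (2 * num_cells R n) * fine (sqint leb v).
Proof.
move=> Lv N; have [cv lv] := Lv.
apply: lsum_le => [j|]; first exact: sqr_ge0.
have c0 : cbd (fun _ : Rn => 0 : R[i]) by exact: cbd_cst.
have Z j : ip2 (fun=> 0) (phi j) = 0.
  by rewrite /ip2 -[RHS](cintegral0 leb); apply: eq_cintegral => x; rewrite mul0r.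
rewrite (_ : \esum_(j in _) _ = \esum_(j in [set: L])
    (normc (ip2 v (theta j) + ip2 (fun=> 0) (phi j)) ^+ 2)%:E); last first.
  by apply: eq_esum => j _; rewrite Z addr0.
rewrite (key_identity cv c0).
have /L2P[mv iv] := lv.
rewrite -mulrA EFinM; apply: lee_wpmul2l; first by rewrite lee_fin ltW// c2p_gt0.
rewrite EFinM fineK; last by rewrite ge0_fin_numE// sqint_ge0.
have nn0 : (0 <= (2 * num_cells R n)%:E)%E by rewrite lee_fin mulr_ge0// ltW// num_cells_gt0.
rewrite /sqint -ge0_integralZl//; first last.
- by move=> x _; rewrite lee_fin sqr_ge0.
- by apply/measurable_EFinP; exact: measurable_normc2.
apply: ge0_le_integral => //.
- by move=> x _; rewrite lee_fin; apply: sumr_ge0 => b _; exact: sqr_ge0.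
- by apply/measurable_EFinP; exact: measurable_glue_sum cv c0.
- by apply: measurable_funeM; apply/measurable_EFinP; exact: measurable_normc2.
move=> x _; rewrite -EFinM lee_fin.
by have := glue_sum_le v (fun=> 0) x; rewrite normc0 expr0n mulr0 addr0.
Qed.

Definition vec (F : L -> E) (q : nat) : E := oapp F 0 (lattice_enum q).

Definition fphi j : E := toL2 (L2c_bump R j).2.
Definition ftheta j : E := toL2 (L2c_wide_bump R j).2.

Lemma L2cD u v : L2c u -> L2c v -> L2c (fun x => u x + v x).
Proof.
move=> [cu lu] [cv lv]; split; first exact: cbdD.
exact: (L2eP (toL2 lu + toL2 lv)).
Qed.

Lemma L2cZ (c : R[i]) u : L2c u -> L2c (fun x => c * u x).
Proof.
move=> [cu lu]; split; first by apply: cbdM => //; exact: cbd_cst.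
exact: (L2eP (c *: toL2 lu)).
Qed.

Lemma L2c_vec (F : L -> E) (c : nat -> R[i]) N : (forall j, L2c (L2e (F j))) ->
  L2c (L2e (\sum_(0 <= q < N) c q *: vec F q)).
Proof.
move=> hF; elim: N => [|N IH].
  rewrite big_geq//; split; first exact: cbd_cst.
  exact: L2eP.
rewrite big_nat_recr//=; apply: (L2cD (v := L2e (c N *: vec F N))) => //.
apply: (L2cZ _ (u := L2e (vec F N))); rewrite /vec; case: (lattice_enum N) => [j|]; first exact: hF.
by split; [exact: cbd_cst|exact: (L2eP (0 : E))].
Qed.

(** Frame bounds are available for continuous functions only. Finite combinations of the [F j] are
    continuous, so the dual inequality holds on them, and duality returns the Bessel bound on all of
    L^2. *)
Let cob (F : L -> E) C : 0 <= C -> (forall j, L2c (L2e (F j))) ->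
  (forall f, L2c (L2e f) -> forall N, \sum_(0 <= q < N) normc (ip f (vec F q)) ^+ 2 <= C * nsq (@ip _ _ _ leb) f) ->
  bessel (@ip _ _ _ leb) (vec F) C.
Proof.
move=> C0 hF hC; apply: cobessel_bessel => // c N.
set f := \sum_(_ <= _ < _) _; set S := \sum_(_ <= _ < _) _.
have S0 : 0 <= S by apply: sumr_ge0 => q _; exact: sqr_ge0.
have [x0|x0] := ltP 0 (nsq (@ip _ _ _ leb) f); last exact: (le_trans x0 (mulr_ge0 _ _)).
have Lf : L2c (L2e f) by exact: L2c_vec.
have hB := hC f Lf N.
have E1 : nsq (@ip _ _ _ leb) f = Re (\sum_(0 <= q < N) conjc (c q) * ip f (vec F q)).
  by rewrite /nsq {2}/f (sesq_sumr hi); congr (Re _); apply: eq_bigr => q _; rewrite (sesqZr hi).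
have : nsq (@ip _ _ _ leb) f <= \sum_(0 <= q < N) normc (c q) * normc (ip f (vec F q)).
  rewrite E1 (le_trans (ler_norm _))// (le_trans (Re_le_normc _))// (le_trans (normc_sum _ _ _))//.
  by apply: ler_sum => q _; rewrite normcM normcJ'.
set Y := \sum_(_ <= _ < _) _ * _ => hY.
have Y2 : Y ^+ 2 <= S * (C * nsq (@ip _ _ _ leb) f).
  by apply: (le_trans (sum_CS _ _ _ _)); rewrite ler_wpM2l.
have : nsq (@ip _ _ _ leb) f ^+ 2 <= S * (C * nsq (@ip _ _ _ leb) f).
  apply: le_trans Y2; apply: lerXn2r => //; rewrite nnegrE; first exact: ltW.
  exact: le_trans (ltW x0) hY.
by rewrite expr2 mulrA ler_pM2r// mulrC.
Qed.

Definition frame_const : R := c2p * (2 * num_cells R n).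

Lemma frame_const_ge0 : 0 <= frame_const.
Proof. by rewrite /frame_const !mulr_ge0// ltW// ?c2p_gt0 ?num_cells_gt0. Qed.

Let coefvec (F : L -> E) f N : \sum_(0 <= q < N) normc (ip f (vec F q)) ^+ 2 =
  \sum_(0 <= q < N) coef (fun j => normc (ip f (F j)) ^+ 2) q.
Proof.
apply: eq_bigr => q _; rewrite /vec /coef; case: (lattice_enum q) => [j|] //.
by change (normc (ip f 0) ^+ 2 = 0); rewrite (sesq0r hi) normc0 expr0n.
Qed.

Lemma bessel_phi : bessel (@ip _ _ _ leb) (vec fphi) frame_const.
Proof.
apply: cob => //; [exact: frame_const_ge0|by move=> j; exact: L2c_bump|move=> f Lf N].
rewrite coefvec; have := upper_frame Lf N.
by rewrite sqint_nsq.
Qed.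

Lemma bessel_theta : bessel (@ip _ _ _ leb) (vec ftheta) frame_const.
Proof.
apply: cob => //; [exact: frame_const_ge0|by move=> j; exact: L2c_wide_bump|move=> f Lf N].
rewrite coefvec; have := upper_frame_w Lf N.
by rewrite sqint_nsq.
Qed.

(** [polar_frame] shows that the limit [T f] and (2 pi)^n f have the same coefficients against all
    phi_j. The lower frame bound does not apply to their difference, since [T f] is not known to be
    continuous; it is applied to the partial sums minus (2 pi)^n f instead. *)
Lemma reproducing u (Lu : L2c u) :
  cvg_nrm (@ip _ _ _ leb) (partial_syn (@ip _ _ _ leb) (vec ftheta) (vec fphi) (toL2 Lu.2)) (c2p%:C *: toL2 Lu.2).
Proof.
have [T hT] := syn_exists hi ip0 (@L2_complete _ _ _ leb) frame_const_ge0 bessel_theta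
  (bessel_cobessel hi frame_const_ge0 bessel_phi).
set f := toL2 Lu.2; set pt := partial_syn _ _ _ f.
have Re_eq v (Lv : L2c v) : Re (ip (T f) (toL2 Lv.2)) = c2p * Re (ip f (toL2 Lv.2)).
  have h1 := polar_frame Lu Lv.
  have h2 : (fun N => Re (ip (pt N) (toL2 Lv.2))) @ \oo --> Re (ip (T f) (toL2 Lv.2)).
    apply/cvgrPdist_lt => e e0.
    have V0 : 0 < nrm (@ip _ _ _ leb) (toL2 Lv.2) + 1 by have := nrm_ge0 (@ip _ _ _ leb) (toL2 Lv.2); lra.
    have [|N hN] := hT f (e / (nrm (@ip _ _ _ leb) (toL2 Lv.2) + 1)); first by rewrite divr_gt0.
    exists N => // k /= Nk; have := hN k Nk; rewrite ltr_pdivlMr// => hk.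
    rewrite distrC (_ : _ - _ = Re (ip (pt k - T f) (toL2 Lv.2))); last by rewrite (sesqBl hi) !cE.
    rewrite (le_lt_trans (Re_le_normc _))// (le_lt_trans (CS hi ip0 _ _))//.
    apply: le_lt_trans hk; rewrite ler_wpM2l ?nrm_ge0//; lra.
  suff h3 : (fun N => Re (ip (pt N) (toL2 Lv.2))) = (fun N => \sum_(0 <= q < N)
      coef (fun j => Re (ip2 u (theta j) * conjc (ip2 v (phi j)))) q).
    by rewrite h3 in h2; exact: (cvg_unique _ h2 h1).
  apply/funext => N; rewrite /pt /partial_syn (sesq_suml hi) Re_sum; apply: eq_bigr => q _.
  rewrite (sesqZl hi) /vec /coef; case: (lattice_enum q) => [j|]; last first.
    by change (Re (ip f 0 * ip 0 (toL2 Lv.2)) = 0); rewrite (sesq0r hi) mul0r.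
  rewrite [oapp _ _ _]/= [X in Re (_ * X)](sesqC hi).
  by [].
(* [polar_frame] gives real parts; testing with i phi_j as well gives the imaginary parts. *)
have eqip j : ip (T f) (fphi j) = c2p%:C * ip f (fphi j).
  have h1 := Re_eq _ (L2c_bump R j); have h2 := Re_eq _ (L2cZ (0 +i* 1) (L2c_bump R j)).
  have E1 : toL2 (L2cZ (0 +i* 1) (L2c_bump R j)).2 = (0 +i* 1) *: fphi j by apply: L2e_inj.
  move: h2; rewrite E1 !(sesqZr hi); move: h1; rewrite -/(fphi j).
  set a := ip (T f) _; set d := ip f _; case: a => a1 a2; case: d => d1 d2 /= h1 h2.
  by apply: complexP; rewrite /=; lra.
move=> e e0; have K0 : 0 < Num.sqrt (num_cells R n / c2p * frame_const) + 1 by rewrite ltr_wpDl ?sqrtr_ge0.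
have [|N hN] := hT f (e / (Num.sqrt (num_cells R n / c2p * frame_const) + 1)); first by rewrite divr_gt0.
exists N => k Nk; have := hN k Nk; rewrite ltr_pdivlMr// => hk.
have Lp : L2c (L2e (pt k)) by apply: L2c_vec => j; exact: L2c_bump.
(* [w] is continuous and has the same phi-coefficients as [pt k - T f], so its norm is at most a
   constant times |pt k - T f|, which tends to 0. *)
pose w := pt k - c2p%:C *: f.
have Lw : L2c (L2e w).
  have := L2cD Lp (L2cZ (- c2p%:C) Lu); rewrite (_ : (fun x => _) = L2e w)//.
  by apply/funext => x; rewrite /w L2eB L2eZ mulNr.
have nc : 0 <= num_cells R n / c2p by rewrite divr_ge0 ?ltW ?num_cells_gt0 ?c2p_gt0.
have : (sqint leb (L2e w) <= (num_cells R n / c2p * (frame_const * nsq (@ip _ _ _ leb) (pt k - T f)))%:E)%E.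
  apply: frame_bound => [|M]; first by have [] := Lw.
  apply: le_trans (bessel_phi (pt k - T f) M); rewrite coefvec.
  apply: ler_sum => q _; rewrite /coef; case: (lattice_enum q) => [j|]//.
  change (normc (ip w (fphi j)) ^+ 2 <= normc (ip (pt k - T f) (fphi j)) ^+ 2).
  by rewrite /w (sesqBl hi) (sesqZl hi) -eqip -(sesqBl hi).
rewrite sqint_nsq lee_fin mulrA => h.
have : nrm (@ip _ _ _ leb) w <= Num.sqrt (num_cells R n / c2p * frame_const) * nrm (@ip _ _ _ leb) (pt k - T f).
  have c0 : 0 <= num_cells R n / c2p * frame_const by exact: mulr_ge0 nc frame_const_ge0.
  rewrite /nrm -(sqrtrM _ c0); exact: ler_wsqrtr.
move=> /le_lt_trans; apply; apply: le_lt_trans hk; rewrite mulrC ler_wpM2l ?nrm_ge0//; lra.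
Qed.

End gabor.

(** * Temperate weights *)

Section temperance.
Context (R : realType) (n : nat).
Local Notation Rn := 'rV[R]_n.
Implicit Types (x y : Rn).

Lemma enorm_le x : enorm x <= n%:R * `|x|.
Proof.
rewrite -(@ler_pXn2r _ 2)// ?nnegrE ?sqrtr_ge0 ?mulr_ge0// sqr_sqrtr; last first.
  by apply: sumr_ge0 => i _; rewrite -expr2 sqr_ge0.
apply: (@le_trans _ _ (\sum_(i < n) `|x| ^+ 2)).
  apply: ler_sum => i _; rewrite -expr2 -real_normK ?num_real//.
  by apply: lerXn2r; rewrite ?nnegrE// rV_coord_le.
rewrite sumr_const card_ord -[leLHS]mulr_natl exprMn.
apply: ler_wpM2r; first exact: sqr_ge0.
by rewrite -natrX ler_nat -mulnn; case: (posnP n) => [->|h] //; rewrite leq_pmulr.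
Qed.

Lemma norm_le_enorm x : `|x| <= enorm x.
Proof.
apply: rV_norm_le => [|i]; first exact: sqrtr_ge0.
rewrite -sqrtr_sqr; apply: ler_wsqrtr; rewrite /dotv (bigD1 i)//= -expr2 lerDl.
by apply: sumr_ge0 => j _; rewrite -expr2 sqr_ge0.
Qed.

Lemma ball_bounded (f : Rn -> R) (r : R) : 0 <= r -> continuous f ->
  exists M, forall x, `|x| <= r -> f x <= M.
Proof.
move=> r0 cf; pose A := [set v : Rn | forall i : 'I_n, `[- r, r]%classic (v ord0 i)].
have cA : compact A by apply: (@rV_compact R n (fun=> `[- r, r]%classic)) => i; exact: segment_compact.
have A0 : A !=set0.
  by exists 0 => i; rewrite mxE /= in_itv/= oppr_le0 r0.
have [c _ hc] := EVT_max_rV A0 cA (continuous_subspaceT cf).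
exists (f c) => x xr; apply: hc; rewrite inE => i /=; rewrite in_itv/= -ler_norml.
exact: le_trans (rV_coord_le x i) xr.
Qed.

Lemma powR_le_nat (a : R) (s : R) : 1 <= a -> a `^ s <= a ^+ (Num.bound s).
Proof.
move=> a1; rewrite -powR_mulrn; last by rewrite (le_trans ler01).
by apply: ler_powR => //; exact: (ltW (unstable.ltr_bound s)).
Qed.

(** Set f = (q0/2 + G)^(1/(2 tau)). It is Lipschitz outside a ball, bounded on the ball, and bounded
    below by (q0/4)^(1/(2 tau)) thanks to the gap between q0/4 and q0/2. Hence f(y) <= K (1 + |x -
    y|) f(x), and the power 2 tau gives the claim. *)
Lemma tau_tempered (tau : R) (G : Rn -> R) : 0 < tau -> tau_function tau G ->
  exists q0 : R, [/\ 0 < q0, forall x, 0 < G x + q0 / 2 &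
    exists N (K : R), 0 <= K /\ forall x y, G y + q0 / 2 <= K * (1 + `|x - y|) ^+ N * (G x + q0 / 2)].
Proof.
move=> t0 [cG [q0 q00 [hq [C1 [r0 [C10 r00 hL]]]]]].
have pos x : 0 < G x + q0 / 2 by have := hq x; lra.
exists q0; split=> //.
pose s : R := 1 / (2 * tau); have s0 : 0 < s by rewrite divr_gt0// mulr_gt0.
pose f x := (q0 / 2 + G x) `^ s.
have fE x : q0 / 2 + G x = f x `^ (2 * tau).
  by rewrite /f -powRrM /s mul1r mulVf ?mulf_neq0 ?gt_eqF// powRr1// addrC ltW.
pose c := (q0 / 4) `^ s; have c0 : 0 < c by rewrite powR_gt0// divr_gt0.
have fc x : c <= f x.
  apply: ge0_ler_powR; rewrite ?nnegrE ?ltW//.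
  - by rewrite divr_gt0.
  - by rewrite addrC.
  - by have := hq x; lra.
have f0 x : 0 < f x by exact: lt_le_trans c0 (fc x).
have [M0 hM0] := ball_bounded (ltW r00) cG.
pose M := (q0 / 2 + M0) `^ s.
have fM x : enorm x <= r0 -> f x <= M.
  move=> xr; have h := hM0 x (le_trans (norm_le_enorm x) xr).
  by apply: (ge0_ler_powR (ltW s0)); rewrite ?nnegrE; have := pos x; move: h; lra.
have M_0 : 0 <= M by exact: powR_ge0.
suff [K [K0 hK]] : exists K : R, 0 <= K /\ forall x y, f y <= K * (1 + `|x - y|) * f x.
  pose K1 := Num.max K 1; have K11 : 1 <= K1 by rewrite le_max lexx orbT.
  exists (Num.bound (2 * tau)), (K1 ^+ Num.bound (2 * tau)); split.
    by rewrite exprn_ge0// (le_trans ler01).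
  move=> x y; rewrite ![G _ + _]addrC !fE -exprMn.
  have p1 : 1 <= K1 * (1 + `|x - y|) by rewrite mulr_ege1// lerDl.
  have t2 : 0 <= 2 * tau by rewrite ltW// mulr_gt0.
  apply: (@le_trans _ _ ((K1 * (1 + `|x - y|) * f x) `^ (2 * tau))).
    apply: (ge0_ler_powR t2); rewrite ?nnegrE; first exact: ltW.
      by rewrite mulr_ge0 ?(ltW (f0 x))// (le_trans ler01).
    apply: (le_trans (hK x y)); apply: ler_wpM2r; first exact: ltW.
    by rewrite ler_wpM2r ?addr_ge0// le_max lexx.
  rewrite powRM; [|exact: le_trans ler01 p1|exact: ltW].
  by apply: ler_wpM2r; [exact: powR_ge0|exact: powR_le_nat].
(* Some point outside the ball is needed as a relay. If there is none, as in dimension 0, f is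
   bounded above and below. *)
have [[p hp]|np] := pselect (exists p : Rn, r0 <= enorm p); last first.
  exists (M / c); split; first by rewrite divr_ge0// ltW.
  move=> x y; have yr : enorm y <= r0.
    by rewrite leNgt; apply/negP => h; apply: np; exists y; exact: ltW.
  apply: (le_trans (fM y yr)); rewrite mulrAC.
  have h1 : M <= M / c * f x by rewrite mulrAC ler_pdivlMr// ler_wpM2l.
  apply: (le_trans h1); apply: ler_peMr; last by rewrite lerDl.
  exact: (mulr_ge0 (divr_ge0 M_0 (ltW c0)) (ltW (f0 x))).
(* The terms serve three cases: [M] when y is in the ball, the middle two when only x is, where one
   passes through p, and the last when both points lie outside. *)
pose K0 := M + f p + n%:R * (r0 + `|p|) / C1 + n%:R / C1.
have nC : 0 <= n%:R / C1 by rewrite divr_ge0// ltW.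
have C1x x y : r0 <= enorm x -> r0 <= enorm y -> f y <= f x + n%:R / C1 * `|x - y|.
  move=> hx hy; have h := hL x y hx hy.
  have : `|f x - f y| <= n%:R / C1 * `|x - y|.
    by rewrite mulrAC ler_pdivlMr// mulrC (le_trans h)// enorm_le.
  by rewrite ler_norml => /andP[h1 _]; lra.
have K00 : 0 <= K0.
  by rewrite /K0 !addr_ge0 ?(ltW (f0 p))// ?divr_ge0 ?mulr_ge0 ?addr_ge0// ltW.
have H x y : f y <= f x + K0 * (1 + `|x - y|).
  have d0 := normr_ge0 (x - y); have fp := f0 p; have fx := f0 x.
  have e0 : 0 <= n%:R * (r0 + `|p|) / C1 by rewrite divr_ge0 ?mulr_ge0 ?addr_ge0// ltW.
  have e1 : 0 <= n%:R / C1 * `|x - y| by rewrite mulr_ge0.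
  have e2 : 0 <= K0 * `|x - y| by rewrite mulr_ge0.
  have e3 : n%:R / C1 * `|x - y| <= K0 * `|x - y|.
    by rewrite ler_wpM2r// /K0 lerDr !addr_ge0// ltW.
  rewrite mulrDr mulr1.
  have [yr|yr] := leP (enorm y) r0.
    by have := fM y yr; move: e0 nC e2 M_0; rewrite /K0; lra.
  have [xr|xr] := leP r0 (enorm x).
    by have := C1x x y xr (ltW yr); lra.
  have h := C1x p y hp (ltW yr).
  have : n%:R / C1 * `|p - y| <= n%:R / C1 * (`|p| + r0 + `|x - y|).
    rewrite ler_wpM2l// (_ : p - y = p - x + (x - y)); last by rewrite addrA subrK.
    rewrite (le_trans (ler_normD _ _))// lerD2r (le_trans (ler_normB _ _))// lerD2l.
    exact: le_trans (norm_le_enorm x) (ltW xr).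
  move: h e0 nC e3 M_0; rewrite /K0.
  rewrite (_ : n%:R * (r0 + `|p|) / C1 = n%:R / C1 * (r0 + `|p|)); last by ring.
  by lra.
exists (1 + K0 / c); split; first by rewrite addr_ge0// divr_ge0// ltW.
move=> x y; apply: (le_trans (H x y)).
have p1 : 1 <= 1 + `|x - y| by rewrite lerDl.
have s1 : f x <= (1 + `|x - y|) * f x by apply: ler_peMl => //; exact: ltW.
have s2 : K0 * (1 + `|x - y|) <= K0 / c * (1 + `|x - y|) * f x.
  rewrite [leRHS]mulrAC; apply: ler_wpM2r; first by rewrite addr_ge0.
  by rewrite mulrAC ler_pdivlMr//; apply: ler_wpM2l.
rewrite (_ : (1 + K0 / c) * _ * _ = (1 + `|x - y|) * f x + K0 / c * (1 + `|x - y|) * f x); last by ring.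
exact: lerD.
Qed.

(** Position and frequency enter as separate factors, matching the separate decay obtained from
    integrating by parts in the different variables. *)
Definition phase_wt N (X Y : Rn * Rn) : R := ((1 + `|X.1 - Y.1|) * (1 + `|X.2 - Y.2|)) ^+ N.

Lemma phase_wt_ge1 N X Y : 1 <= phase_wt N X Y.
Proof. by apply: exprn_ege1; rewrite mulr_ege1// lerDl. Qed.

(** Add the estimates for V + a/2 and A + b/2. The additive constants are absorbed because q + V + A
    >= 1. *)
Lemma W_tempered (kappa gamma q : R) (V A : Rn -> R) : 0 < kappa -> 0 < gamma ->
  tau_function kappa V -> tau_function gamma A -> 0 < q ->
  (forall x xi, 1 <= q + V x + A xi) ->
  exists N (K : R), 0 <= K /\ forall X Y : Rn * Rn,
    q + V Y.1 + A Y.2 <= K * phase_wt N X Y * (q + V X.1 + A X.2).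
Proof.
move=> k0 g0 /(tau_tempered k0)[a [a0 Va [N1 [K1 [K10 h1]]]]]
  /(tau_tempered g0)[b [b0 Ab [N2 [K2 [K20 h2]]]]] q0 hW.
pose N := maxn N1 N2; pose K := Num.max K1 K2.
exists N, (K * (1 + a + b) + q); split.
  have K00 : 0 <= K by rewrite le_max K10.
  by apply: addr_ge0; [apply: mulr_ge0 => //; lra|exact: ltW].
move=> X Y; set P := phase_wt N X Y; have P1 : 1 <= P by exact: phase_wt_ge1.
have W1 := hW X.1 X.2; set W := q + V X.1 + A X.2 in W1 *.
have up (N' : nat) (c : R) : (N' <= N)%N -> 1 <= c -> c <= (1 + `|X.1 - Y.1|) * (1 + `|X.2 - Y.2|) -> c ^+ N' <= P.
  move=> NN c1 cP; apply: (@le_trans _ _ (c ^+ N)); first exact: ler_weXn2l.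
  by apply: lerXn2r; rewrite ?nnegrE ?mulr_ge0 ?addr_ge0// (le_trans ler01).
have v1 : V Y.1 + a / 2 <= K * P * (V X.1 + a / 2).
  apply: (le_trans (h1 X.1 Y.1)); rewrite ler_wpM2r ?(ltW (Va _))//.
  apply: ler_pM => //; first by rewrite le_max lexx.
  by apply: up; rewrite ?leq_maxl ?lerDl// ler_peMr ?addr_ge0// lerDl.
have v2 : A Y.2 + b / 2 <= K * P * (A X.2 + b / 2).
  apply: (le_trans (h2 X.2 Y.2)); rewrite ler_wpM2r ?(ltW (Ab _))//.
  apply: ler_pM => //; first by rewrite le_max lexx orbT.
  by apply: up; rewrite ?leq_maxr ?lerDl// ler_peMl ?addr_ge0// lerDl.
have KP : 0 <= K * P by rewrite mulr_ge0 ?le_max ?K10// (le_trans ler01).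
have s1 : V X.1 + a / 2 + (A X.2 + b / 2) <= (1 + a + b) * W.
  by rewrite /W; have := ler_wpM2l (ltW a0) W1; have := ler_wpM2l (ltW b0) W1; rewrite /W; lra.
have s2 := ler_wpM2l KP s1.
have s3 : q <= q * P * W.
  by rewrite -mulrA; apply: ler_peMr; [exact: ltW|exact: mulr_ege1].
rewrite mulrDl mulrDl; apply: (@le_trans _ _ (K * P * ((1 + a + b) * W) + q * P * W)).
  by lra.
by rewrite lerD2r le_eqVlt; apply/orP; left; apply/eqP; ring.
Qed.

(** A negative power reverses the inequality and so exchanges the two points; rounding s up to an
    integer keeps the factor polynomial. *)
Lemma powN_tempered (W : Rn * Rn -> R) N (K s : R) : 0 <= s -> (forall X, 1 <= W X) ->
  0 <= K -> (forall X Y, W Y <= K * phase_wt N X Y * W X) ->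
  exists N' (K' : R), 0 <= K' /\ forall X Y, W X `^ (- s) <= K' * phase_wt N' X Y * W Y `^ (- s).
Proof.
move=> s0 W1 K0 hW; pose K1 := Num.max K 1; pose B := Num.bound s.
have K11 : 1 <= K1 by rewrite le_max lexx orbT.
exists (N * B)%N, (K1 ^+ B); split; first by rewrite exprn_ge0// (le_trans ler01).
move=> X Y; have W0 Z : 0 < W Z by exact: lt_le_trans ltr01 (W1 Z).
have P1 := phase_wt_ge1 N X Y.
have h : W Y `^ s <= (K1 * phase_wt N X Y) ^+ B * W X `^ s.
  apply: (@le_trans _ _ ((K1 * phase_wt N X Y * W X) `^ s)).
    apply: (ge0_ler_powR s0); rewrite ?nnegrE.
    - exact: ltW.
    - by rewrite mulr_ge0 ?(ltW (W0 X))// (le_trans ler01)// mulr_ege1.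
    apply: (le_trans (hW X Y)); apply: ler_wpM2r; first exact: ltW.
    by apply: ler_wpM2r; [exact: le_trans ler01 P1|rewrite le_max lexx].
  rewrite powRM; [|by rewrite (le_trans ler01)// mulr_ege1|exact: ltW].
  by apply: ler_wpM2r; [exact: powR_ge0|apply: powR_le_nat; exact: mulr_ege1].
have -> : phase_wt (N * B) X Y = phase_wt N X Y ^+ B by rewrite /phase_wt exprM.
rewrite !powRN -exprMn.
rewrite ler_pdivlMr ?powR_gt0// mulrC ler_pdivrMr ?powR_gt0//.
Qed.

End temperance.

Section lattice.
Context (R : realType) (n : nat).
Local Notation Rn := 'rV[R]_n.
Local Notation Zn := 'rV[int]_n.
Local Notation L := ('rV[int]_n * 'rV[int]_n)%type.
Local Notation leb := (lebesgue_rV R n).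
Local Notation leb2 := (leb \x leb)%E.
Implicit Types (j k : L) (X Y : Rn * Rn).

Definition cube (m : Zn) : set Rn := [set x | forall i, `[(m ord0 i)%:~R, (m ord0 i)%:~R + 1[%classic (x ord0 i)].

Lemma measurable_cube m : measurable (cube m).
Proof.
rewrite (_ : cube m = \bigcap_(i in [set: 'I_n]) (rV_coord i @^-1` `[(m ord0 i)%:~R, (m ord0 i)%:~R + 1[%classic)).
  apply: fin_bigcap_measurable => // i _.
  by rewrite -[X in measurable X]setTI; exact: measurable_rV_coord.
by apply/seteqP; split => x h; [move=> i _; exact: h|move=> i; exact: (h i)].
Qed.

Lemma cube_measure m : leb (cube m) = 1%E.
Proof.
pose Q (i : 'I_n) : set R := `[(m ord0 i)%:~R, (m ord0 i)%:~R + 1[%classic.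
transitivity (\prod_(i < n) lebesgue_measure (Q i))%E.
  by apply: (lebesgue_rV_box (B := Q)) => i; exact: measurable_itv.
rewrite big1// => i _.
by rewrite lebesgue_measure_itv/= lte_fin ltrDl ltr01 -EFinD addrAC subrr add0r.
Qed.

Lemma cube_near m x : cube m x -> `|x - lattice_pt R m| <= 1.
Proof.
move=> h; apply: rV_norm_le => // i; rewrite !mxE.
have := h i; rewrite /= in_itv/= => /andP[h1 h2].
by rewrite ler_norml; apply/andP; split; lra.
Qed.

Lemma cube_floor m x : cube m x -> m = \row_i Num.floor (x ord0 i).
Proof.
move=> h; apply/rowP => i; rewrite mxE; apply/esym/floor_def.
by have := h i; rewrite /= in_itv/= rmorphD/=.
Qed.

Lemma cube_sum (g : L -> R) (G : Rn * Rn -> R) : (forall j, 0 <= g j) ->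
  measurable_fun setT G -> (forall X, 0 <= G X) ->
  (forall j X, `|X.1 - lattice_pt R j.1| <= 1 -> `|X.2 - lattice_pt R j.2| <= 1 -> g j <= G X) ->
  (\esum_(j in [set: L]) (g j)%:E <= \int[leb2]_X (G X)%:E)%E.
Proof.
move=> g0 mG G0 gG; pose Q j : set (Rn * Rn) := cube j.1 `*` cube j.2.
have mQ j : measurable (Q j) by apply: measurableX; exact: measurable_cube.
pose I j X : \bar R := ((g j)%:E * (\1_(Q j) X)%:E)%E.
have mI j : measurable_fun setT (I j).
  by apply: measurable_funeM; apply/measurable_EFinP; exact: measurable_indic.
have I0 j X : (0 <= I j X)%E by rewrite mule_ge0// lee_fin.
have -> : \esum_(j in [set: L]) (g j)%:E = (\int[leb2]_X (\esum_(j in [set: L]) I j X))%E.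
  rewrite integral_lsum//; apply: eq_esum => j _.
  rewrite /I ge0_integralZl//; try (by apply/measurable_EFinP; exact: measurable_indic);
    try (by move=> *; rewrite lee_fin); try by rewrite lee_fin.
  rewrite integral_indic// setIT [X in (_ * X)%E](_ : _ = 1%E) ?mule1//.
  rewrite -[LHS]/(product_measure1 leb leb (cube j.1 `*` cube j.2)).
  rewrite product_measure1E; [|exact: measurable_cube|exact: measurable_cube].
  rewrite -[RHS]mule1; congr (_ * _)%E; exact: cube_measure.
apply: ge0_le_integral => //.
- by move=> X _; exact: esum_ge0.
- exact: measurable_esum.
- exact/measurable_EFinP.
move=> X _; pose j0 : L := (\row_i Num.floor (X.1 ord0 i), \row_i Num.floor (X.2 ord0 i)).
have E j : j != j0 -> I j X = 0%E.
  move=> jj; rewrite /I indicE memNset ?mule0// => -[/cube_floor h1 /cube_floor h2].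
  by move/eqP: jj; apply; rewrite [j]surjective_pairing h1 h2.
have -> : \esum_(j in [set: L]) I j X = \esum_(j in [set j0]) I j X.
  rewrite [RHS]esum_mkcond; apply: eq_esum => j _; case: ifPn => // /negP h.
  by apply: E; apply/eqP => jj; apply: h; rewrite inE.
rewrite esum_set1// /I indicE; case: (boolP (X \in Q j0)) => [|_]; last by rewrite mule0 lee_fin.
rewrite inE => -[h1 h2]; rewrite mule1 lee_fin.
by apply: gG; exact: cube_near.
Qed.

(** The symmetric kernel of Schur's test: summable over the lattice uniformly in the other index. *)
Definition rho j k : R := wt (lattice_pt R j.1 - lattice_pt R k.1) * wt (lattice_pt R j.2 - lattice_pt R k.2).

Lemma rho_ge0 j k : 0 <= rho j k.
Proof. by rewrite mulr_ge0// wt_ge0. Qed.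

Lemma rhoC j k : rho j k = rho k j.
Proof. by rewrite /rho /wt distrC [X in _ * (1 + X) ^- _]distrC. Qed.

Definition Crho : R := 16 ^+ n * 16 ^+ n * (Iwt R n * Iwt R n).

Lemma rho_sum k N : \sum_(0 <= q < N) coef (fun j => rho j k) q <= Crho.
Proof.
apply: lsum_le => [j|]; first exact: rho_ge0.
pose G X := 16 ^+ n * wt (X.1 - lattice_pt R k.1) * (16 ^+ n * wt (X.2 - lattice_pt R k.2)).
have mw (a : Rn) : measurable_fun setT (fun x : Rn => wt (x - a)).
  by apply: (measurableT_comp (@measurable_wt R n)); exact: measurable_rV_shift.
have mG : measurable_fun setT G.
  apply: measurable_funM; apply: measurable_funM => //.
    exact: (measurableT_comp (mw _) measurable_fst).
  exact: (measurableT_comp (mw _) measurable_snd).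
have w16 (a x : Rn) (m : Zn) : `|x - lattice_pt R m| <= 1 -> wt (lattice_pt R m - a) <= 16 ^+ n * wt (x - a).
  move=> h; rewrite (_ : lattice_pt R m - a = (x - a) + (lattice_pt R m - x)); last by rewrite [RHS]addrC addrA subrK.
  apply: (le_trans (peetreV _ _ _)); rewrite ler_wpM2r ?wt_ge0//.
  apply: (@le_trans _ _ (2 ^+ (2 * n))).
    by apply: lerXn2r; rewrite ?nnegrE// ?addr_ge0// distrC; lra.
  by rewrite exprM; apply: lerXn2r; rewrite ?nnegrE ?exprn_ge0// expr2; lra.
have G0 X : 0 <= G X by rewrite !mulr_ge0 ?exprn_ge0 ?wt_ge0.
apply: (le_trans (cube_sum (g := fun j => rho j k) (fun j => rho_ge0 j k) mG G0 _)).
  move=> j X h1 h2; rewrite /rho /G ler_pM ?wt_ge0//; exact: w16.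
rewrite fubini_tonelli1//; last by apply/measurable_EFinP.
pose c : R := 16 ^+ n; have c0 : 0 <= c by rewrite exprn_ge0.
have Iw (a : Rn) : (\int[leb]_x (wt (x - a))%:E = (Iwt R n)%:E)%E.
  rewrite (@integral_rV_shift R n (- a) (fun x => (wt x)%:E)).
  - by rewrite /Iwt /Rintegral fineK//; exact: integrable_fin_num (integrable_wt R n).
  - by apply/measurable_EFinP; exact: measurable_wt.
  - by move=> x; rewrite lee_fin wt_ge0.
have Ic (r : R) (a : Rn) : 0 <= r ->
    (\int[leb]_y (r * (c * wt (y - a)))%:E = (r * (c * Iwt R n))%:E)%E.
  move=> r0; have E : (fun y : Rn => (r * (c * wt (y - a)))%:E) = (fun y => (r * c)%:E * (wt (y - a))%:E)%E.
    by apply/funext => y; rewrite -EFinM mulrA.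
  rewrite E ge0_integralZl//; try (by apply/measurable_EFinP);
    try (by move=> *; rewrite lee_fin wt_ge0); try by rewrite lee_fin mulr_ge0.
  by rewrite Iw -EFinM mulrA.
have -> : (\int[leb]_x fubini_F leb (fun z => (G z)%:E) x =
    \int[leb]_x (c * Iwt R n * (c * wt (x - lattice_pt R k.1)))%:E)%E.
  apply: eq_integral => x _; rewrite /fubini_F /G /= -/c Ic; last by rewrite mulr_ge0 ?wt_ge0.
  by rewrite mulrC.
rewrite Ic; last by rewrite mulr_ge0// Iwt_ge0.
by rewrite lee_fin /Crho -/c le_eqVlt; apply/orP; left; apply/eqP; ring.
Qed.

End lattice.

Section smooth_sym.
Context (R : realType) (V : normedModType R).
Local Notation Re := complex.Re.
Local Notation Im := complex.Im.

Lemma Cn_iter (g : V -> R^o) (Ts : seq V) k : Cn (size Ts + k) g -> Cn k (iter_derive Ts g).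
Proof.
elim: Ts k => [|v Ts IH] k // h; have {}h : Cn (size Ts + k.+1) g by rewrite addnS.
by have [_ h'] := IH _ h; exact: h'.
Qed.

Lemma smooth_sym (f : V -> R[i]) (w : V -> R) : smooth f ->
  (forall Ts, exists C : R, forall x, normc (cderive Ts f x) <= C * w x) ->
  sym (fun _ : unit => w) (fun _ => f).
Proof.
move=> sf hf k.
suff H Ts : symk k (fun _ : unit => w) (fun _ => cderive Ts f).
  have := H [::]; rewrite (_ : cderive [::] f = f)//.
  by apply/funext => x; rewrite /cderive/=; case: (f x).
have cn k' Ts' : Cn k' (iter_derive Ts' (fun y => Re (f y) : R^o)) /\
    Cn k' (iter_derive Ts' (fun y => Im (f y) : R^o)).
  by have [h1 h2] := sf (size Ts' + k')%N; split; exact: Cn_iter.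
elim: k Ts => [|k IH] Ts.
  split; first by move=> _; have [h1 h2] := cn 0 Ts; split.
  by split=> //; have [C hC] := hf Ts; exists C => _.
split; first by move=> _; have [h1 h2] := cn 0 Ts; split.
split; first by have [C hC] := hf Ts; exists C => _.
move=> v; split=> [_ z|]; last exact: (IH (v :: Ts)).
by have [[h1 _] [h2 _]] := cn 1 Ts; split; exact: diff_derivable.
Qed.

Lemma schwartz_sym (u : V -> R[i]) N : schwartz u ->
  sym (fun _ x => (1 + `|x|) ^- N) (fun _ : unit => u).
Proof.
move=> [su hu]; apply: smooth_sym => // Ts; have [C hC] := hu N Ts.
exists C => x; rewrite -[_ * _]/(C / (1 + `|x|) ^+ N).
by rewrite ler_pdivlMr ?exprn_gt0 ?ltr_pwDl// mulrC.
Qed.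

End smooth_sym.

(** As q + V + A >= 1, its positive powers in the denominators of the metric are at least 1. Hence
    the square root of g_X(T) is at most |t| + |tau| for T = (t, tau), a constant independent of
    X. *)
Lemma symbol_sym (R : realType) (n : nat) (q kappa gamma : R) (A V : 'rV[R]_n -> R)
    (M : 'rV[R]_n * 'rV[R]_n -> R) (a : 'rV[R]_n * 'rV[R]_n -> R[i]) :
  0 < kappa -> 0 < gamma -> (forall x xi, 1 <= q + V x + A xi) -> (forall X, 0 <= M X) ->
  symbol_class M (metric q kappa gamma A V) a -> sym (fun _ : unit => M) (fun _ => a).
Proof.
move=> k0 g0 W1 M0 [sa ha]; apply: smooth_sym => // Ts.
have [C C0 hC] := ha (size Ts).
exists (C * \prod_(T <- Ts) (enorm T.1 + enorm T.2)) => X.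
apply: (le_trans (hC X (in_tuple Ts))); rewrite mulrAC ler_wpM2r//.
apply: ler_wpM2l; first exact: ltW.
elim: (Ts) => [|T Ts' IH]; first by rewrite !big_nil.
rewrite !big_cons ler_pM ?sqrtr_ge0//.
  by apply: prodr_ge0 => T' _; exact: sqrtr_ge0.
have e1 := sqrtr_ge0 (dotv T.1 T.1); have e2 := sqrtr_ge0 (dotv T.2 T.2).
rewrite -/(enorm T.1) in e1; rewrite -/(enorm T.2) in e2.
have ee : 0 <= enorm T.1 + enorm T.2 by rewrite addr_ge0.
rewrite -[leRHS]ger0_norm// -sqrtr_sqr; apply: ler_wsqrtr.
have W1' s : 0 <= s -> 1 <= (q + V X.1 + A X.2) `^ s.
  by move=> s0; rewrite -(powRr0 (q + V X.1 + A X.2)); apply: ler_powR.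
have d (e s : R) : 0 <= s -> e ^+ 2 / (q + V X.1 + A X.2) `^ s <= e ^+ 2.
  by move=> /W1' h; rewrite ler_pdivrMr ?(lt_le_trans ltr01)// ler_peMr// sqr_ge0.
have h1 := d (enorm T.1) (1 / kappa) (ltW (divr_gt0 ltr01 k0)).
have h2 := d (enorm T.2) (1 / gamma) (ltW (divr_gt0 ltr01 g0)).
have h3 := mulr_ge0 e1 e2; rewrite /metric sqrrD [leRHS]addrAC.
by apply: (le_trans (lerD h1 h2)); rewrite lerDl mulrn_wge0.
Qed.

(** * Quantization *)

Section wts.
Context (R : realType) (n : nat).
Local Notation Rn := 'rV[R]_n.
Local Notation leb := (lebesgue_rV R n).

Lemma wt_shift_integral (a : Rn) : leb.-integrable setT (EFin \o (fun x => wt (x - a))) /\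
  \int[leb]_x wt (x - a) = Iwt R n.
Proof.
have mw : measurable_fun setT (fun x : Rn => wt (x - a)).
  by apply: (measurableT_comp (@measurable_wt R n)); exact: measurable_rV_shift.
have E : (\int[leb]_x (wt (x - a))%:E = \int[leb]_x (wt x)%:E)%E.
  rewrite (@integral_rV_shift R n (- a) (fun x => (wt x)%:E))//.
    by apply/measurable_EFinP; exact: measurable_wt.
  by move=> x; rewrite lee_fin wt_ge0.
split; last by rewrite /Rintegral E.
apply/integrable_ge0P => //; first by move=> x; exact: wt_ge0.
by rewrite E integral_wt.
Qed.

Lemma normc_cint_wt_shift (f : Rn -> R[i]) a C : cmeasurable f ->
  (forall x, normc (f x) <= C * wt (x - a)) -> normc (cintegral leb f) <= C * Iwt R n.
Proof.
move=> mf hf; have [iw <-] := wt_shift_integral a.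
have iCw : leb.-integrable setT (EFin \o (fun x => C * wt (x - a))).
  rewrite (_ : EFin \o _ = (fun x => C%:E * (EFin \o (fun x => wt (x - a))) x)%E); last by apply/funext.
  exact: integrableZl.
apply: (le_trans (normc_cintegral_le mf hf iCw)).
by rewrite RintegralZl.
Qed.

Lemma wt_shift_le (a x : Rn) : wt (x - a) <= (1 + `|a|) ^+ (2 * n) * wt x.
Proof. by have := peetreV x (- a) (2 * n); rewrite normrN. Qed.

End wts.

(** * Triple phase space (x, y, xi) and decay of the y-integral *)

Section phase_space.
Context (R : realType) (n : nat) (t : R).
Local Notation Rn := 'rV[R]_n.
Local Notation Z := ((Rn * Rn) * Rn)%type.
Local Notation leb := (lebesgue_rV R n).

Definition inj_x (b : Rn) : Z := ((b, 0), 0).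
Definition inj_y (b : Rn) : Z := ((0, b), 0).
Definition inj_xi (b : Rn) : Z := ((0, 0), b).
Definition symbol_arg (z : Z) : Rn * Rn := (t *: z.1.1 + (1 - t) *: z.1.2, z.2).

Lemma continuous_fst (U V : topologicalType) : continuous (@fst U V).
Proof. by move=> x; exact: cvg_fst. Qed.

Lemma continuous_snd (U V : topologicalType) : continuous (@snd U V).
Proof. by move=> x; exact: cvg_snd. Qed.

Lemma continuous_pair (U V W : topologicalType) (f : U -> V) (g : U -> W) :
  continuous f -> continuous g -> continuous (fun x => (f x, g x)).
Proof. by move=> cf cg x; apply: cvg_pair; [exact: cf|exact: cg]. Qed.

Lemma continuous_const (U V : topologicalType) (c : V) : continuous (fun _ : U => c).
Proof. by move=> x; exact: cvg_cst. Qed.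

Lemma continuous_ident (U : topologicalType) : continuous (fun x : U => x).
Proof. by move=> x; exact: cvg_id. Qed.

Lemma continuous_x : continuous (fun z : Z => z.1.1).
Proof. by move=> z; apply: (@continuous_comp _ _ _ fst fst); exact: continuous_fst. Qed.

Lemma continuous_y : continuous (fun z : Z => z.1.2).
Proof. by move=> z; apply: (@continuous_comp _ _ _ fst snd); [exact: continuous_fst|exact: continuous_snd]. Qed.

Lemma continuous_inj_x : continuous inj_x.
Proof.
apply: (@continuous_pair Rn (Rn * Rn)%type Rn (fun b => (b, 0)) (fun=> 0)); last exact: continuous_const.
by apply: (@continuous_pair Rn Rn Rn); [exact: continuous_ident|exact: continuous_const].
Qed.

Lemma continuous_inj_y : continuous inj_y.
Proof.
apply: (@continuous_pair Rn (Rn * Rn)%type Rn (fun b => (0, b)) (fun=> 0)); last exact: continuous_const.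
by apply: (@continuous_pair Rn Rn Rn); [exact: continuous_const|exact: continuous_ident].
Qed.

Lemma continuous_inj_xi : continuous inj_xi.
Proof. by apply: (@continuous_pair Rn (Rn * Rn)%type Rn (fun=> 0)); [exact: continuous_const|exact: continuous_ident]. Qed.

Lemma continuous_symbol_arg : continuous symbol_arg.
Proof.
apply: continuous_pair; last exact: continuous_snd.
move=> z; have h1 := continuous_x (x := z); have h2 := continuous_y (x := z).
exact: (cvgD (cvgZ (cvg_cst t) h1) (cvgZ (cvg_cst (1 - t)) h2)).
Qed.

Lemma linear_inj_x (h : R) u v : inj_x (h *: u + v) = h *: inj_x u + inj_x v.
Proof. by rewrite /inj_x; congr pair; [congr pair|]; rewrite /= ?scaler0 ?addr0. Qed.

Lemma linear_inj_y (h : R) u v : inj_y (h *: u + v) = h *: inj_y u + inj_y v.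
Proof. by rewrite /inj_y; congr pair; [congr pair|]; rewrite /= ?scaler0 ?addr0. Qed.

Lemma linear_inj_xi (h : R) u v : inj_xi (h *: u + v) = h *: inj_xi u + inj_xi v.
Proof. by rewrite /inj_xi; congr pair; rewrite /= ?scaler0 ?addr0. Qed.

Lemma affine_symbol_arg (h : R) (v z : Z) : symbol_arg (h *: v + z) = h *: symbol_arg v + symbol_arg z.
Proof.
rewrite /symbol_arg; congr pair => /=; rewrite !scalerDr !scalerA.
by rewrite !(mulrC h) -!addrA; congr (_ + _); rewrite addrCA.
Qed.

Lemma add_inj_x x y xi b : (((x, y), xi) : Z) + inj_x b = ((x + b, y), xi).
Proof. by rewrite /inj_x; congr pair; [congr pair|]; rewrite /= ?addr0. Qed.

Lemma add_inj_y x y xi b : (((x, y), xi) : Z) + inj_y b = ((x, y + b), xi).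
Proof. by rewrite /inj_y; congr pair; [congr pair|]; rewrite /= ?addr0. Qed.

Lemma add_inj_xi x y xi b : (((x, y), xi) : Z) + inj_xi b = ((x, y), xi + b).
Proof. by rewrite /inj_xi; congr pair; rewrite /= ?addr0. Qed.

Lemma symk_lin (I I' : Type) (V V' : normedModType R) k (w : I' -> V' -> R) (F : I' -> V' -> R[i])
    (ri : I -> I') (L : V -> V') : (forall i z, 0 <= w i z) -> continuous L ->
  (forall (h : R) v z, L (h *: v + z) = h *: L v + L z) -> symk k w F ->
  symk k (fun i z => w (ri i) (L z)) (fun i z => F (ri i) (L z)).
Proof.
move=> w0 cL aL; apply: (@symk_comp R V V' I I' k w F ri (fun _ => L) (fun=> 1) L) => //.
  by move=> _; rewrite normr1.
by move=> _ h v z; rewrite scale1r.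
Qed.

Lemma symk_shift (I I' : Type) (V : normedModType R) k (w : I' -> V -> R) (F : I' -> V -> R[i])
    (ri : I -> I') (c : I -> V) : (forall i z, 0 <= w i z) -> symk k w F ->
  symk k (fun i z => w (ri i) (z - c i)) (fun i z => F (ri i) (z - c i)).
Proof.
move=> w0; apply: (@symk_comp R V V I I' k w F ri (fun i z => z - c i) (fun=> 1) id) => //.
- by move=> _; rewrite normr1.
- by move=> i z; exact: (cvgB cvg_id (cvg_cst (c i))).
- by move=> i h v z; rewrite scale1r addrA.
Qed.

Section Jbound.
Variables (I : Type) (b : I -> Z -> R[i]) (u : I -> Rn -> R[i]) (lam : I -> R) (c kap : I -> Rn).
Hypothesis lam0 : forall i, 0 <= lam i.
Hypothesis sb : sym (fun _ _ => 1) b.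
Hypothesis su : sym (fun i y => lam i * wt (y - c i)) u.

Definition slice_integral i x xi : R[i] :=
  cintegral leb (fun y => cexpi (dotv (kap i - xi) y) * (b i ((x, y), xi) * u i y)).

Lemma slice_integrand i x xi : (cmeasurable (fun y => cexpi (dotv (kap i - xi) y) * (b i ((x, y), xi) * u i y))) /\
  exists C, 0 <= C /\ forall y, normc (cexpi (dotv (kap i - xi) y) * (b i ((x, y), xi) * u i y)) <= C * wt y.
Proof.
have [C1 [C10 h1]] := symk_bound (sb 0); have [C2 [C20 h2]] := symk_bound (su 0).
split.
  apply: ccont_meas1; apply: ccontM.
    apply: ccont_cexpi; apply: (continuous_sum (f := fun j (y : Rn) => (kap i - xi) ord0 j * y ord0 j)) => j y.
    exact: (cvgM (cvg_cst _) (@coord_continuous _ _ _ ord0 j y)).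
  apply: ccontM; last exact: (symk_cont i (su 0)).
  apply: (ccont_comp (j := fun y => (((x, y), xi) : Z))); last exact: (symk_cont i (sb 0)).
  apply: (@continuous_pair Rn (Rn * Rn)%type Rn (fun y => (x, y)) (fun=> xi)); last exact: continuous_const.
  by apply: (@continuous_pair Rn Rn Rn); [exact: continuous_const|exact: continuous_ident].
exists (C1 * (C2 * lam i * (1 + `|c i|) ^+ (2 * n))); split.
  by rewrite !mulr_ge0// exprn_ge0// addr_ge0.
move=> y; rewrite normcM normc_cexpi mul1r normcM -[leRHS]mulrA; apply: ler_pM; rewrite ?normc_ge0//.
  by have := h1 (fun _ _ => ler01) i ((x, y), xi); rewrite mulr1.
apply: (le_trans (h2 (fun i y => mulr_ge0 (lam0 i) (wt_ge0 _)) i y)).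
by rewrite -!mulrA !ler_wpM2l// wt_shift_le.
Qed.

(** Integration by parts in y against the phase (kap - xi).y gives arbitrary decay in xi - kap,
    uniformly in x and in the index. *)
Lemma slice_integral_bound N : exists C, 0 <= C /\
  forall i x xi, normc (slice_integral i x xi) <= C * lam i * (1 + `|xi - kap i|) ^- N.
Proof.
pose F i (z : Z) := b i z * u i z.1.2.
pose w i (z : Z) := lam i * wt (z.1.2 - c i).
have w0 i z : 0 <= w i z by rewrite mulr_ge0// wt_ge0.
have sF : sym w F.
  move=> k; have su' : symk k w (fun i (z : Z) => u i z.1.2).
    apply: (symk_lin id (L := fun z : Z => z.1.2)) (su k) => //.
      by move=> i y; rewrite mulr_ge0// wt_ge0.
    exact: continuous_y.
  have := symkM (fun _ _ => ler01) w0 (sb k) su'.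
  by apply: (symk_mono (K := 1)) => // i z; rewrite ?mul1r// mulr_ge0.
pose l i (j : 'I_n) (z : Z) := kap i ord0 j - z.2 ord0 j.
pose lin (j : 'I_n) (z : Z) := - z.2 ord0 j.
have cl i j : continuous (l i j).
  move=> z; apply: cvgB; first exact: cvg_cst.
  by apply: (@continuous_comp _ _ _ snd (fun x : Rn => x ord0 j)); [exact: continuous_snd|exact: coord_continuous].
have al i j h v z : l i j (h *: v + z) = h * lin j v + l i j z.
  by rewrite /l /lin !mxE; ring.
have l0 j y : lin j (inj_y y) = 0 by rewrite /lin /= mxE oppr0.
have sw : slice_le inj_y w.
  move=> i [[x y] xi]; exists (lam i * (1 + `|c i - y|) ^+ (2 * n)) => y'.
  rewrite add_inj_y /w /= -mulrA ler_wpM2l//.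
  by have := wt_shift_le (c i - y) y'; rewrite opprB addrCA addrA.
have [G [sG hG]] := ibp (N := N) (k := 0) linear_inj_y continuous_inj_y cl al l0 w0 sw (sF _).
have pos N' i z : 0 <= (1 + `|freq l i z|) ^- N' * w i z.
  by rewrite mulr_ge0// invr_ge0 exprn_ge0// addr_ge0.
have [C [C0 hC]] := symk_bound sG.
exists (C * Iwt R n); split; first by rewrite mulr_ge0// Iwt_ge0.
(* Based at y = 0, the slice z + [inj_y y] runs over all (x, y, xi). *)
move=> i x xi; pose z : Z := ((x, 0), xi).
have -> : slice_integral i x xi = cintegral leb (fun y => ph l i z y * F i (z + inj_y y)).
  apply: eq_cintegral => y; rewrite /F add_inj_y add0r /=; congr (cexpi _ * _).
  by apply: eq_bigr => j _; rewrite /l !mxE.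
rewrite hG; have fq : freq l i z = kap i - xi by apply/rowP => j; rewrite !mxE.
rewrite distrC -fq.
rewrite (_ : C * Iwt R n * lam i * _ = C * lam i * (1 + `|freq l i z|) ^- N * Iwt R n); last by ring.
apply: (normc_cint_wt_shift (a := c i)).
  apply: ccont_meas1; apply: ccontM; first exact: ccont_ph.
  apply: (ccont_comp (j := fun y => z + inj_y y)); last exact: (symk_cont i sG).
  by move=> y; have h := continuous_inj_y (x := y); exact: (cvgD (cvg_cst z) h).
move=> y; rewrite normcM normc_cexpi mul1r; apply: (le_trans (hC (pos N) i (z + inj_y y))).
rewrite add_inj_y add0r /w /= (_ : freq l i ((x, y), xi) = freq l i z)//.
by rewrite le_eqVlt; apply/orP; left; apply/eqP; ring.
Qed.

End Jbound.

End phase_space.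

Section quantization.
Context (R : realType) (n : nat) (t : R) (a : 'rV[R]_n * 'rV[R]_n -> R[i]).
Local Notation Rn := 'rV[R]_n.
Local Notation Z := ((Rn * Rn) * Rn)%type.
Local Notation leb := (lebesgue_rV R n).
Hypothesis sa : sym (fun (_ : unit) (_ : Rn * Rn) => 1 : R) (fun _ => a).
Implicit Types (u v : Rn -> R[i]) (x y xi : Rn).

(* Integrating first in y makes the xi-integral of quant absolutely convergent. *)
Definition quant_kernel x y xi : R[i] := cexpi (dotv (x - y) xi) * a (t *: x + (1 - t) *: y, xi).
Definition quant_slice u x xi : R[i] := cintegral leb (fun y => quant_kernel x y xi * u y).
Definition quant u x : R[i] := ((2 * pi) ^- n)%:C * cintegral leb (quant_slice u x).
(** The inputs whose quantization is given by absolutely convergent iterated integrals. The bound is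
    uniform in x, so that [quant u] is bounded and continuous. *)
Definition admissible u := ccont u /\ exists C, 0 <= C /\ (forall y, normc (u y) <= C * wt y) /\
  forall x xi, normc (quant_slice u x xi) <= C * wt xi.

Lemma a_bound : exists C, 0 <= C /\ forall X, normc (a X) <= C.
Proof.
have [C [C0 hC]] := symk_bound (sa 0); exists C; split=> // X.
by have := hC (fun _ _ => ler01) tt X; rewrite mulr1.
Qed.

Lemma continuous_coord_comp (U : topologicalType) (f : U -> Rn) j : continuous f -> continuous (fun z => f z ord0 j).
Proof. by move=> cf z; apply: (@continuous_comp _ _ _ f (fun x : Rn => x ord0 j)); [exact: cf|exact: coord_continuous]. Qed.

Lemma continuous_dotv (U : normedModType R) (f g : U -> Rn) : continuous f -> continuous g ->
  continuous (fun z => dotv (f z) (g z)).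
Proof.
move=> cf cg; apply: (continuous_sum (f := fun j z => f z ord0 j * g z ord0 j)) => j z.
have h1 := @continuous_coord_comp _ f j cf z; have h2 := @continuous_coord_comp _ g j cg z.
exact: (cvgM h1 h2).
Qed.

Lemma continuous_sub (U : topologicalType) (V : normedModType R) (f g : U -> V) : continuous f -> continuous g -> continuous (fun z => f z - g z).
Proof. by move=> cf cg z; have h1 := cf z; have h2 := cg z; exact: (cvgB h1 h2). Qed.

Lemma ccont_quant_kernel : ccont (fun z : Z => quant_kernel z.1.1 z.1.2 z.2).
Proof.
apply: ccontM.
  apply: ccont_cexpi; apply: continuous_dotv; last exact: continuous_snd.
  by apply: continuous_sub; [exact: continuous_x|exact: continuous_y].
exact: (ccont_comp (j := symbol_arg t) (@continuous_symbol_arg R n t) (symk_cont tt (sa 0))).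
Qed.

Lemma normc_quant_kernel x y xi : normc (quant_kernel x y xi) = normc (a (t *: x + (1 - t) *: y, xi)).
Proof. by rewrite normcM normc_cexpi mul1r. Qed.

Lemma continuous_triple (U : topologicalType) (f g h : U -> Rn) : continuous f -> continuous g -> continuous h ->
  continuous (fun z => ((f z, g z), h z) : Z).
Proof.
move=> cf cg ch; apply: (@continuous_pair U (Rn * Rn)%type Rn (fun z => (f z, g z)) h) => //.
exact: (@continuous_pair U Rn Rn).
Qed.

Lemma ccont_quant_kernel_comp (U : normedModType R) (f g h : U -> Rn) : continuous f -> continuous g -> continuous h ->
  ccont (fun z => quant_kernel (f z) (g z) (h z)).
Proof. by move=> cf cg ch; exact: (ccont_comp (continuous_triple cf cg ch) ccont_quant_kernel). Qed.

Lemma ccont_quant_kernel1 u x xi : ccont u -> ccont (fun y => quant_kernel x y xi * u y).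
Proof.
move=> cu; apply: ccontM => //.
by apply: (@ccont_quant_kernel_comp Rn); [exact: continuous_const|exact: continuous_ident|exact: continuous_const].
Qed.

Lemma ccont_quant_kernel2 u x : ccont u -> ccont (fun p : Rn * Rn => quant_kernel x p.2 p.1 * u p.2).
Proof.
move=> cu; apply: ccontM.
  by apply: (@ccont_quant_kernel_comp (Rn * Rn)%type); [exact: continuous_const|exact: continuous_snd|exact: continuous_fst].
by apply: (ccont_comp (j := @snd Rn Rn)) cu; exact: continuous_snd.
Qed.

Lemma cmeasurable_quant_slice u x : ccont u -> cmeasurable (quant_slice u x).
Proof. by move=> cu; exact: (cmeasurable_cint (ccont_meas2 (ccont_quant_kernel2 x cu))). Qed.

Lemma quant_kernel_bound u : admissible u -> exists C, 0 <= C /\ forall x y xi, normc (quant_kernel x y xi * u y) <= C * wt y.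
Proof.
move=> [_ [C [C0 [h _]]]]; have [D [D0 hD]] := a_bound; exists (D * C); split; first exact: mulr_ge0.
by move=> x y xi; rewrite normcM normc_quant_kernel -mulrA ler_pM// normc_ge0.
Qed.

Lemma cintegrable_quant_kernel u x xi : admissible u -> cintegrable leb (fun y => quant_kernel x y xi * u y).
Proof.
move=> au; have [C [_ hC]] := quant_kernel_bound au.
by apply: (cint_wt (C := C)) => //; apply: ccont_meas1; apply: ccont_quant_kernel1; case: au.
Qed.

Lemma cintegrable_quant_slice u x : admissible u -> cintegrable leb (quant_slice u x).
Proof.
move=> [cu [C [_ [_ hC]]]].
by apply: (cint_wt (C := C)) => //; exact: cmeasurable_quant_slice.
Qed.

Lemma quant_slice_cvg u (s : nat -> Rn) x xi : admissible u -> s @ \oo --> x ->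
  (fun k => normc (quant_slice u (s k) xi - quant_slice u x xi)) @ \oo --> 0.
Proof.
move=> au sx; have [C [C0 hC]] := quant_kernel_bound au; have cu := au.1.
apply: (cDCT (g := fun y => C * wt y)) => //.
- by move=> k; apply: ccont_meas1; exact: ccont_quant_kernel1.
- by apply: ccont_meas1; exact: ccont_quant_kernel1.
- exact: integrable_cwt.
move=> y; apply: (ccont_cvg (f := fun x => quant_kernel x y xi * u y)) sx.
apply: ccontM; last exact: ccont_cst.
by apply: (@ccont_quant_kernel_comp Rn); [exact: continuous_ident|exact: continuous_const|exact: continuous_const].
Qed.

Lemma cintegral_quant_slice_cbd u : admissible u -> cbd (fun x => cintegral leb (quant_slice u x)).
Proof.
move=> au; have [cu [C [C0 [_ hC]]]] := au.
split; last first.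
  exists (C * Iwt R n) => x; apply: normc_cint_wt => //; exact: cmeasurable_quant_slice.
apply: ccont_seq => s x sx; apply: (cDCT (g := fun xi => C * wt xi)) => //.
- by move=> k; exact: cmeasurable_quant_slice.
- exact: cmeasurable_quant_slice.
- exact: integrable_cwt.
by move=> xi; exact: quant_slice_cvg.
Qed.

Lemma quant_cbd u : admissible u -> cbd (quant u).
Proof. by move=> au; apply: (cbdM (cbd_cst _ _)); exact: cintegral_quant_slice_cbd. Qed.

Lemma quant_slice_lin (c : R[i]) u v x xi : admissible u -> admissible v ->
  quant_slice (fun y => c * u y + v y) x xi = c * quant_slice u x xi + quant_slice v x xi.
Proof.
move=> au av; have i1 := cintegrable_quant_kernel x xi au; have i2 := cintegrable_quant_kernel x xi av.
rewrite /quant_slice -cintegralZ// -cintegralD//; last exact: cintegrableZ.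
by apply: eq_cintegral => y /=; rewrite mulrDr mulrCA.
Qed.

Lemma admissible_lin (c : R[i]) u v : admissible u -> admissible v -> admissible (fun y => c * u y + v y).
Proof.
move=> au av; have [cu [C [C0 [hC hC']]]] := au; have [cv [D [D0 [hD hD']]]] := av.
split; first by apply: ccontD => //; apply: ccontM => //; exact: ccont_cst.
have c0 := normc_ge0 c.
exists (normc c * C + D); split; first by rewrite addr_ge0// mulr_ge0.
have H (z1 z2 : R[i]) (w : R) : normc z1 <= C * w -> normc z2 <= D * w ->
    normc (c * z1 + z2) <= (normc c * C + D) * w.
  move=> h1 h2; rewrite (le_trans (le_normcD _ _))// mulrDl lerD// normcM -mulrA.
  by rewrite ler_wpM2l.
by split=> [y|x xi]; [exact: H|rewrite quant_slice_lin//; exact: H].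
Qed.

Lemma quant_lin (c : R[i]) u v x : admissible u -> admissible v ->
  quant (fun y => c * u y + v y) x = c * quant u x + quant v x.
Proof.
move=> au av; have i1 := cintegrable_quant_slice x au; have i2 := cintegrable_quant_slice x av.
rewrite /quant [c * (_ * _)]mulrCA -mulrDr; congr (_ * _).
rewrite -cintegralZ// -cintegralD//; last exact: cintegrableZ.
by apply: eq_cintegral => xi; rewrite quant_slice_lin.
Qed.

Lemma admissible0 : admissible (fun=> 0).
Proof.
split; first exact: ccont_cst.
exists 0; split=> //; split=> [y|x xi]; rewrite mul0r ?normc0// /quant_slice.
rewrite (_ : (fun y => _) = fun=> 0) ?cintegral0 ?normc0//.
by apply/funext => y; rewrite mulr0.
Qed.

Lemma quant_slice0 x xi : quant_slice (fun=> 0) x xi = 0.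
Proof.
rewrite /quant_slice (_ : (fun y => _) = fun=> 0) ?cintegral0//.
by apply/funext => y; rewrite mulr0.
Qed.

Lemma quant0 x : quant (fun=> 0) x = 0.
Proof.
rewrite /quant (_ : quant_slice _ x = fun=> 0) ?cintegral0 ?mulr0//.
by apply/funext => xi; exact: quant_slice0.
Qed.

Lemma admissible_sum (c : nat -> R[i]) (f : nat -> Rn -> R[i]) N : (forall q, admissible (f q)) ->
  [/\ admissible (fun y => \sum_(0 <= q < N) c q * f q y),
    forall x xi, quant_slice (fun y => \sum_(0 <= q < N) c q * f q y) x xi = \sum_(0 <= q < N) c q * quant_slice (f q) x xi &
    forall x, quant (fun y => \sum_(0 <= q < N) c q * f q y) x = \sum_(0 <= q < N) c q * quant (f q) x].
Proof.
move=> af; elim: N => [|N [IH1 IH2 IH3]].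
  rewrite (_ : (fun y => _) = fun=> 0); last by apply/funext => y; rewrite big_geq.
  by split=> [|x xi|x]; rewrite ?big_geq ?quant_slice0 ?quant0//; exact: admissible0.
rewrite (_ : (fun y => _) = fun y => c N * f N y + \sum_(0 <= q < N) c q * f q y); last first.
  by apply/funext => y; rewrite big_nat_recr//= addrC.
split=> [|x xi|x]; first exact: admissible_lin.
  by rewrite quant_slice_lin// IH2 big_nat_recr//= addrC.
by rewrite quant_lin// IH3 big_nat_recr//= addrC.
Qed.

Lemma dotvBl x y xi : dotv (x - y) xi = dotv x xi - dotv y xi.
Proof. by rewrite /dotv -sumrB; apply: eq_bigr => j _; rewrite !mxE mulrBl. Qed.

Lemma dotvC x y : dotv x y = dotv y x.
Proof. by apply: eq_bigr => j _; rewrite mulrC. Qed.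

Lemma sym_symbol_arg (I : Type) : sym (fun (_ : I) (_ : Z) => 1 : R) (fun (_ : I) (z : Z) => a (symbol_arg t z)).
Proof.
move=> k; apply: (@symk_lin R I unit _ _ k (fun _ _ => 1) (fun _ => a) (fun=> tt) (symbol_arg t)) => //.
- exact: continuous_symbol_arg.
- exact: affine_symbol_arg.
Qed.

(** The extra amplitude [b] carries the cutoff chi(eps y, eps xi). Uniformity in the index is
    uniformity in eps, and supplies the dominating function when the regularization is removed. *)
Lemma osc_bound (I : Type) (b : I -> Rn * Rn -> R[i]) (v : I -> Rn -> R[i]) (lam : I -> R) (c kap : I -> Rn) N :
  (forall i, 0 <= lam i) -> sym (fun _ _ => 1) (fun i (z : Z) => b i (z.1.2, z.2)) ->
  sym (fun i y => lam i * wt (y - c i)) v ->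
  exists C, 0 <= C /\ forall i x xi,
    normc (cintegral leb (fun y => b i (y, xi) * (quant_kernel x y xi * (cexpi (dotv (kap i) y) * v i y)))) <=
    C * lam i * (1 + `|xi - kap i|) ^- N.
Proof.
move=> lam0 sb sv.
have sb' : sym (fun _ _ => 1) (fun i (z : Z) => b i (z.1.2, z.2) * a (symbol_arg t z)).
  move=> k; have := symkM (fun _ _ => ler01) (fun _ _ => ler01) (sb k) (@sym_symbol_arg I k).
  by apply: (symk_mono (K := 1)) => // i z; rewrite ?mul1r mulr1.
have [C [C0 hC]] := slice_integral_bound kap lam0 sb' sv N; exists C; split=> // i x xi.
have := hC i x xi; rewrite /slice_integral => h; set J := (X in normc X <= _) in h.
suff -> : cintegral leb (fun y => b i (y, xi) * (quant_kernel x y xi * (cexpi (dotv (kap i) y) * v i y))) =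
    cexpi (dotv x xi) * J by rewrite normcM normc_cexpi mul1r.
have [mi [D [D0 hD]]] := slice_integrand kap lam0 sb' sv i x xi.
rewrite /J -cintegralZ; last exact: (cint_wt mi hD).
apply: eq_cintegral => y; rewrite /quant_kernel /symbol_arg /= !dotvBl !cexpiD.
by rewrite (dotvC xi y); ring.
Qed.

Lemma quant_slice_bound (I : Type) (v : I -> Rn -> R[i]) (lam : I -> R) (c kap : I -> Rn) N :
  (forall i, 0 <= lam i) -> sym (fun i y => lam i * wt (y - c i)) v ->
  exists C, 0 <= C /\ forall i x xi,
    normc (quant_slice (fun y => cexpi (dotv (kap i) y) * v i y) x xi) <= C * lam i * (1 + `|xi - kap i|) ^- N.
Proof.
move=> lam0 sv.
have s1 : sym (fun _ _ => 1) (fun (i : I) (z : Z) => 1 : R[i]).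
  by move=> k; apply: (@symk_cst _ _ _ _ _ (fun=> 1) 1) => // i z; rewrite normc1 mulr1.
have [C [C0 hC]] := osc_bound (b := fun _ _ => 1) kap N lam0 s1 sv.
exists C; split=> // i x xi; have := hC i x xi.
by congr (normc _ <= _); apply: eq_cintegral => y; rewrite mul1r.
Qed.

Lemma atom_admissible (v : Rn -> R[i]) (c kap : Rn) : sym (fun (_ : unit) y => wt (y - c)) (fun=> v) ->
  admissible (fun y => cexpi (dotv kap y) * v y).
Proof.
move=> sv.
have sv' : sym (fun (i : unit) y => 1 * wt (y - c)) (fun=> v).
  by move=> k; apply: (symk_mono (K := 1)) (sv k) => // i z; rewrite ?mul1r ?wt_ge0.
have [C [C0 hC]] := quant_slice_bound (fun=> kap) (2 * n) (fun=> ler01) sv'.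
have [D [D0 /(_ (fun _ _ => wt_ge0 _)) hD]] := symk_bound (sv 0).
have p0 (d : Rn) : 0 <= (1 + `|d|) ^+ (2 * n) by rewrite exprn_ge0// addr_ge0.
split.
  apply: ccontM; last exact: (symk_cont tt (sv 0)).
  by apply: ccont_cexpi; apply: continuous_dotv; [exact: continuous_const|exact: continuous_ident].
pose K1 := D * (1 + `|c|) ^+ (2 * n); pose K2 := C * (1 + `|kap|) ^+ (2 * n).
have K10 : 0 <= K1 by rewrite mulr_ge0.
have K20 : 0 <= K2 by rewrite mulr_ge0.
exists (K1 + K2); split; first exact: addr_ge0.
split=> [y|x xi].
  rewrite normcM normc_cexpi mul1r; apply: (le_trans (hD tt y)).
  apply: (@le_trans _ _ (K1 * wt y)); first by rewrite -mulrA ler_wpM2l// wt_shift_le.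
  by apply: ler_wpM2r; [exact: wt_ge0|rewrite lerDl].
apply: (le_trans (hC tt x xi)); rewrite mulr1.
apply: (@le_trans _ _ (K2 * wt xi)); first by rewrite -mulrA ler_wpM2l// (wt_shift_le kap xi).
by apply: ler_wpM2r; [exact: wt_ge0|rewrite lerDr].
Qed.

Lemma schwartz_wt u : schwartz u -> sym (fun (_ : unit) y => wt (y - 0)) (fun=> u).
Proof.
move=> su k; apply: (symk_mono (K := 1)) (schwartz_sym (2 * n) su k) => // i z.
by rewrite mul1r subr0.
Qed.

Lemma dotv0 y : dotv 0 y = 0.
Proof. by rewrite /dotv big1// => j _; rewrite mxE mul0r. Qed.

Lemma schwartz_admissible u : schwartz u -> admissible u.
Proof.
move=> su; have := atom_admissible 0 (schwartz_wt su).
rewrite (_ : (fun y => _) = u)//.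
by apply/funext => y; rewrite dotv0 cexpi0 mul1r.
Qed.

Section oscillatory.
Variables (chi : Rn * Rn -> R[i]) (u : Rn -> R[i]).
Hypothesis schi : schwartz chi.
Hypothesis su : schwartz u.
Hypothesis chi0 : chi 0 = 1.

Let reg x (eps : R) (p : Rn * Rn) : R[i] := chi (eps *: p) * (quant_kernel x p.1 p.2 * u p.1).

Lemma ccont_chi : ccont chi.
Proof. exact: (symk_cont tt (schwartz_sym 0 schi 0)). Qed.

Lemma chi_bound : exists C, 0 <= C /\ forall p, normc (chi p) <= C.
Proof.
have [C [C0 hC]] := symk_bound (schwartz_sym 0 schi 0); exists C; split=> // p.
have w0 (i : unit) (z : Rn * Rn) : 0 <= (1 + `|z|) ^- 0 by rewrite expr0 invr1.
by have := hC w0 tt p; rewrite expr0 invr1 mulr1.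
Qed.

Lemma continuous_scale_pt (U : normedModType R) (eps : R) : continuous (fun p : U => eps *: p).
Proof. by move=> p; exact: (cvgZ (cvg_cst eps) cvg_id). Qed.

Lemma ccont_reg x eps : ccont (reg x eps).
Proof.
apply: ccontM.
  by apply: (ccont_comp (j := fun p : Rn * Rn => eps *: p)) ccont_chi; exact: continuous_scale_pt.
apply: ccontM; last first.
  by apply: (ccont_comp (j := @fst Rn Rn)) (schwartz_admissible su).1; exact: continuous_fst.
by apply: (@ccont_quant_kernel_comp (Rn * Rn)%type); [exact: continuous_const|exact: continuous_fst|exact: continuous_snd].
Qed.

Lemma reg_bound x eps : 0 < eps -> exists C, forall y xi, normc (reg x eps (y, xi)) <= C * (wt y * wt xi).
Proof.
move=> e0; have [C [C0 hC]] := quant_kernel_bound (schwartz_admissible su).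
have [D [D0 hD]] := symk_bound (schwartz_sym (2 * n) schi 0).
have w0 (i : unit) (p : Rn * Rn) : 0 <= (1 + `|p|) ^- (2 * n) by rewrite invr_ge0 exprn_ge0// addr_ge0.
(* 1 + eps |p| >= m (1 + |p|) converts the decay of the dilated cutoff into decay in p. *)
pose m := Num.min 1 eps; have m0 : 0 < m by rewrite lt_min ltr01.
exists (D * m ^- (2 * n) * C) => y xi; rewrite /reg normcM.
apply: (@le_trans _ _ ((D * (m ^- (2 * n) * wt xi)) * (C * wt y))); last first.
  by rewrite le_eqVlt; apply/orP; left; apply/eqP; ring.
apply: ler_pM; rewrite ?normc_ge0//.
apply: (le_trans (hD w0 tt _)); apply: ler_wpM2l => //.
rewrite /wt -invfM -exprMn lef_pV2 ?posrE ?exprn_gt0 ?mulr_gt0 ?ltr_pwDl//.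
apply: lerXn2r; rewrite ?nnegrE ?mulr_ge0 ?addr_ge0// ?(ltW m0)//.
rewrite mulrDr mulr1 lerD//; first by rewrite ge_min lexx.
rewrite normrZ (gtr0_norm e0); apply: ler_pM; rewrite ?(ltW m0)//.
  by rewrite ge_min lexx orbT.
by rewrite prod_normE /= le_max lexx orbT.
Qed.

Lemma reg_integrable x eps : 0 < eps -> cintegrable (leb \x leb)%E (reg x eps).
Proof.
move=> e0; have [C hC] := reg_bound x e0.
exact: (cint_wt2 (ccont_meas2 (ccont_reg x eps)) hC).
Qed.

Lemma chi_cvg (s : nat -> R) p : s @ \oo --> 0 -> (fun k => normc (chi (s k *: p) - 1)) @ \oo --> 0.
Proof.
move=> s0; rewrite -chi0; apply: (ccont_cvg ccont_chi).
by rewrite -[X in _ --> X](scale0r p); exact: (cvgZ s0 (cvg_cst p)).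
Qed.

(** Fubini puts the y-integral inside; then dominated convergence is applied in xi, with the bound
    of [osc_bound], and in y. Dilation factors at most 1 keep the derivatives of the dilated cutoffs
    bounded uniformly in k. *)
Lemma osc_seq x (s : nat -> R) : (forall k, 0 < s k <= 1) -> s @ \oo --> 0 ->
  (fun k => normc (cintegral (leb \x leb)%E (reg x (s k)) - cintegral leb (quant_slice u x))) @ \oo --> 0.
Proof.
move=> s01 s0; have au := schwartz_admissible su.
have E k : cintegral (leb \x leb)%E (reg x (s k)) =
    cintegral leb (fun xi => cintegral leb (fun y => reg x (s k) (y, xi))).
  have /andP[sk _] := s01 k; have [C hC] := reg_bound x sk.
  by have [_ ->] := cfubini_wt (ccont_meas2 (ccont_reg x (s k))) hC.
have sb : sym (fun _ _ => 1) (fun k (z : Z) => chi (s k *: (z.1.2, z.2))).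
  have sc : sym (fun (_ : unit) (_ : Rn * Rn) => 1 : R) (fun=> chi).
    by move=> k; apply: (symk_mono (K := 1)) (schwartz_sym 0 schi k) => // i p; rewrite expr0 invr1 ?mulr1.
  pose L (z : Z) : Rn * Rn := (z.1.2, z.2).
  have cL : continuous L by apply: (@continuous_pair Z Rn Rn); [exact: continuous_y|exact: continuous_snd].
  move=> k; apply: (@symk_comp R _ _ nat unit k (fun _ _ => 1) (fun=> chi) (fun=> tt)
    (fun k z => s k *: L z) s L) (sc k) => //.
  - by move=> i; have /andP[h1 h2] := s01 i; rewrite gtr0_norm.
  - by move=> i z; have h := cL z; exact: (cvgZ (cvg_cst (s i)) h).
  by move=> i h v z; rewrite scalerA mulrC -scalerA -scalerDr.
have sv : sym (fun (i : nat) y => 1 * wt (y - 0)) (fun=> u).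
  move=> k; apply: (@symk_comp R _ _ nat unit k (fun _ y => 1 * wt (y - 0)) (fun=> u) (fun=> tt)
    (fun k z => z) (fun=> 1) id) => //.
  - by move=> _ z; rewrite mul1r wt_ge0.
  - by move=> _; rewrite normr1.
  - by move=> _; exact: continuous_ident.
  - by move=> _ h v z; rewrite scale1r.
  by apply: (symk_mono (K := 1)) (schwartz_wt su k) => // i z; rewrite ?mul1r// wt_ge0.
have [C [C0 hC]] := osc_bound (b := fun k p => chi (s k *: p)) (fun=> 0) (2 * n) (fun=> ler01) sb sv.
have hC' k xi : normc (cintegral leb (fun y => reg x (s k) (y, xi))) <= C * wt xi.
  have := hC k x xi; rewrite mulr1 subr0; congr (normc _ <= _); apply: eq_cintegral => y.
  by rewrite dotv0 cexpi0 mul1r.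
under eq_fun do rewrite E.
apply: (cDCT (g := fun xi => C * wt xi)) => //.
- move=> k; apply: (cmeasurable_cint (h := fun p => reg x (s k) (p.2, p.1))).
  apply: ccont_meas2; apply: (ccont_comp (j := fun p : Rn * Rn => (p.2, p.1))) (ccont_reg x (s k)).
  by apply: (@continuous_pair (Rn * Rn)%type Rn Rn); [exact: continuous_snd|exact: continuous_fst].
- by apply: cmeasurable_quant_slice; case: au.
- exact: integrable_cwt.
move=> xi; have [D [D0 hD]] := quant_kernel_bound au; have [B [B0 hB]] := chi_bound.
apply: (cDCT (g := fun y => (B * D) * wt y)) => //.
- move=> k; apply: ccont_meas1; apply: (ccont_comp (j := fun y : Rn => (y, xi))) (ccont_reg x (s k)).
  by apply: (@continuous_pair Rn Rn Rn); [exact: continuous_ident|exact: continuous_const].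
- by apply: ccont_meas1; apply: ccont_quant_kernel1; case: au.
- by move=> k y; rewrite /reg normcM -mulrA ler_pM ?normc_ge0//=.
- exact: integrable_cwt.
move=> y; have h := chi_cvg (y, xi) s0.
rewrite (_ : (fun k => _) = (fun k => normc (chi (s k *: (y, xi)) - 1) * normc (quant_kernel x y xi * u y))); last first.
  by apply/funext => k; rewrite /reg -normcM mulrBl mul1r.
by rewrite -[X in _ --> X](mul0r (normc (quant_kernel x y xi * u y))); exact: (cvgM h (cvg_cst _)).
Qed.

Lemma osc_part (f : R[i] -> R) x : (forall z w, `|f z - f w| <= normc (z - w)) ->
  f (cintegral (leb \x leb)%E (reg x eps)) @[eps --> 0^'+] --> f (cintegral leb (quant_slice u x)).
Proof.
move=> hf; apply/cvg_at_rightP => s [s0 sl].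
(* Dropping finitely many terms brings the sequence into ]0, 1], as [osc_seq] requires. *)
move/cvgrPdist_le : (sl) => /(_ 1 ltr01) [N _ hN].
rewrite -(cvg_shiftn N); pose v k := s (k + N)%N.
have v1 k : 0 < v k <= 1 by rewrite s0/= (le_trans _ (hN _ (leq_addl k N)))// sub0r normrN ler_norm.
have vl : v @ \oo --> 0 by rewrite -(cvg_shiftn N) in sl.
have := osc_seq x v1 vl => h; apply/subr_cvg0; apply/norm_cvg0P.
apply: squeeze_cvgr h; last exact: cvg_cst.
by near=> k; rewrite normr_ge0/=; exact: hf.
Unshelve. all: by end_near. Qed.

End oscillatory.

Lemma is_quantization_quant u : schwartz u -> is_quantization a t u (quant u).
Proof.
move=> su x; exists (cintegral leb (quant_slice u x)) => // chi schi chi0; split=> /=.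
- by move=> eps e0; exact: (reg_integrable schi su x e0).
- apply: (osc_part schi su chi0 (f := fun z => complex.Re z)) => z w.
  by rewrite (_ : _ - _ = complex.Re (z - w)) ?Re_le_normc// !cE.
apply: (osc_part schi su chi0 (f := fun z => complex.Im z)) => z w.
by rewrite (_ : _ - _ = complex.Im (z - w)) ?Im_le_normc// !cE.
Qed.

End quantization.

(** * Matrix coefficients *)

Section phase.
Context (R : realType) (n : nat) (V : normedModType R) (I : Type).
Local Notation Rn := 'rV[R]_n.
Local Notation leb := (lebesgue_rV R n).

(** Along a slice the phase is affine, th(z + E b) = th(z) + l(z).b; the constant factor exp(i
    th(z)) passes through the integrals and reduces this to [ibp]. *)
Lemma ibp_phase (E : Rn -> V) (l : I -> 'I_n -> V -> R) (lin : 'I_n -> V -> R) (th : I -> V -> R) N k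
    (w : I -> V -> R) (F : I -> V -> R[i]) :
  (forall (h : R) u v, E (h *: u + v) = h *: E u + E v) -> continuous E ->
  (forall i j, continuous (l i j)) ->
  (forall i j (h : R) v z, l i j (h *: v + z) = h * lin j v + l i j z) ->
  (forall j b, lin j (E b) = 0) ->
  (forall i z b, th i (z + E b) = th i z + \sum_j l i j z * b ord0 j) ->
  (forall i z, 0 <= w i z) -> slice_le E w -> symk (N * n + k) w F ->
  exists G, symk k (fun i z => (1 + `|freq l i z|) ^- N * w i z) G /\
    forall i z, cintegral leb (fun b => cexpi (th i (z + E b)) * F i (z + E b)) =
                cintegral leb (fun b => cexpi (th i (z + E b)) * G i (z + E b)).
Proof.
move=> lE cE cl al l0 hth w0 sw sF.
have [G [sG hG]] := ibp (N := N) (k := k) lE cE cl al l0 w0 sw sF.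
exists G; split=> // i z.
have w0' i' z' : 0 <= (1 + `|freq l i' z'|) ^- N * w i' z'.
  by rewrite mulr_ge0// invr_ge0 exprn_ge0// addr_ge0.
have H k' w' F' : symk k' w' F' -> (forall i z, 0 <= w' i z) -> (forall i z, w' i z <= w i z) ->
    cintegral leb (fun b => cexpi (th i (z + E b)) * F' i (z + E b)) =
    cexpi (th i z) * cintegral leb (fun b => ph l i z b * F' i (z + E b)).
  move=> sF' w'0 ww; have [C [C0 hC]] := symk_bound sF'; have [K hK] := sw i z.
  rewrite -cintegralZ; last first.
    apply: (cint_wt (C := C * K)).
      apply: ccont_meas1; apply: ccontM; first exact: ccont_ph.
      apply: (ccont_comp (j := fun y => z + E y)); last exact: (symk_cont i sF').
      by move=> y; have h := cE y; exact: (cvgD (cvg_cst z) h).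
    move=> b; rewrite normcM normc_cexpi mul1r -mulrA; apply: (le_trans (hC w'0 i _)).
    by apply: ler_wpM2l => //; exact: le_trans (ww _ _) (hK b).
  by apply: eq_cintegral => b; rewrite hth cexpiD mulrA.
rewrite (H _ _ _ sF)// (H _ _ _ sG)//; first by rewrite hG.
move=> i' z'; rewrite ler_piMl// invf_le1 ?exprn_ege1 ?exprn_gt0 ?ltr_pwDl//.
by rewrite lerDl.
Qed.

End phase.

(** * Changing the order of integration in three variables *)

Section triple.
Context (R : realType) (n : nat).
Local Notation Rn := 'rV[R]_n.
Local Notation Z := ((Rn * Rn) * Rn)%type.
Local Notation leb := (lebesgue_rV R n).
Variables (h : Z -> R[i]) (C : R).
Hypothesis ch : ccont h.
Hypothesis hC : forall x y xi, normc (h ((x, y), xi)) <= C * (wt x * wt y * wt xi).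

Let hp (f1 f2 f3 : Z -> Rn) : continuous f1 -> continuous f2 -> continuous f3 ->
  ccont (fun z => h ((f1 z, f2 z), f3 z)).
Proof. by move=> c1 c2 c3; exact: (ccont_comp (continuous_triple c1 c2 c3) ch). Qed.

Let swap_inner xi : cintegral leb (fun x => cintegral leb (fun y => h ((x, y), xi))) =
  cintegral leb (fun y => cintegral leb (fun x => h ((x, y), xi))).
Proof.
apply: (cswap_wt (h := fun p => h (p, xi)) (C := C * wt xi)).
  apply: ccont_meas2; apply: (ccont_comp (j := fun p : Rn * Rn => ((p, xi) : Z))) ch.
  by apply: (@continuous_pair (Rn * Rn)%type (Rn * Rn)%type Rn); [exact: continuous_ident|exact: continuous_const].
by move=> x y; apply: (le_trans (hC x y xi)); rewrite le_eqVlt; apply/orP; left; apply/eqP; ring.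
Qed.

Let swap_outer : cintegral leb (fun x => cintegral leb (fun xi => cintegral leb (fun y => h ((x, y), xi)))) =
  cintegral leb (fun xi => cintegral leb (fun x => cintegral leb (fun y => h ((x, y), xi)))).
Proof.
have c : ccont (fun z : Z => h ((z.1.1, z.2), z.1.2)).
  by apply: hp; [exact: continuous_x|exact: continuous_snd|exact: continuous_y].
apply: (cswap_wt (h := fun p => cintegral leb (fun y => h ((p.1, y), p.2))) (C := C * Iwt R n)).
  exact: (cmeasurable_cint (ccont_meas3 c)).
move=> x xi; rewrite mulrAC; apply: normc_cint_wt => [|y].
  apply: ccont_meas1; apply: (ccont_comp (j := fun y : Rn => ((x, y), xi) : Z)) ch.
  by apply: (@continuous_triple R n Rn); [exact: continuous_const|exact: continuous_ident|exact: continuous_const].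
by rewrite (le_trans (hC x y xi))// le_eqVlt; apply/orP; left; apply/eqP; ring.
Qed.

Let swap_x x : cintegral leb (fun xi => cintegral leb (fun y => h ((x, y), xi))) =
  cintegral leb (fun y => cintegral leb (fun xi => h ((x, y), xi))).
Proof.
apply: (cswap_wt (h := fun p => h ((x, p.2), p.1)) (C := C * wt x)).
  apply: ccont_meas2; apply: (ccont_comp (j := fun p : Rn * Rn => ((x, p.2), p.1) : Z)) ch.
  by apply: (@continuous_triple R n (Rn * Rn)%type); [exact: continuous_const|exact: continuous_snd|exact: continuous_fst].
by move=> xi y; apply: (le_trans (hC x y xi)); rewrite le_eqVlt; apply/orP; left; apply/eqP; ring.
Qed.

Lemma triple_swap_cycle : cintegral leb (fun x => cintegral leb (fun xi => cintegral leb (fun y => h ((x, y), xi)))) =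
  cintegral leb (fun xi => cintegral leb (fun y => cintegral leb (fun x => h ((x, y), xi)))).
Proof. by rewrite swap_outer; apply: eq_cintegral => xi; exact: swap_inner. Qed.

Lemma triple_swap_last : cintegral leb (fun x => cintegral leb (fun xi => cintegral leb (fun y => h ((x, y), xi)))) =
  cintegral leb (fun x => cintegral leb (fun y => cintegral leb (fun xi => h ((x, y), xi)))).
Proof. by apply: eq_cintegral => x; exact: swap_x. Qed.

End triple.

Section matrix.
Context (R : realType) (n : nat) (t : R) (a : 'rV[R]_n * 'rV[R]_n -> R[i]).
Local Notation Rn := 'rV[R]_n.
Local Notation L := ('rV[int]_n * 'rV[int]_n)%type.
Local Notation Z := ((Rn * Rn) * Rn)%type.
Local Notation leb := (lebesgue_rV R n).
Variables (M : Rn * Rn -> R) (N0 : nat) (K0 : R).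
Hypothesis M0 : forall X, 0 <= M X.
Hypothesis M1 : forall X, M X <= 1.
Hypothesis K00 : 0 <= K0.
Hypothesis MT : forall X Y, M X <= K0 * phase_wt N0 X Y * M Y.
Hypothesis saM : sym (fun (_ : unit) => M) (fun _ => a).
Local Notation phi := (gabor_atom (@cell_bump R n)).
Local Notation phase_pt j := (lattice_pt R j.1, lattice_pt R j.2).

Lemma sym_bounded_symbol : sym (fun (_ : unit) (_ : Rn * Rn) => 1 : R) (fun _ => a).
Proof. by move=> k; apply: (symk_mono (K := 1)) (saM k) => // i z; rewrite mul1r. Qed.

Lemma kdotE (k : 'rV[int]_n) (x : Rn) : kdot k x = dotv (lattice_pt R k) x.
Proof. by rewrite /kdot /dotv; apply: eq_bigr => i _; rewrite mxE. Qed.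

Lemma gabor_atomE (tau : Rn -> R) j x : gabor_atom tau j x = cexpi (dotv (lattice_pt R j.2) x) * (tau (x - lattice_pt R j.1))%:C.
Proof. by rewrite /gabor_atom kdotE mulrC. Qed.

Lemma sym_shift (tau : Rn -> R) (I : Type) (c : I -> Rn) N : sym (fun (_ : unit) x => (1 + `|x|) ^- N) (fun _ x => (tau x)%:C) ->
  sym (fun i x => (1 + `|x - c i|) ^- N) (fun i x => (tau (x - c i))%:C).
Proof.
move=> st k; apply: (@symk_shift R I unit _ k (fun _ x => (1 + `|x|) ^- N) (fun _ x => (tau x)%:C) (fun=> tt) c) => //.
Qed.

Lemma phi_admissible j : admissible t a (phi j).
Proof.
rewrite (_ : phi j = fun y => cexpi (dotv (lattice_pt R j.2) y) * (cell_bump (y - lattice_pt R j.1))%:C).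
  by apply: (@atom_admissible R n t a sym_bounded_symbol _ (lattice_pt R j.1)); exact: (sym_shift (fun=> lattice_pt R j.1) (@bump_sym R n _)).
by apply/funext => x; rewrite gabor_atomE.
Qed.

(** Decay budget: N0 pays for moving M to the lattice point, 2n for the kernel [rho], and 2n for
    integrability in one variable. *)
Let P := (N0 + 4 * n)%N.
Let F (i : L * L) (z : Z) : R[i] :=
  a (symbol_arg t z) * ((cell_bump (z.1.2 - lattice_pt R i.1.1))%:C * (cell_bump (z.1.1 - lattice_pt R i.2.1))%:C).
Let w (i : L * L) (z : Z) : R :=
  M (symbol_arg t z) * ((1 + `|z.1.2 - lattice_pt R i.1.1|) ^- P * (1 + `|z.1.1 - lattice_pt R i.2.1|) ^- P).
Let th (i : L * L) (z : Z) : R :=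
  dotv (z.1.1 - z.1.2) z.2 + dotv (lattice_pt R i.1.2) z.1.2 - dotv (lattice_pt R i.2.2) z.1.1.

Let pP0 N (x : Rn) : 0 <= (1 + `|x|) ^- N.
Proof. by rewrite invr_ge0 exprn_ge0// addr_ge0. Qed.

Let pP1 N (x : Rn) : (1 + `|x|) ^- N <= 1.
Proof. by rewrite invf_le1 ?exprn_ege1 ?exprn_gt0 ?ltr_pwDl// lerDl. Qed.

Let w_ge0 i z : 0 <= w i z.
Proof. by rewrite mulr_ge0// mulr_ge0. Qed.

Let sF : sym w F.
Proof.
move=> k; apply: symkM => //; try by move=> i z; rewrite mulr_ge0.
  apply: (@symk_lin R (L * L)%type unit _ _ k (fun _ => M) (fun _ => a) (fun=> tt) (symbol_arg t)) => //.
  - exact: continuous_symbol_arg.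
  - exact: affine_symbol_arg.
apply: symkM => //.
  apply: (@symk_lin R _ (L * L)%type _ _ k (fun i y => (1 + `|y - lattice_pt R i.1.1|) ^- P)
    (fun i y => (cell_bump (y - lattice_pt R i.1.1))%:C) id (fun z : Z => z.1.2)) => //; first exact: continuous_y.
  exact: (sym_shift (fun i : (L * L)%type => lattice_pt R i.1.1) (@bump_sym R n P) k).
apply: (@symk_lin R _ (L * L)%type _ _ k (fun i y => (1 + `|y - lattice_pt R i.2.1|) ^- P)
    (fun i y => (cell_bump (y - lattice_pt R i.2.1))%:C) id (fun z : Z => z.1.1)) => //; first exact: continuous_x.
exact: (sym_shift (fun i : (L * L)%type => lattice_pt R i.2.1) (@bump_sym R n P) k).
Qed.

Let ly (i : L * L) (j : 'I_n) (z : Z) := lattice_pt R i.1.2 ord0 j - z.2 ord0 j.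
Let lx (i : L * L) (j : 'I_n) (z : Z) := z.2 ord0 j - lattice_pt R i.2.2 ord0 j.
Let lxi (i : L * L) (j : 'I_n) (z : Z) := z.1.1 ord0 j - z.1.2 ord0 j.

Let freqy i z : freq ly i z = lattice_pt R i.1.2 - z.2.
Proof. by apply/rowP => j; rewrite mxE /ly !mxE. Qed.
Let freqx i z : freq lx i z = z.2 - lattice_pt R i.2.2.
Proof. by apply/rowP => j; rewrite mxE /lx !mxE. Qed.
Let freqxi i z : freq lxi i z = z.1.1 - z.1.2.
Proof. by apply/rowP => j; rewrite !mxE. Qed.

Let w1 i z := (1 + `|freq ly i z|) ^- P * w i z.
Let w2 i z := (1 + `|freq lx i z|) ^- P * w1 i z.
Let w3 i z := (1 + `|freq lxi i z|) ^- P * w2 i z.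

Let w1_ge0 i z : 0 <= w1 i z. Proof. by rewrite mulr_ge0. Qed.
Let w2_ge0 i z : 0 <= w2 i z. Proof. by rewrite mulr_ge0. Qed.
Let w3_ge0 i z : 0 <= w3 i z. Proof. by rewrite mulr_ge0. Qed.

Let pP_wt (x c : Rn) : (1 + `|x - c|) ^- P <= (1 + `|c|) ^+ (2 * n) * wt x.
Proof.
apply: (le_trans _ (wt_shift_le c x)); rewrite /wt lef_pV2 ?posrE ?exprn_gt0 ?ltr_pwDl//.
rewrite ler_weXn2l ?lerDl// /P (leq_trans _ (leq_addl _ _))// leq_mul2r.
by rewrite orbT.
Qed.

Let w_le i z : w i z <= (1 + `|z.1.2 - lattice_pt R i.1.1|) ^- P * (1 + `|z.1.1 - lattice_pt R i.2.1|) ^- P.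
Proof. by rewrite ler_piMl// mulr_ge0. Qed.

Let sly : slice_le (@inj_y R n) w.
Proof.
move=> i [[x y] xi]; exists ((1 + `|lattice_pt R i.1.1 - y|) ^+ (2 * n)) => b; rewrite add_inj_y.
apply: (le_trans (w_le i _)); apply: (le_trans (ler_piMr _ _)) => //=.
by rewrite (_ : y + b - _ = b - (lattice_pt R i.1.1 - y)) ?pP_wt// opprB addrCA addrA.
Qed.

Let slx : slice_le (@inj_x R n) w1.
Proof.
move=> i [[x y] xi]; exists ((1 + `|lattice_pt R i.2.1 - x|) ^+ (2 * n)) => b; rewrite add_inj_x.
apply: (le_trans (ler_piMl (w_ge0 _ _) (pP1 _ _))); apply: (le_trans (w_le i _)).
apply: (le_trans (ler_piMl _ _)) => //=.
by rewrite (_ : x + b - _ = b - (lattice_pt R i.2.1 - x)) ?pP_wt// opprB addrCA addrA.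
Qed.

Let slxi : slice_le (@inj_xi R n) w2.
Proof.
move=> i [[x y] xi]; exists ((1 + `|lattice_pt R i.1.2 - xi|) ^+ (2 * n)) => b; rewrite add_inj_xi.
apply: (le_trans (ler_piMl (w1_ge0 _ _) (pP1 _ _))).
apply: (@le_trans _ _ ((1 + `|freq ly i ((x, y), xi + b)|) ^- P)).
  apply: ler_piMr => //; apply: (le_trans (w_le i _)); exact: mulr_ile1.
rewrite freqy distrC /=.
by rewrite (_ : xi + b - _ = b - (lattice_pt R i.1.2 - xi)) ?pP_wt// opprB addrCA addrA.
Qed.

Let thy i z b : th i (z + inj_y b) = th i z + \sum_j ly i j z * b ord0 j.
Proof.
rewrite /th /dotv /= !addr0 -!big_split/= -!sumrB -!big_split/=.
by apply: eq_bigr => j _; rewrite /ly !mxE; ring.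
Qed.

Let thx i z b : th i (z + inj_x b) = th i z + \sum_j lx i j z * b ord0 j.
Proof.
rewrite /th /dotv /= !addr0 -!big_split/= -!sumrB -!big_split/=.
by apply: eq_bigr => j _; rewrite /lx !mxE; ring.
Qed.

Let thxi i z b : th i (z + inj_xi b) = th i z + \sum_j lxi i j z * b ord0 j.
Proof.
rewrite /th /dotv /= !addr0 -!big_split/= -!sumrB -!big_split/=.
by apply: eq_bigr => j _; rewrite /lxi !mxE; ring.
Qed.

Let cont_th i : continuous (th i).
Proof.
move=> z; have h1 : continuous (fun z : Z => dotv (z.1.1 - z.1.2) z.2).
  by apply: continuous_dotv; [apply: continuous_sub; [exact: continuous_x|exact: continuous_y]|exact: continuous_snd].
have h2 : continuous (fun z : Z => dotv (lattice_pt R i.1.2) z.1.2).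
  by apply: continuous_dotv; [exact: continuous_const|exact: continuous_y].
have h3 : continuous (fun z : Z => dotv (lattice_pt R i.2.2) z.1.1).
  by apply: continuous_dotv; [exact: continuous_const|exact: continuous_x].
exact: (cvgB (cvgD (h1 z) (h2 z)) (h3 z)).
Qed.

(** Each integration by parts controls one difference: y gives decay in xi - k, x gives decay in xi
    - k', and xi gives decay in x - y. Together with the bumps at m and m' they link (m, k) to (m',
    k'). *)
Let three : exists G1 G2 G3, [/\ symk 0 w1 G1, symk 0 w2 G2, symk 0 w3 G3 &
  [/\ forall i z, cintegral leb (fun b => cexpi (th i (z + inj_y b)) * F i (z + inj_y b)) =
                cintegral leb (fun b => cexpi (th i (z + inj_y b)) * G1 i (z + inj_y b)),
      forall i z, cintegral leb (fun b => cexpi (th i (z + inj_x b)) * G1 i (z + inj_x b)) =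
                cintegral leb (fun b => cexpi (th i (z + inj_x b)) * G2 i (z + inj_x b)) &
      forall i z, cintegral leb (fun b => cexpi (th i (z + inj_xi b)) * G2 i (z + inj_xi b)) =
                cintegral leb (fun b => cexpi (th i (z + inj_xi b)) * G3 i (z + inj_xi b))]].
Proof.
have cc (f : Z -> Rn) j : continuous f -> continuous (fun z => f z ord0 j).
  by move=> cf; exact: continuous_coord_comp.
(* The first application leaves P n derivatives for each of the following ones. *)
have [G1 [s1 h1]] : exists G, symk (P * n + (P * n + 0)) w1 G /\ forall i z,
    cintegral leb (fun b => cexpi (th i (z + inj_y b)) * F i (z + inj_y b)) =
    cintegral leb (fun b => cexpi (th i (z + inj_y b)) * G i (z + inj_y b)).
  apply: (@ibp_phase R n _ _ (@inj_y R n) ly (fun j (z : Z) => - z.2 ord0 j) th P _ w F (@linear_inj_y R n) (@continuous_inj_y R n)) => //.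
  - by move=> i j; apply: continuous_sub; [exact: continuous_const|apply: cc; exact: continuous_snd].
  - by move=> i j h v z; rewrite /ly !mxE; ring.
  - by move=> j b; rewrite /= mxE oppr0.
have [G2 [s2 h2]] : exists G, symk (P * n + 0) w2 G /\ forall i z,
    cintegral leb (fun b => cexpi (th i (z + inj_x b)) * G1 i (z + inj_x b)) =
    cintegral leb (fun b => cexpi (th i (z + inj_x b)) * G i (z + inj_x b)).
  apply: (@ibp_phase R n _ _ (@inj_x R n) lx (fun j (z : Z) => z.2 ord0 j) th P _ w1 G1 (@linear_inj_x R n) (@continuous_inj_x R n)) => //.
  - by move=> i j; apply: continuous_sub; [apply: cc; exact: continuous_snd|exact: continuous_const].
  - by move=> i j h v z; rewrite /lx !mxE; ring.
  - by move=> j b; rewrite /= mxE.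
have [G3 [s3 h3]] : exists G, symk 0 w3 G /\ forall i z,
    cintegral leb (fun b => cexpi (th i (z + inj_xi b)) * G2 i (z + inj_xi b)) =
    cintegral leb (fun b => cexpi (th i (z + inj_xi b)) * G i (z + inj_xi b)).
  apply: (@ibp_phase R n _ _ (@inj_xi R n) lxi (fun j (z : Z) => z.1.1 ord0 j - z.1.2 ord0 j) th P _ w2 G2 (@linear_inj_xi R n) (@continuous_inj_xi R n)) => //.
  - by move=> i j; apply: continuous_sub; apply: cc; [exact: continuous_x|exact: continuous_y].
  - by move=> i j h v z; rewrite /lxi !mxE; ring.
  - by move=> j b; rewrite /= !mxE subrr.
have dn k v G : symk k v G -> symk 0 v G by elim: k => // k IH h; apply: IH; exact: symkS.
by exists G1, G2, G3; split=> //; [exact: dn s1|exact: dn s2].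
Qed.

(** After the integration by parts in y the integrand is absolutely integrable in all three
    variables: x and y by the bumps, xi by the gain. From here on the order of integration is
    free. *)
Let w1_wt i : exists K, 0 <= K /\ forall x y xi, w1 i ((x, y), xi) <= K * (wt x * wt y * wt xi).
Proof.
pose A (c : Rn) := (1 + `|c|) ^+ (2 * n); have A0 c : 0 <= A c by rewrite exprn_ge0// addr_ge0.
exists (A (lattice_pt R i.1.2) * (A (lattice_pt R i.1.1) * A (lattice_pt R i.2.1))); split; first by rewrite !mulr_ge0.
move=> x y xi; rewrite /w1 freqy distrC /=.
rewrite (_ : _ * (_ * _ * _) = (A (lattice_pt R i.1.2) * wt xi) * ((A (lattice_pt R i.1.1) * wt y) * (A (lattice_pt R i.2.1) * wt x))); last by ring.
apply: ler_pM; [exact: pP0|exact: w_ge0|exact: pP_wt|].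
apply: (le_trans (w_le i _)); apply: ler_pM => //=; exact: pP_wt.
Qed.

Let swap_ok k (w' : L * L -> Z -> R) G i : symk k w' G -> (forall i z, 0 <= w' i z) ->
  (forall i z, w' i z <= w1 i z) ->
  ccont (fun z => cexpi (th i z) * G i z) /\
  exists C, forall x y xi, normc (cexpi (th i ((x, y), xi)) * G i ((x, y), xi)) <= C * (wt x * wt y * wt xi).
Proof.
move=> sG w'0 ww; have [C [C0 hC]] := symk_bound sG; have [K [K0' hK]] := w1_wt i; split.
  by apply: ccontM; [apply: ccont_cexpi; exact: cont_th|exact: (symk_cont i sG)].
exists (C * K) => x y xi; rewrite normcM normc_cexpi mul1r; apply: (le_trans (hC w'0 i _)).
by rewrite -mulrA ler_wpM2l// (le_trans (ww _ _)).
Qed.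

(** Temperance moves M from the symbol's point to the lattice point of j; triangle inequalities turn
    the remaining decay into [rho], and what is left is integrable in x, y and xi with j, k only as
    centres. *)
Let w3_rho : exists K, 0 <= K /\ forall i x y xi, w3 i ((x, y), xi) <=
  K * M (phase_pt i.1) * rho R i.1 i.2 * (wt (x - lattice_pt R i.2.1) * (wt (y - lattice_pt R i.1.1) * wt (xi - lattice_pt R i.1.2))).
Proof.
pose b : R := (1 + `|t|) ^+ N0; have b0 : 0 <= b by rewrite exprn_ge0// addr_ge0.
exists (K0 * b); split; first by rewrite mulr_ge0.
move=> [[m k] [m' k']] x y xi /=; rewrite /w3 /w2 /w1 freqxi freqx freqy /w /symbol_arg /=.
set X1 := 1 + `|x - y|; set Y1 := 1 + `|y - lattice_pt R m|; set Y2 := 1 + `|x - lattice_pt R m'|.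
set Q1 := 1 + `|lattice_pt R k - xi|; set Q2 := 1 + `|xi - lattice_pt R k'|.
have g1 (z : Rn) : 1 <= 1 + `|z| by rewrite lerDl.
have p1 (z : Rn) : 0 < 1 + `|z| by rewrite ltr_pwDl.
(* The base point is t x + (1 - t) y = m + t (x - y) + (y - m), which explains the factors in x - y
   and y - m and the constant in |t|. *)
have MM : M (t *: x + (1 - t) *: y, xi) <= K0 * (b * (X1 ^+ N0 * Y1 ^+ N0 * Q1 ^+ N0)) * M (lattice_pt R m, lattice_pt R k).
  apply: (le_trans (MT _ (lattice_pt R m, lattice_pt R k))); apply: ler_wpM2r => //; apply: ler_wpM2l => //.
  rewrite /b /phase_wt /= -!exprMn; apply: lerXn2r; rewrite ?nnegrE ?mulr_ge0 ?addr_ge0//.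
  rewrite [1 + `|xi - _|](_ : _ = Q1); last by rewrite /Q1 distrC.
  rewrite !mulrA; apply: ler_wpM2r; first exact: ltW (p1 _).
  rewrite (_ : t *: x + _ - _ = t *: (x - y) + (y - lattice_pt R m)); last first.
    by rewrite scalerBl scale1r scalerBr; rewrite !addrA; congr (_ + _); rewrite -!addrA; congr (_ + _); rewrite addrC.
  apply: (le_trans (peetre _ _)); apply: ler_wpM2r; first exact: ltW (p1 _).
  have := mulr_ge0 (normr_ge0 t) (normr_ge0 (x - y)); have := normr_ge0 t; have := normr_ge0 (x - y).
  by rewrite normrZ /X1 mulrDl mul1r mulrDr mulr1; lra.
have PE (z : R) : z ^+ P = z ^+ N0 * (z ^+ (2 * n) * z ^+ (2 * n)).
  by rewrite -exprD -mulnDl -exprD.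
(* The chain from m to m' through y and x. *)
have e1 : (X1 ^+ (2 * n) * (Y1 ^+ (2 * n) * Y2 ^+ (2 * n)))^-1 <= wt (lattice_pt R m - lattice_pt R m').
  rewrite /wt lef_pV2 ?posrE ?exprn_gt0 ?mulr_gt0 ?exprn_gt0 ?p1//.
  rewrite -!exprMn; apply: lerXn2r; rewrite ?nnegrE ?mulr_ge0 ?addr_ge0//.
  rewrite (_ : lattice_pt R m - lattice_pt R m' = - (y - lattice_pt R m) + (- (x - y) + (x - lattice_pt R m'))); last first.
    by rewrite !opprB addrA subrKA addrA subrK.
  apply: (le_trans (peetre _ _)); rewrite normrN [leRHS]mulrCA; apply: ler_wpM2l; first exact: ltW (p1 _).
  by apply: (le_trans (peetre _ _)); rewrite normrN.
have e2 : (Q1 ^+ (2 * n) * Q2 ^+ (2 * n))^-1 <= wt (lattice_pt R k - lattice_pt R k').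
  rewrite /wt lef_pV2 ?posrE ?exprn_gt0 ?mulr_gt0 ?exprn_gt0 ?p1//.
  rewrite -!exprMn; apply: lerXn2r; rewrite ?nnegrE ?mulr_ge0 ?addr_ge0//.
  rewrite (_ : lattice_pt R k - lattice_pt R k' = (lattice_pt R k - xi) + (xi - lattice_pt R k')) ?peetre//.
  by rewrite addrA subrK.
rewrite [wt (xi - _)](_ : _ = Q1 ^- (2 * n)); last by rewrite /wt distrC.
have X0 : 0 < X1 by exact: p1. have Y10 : 0 < Y1 by exact: p1. have Y20 : 0 < Y2 by exact: p1.
have Q10 : 0 < Q1 by exact: p1. have Q20 : 0 < Q2 by exact: p1.
have n1 (z : R) N : 1 <= z -> z ^- N <= 1 by move=> z1; rewrite invf_le1 ?exprn_gt0 ?exprn_ege1// (lt_le_trans ltr01).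
apply: (@le_trans _ _ (X1 ^- P * (Q2 ^- P * (Q1 ^- P * ((K0 * (b * (X1 ^+ N0 * Y1 ^+ N0 * Q1 ^+ N0)) * M (lattice_pt R m, lattice_pt R k)) * (Y1 ^- P * Y2 ^- P)))))).
  do 3! (apply: ler_wpM2l; first by rewrite invr_ge0 exprn_ge0// ltW).
  by apply: ler_wpM2r => //; rewrite mulr_ge0// invr_ge0 exprn_ge0// ltW.
have q0 (z : R) N : 0 < z -> z ^+ N != 0 by move=> z0; rewrite expf_neq0// gt_eqF.
rewrite [leLHS](_ : _ = K0 * b * M (lattice_pt R m, lattice_pt R k) *
   ((X1 ^+ (2 * n) * (Y1 ^+ (2 * n) * Y2 ^+ (2 * n)))^-1 * (Q1 ^+ (2 * n) * Q2 ^+ (2 * n))^-1) *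
   (Y2 ^- (2 * n) * (Y1 ^- (2 * n) * Q1 ^- (2 * n))) * (X1 ^- (2 * n) * (Q2 ^- (N0 + 2 * n) * Y2 ^- N0))); last first.
  by rewrite !PE exprD; field; rewrite !q0.
rewrite -[leRHS]mulr1; apply: ler_pM => //.
- by rewrite !mulr_ge0// ?invr_ge0 ?mulr_ge0// exprn_ge0// ltW.
- by rewrite !mulr_ge0// ?invr_ge0 ?mulr_ge0// exprn_ge0// ltW.
- apply: ler_wpM2r; first by rewrite !mulr_ge0// ?invr_ge0 ?mulr_ge0// exprn_ge0// ltW.
  apply: ler_wpM2l; first by rewrite !mulr_ge0.
  by apply: ler_pM => //; rewrite invr_ge0 !mulr_ge0// exprn_ge0// ltW.
by rewrite !mulr_ile1 ?mulr_ge0 ?invr_ge0 ?exprn_ge0 ?(ltW X0) ?(ltW Q20) ?(ltW Y20)// n1// g1.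
Qed.

(** Up to the constant (2 pi)^-n, the coefficient is an iterated integral in (x, xi, y). It is
    integrated by parts in y, then x, then xi, and the final integrand is bounded by [w3_rho]. *)
Lemma matrix_bound : exists C, 0 <= C /\ forall j k,
  normc (ip2 (quant t a (phi j)) (phi k)) <= C * (M (phase_pt j) * rho R j k).
Proof.
have [G1 [G2 [G3 [s1 s2 s3 [h1 h2 h3]]]]] := three.
have [K [K1 hK]] := w3_rho; have [C [C0 hC]] := symk_bound s3.
pose c : R := (2 * pi) ^- n.
exists (`|c| * (C * K * (Iwt R n * (Iwt R n * Iwt R n)))); split.
  by rewrite !mulr_ge0// Iwt_ge0.
move=> j k; pose i : L * L := (j, k); have aj := phi_admissible j.
pose H G z := cexpi (th i z) * G i z : R[i].
have E1 : ip2 (quant t a (phi j)) (phi k) = c%:C *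
    cintegral leb (fun x => cintegral leb (fun xi => cintegral leb (fun y => H F ((x, y), xi)))).
  have E2 x : cintegral leb (fun xi => cintegral leb (fun y => H F ((x, y), xi))) =
      conjc (phi k x) * cintegral leb (quant_slice t a (phi j) x).
    rewrite -cintegralZ; last exact: (cintegrable_quant_slice sym_bounded_symbol).
    apply: eq_cintegral => xi; rewrite -cintegralZ; last exact: (cintegrable_quant_kernel sym_bounded_symbol).
    apply: eq_cintegral => y; rewrite (gabor_atomE _ k) conjcM conjc_real -cexpiN gabor_atomE.
    have -> : H F ((x, y), xi) = cexpi (dotv (x - y) xi + dotv (lattice_pt R j.2) y - dotv (lattice_pt R k.2) x) *
      (a (t *: x + (1 - t) *: y, xi) * ((cell_bump (y - lattice_pt R j.1))%:C * (cell_bump (x - lattice_pt R k.1))%:C)) by [].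
    by rewrite /quant_kernel !cexpiD; ring.
  rewrite -cintegralZ.
    by apply: eq_cintegral => x; rewrite E2 /quant mulrAC mulrA.
  rewrite (_ : (fun x => _) = fun x => cintegral leb (quant_slice t a (phi j) x) * conjc (phi k x)); last first.
    by apply/funext => x; rewrite E2 mulrC.
  have [cv [B hB]] := cintegral_quant_slice_cbd sym_bounded_symbol aj.
  apply: (cintegrable_bM (ccont_meas1 cv) hB); apply: cintegrableJ.
  have [ck [D [D0 [hD _]]]] := phi_admissible k.
  by apply: cint_wt hD; exact: ccont_meas1.
rewrite E1 normcM normc_real -[leRHS]mulrA ler_wpM2l//.
have lew (w' : L * L -> Z -> R) (f : L * L -> 'I_n -> Z -> R) i' z : 0 <= w' i' z -> (1 + `|freq f i' z|) ^- P * w' i' z <= w' i' z.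
  by move=> w'0; rewrite ler_piMl.
have [c1 [B1 b1]] := swap_ok i s1 w1_ge0 (fun i z => lexx _).
have [c2 [B2 b2]] := swap_ok i s2 w2_ge0 (fun i z => lew _ _ i z (w1_ge0 i z)).
have [c3 _] := swap_ok i s3 w3_ge0 (fun i z => le_trans (lew _ _ i z (w2_ge0 i z)) (lew _ _ i z (w1_ge0 i z))).
(* Each step needs its own variable innermost: y first, then x, then xi. The reorderings are
   legitimate because G1 and G2 are dominated through [w1]. *)
have -> : cintegral leb (fun x => cintegral leb (fun xi => cintegral leb (fun y => H F ((x, y), xi)))) =
  cintegral leb (fun x => cintegral leb (fun y => cintegral leb (fun xi => H G3 ((x, y), xi)))).
  transitivity (cintegral leb (fun x => cintegral leb (fun xi => cintegral leb (fun y => H G1 ((x, y), xi))))).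
    apply: eq_cintegral => x; apply: eq_cintegral => xi.
    have := h1 i ((x, 0), xi); rewrite /H.
    by under eq_fun do rewrite add_inj_y add0r; under [in RHS]eq_fun do rewrite add_inj_y add0r.
  rewrite (triple_swap_cycle c1 b1).
  transitivity (cintegral leb (fun xi => cintegral leb (fun y => cintegral leb (fun x => H G2 ((x, y), xi))))).
    apply: eq_cintegral => xi; apply: eq_cintegral => y.
    have := h2 i ((0, y), xi); rewrite /H.
    by under eq_fun do rewrite add_inj_x add0r; under [in RHS]eq_fun do rewrite add_inj_x add0r.
  rewrite -(triple_swap_cycle c2 b2) (triple_swap_last c2 b2).
  apply: eq_cintegral => x; apply: eq_cintegral => y.
  have := h3 i ((x, y), 0); rewrite /H.
  by under eq_fun do rewrite add_inj_xi add0r; under [in RHS]eq_fun do rewrite add_inj_xi add0r.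
pose T := C * K * (M (phase_pt j) * rho R j k).
have hz x y xi : normc (H G3 ((x, y), xi)) <=
    T * (wt (x - lattice_pt R k.1) * (wt (y - lattice_pt R j.1) * wt (xi - lattice_pt R j.2))).
  rewrite /H normcM normc_cexpi mul1r; apply: (le_trans (hC w3_ge0 i _)).
  rewrite /T -!mulrA; apply: ler_wpM2l => //.
  by have := hK i x y xi; rewrite -!mulrA.
have c3' : ccont (H G3) by exact: c3.
rewrite (_ : C * K * _ * _ = T * Iwt R n * Iwt R n * Iwt R n); last by rewrite /T; ring.
apply: (normc_cint_wt_shift (a := lattice_pt R k.1)) => [|x].
  apply: (cmeasurable_cint (h := fun p => cintegral leb (fun xi => H G3 (p, xi)))).
  exact: (cmeasurable_cint (ccont_meas3 c3')).
rewrite mulrAC.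
apply: (normc_cint_wt_shift (a := lattice_pt R j.1)) => [|y].
  exact: (cmeasurable_slice1 x (cmeasurable_cint (ccont_meas3 c3'))).
rewrite (_ : T * _ * _ * _ = (T * wt (x - lattice_pt R k.1) * wt (y - lattice_pt R j.1)) * Iwt R n); last by ring.
apply: (normc_cint_wt_shift (a := lattice_pt R j.2)) => [|xi].
  exact: (cmeasurable_slice1 (x, y) (ccont_meas3 c3')).
by move: (hz x y xi); clearbody T; rewrite -!mulrA.
Qed.

End matrix.

(** * The operator *)

Section L2_limit.
Context d (T : measurableType d) (R : realType) (mu : {measure set T -> \bar R}).
Local Notation E := (L2t mu).
Local Notation ip := (@ip _ _ _ mu).

(** Identifies a norm limit with a pointwise limit: Fatou's lemma bounds the square integral of the
    difference by every e^2, which also puts it in L^2. *)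
Lemma L2_limit_ae (F : nat -> E) (G : E) (H : T -> R[i]) : cvg_nrm ip F G -> cmeasurable H ->
  (forall x, (fun k => normc (L2e (F k) x - H x)) @ \oo --> 0) -> L2e G = H %[ae mu].
Proof.
move=> FG mH FH; pose D x := H x - L2e G x.
have mG := ((L2P _ _).1 (L2eP G)).1.
have mD : cmeasurable D.
  rewrite (_ : D = fun x => H x + -1 * L2e G x); last by apply/funext => x; rewrite mulN1r.
  by apply: cmeasurableD => //; apply: cmeasurableM => //; exact: cmeasurable_cst.
have le e : 0 < e -> (sqint mu D <= (e ^+ 2)%:E)%E.
  move=> e0; have [N hN] := FG e e0.
  apply: (@fatou_real _ _ _ mu (fun k x => normc (L2e (F k - G) x) ^+ 2) _ _ N).
  - by move=> k; exact: measurable_normc2 ((L2P _ _).1 (L2eP (F k - G))).1.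
  - by move=> k x; exact: sqr_ge0.
  - move=> x; suff h : (fun k => normc (L2e (F k - G) x)) @ \oo --> normc (D x).
      by rewrite expr2; under eq_fun do rewrite expr2; exact: (cvgM h h).
    apply/subr_cvg0/norm_cvg0P; apply: squeeze_cvgr (FH x); last exact: cvg_cst.
    near=> k; apply/andP; split; first exact: normr_ge0.
    rewrite ler_norml L2eB.
    have h1 : L2e (F k) x - L2e G x = (L2e (F k) x - H x) + D x by rewrite /D addrA subrK.
    have h2 : D x = - (L2e (F k) x - H x) + (L2e (F k) x - L2e G x) by rewrite h1 addKr.
    have := le_normcD (L2e (F k) x - H x) (D x); rewrite -h1.
    have := le_normcD (- (L2e (F k) x - H x)) (L2e (F k) x - L2e G x); rewrite -h2 normcN.
    by move=> ? ?; apply/andP; split; lra.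
  move=> k Nk; have := hN k Nk; rewrite -/(sqint mu (L2e (F k - G))) sqint_nsq lee_fin => h.
  rewrite -[nsq _ _]sqr_sqrtr; last exact: ip_ge0.
  by apply: lerXn2r; rewrite ?nnegrE ?sqrtr_ge0// ltW// ltW.
have LD : L2 mu D by apply/L2P; split=> //; apply: (le_lt_trans (le 1 ltr01)); rewrite ltry.
have z : nrm ip (toL2 LD) = 0.
  apply/eqP; rewrite eq_le nrm_ge0 andbT; apply/ler_addgt0Pr => e e0; rewrite add0r.
  have h : (sqint mu (L2e (toL2 LD)) <= (e ^+ 2)%:E)%E by exact: le e e0.
  rewrite sqint_nsq lee_fin in h.
  rewrite /nrm -(ger0_norm (ltW e0)) -sqrtr_sqr ler_wsqrtr//.
have /nrm_eq0_ae : nrm ip (toL2 LD + G - G) = 0 by rewrite addrK.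
apply: filterS => x h; rewrite -h// L2eD toL2K /D subrK.
by [].
Unshelve. all: by end_near. Qed.

Lemma ae_eq_cintegral (f g : T -> R[i]) : cmeasurable f -> cmeasurable g ->
  f = g %[ae mu] -> cintegral mu f = cintegral mu g.
Proof.
move=> [f1 f2] [g1 g2] fg; apply: complexP => /=; congr fine; apply: ae_eq_integral => //;
  try (exact/measurable_EFinP); by apply: filterS fg => x h _; rewrite h.
Qed.

Lemma cmeasurable_lim (h : nat -> T -> R[i]) (f : T -> R[i]) : (forall k, cmeasurable (h k)) ->
  (forall x, (fun k => normc (h k x - f x)) @ \oo --> 0) -> cmeasurable f.
Proof.
move=> mh hf; split.
  apply: (@measurable_fun_cvg _ _ _ _ (fun k x => complex.Re (h k x))) => [k|x _]; first by have [] := mh k.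
  apply/subr_cvg0/norm_cvg0P; apply: squeeze_cvgr (hf x); last exact: cvg_cst.
  near=> k; rewrite normr_ge0/= (_ : _ - _ = complex.Re (h k x - f x)) ?Re_le_normc//.
  by rewrite !cE.
apply: (@measurable_fun_cvg _ _ _ _ (fun k x => complex.Im (h k x))) => [k|x _]; first by have [] := mh k.
apply/subr_cvg0/norm_cvg0P; apply: squeeze_cvgr (hf x); last exact: cvg_cst.
near=> k; rewrite normr_ge0/= (_ : _ - _ = complex.Im (h k x - f x)) ?Im_le_normc//.
by rewrite !cE.
Unshelve. all: by end_near. Qed.

End L2_limit.

Lemma csummable_cvg (R : realType) (z : nat -> R[i]) (D : nat -> R) (M : R) :
  (forall q, normc (z q) <= D q) -> (forall N, \sum_(0 <= q < N) D q <= M) ->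
  exists l, (fun N => normc (\sum_(0 <= q < N) z q - l)) @ \oo --> 0.
Proof.
move=> zD DM.
have c1 : cvgn (fun N => complex.Re (\sum_(0 <= q < N) z q)).
  apply: (summable_increments_cvg (D := D) (M := M)) => // k.
  rewrite big_nat_recr//= cReD addrAC subrr add0r (le_trans (Re_le_normc _))//.
have c2 : cvgn (fun N => complex.Im (\sum_(0 <= q < N) z q)).
  apply: (summable_increments_cvg (D := D) (M := M)) => // k.
  rewrite big_nat_recr//= cImD addrAC subrr add0r (le_trans (Im_le_normc _))//.
move/cvg_ex: c1 => [l1 h1]; move/cvg_ex: c2 => [l2 h2]; exists (l1 +i* l2).
have H : (fun N => `|complex.Re (\sum_(0 <= q < N) z q) - l1| + `|complex.Im (\sum_(0 <= q < N) z q) - l2|) @ \oo --> 0.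
  by rewrite -[X in _ --> X]addr0; apply: cvgD; apply/norm_cvg0P/subr_cvg0.
apply: squeeze_cvgr H; last exact: cvg_cst.
near=> k; rewrite normc_ge0/=.
by have := normc_ReIm (\sum_(0 <= q < k) z q - (l1 +i* l2)); rewrite !cE.
Unshelve. all: by end_near. Qed.

Section operator.
Context (R : realType) (n : nat) (t : R) (a : 'rV[R]_n * 'rV[R]_n -> R[i]).
Local Notation Rn := 'rV[R]_n.
Local Notation L := ('rV[int]_n * 'rV[int]_n)%type.
Local Notation Z := ((Rn * Rn) * Rn)%type.
Local Notation leb := (lebesgue_rV R n).
Local Notation E := (L2t leb).
Local Notation ip := (@ip _ _ _ leb).
Local Notation c2p := ((pi *+ 2) ^+ n : R).
Variables (M : Rn * Rn -> R) (N0 : nat) (K0 : R).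
Hypothesis M0 : forall X, 0 <= M X.
Hypothesis M1 : forall X, M X <= 1.
Hypothesis K00 : 0 <= K0.
Hypothesis MT : forall X Y, M X <= K0 * phase_wt N0 X Y * M Y.
Hypothesis saM : sym (fun (_ : unit) => M) (fun _ => a).
Local Notation phi := (gabor_atom (@cell_bump R n)).
Local Notation theta := (gabor_atom (@wide_cell_bump R n)).
Local Notation phase_pt j := (lattice_pt R j.1, lattice_pt R j.2).
Local Notation quant := (quant t a).

Let sa := sym_bounded_symbol M0 M1 saM.
Let hi : sesq ip := ip_sesq leb.
Let ip0 : forall f, 0 <= nsq ip f := ip_ge0 (mu := leb).

Lemma rho_le1 (j k : L) : rho R j k <= 1.
Proof. by rewrite mulr_ile1 ?wt_ge0// wt_le1. Qed.

(** Only boundedness and continuity of the quantized atom are known beforehand; square summability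
    of its matrix coefficients puts it in L^2. *)
Lemma psi_L2c j : L2c (quant (phi j)).
Proof.
have cv : cbd (quant (phi j)) by apply: (quant_cbd sa); exact: (phi_admissible _ M0 M1 saM).
split=> //; apply/L2P; split; first exact: (ccont_meas1 cv.1).
have [C [C0 hC]] := matrix_bound t M0 M1 K00 MT saM.
have F0 : (sqint leb (quant (phi j)) <= (num_cells R n / c2p * (C ^+ 2 * Crho R n))%:E)%E.
  apply: frame_bound => // N.
  have h := ler_wpM2l (sqr_ge0 C) (rho_sum R j N); apply: le_trans h.
  rewrite mulr_sumr; apply: ler_sum => q _; rewrite /coef; case: (lattice_enum q) => [k|]; last by rewrite /= mulr0.
  change (normc (ip2 (quant (phi j)) (phi k)) ^+ 2 <= C ^+ 2 * rho R k j).
  apply: (@le_trans _ _ ((C * (M (phase_pt j) * rho R j k)) ^+ 2)).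
    by apply: lerXn2r (hC j k); rewrite ?nnegrE ?normc_ge0//; apply: mulr_ge0 => //; apply: mulr_ge0 => //; exact: rho_ge0.
  rewrite exprMn ler_wpM2l ?sqr_ge0// rhoC expr2.
  have r0 := rho_ge0 R k j; have r1 := rho_le1 k j.
  have h : M (phase_pt j) * rho R k j <= rho R k j by rewrite ler_piMl.
  apply: (le_trans _ h); apply: ler_piMr; [exact: mulr_ge0|exact: le_trans h r1].
exact: le_lt_trans F0 (ltry _).
Qed.

Definition psi j : E := toL2 (psi_L2c j).2.

(** Schur's test: the kernel is split into two square roots for Cauchy-Schwarz, one factor [Crho]
    comes from summing over j and the other from summing over k. The weight M depends on j only and
    stays with c_j. The lower frame bound returns from coefficients to the norm. *)
Lemma schur : exists K, 0 <= K /\ forall (c : nat -> R[i]) N,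
  nsq ip (\sum_(0 <= q < N) c q *: vec psi q) <=
  K * \sum_(0 <= q < N) coef (fun j => M (phase_pt j)) q ^+ 2 * normc (c q) ^+ 2.
Proof.
have [C [C0 hC]] := matrix_bound t M0 M1 K00 MT saM.
have Cr0 : 0 <= Crho R n.
  by apply: le_trans (rho_sum R ((0, 0) : L) 0); rewrite big_geq.
have n0 := num_cells_gt0 R n; have p0 := c2p_gt0 R n.
exists (num_cells R n / c2p * (C ^+ 2 * Crho R n ^+ 2)); split.
  apply: mulr_ge0; first by apply: divr_ge0; exact: ltW.
  by apply: mulr_ge0; exact: sqr_ge0.
move=> c N; set f := \sum_(_ <= _ < _) _; set S := \sum_(_ <= _ < _) _.
have Lf : L2c (L2e f) by apply: L2c_vec => j; exact: psi_L2c.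
rewrite -lee_fin -sqint_nsq -(mulrA (num_cells R n / c2p)); apply: frame_bound; first exact: Lf.1.
move=> N'; pose rk (k : L) q := coef (fun j => rho R j k) q.
pose Mq q := coef (fun j => M (phase_pt j)) q.
have rk0 k q : 0 <= rk k q by rewrite /rk /coef; case: (lattice_enum q) => [j|] //=; exact: rho_ge0.
have Mq0 q : 0 <= Mq q by rewrite /Mq /coef; case: (lattice_enum q) => [j|] //=.
have hk k : normc (ip2 (L2e f) (phi k)) ^+ 2 <=
    C ^+ 2 * Crho R n * \sum_(0 <= q < N) Mq q ^+ 2 * normc (c q) ^+ 2 * rk k q.
  have -> : ip2 (L2e f) (phi k) = \sum_(0 <= q < N) c q * ip (vec psi q) (fphi R k).
    change (ip f (fphi R k) = \sum_(0 <= q < N) c q * ip (vec psi q) (fphi R k)).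
    by rewrite /f (sesq_suml hi); apply: eq_bigr => q _; rewrite (sesqZl hi).
  pose s q := Num.sqrt (rk k q).
  have ss q : s q ^+ 2 = rk k q by rewrite sqr_sqrtr.
  have s0 q : 0 <= s q by exact: sqrtr_ge0.
  apply: (@le_trans _ _ ((C * \sum_(0 <= q < N) s q * (s q * (Mq q * normc (c q)))) ^+ 2)).
    apply: lerXn2r; rewrite ?nnegrE ?normc_ge0//.
      by rewrite mulr_ge0// sumr_ge0// => q _; rewrite !mulr_ge0// normc_ge0.
    apply: (le_trans (normc_sum _ _ _)); rewrite mulr_sumr; apply: ler_sum => q _.
    rewrite normcM mulrA -expr2 ss.
    rewrite (_ : C * _ = normc (c q) * (C * (Mq q * rk k q))); last by ring.
    apply: ler_wpM2l; first exact: normc_ge0.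
    rewrite /Mq /rk /coef /vec; case: (lattice_enum q) => [j|]; first exact: hC.
    change (normc (ip 0 (fphi R k)) <= C * (0 * 0)).
    by rewrite (sesq0l hi) normc0 !mulr0.
  rewrite exprMn -mulrA ler_wpM2l ?sqr_ge0//; apply: (le_trans (sum_CS _ _ _ _)).
  apply: ler_pM; try (by apply: sumr_ge0 => q _; exact: sqr_ge0).
    by under eq_bigr do rewrite ss; exact: rho_sum.
  by apply: ler_sum => q _; rewrite !exprMn ss mulrC.
apply: (@le_trans _ _ (C ^+ 2 * Crho R n * \sum_(0 <= q < N) Mq q ^+ 2 * normc (c q) ^+ 2 *
    \sum_(0 <= k < N') coef (fun k => rk k q) k)).
  under [X in _ <= _ * X]eq_bigr do rewrite mulr_sumr.
  rewrite exchange_big/= mulr_sumr; apply: ler_sum => q _; rewrite /coef.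
  case: (lattice_enum q) => [k|]; first exact: hk.
  by change (0 <= C ^+ 2 * Crho R n * \sum_(0 <= i < N) Mq i ^+ 2 * normc (c i) ^+ 2 * 0);
    rewrite big1 ?mulr0// => i _; rewrite mulr0.
rewrite (_ : C ^+ 2 * Crho R n ^+ 2 * S = C ^+ 2 * Crho R n * (Crho R n * S)); last by ring.
apply: ler_wpM2l; first by rewrite mulr_ge0// sqr_ge0.
rewrite mulr_sumr; apply: ler_sum => q _; rewrite mulrC; apply: ler_wpM2r.
  by rewrite mulr_ge0// sqr_ge0.
rewrite /rk /coef; case: (lattice_enum q) => [j|].
  apply: le_trans (rho_sum R j N'); rewrite le_eqVlt; apply/orP; left; apply/eqP.
  by apply: eq_bigr => k _; rewrite /coef; case: (lattice_enum k) => [i|] //=; exact: rhoC.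
by rewrite big1// => k _; case: (lattice_enum k).
Qed.

(** The coefficient is an oscillating integral at x = xi = 0, so integration by parts gives the
    decay in frequency. Decay in position comes from u on the cell: of its 6n powers, 4n are spent
    by Peetre's inequality on the position and 2n remain integrable. *)
Lemma coef_decay u : schwartz u -> exists C, 0 <= C /\ forall j,
  normc (ip2 u (theta j)) <= C * ((1 + `|lattice_pt R j.1|) ^- (4 * n) * (1 + `|lattice_pt R j.2|) ^- (4 * n)).
Proof.
move=> su; pose lam (j : L) : R := (1 + `|lattice_pt R j.1|) ^- (4 * n).
pose v (j : L) y := u y * (wide_cell_bump (y - lattice_pt R j.1))%:C.
have lam0 j : 0 <= lam j by rewrite invr_ge0 exprn_ge0// addr_ge0.
have pp N (x : Rn) : 0 < (1 + `|x|) ^+ N by rewrite exprn_gt0// ltr_pwDl.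
have s1 : sym (fun (_ : L) (_ : Z) => 1 : R) (fun _ _ => 1).
  by move=> k; apply: (@symk_cst _ _ _ _ _ (fun=> 1) 1) => // i z; rewrite normc1 mulr1.
have sv : sym (fun j y => lam j * wt (y - 0)) v.
  move=> k; have s2 : symk k (fun (_ : L) (y : Rn) => (1 + `|y|) ^- (6 * n)) (fun=> u).
    apply: (@symk_comp R _ _ L unit k (fun _ y => (1 + `|y|) ^- (6 * n)) (fun=> u) (fun=> tt)
      (fun k z => z) (fun=> 1) id) => //.
    - by move=> _; rewrite normr1.
    - by move=> _; exact: continuous_ident.
    - by move=> _ h w z; rewrite scale1r.
    exact: schwartz_sym.
  have s3 := sym_shift (fun j : L => lattice_pt R j.1) (@wide_bump_sym R n (4 * n)) k.
  apply: (symk_mono (K := 1)) (symkM _ _ s2 s3) => //.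
  move=> j y; rewrite mul1r subr0 /lam /wt -!invfM lef_pV2 ?posrE ?mulr_gt0//.
    rewrite (_ : (6 * n = 4 * n + 2 * n)%N); last by rewrite -mulnDl.
    rewrite exprD mulrAC; apply: ler_wpM2r; first exact: ltW.
    rewrite -exprMn; apply: lerXn2r; rewrite ?nnegrE ?mulr_ge0 ?addr_ge0//.
    have := peetre y (- (y - lattice_pt R j.1)).
    by rewrite normrN opprB addrCA subrr addr0.
have [C [C0 hC]] := slice_integral_bound (fun j : L => - lattice_pt R j.2) lam0 s1 sv (4 * n).
exists C; split=> // j; have := hC j 0 0; rewrite sub0r opprK -mulrA.
congr (normc _ <= _); apply: eq_cintegral => y; rewrite gabor_atomE conjcM conjc_real -cexpiN mul1r subr0.
have -> : dotv (- lattice_pt R j.2) y = - dotv (lattice_pt R j.2) y by rewrite -sumrN; apply: eq_bigr => i _; rewrite mxE mulNr.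
by rewrite /v; ring.
Qed.

(** Cost of recentring the weights of phi_j at the origin. It grows like the power 2n, so against
    the decay 4n of the coefficients a summable 2n is left. *)
Let bj (j : L) : R := (1 + `|lattice_pt R j.1|) ^+ (2 * n) * (1 + `|lattice_pt R j.2|) ^+ (2 * n).

Let pp N (x : Rn) : 0 < (1 + `|x|) ^+ N.
Proof. by rewrite exprn_gt0// ltr_pwDl. Qed.

Let bj0 j : 0 <= bj j.
Proof. by rewrite mulr_ge0// ltW. Qed.

Lemma phi_weight : exists B, 0 <= B /\ forall j,
  (forall y, normc (phi j y) <= B * bj j * wt y) /\
  forall x xi, normc (quant_slice t a (phi j) x xi) <= B * bj j * wt xi.
Proof.
have sv : sym (fun (j : L) y => 1 * wt (y - lattice_pt R j.1)) (fun j y => (cell_bump (y - lattice_pt R j.1))%:C).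
  move=> k; apply: (symk_mono (K := 1)) (sym_shift (fun j : L => lattice_pt R j.1) (@bump_sym R n (2 * n)) k) => // j y.
  by rewrite !mul1r.
have [C [C0 hC]] := quant_slice_bound t sa (fun j : L => lattice_pt R j.2) (2 * n) (fun=> ler01) sv.
have [D [D0 hD]] := symk_bound (sv 0).
have ge1 (x : Rn) : 1 <= (1 + `|x|) ^+ (2 * n) by rewrite exprn_ege1// lerDl.
exists (C + D); split; first exact: addr_ge0.
have w0 (x : Rn) : 0 <= wt x by exact: wt_ge0.
move=> j; split=> [y|x xi].
  rewrite gabor_atomE normcM normc_cexpi mul1r.
  apply: (le_trans (hD (fun _ _ => mulr_ge0 ler01 (w0 _)) j y)); rewrite mul1r -mulrA.
  apply: ler_pM => //; first by rewrite lerDr.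
  apply: (le_trans (wt_shift_le (lattice_pt R j.1) y)); apply: ler_wpM2r => //.
  by rewrite ler_peMr// ltW.
have := hC j x xi; rewrite mulr1 (_ : (fun y => _) = phi j); last by apply/funext => y; rewrite gabor_atomE.
move=> h; apply: (le_trans h); rewrite -mulrA.
apply: ler_pM => //; first by rewrite lerDl.
apply: (le_trans (wt_shift_le (lattice_pt R j.2) xi)); apply: ler_wpM2r => //.
by rewrite ler_peMl// ltW.
Qed.

Let en_fun (F : L -> Rn -> R[i]) q : Rn -> R[i] := oapp F (fun=> 0) (lattice_enum q).

Let L2e_vec (F : L -> E) q x : L2e (vec F q) x = en_fun (fun j => L2e (F j)) q x.
Proof. by rewrite /vec /en_fun; case: (lattice_enum q). Qed.

(** The partial sums u_N converge to (2 pi)^n u in L^2 and, with a common integrable bound,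
    pointwise. Two dominated convergences carry this through the y- and xi-integrals of [quant],
    while [T] produces the norm limit of the same functions; [L2_limit_ae] identifies the two. *)
Lemma synthesis_schwartz (T : E -> E) u (Lu : L2 leb u) : schwartz u ->
  (forall f, cvg_nrm ip (partial_syn ip (vec (ftheta R (n := n))) (fun q => (c2p^-1)%:C *: vec psi q) f) (T f)) ->
  L2e (T (toL2 Lu)) = quant u %[ae leb].
Proof.
move=> su hT; have au := schwartz_admissible t sa su; set f := toL2 Lu.
have cu : cbd u.
  split; first exact: au.1.
  have [_ [C [C0 [hC _]]]] := au; exists C => y; apply: (le_trans (hC y)).
  by rewrite ler_piMr// wt_le1.
have p0 := c2p_gt0 R n.
pose c q := ip f (vec (ftheta R (n := n)) q).
pose ph q := en_fun phi q.
have aph q : admissible t a (ph q).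
  rewrite /ph /en_fun; case: (lattice_enum q) => [j|]; first exact: (phi_admissible _ M0 M1 saM).
  exact: admissible0.
pose uN N y := \sum_(0 <= q < N) c q * ph q y.
have auN N : admissible t a (uN N) by have [] := admissible_sum sa c N aph.
have rep : cvg_nrm ip (partial_syn ip (vec (ftheta R (n := n))) (vec (fphi R (n := n))) f) (c2p%:C *: f).
  exact: (reproducing (conj cu Lu)).
have uNE N y : L2e (partial_syn ip (vec (ftheta R (n := n))) (vec (fphi R (n := n))) f N) y = uN N y.
  by rewrite L2e_sum; apply: eq_bigr => q _; rewrite L2eZ L2e_vec.
have TNE N x : L2e (partial_syn ip (vec (ftheta R (n := n))) (fun q => (c2p^-1)%:C *: vec psi q) f N) x =
    (c2p^-1)%:C * quant (uN N) x.
  have [_ _ h] := admissible_sum sa c N aph; rewrite L2e_sum /uN h mulr_sumr; apply: eq_bigr => q _.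
  rewrite !L2eZ L2e_vec mulrCA; congr (_ * (_ * _)).
  by rewrite /ph /en_fun; case: (lattice_enum q) => [j|] //=; rewrite quant0.
have [B [B0 hB]] := phi_weight; have [C [C0 hC]] := coef_decay su.
pose dq q := normc (c q) * coef bj q.
have dq0 q : 0 <= dq q by rewrite mulr_ge0 ?normc_ge0// /coef; case: (lattice_enum q).
pose S := C * Crho R n.
have dS N : \sum_(0 <= q < N) dq q <= S.
  have h := ler_wpM2l C0 (rho_sum R ((0, 0) : L) N); apply: le_trans h.
  rewrite mulr_sumr; apply: ler_sum => q _; rewrite /dq /coef /c /vec; case: (lattice_enum q) => [j|]; last by rewrite /= !mulr0.
  change (normc (ip2 u (theta j)) * bj j <= C * rho R j (0, 0)).
  apply: (@le_trans _ _ (C * ((1 + `|lattice_pt R j.1|) ^- (4 * n) * (1 + `|lattice_pt R j.2|) ^- (4 * n)) * bj j)).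
    by apply: ler_wpM2r.
  have z0 : lattice_pt R (0 : 'rV[int]_n) = 0 by apply/rowP => i; rewrite !mxE.
  rewrite -mulrA ler_wpM2l// /rho /= z0 !subr0 /bj /wt.
  have -> : (4 * n = 2 * n + 2 * n)%N by rewrite -mulnDl.
  rewrite !exprD le_eqVlt; apply/orP; left; apply/eqP; field.
  by rewrite !gt_eqF.
have S0 : 0 <= S by have := dS 0; rewrite big_geq.
(* Stated for a functional [J] so that point evaluation and [quant_slice] at (x, xi) share one
   estimate. *)
have phq q (J : (Rn -> R[i]) -> R[i]) w : J (fun=> 0) = 0 -> 0 <= w ->
    (forall j, normc (J (phi j)) <= B * bj j * w) -> normc (c q * J (ph q)) <= dq q * (B * w).
  move=> J0 w0 hJ; rewrite normcM /dq -mulrA; apply: ler_wpM2l; first exact: normc_ge0.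
  rewrite /ph /en_fun /coef; case: (lattice_enum q) => [j|] /=; last by rewrite J0 normc0 mul0r.
  by rewrite mulrCA mulrA.
have sumN (J : (Rn -> R[i]) -> R[i]) w N : J (fun=> 0) = 0 -> 0 <= w ->
    (forall j, normc (J (phi j)) <= B * bj j * w) ->
    normc (\sum_(0 <= q < N) c q * J (ph q)) <= S * B * w.
  move=> J0 w0 hJ; apply: (le_trans (normc_sum _ _ _)).
  apply: (@le_trans _ _ (\sum_(0 <= q < N) dq q * (B * w))).
    by apply: ler_sum => q _; exact: phq.
  by rewrite -mulr_suml -mulrA ler_wpM2r// mulr_ge0.
have buN N y : normc (uN N y) <= S * B * wt y.
  by apply: (sumN (fun g => g y)) => //; [exact: wt_ge0|move=> j; exact: (hB j).1].
have JuN N x xi : quant_slice t a (uN N) x xi = \sum_(0 <= q < N) c q * quant_slice t a (ph q) x xi.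
  by have [] := admissible_sum sa c N aph.
have bJN N x xi : normc (quant_slice t a (uN N) x xi) <= S * B * wt xi.
  rewrite JuN; apply: (sumN (fun g => quant_slice t a g x xi)) => //; [|exact: wt_ge0|move=> j; exact: (hB j).2].
  exact: quant_slice0.
(* The pointwise limit exists everywhere by absolute summability, but equals (2 pi)^n u only almost
   everywhere; this is harmless under the y-integral. *)
have /choice[U hU] : forall y, exists l, (fun N => normc (uN N y - l)) @ \oo --> 0.
  move=> y; apply: (csummable_cvg (D := fun q => dq q * (B * wt y)) (M := S * (B * wt y))) => [q|N].
    by apply: (phq q (fun g => g y)) => //; [exact: wt_ge0|move=> j; exact: (hB j).1].
  by rewrite -mulr_suml ler_wpM2r// mulr_ge0// wt_ge0.
have muN N : cmeasurable (uN N) by exact: ccont_meas1 (auN N).1.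
have mU : cmeasurable U by exact: (cmeasurable_lim muN).
have hUu : L2e (c2p%:C *: f) = U %[ae leb].
  by apply: (L2_limit_ae rep mU) => y; under eq_fun do rewrite uNE; exact: hU.
have hV x : (fun N => normc (quant (uN N) x - c2p%:C * quant u x)) @ \oo --> 0.
  have hJ xi : (fun N => normc (quant_slice t a (uN N) x xi - c2p%:C * quant_slice t a u x xi)) @ \oo --> 0.
    have [Ca [Ca0 hCa]] := a_bound sa.
    have mq g : cmeasurable g -> cmeasurable (fun y => quant_kernel t a x y xi * g y).
      move=> mg; apply: cmeasurableM => //; apply: ccont_meas1.
      by apply: (@ccont_quant_kernel_comp R n t a sa Rn); [exact: continuous_const|exact: continuous_ident|exact: continuous_const].
    have mu' := ccont_meas1 au.1.
    have -> : c2p%:C * quant_slice t a u x xi = cintegral leb (fun y => quant_kernel t a x y xi * U y).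
      rewrite -cintegralZ; last exact: (cintegrable_quant_kernel sa).
      apply: ae_eq_cintegral; [|exact: mq|].
        by apply: cmeasurableM; [exact: cmeasurable_cst|exact: mq].
      by apply: filterS hUu => y h; move: (h I) => <-; rewrite L2eZ toL2K mulrCA.
    apply: (cDCT (g := fun y => (Ca * (S * B)) * wt y)) => //.
    - by move=> N; exact: mq.
    - exact: mq.
    - by move=> N y; rewrite normcM normc_quant_kernel -mulrA ler_pM ?normc_ge0.
    - exact: integrable_cwt.
    move=> y; rewrite (_ : (fun k => _) = (fun k => normc (quant_kernel t a x y xi) * normc (uN k y - U y))); last first.
      by apply/funext => k; rewrite -normcM mulrBr.
    by rewrite -[X in _ --> X](mulr0 (normc (quant_kernel t a x y xi))); exact: (cvgM (cvg_cst _) (hU y)).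
  have h2 : (fun N => normc (cintegral leb (quant_slice t a (uN N) x) - cintegral leb (fun xi => c2p%:C * quant_slice t a u x xi))) @ \oo --> 0.
    apply: (cDCT (g := fun y => (S * B) * wt y)) => //.
    - by move=> N; exact: (cmeasurable_quant_slice t sa x (auN N).1).
    - by apply: cmeasurableM; [exact: cmeasurable_cst|exact: (cmeasurable_quant_slice t sa x au.1)].
    - exact: integrable_cwt.
  rewrite cintegralZ in h2; last exact: (cintegrable_quant_slice sa).
  rewrite (_ : (fun N => _) = (fun N => normc ((2 * pi) ^- n)%:C * normc (cintegral leb (quant_slice t a (uN N) x) - c2p%:C * cintegral leb (quant_slice t a u x)))); last first.
    by apply/funext => N; rewrite -normcM mulrBr [in X in _ - X]mulrCA.
  by rewrite -[X in _ --> X](mulr0 (normc ((2 * pi) ^- n)%:C)); exact: (cvgM (cvg_cst _) h2).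
apply: (L2_limit_ae (hT f)); first exact: ccont_meas1 (quant_cbd sa au).1.
move=> x; under eq_fun do rewrite TNE.
rewrite (_ : (fun N => _) = (fun N => normc (c2p^-1)%:C * normc (quant (uN N) x - c2p%:C * quant u x))); last first.
  have cK : (c2p^-1)%:C * c2p%:C = 1 :> R[i].
    by apply: complexP; rewrite /= !(mulr0, mul0r, subr0, addr0)// mulVf// gt_eqF.
  by apply/funext => N; rewrite -normcM mulrBr (mulrA (c2p^-1)%:C c2p%:C (quant u x)) cK mul1r.
have h : (fun N => normc (c2p^-1)%:C * normc (quant (uN N) x - c2p%:C * quant u x)) @ \oo --> normc (c2p^-1)%:C * 0.
  exact: (cvgM (cvg_cst _) (hV x)).
by rewrite mulr0 in h; exact: h.
Qed.

End operator.

(** * Singular values *)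

Section L2_operators.
Context d (X : measurableType d) (R : realType) (mu : {measure set X -> \bar R}).
Local Notation E := (L2t mu).
Local Notation ip := (@ip _ _ _ mu).
Implicit Types (T : E -> E) (f g : X -> R[i]).

Let hi : sesq ip := ip_sesq mu.
Let ip0 : forall x, 0 <= nsq ip x := ip_ge0 (mu := mu).

(* Functions outside L2 are sent to 0. *)
Definition opL2 T f : X -> R[i] :=
  if pselect (L2 mu f) is left h then L2e (T (toL2 h)) else fun=> 0.

Lemma opL2E T f (h : L2 mu f) : opL2 T f = L2e (T (toL2 h)).
Proof.
rewrite /opL2; case: pselect => // h'; congr (L2e (T _)).
by apply: L2e_inj; rewrite !toL2K.
Qed.

Lemma opL2_L2e T x : opL2 T (L2e x) = L2e (T x).
Proof. by rewrite (opL2E _ (L2eP x)); congr (L2e (T _)); apply: L2e_inj; rewrite toL2K. Qed.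

Lemma opL2_bounded T (C : R) : (forall c x y, nrm ip (T (c *: x + y) - (c *: T x + T y)) = 0) ->
  (forall x, nsq ip (T x) <= C * nsq ip x) -> bounded_operator mu (opL2 T).
Proof.
move=> Tl TC; split=> [f Lf|c f g Lf Lg|].
- by rewrite (opL2E T Lf); exact: L2eP.
- rewrite (opL2E T Lf) (opL2E T Lg).
  have -> : (fun x => c * f x + g x) = L2e (c *: toL2 Lf + toL2 Lg).
    by apply/funext => x; rewrite L2eD L2eZ !toL2K.
  by rewrite opL2_L2e; have /nrm_eq0_ae := Tl c (toL2 Lf) (toL2 Lg).
exists (Num.sqrt `|C|) => f Lf.
rewrite (opL2E T Lf) -[X in (_ <= _ * L2norm _ X)%E](toL2K Lf) !L2norm_nrm -EFinM lee_fin.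
rewrite /nrm -sqrtrM// ler_wsqrtr//; apply: (le_trans (TC _)).
by apply: ler_wpM2r; [exact: ip0|exact: ler_norm].
Qed.

Variables (t p : nat -> E) (B K r S : R) (w : nat -> R).
Hypothesis B0 : 0 <= B.
Hypothesis K0 : 0 <= K.
Hypothesis r0 : 0 < r.
Hypothesis w0 : forall q, 0 <= w q.
Hypothesis tB : bessel ip t B.
Hypothesis pK : forall (c : nat -> R[i]) N,
  nsq ip (\sum_(0 <= q < N) c q *: p q) <= K * \sum_(0 <= q < N) w q ^+ 2 * normc (c q) ^+ 2.
Hypothesis wS : forall N, \sum_(0 <= q < N) w q `^ r <= S.

Let complete := @L2_complete _ _ _ mu.
Let pc : cobessel ip p (K * (S `^ r^-1) ^+ 2) := synthesis_cobessel K0 r0 w0 pK wS.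
Let KW0 : 0 <= K * (S `^ r^-1) ^+ 2.
Proof. by rewrite mulr_ge0// sqr_ge0. Qed.

Lemma synthesis_op : exists T, forall x, cvg_nrm ip (partial_syn ip t p x) (T x).
Proof. exact: (syn_exists hi ip0 complete KW0 tB pc). Qed.

Lemma adjoint_op : exists T, forall x, cvg_nrm ip (partial_syn ip p t x) (T x).
Proof.
exact: (syn_exists hi ip0 complete B0 (cobessel_bessel hi ip0 KW0 pc) (bessel_cobessel hi B0 tB)).
Qed.

Variable T : E -> E.
Hypothesis hT : forall x, cvg_nrm ip (partial_syn ip t p x) (T x).

Lemma synthesis_compact : compact_operator mu (opL2 T).
Proof.
move=> u hu; pose v k : E := toL2 (hu k).1.
have v1 k : nsq ip (v k) <= 1.
  have := (hu k).2; rewrite -[X in L2norm _ X](toL2K (hu k).1) L2norm_nrm lee_fin => h.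
  rewrite -(sqr_sqrtr (ip0 (v k))) -[leRHS](expr1n R 2).
  by apply: lerXn2r; rewrite ?nnegrE ?sqrtr_ge0.
have [ph hph /complete[l hl]] := syn_compact hi ip0 B0 K0 r0 w0 tB pK wS hT v1.
exists ph, (L2e l); split=> //; first exact: L2eP.
have -> : (fun k => L2norm mu (fun x => opL2 T (u (ph k)) x - L2e l x)) =
    (fun k => (nrm ip (T (v (ph k)) - l))%:E).
  apply/funext => k; rewrite -L2norm_nrm; congr (L2norm mu _); apply/funext => x.
  by rewrite (opL2E T (hu (ph k)).1) L2eB.
apply: cvg_EFin; first exact: nearW.
apply/cvgrPdist_lt => e e0; have [N hN] := hl e e0.
exists N => // k /= Nk; rewrite sub0r normrN ger0_norm ?nrm_ge0//; exact: hN.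
Qed.

Lemma ae0P (x : E) : nrm ip x = 0 <-> L2e x = cst 0 %[ae mu].
Proof. by have := nrm_eq0_ae x 0; rewrite subr0. Qed.

(** The adjoint is the synthesis with the two families exchanged. Eigenfunctions of the composite
    operator, taken almost everywhere, are eigenvectors of the form <Tx, Ty>, so
    [eigen_multiplicity] matches multiplicities with repetitions in s. *)
Theorem synthesis_schatten : schatten mu r (opL2 T).
Proof.
have [Ts hTs] := adjoint_op.
have bT : bounded_operator mu (opL2 T).
  apply: opL2_bounded; first exact: (syn_linear hi ip0 hT).
  exact: (syn_bounded hi ip0 B0 K0 r0 w0 tB pK wS hT).
split=> //; first exact: synthesis_compact.
have [e [s [[s0 sd eo] [eb e1 sx [S' sS]]]]] := syn_singular hi ip0 complete B0 K0 r0 w0 tB pK wS hT.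
have TsT x v : ip (Ts (T x)) v = ip (T x) (T v).
  by rewrite (sesqC hi) -(syn_adjoint hi ip0 hT hTs) -(sesqC hi).
exists s; last first.
  apply: (@le_lt_trans _ _ S'%:E); last exact: ltry.
  apply: lime_le; first by apply: is_cvg_nneseries => q _ _; rewrite lee_fin powR_ge0.
  by apply: nearW => N; rewrite sumEFin lee_fin.
split=> //; exists (opL2 Ts).
  split; first apply: opL2_bounded.
  - exact: (syn_linear hi ip0 hTs).
  - exact: (syn_adj_bounded hi ip0 B0 K0 r0 w0 tB pK wS hTs).
  move=> f g Lf Lg; rewrite (opL2E T Lf) (opL2E Ts Lg).
  rewrite -[X in L2inner _ _ X](toL2K Lg) -[X in _ = L2inner _ X _](toL2K Lf).
  exact: (syn_adjoint hi ip0 hT hTs).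
move=> sigma sig0 m.
rewrite -(eigen_multiplicity hi ip0 (syn_form hi ip0 hT) s0 r0 eo eb e1 sx sS m sig0).
have eig (x : E) : opL2 Ts (opL2 T (L2e x)) = (fun y => (sigma ^+ 2)%:C * L2e x y) %[ae mu] <->
    forall v, ip (T x) (T v) = (sigma ^+ 2)%:C * ip x v.
  rewrite !opL2_L2e; split=> [h v|h].
    have /nrm_eq0_ae h' : L2e (Ts (T x)) = L2e ((sigma ^+ 2)%:C *: x) %[ae mu] by exact: h.
    have := nrm_eq0_ip hi ip0 v h'; rewrite (sesqBl hi) (sesqZl hi) TsT => /eqP.
    by rewrite subr_eq0 => /eqP.
  change (L2e (Ts (T x)) = L2e ((sigma ^+ 2)%:C *: x) %[ae mu]).
  apply/nrm_eq0_ae; rewrite /nrm /nsq (sesqBl hi) (sesqZl hi) TsT h subrr.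
  by rewrite sqrtr0.
split=> [[f [hf fi]]|[x [hx xi]]].
  exists (fun j => toL2 (hf j).1); split=> [j v|c /ae0P h].
    by apply: (eig (toL2 (hf j).1)).1; rewrite toL2K; exact: (hf j).2.
  apply: fi; apply: filterS h => y hy yI; rewrite -(hy yI) L2e_sum.
  by apply: eq_bigr => j _; rewrite L2eZ toL2K.
exists (fun j => L2e (x j)); split=> [j|c h].
  by split; [exact: L2eP|apply: (eig (x j)).2; exact: hx].
apply: xi; apply/ae0P; apply: filterS h => y hy yI; rewrite -(hy yI) L2e_sum.
by apply: eq_bigr => j _; rewrite L2eZ.
Qed.

End L2_operators.

Lemma admissible_L2 (R : realType) (n : nat) (t : R) (a : 'rV[R]_n * 'rV[R]_n -> R[i]) (u : 'rV[R]_n -> R[i]) :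
  admissible t a u -> L2 (lebesgue_rV R n) u.
Proof.
move=> [cu [C [C0 [hC _]]]]; apply: (L2_le (g := fun x => C ^+ 2 * wt x)); last exact: integrable_cwt.
  exact: ccont_meas1.
move=> x; apply: (@le_trans _ _ ((C * wt x) ^+ 2)).
  by apply: lerXn2r (hC x); rewrite nnegrE ?normc_ge0 ?mulr_ge0 ?wt_ge0.
rewrite exprMn; apply: ler_wpM2l; first exact: sqr_ge0.
by rewrite expr2 ler_piMl ?wt_ge0// wt_le1.
Qed.

(** Temperance bounds the value at a lattice point by a constant times the value anywhere in its
    unit cube, so the lattice sum is dominated by the integral. *)
Lemma lattice_sum (R : realType) (n : nat) (W : 'rV[R]_n * 'rV[R]_n -> R) N (K mu : R) :
  continuous W -> (forall X, 1 <= W X) -> 0 <= mu -> 0 <= K ->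
  (forall X Y, W Y <= K * phase_wt N X Y * W X) ->
  (\int[lebesgue_rV R n]_xi \int[lebesgue_rV R n]_x (W (x, xi) `^ (- mu))%:E < +oo)%E ->
  exists S, forall N', \sum_(0 <= q < N') coef (fun j => W (lattice_pt R j.1, lattice_pt R j.2) `^ (- mu)) q <= S.
Proof.
move=> cW W1 mu0 K0 WT fin; have [N1 [K1 [K10 h1]]] := powN_tempered mu0 W1 K0 WT.
have mW : measurable_fun setT (fun X => W X `^ (- mu)).
  by apply: (measurableT_comp (@measurable_powR R (- mu))); exact: measurable_cts2.
pose c : R := K1 * 4 ^+ N1; have c0 : 0 <= c by rewrite mulr_ge0// exprn_ge0.
have F : (\int[lebesgue_rV R n \x lebesgue_rV R n]_X (W X `^ (- mu))%:E < +oo)%E.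
  rewrite (fubini_tonelli2 (fun X => (W X `^ (- mu))%:E))//; first exact/measurable_EFinP.
  by move=> X; rewrite lee_fin powR_ge0.
have F0 : (0 <= \int[lebesgue_rV R n \x lebesgue_rV R n]_X (W X `^ (- mu))%:E)%E.
  by apply: integral_ge0 => X _; rewrite lee_fin powR_ge0.
exists (c * fine (\int[lebesgue_rV R n \x lebesgue_rV R n]_X (W X `^ (- mu))%:E)) => N'.
apply: lsum_le => [j|]; first exact: powR_ge0.
rewrite EFinM fineK; last by rewrite ge0_fin_numE.
rewrite -ge0_integralZl_EFin//; last 2 first.
- by move=> X _; rewrite lee_fin powR_ge0.
- exact/measurable_EFinP.
apply: (cube_sum (g := fun j => W (lattice_pt R j.1, lattice_pt R j.2) `^ (- mu)) (G := fun X => c * W X `^ (- mu))).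
- by move=> j; exact: powR_ge0.
- exact: measurable_funM.
- by move=> X; rewrite mulr_ge0// powR_ge0.
move=> j X x1 x2; apply: (le_trans (h1 _ X)); apply: ler_wpM2r; first exact: powR_ge0.
apply: ler_wpM2l => //; apply: lerXn2r; rewrite ?nnegrE ?mulr_ge0 ?addr_ge0//=.
(* Within distance 1 both factors of [phase_wt] are at most 2, whence 4^N1. *)
rewrite (_ : 4 = 2 * 2); last by ring.
by apply: ler_pM; rewrite ?addr_ge0// (_ : 2 = 1 + 1)// lerD2l distrC.
Qed.

Local Close Scope complex_scope.

Theorem theorem5p5 (R : realType) (n : nat) (gamma kappa : R)
    (A V : 'rV[R]_n -> R) (q r mu : R) (a : 'rV[R]_n * 'rV[R]_n -> R[i]) :
  0 < gamma -> 0 < kappa ->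
  tau_function gamma A -> tau_function kappa V ->
  0 < q -> (forall x xi : 'rV[R]_n, 1 <= q + V x + A xi) ->
  1 <= r -> 0 < mu ->
  (\int[lebesgue_rV R n]_xi \int[lebesgue_rV R n]_x
     ((q + V x + A xi) `^ (- mu))%:E < +oo)%E ->
  symbol_class (fun X => (q + V X.1 + A X.2) `^ (- mu / r))
    (metric q kappa gamma A V) a ->
  forall t : R, quantization_in_schatten a t r.
Proof.
move=> g0 k0 tA tV q0 hW r1 mu0 fin sa t.
have r0 : 0 < r := lt_le_trans ltr01 r1.
pose W (X : 'rV[R]_n * 'rV[R]_n) := q + V X.1 + A X.2.
have W1 X : 1 <= W X by exact: hW.
have cW : continuous W.
  move=> X; have h1 := @continuous_comp _ _ _ fst V X (@continuous_fst _ _ X) (tV.1 X.1).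
  have h2 := @continuous_comp _ _ _ snd A X (@continuous_snd _ _ X) (tA.1 X.2).
  exact: (cvgD (cvgD (cvg_cst q) h1) h2).
have [N1 [K1 [K10 WT]]] := W_tempered k0 g0 tV tA q0 hW.
(* With this exponent the r-th powers of the weights are the values W^-mu, whose lattice sum is
   finite. *)
pose M X := W X `^ (- (mu / r)).
have M0 X : 0 <= M X by exact: powR_ge0.
have M1 X : M X <= 1.
  rewrite /M powRN invf_le1; last by rewrite powR_gt0// (lt_le_trans ltr01).
  by rewrite -[leLHS](powRr0 (W X)) ler_powR// divr_ge0// ltW.
have [N0 [K0 [K00 MT]]] := powN_tempered (divr_ge0 (ltW mu0) (ltW r0)) W1 K10 WT.
have saM : sym (fun _ : unit => M) (fun=> a).
  by apply: (symbol_sym k0 g0 hW M0); rewrite /M -mulNr.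
have [S hS] := lattice_sum cW W1 (ltW mu0) K10 WT fin.
have [K [Kge hK]] := schur t M0 M1 K00 MT saM.
pose w := coef (fun j => M (lattice_pt R j.1, lattice_pt R j.2)).
have w0 k : 0 <= w k by rewrite /w /coef; case: (lattice_enum k) => [j|] //=.
have wS N : \sum_(0 <= k < N) w k `^ r <= S.
  apply: le_trans (hS N); apply: ler_sum => k _; rewrite /w /coef; case: (lattice_enum k) => [j|] /=.
    by rewrite /M -powRrM mulNr divfK// gt_eqF.
  by rewrite powR0// gt_eqF.
(* The factor (2 pi)^-n of the reproducing formula is put into the synthesis vectors, so that [T] is
   the quantization itself. *)
pose c : R[i] := ((((pi *+ 2) ^+ n : R)^-1)%:C)%C.
pose p k : L2t (lebesgue_rV R n) := c *: vec (psi t M0 M1 K00 MT saM) k.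
have pK (d : nat -> R[i]) N : nsq (@ip _ _ _ (lebesgue_rV R n)) (\sum_(0 <= k < N) d k *: p k) <=
    (K * normc c ^+ 2) * \sum_(0 <= k < N) w k ^+ 2 * normc (d k) ^+ 2.
  rewrite (eq_bigr (fun k => (d k * c) *: vec (psi t M0 M1 K00 MT saM) k)); last first.
    by move=> k _; rewrite scalerA.
  apply: (le_trans (hK _ N)); rewrite -mulrA; apply: ler_wpM2l => //.
  rewrite mulr_sumr; apply: ler_sum => k _; rewrite normcM exprMn mulrA mulrC.
  exact: lexx.
have Kc : 0 <= K * normc c ^+ 2 by rewrite mulr_ge0// sqr_ge0.
have [T hT] := synthesis_op Kc r0 w0 (@bessel_theta R n) pK wS.
exists (opL2 T).
  exact: (synthesis_schatten (@frame_const_ge0 R n) Kc r0 w0 (@bessel_theta R n) pK wS hT).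
move=> u su; exists (quant t a u); first exact: (is_quantization_quant t (sym_bounded_symbol M0 M1 saM) su).
have Lu := admissible_L2 (schwartz_admissible t (sym_bounded_symbol M0 M1 saM) su).
by rewrite (opL2E T Lu); exact: (synthesis_schwartz Lu su hT).
Qed.
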